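(* Let $T>0$ and $\nu\ge 0$ be fixed. Let the pressure be $p(\rho)=\rho^\gamma$ with $\gamma>1$, and let $\mu(\rho)=\rho^{\frac{s+3}{2}}$ with $s\ge -1$ and $\gamma\ge s+2$. Assume condition A2b): $\{b_{i,j}\}$ is symmetric, $b_{i,j}\ge 0$ for $i\ne j$, for any $\rho_1,\dots,\rho_n>0$ the solutions $(u_1,\dots,u_n)\in\mathbb{R}^n$ of $\sum_{j}b_{i,j}\rho_i\rho_j(u_i-u_j)=0$, $i=1,\dots,n$, are exactly the multiples of $(1,\dots,1)$, and $M_i\rho_i>0$ for every $i=1,\dots,n$ (so that $\widehat M:=\min_i M_i>0$). For every $\epsilon>0$ let $(\hat\rho^\epsilon,\hat m^\epsilon,\hat J^\epsilon)$ be a periodic dissipative weak solution, with finite total mass and finite total energy (with constant $K$ independent of $\epsilon$), of the diffusively scaled Navier–Stokes–Korteweg multicomponent system (S$_\epsilon$) of the context. Let $(\bar{\hat\rho},\bar{\hat m},\bar{\hat J})$ be a smooth solution on $[0,T]$ of the equilibrium system (E$_\epsilon$) of the context. Assume that $$\|\lambda_L(\rho_i^\epsilon)\|_{L^\infty((0,T);L^1(\mathbb{T}^3))},\ \|\mu_L(\rho_i^\epsilon)\|_{L^\infty((0,T);L^1(\mathbb{T}^3))}\le \tilde E ,\qquad i=1,\dots,n,$$ with $\tilde E>0$ independent of $\epsilon$, and that there are two constants $k_*,N$, independent of $\epsilon$, such that $0<k_*\le\rho_i^\epsilon\le N$ on $\mathbb{T}^3\times(0,T)$ for all $i$. Let $$\Psi(t)=\int_{\mathbb{T}^3}\sum_{i=1}^n\left(\frac12\rho_i^\epsilon\left|\frac{m_i^\epsilon}{\rho_i^\epsilon}-\frac{\bar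 m_i}{\bar\rho_i}\right|^2+\frac12\rho_i^\epsilon\left|\frac{J_i^\epsilon}{\rho_i^\epsilon}-\frac{\bar J_i}{\bar\rho_i}\right|^2+h(\rho_i^\epsilon|\bar\rho_i)\right)dx .$$ Then for any $t\in[0,T]$ $$\Psi(t)\le\left(\Psi(0)+C\nu\epsilon+C\epsilon^4\right)e^{\hat C t},$$ where $C,\hat C>0$ are constants independent of $\epsilon$, $\nu$ and $t$; they depend only on $T$, $K$, $k_*$, $N$, $\widehat M$, $\tilde E$, on $\bar\rho_1,\dots,\bar\rho_n$ and their derivatives, and on the fixed structural parameters ($n$, $b_{i,j}$, $M_i$, $\gamma$, $s$). Moreover, if $\Psi(0)\to0$ as $\epsilon\to0$, then $\sup_{t\in[0,T]}\Psi(t)\to0$ as $\epsilon\to0$.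
   Context: Notation. $\mathbb{T}^3$ is the 3-dimensional torus, $n$ is the number of components, $i=1,\dots,n$. For a vector field $\phi$, $(\nabla\phi)_{kl}=\partial_l\phi_k$, $D(\phi)=\frac12(\nabla\phi+{}^t\nabla\phi)$; for a matrix field $A$, $(\operatorname{div}A)_k=\sum_l\partial_lA_{kl}$; $(a\otimes b)_{kl}=a_kb_l$. $\hat\rho=(\rho_1,\dots,\rho_n)$, $\hat m=(m_1,\dots,m_n)$ with $m_i=\rho_iu_i$, $\hat J=(J_1,\dots,J_n)$ with $J_i=\rho_iv_i=\nabla\mu(\rho_i)$, where the drift velocity is $v_i=\nabla\mu(\rho_i)/\rho_i$. The function $\mu$ is related to the capillarity $k(\rho)\ge0$ by $\mu'(\rho)=\sqrt{\rho k(\rho)}$, and $\lambda(\rho)=2(\rho\mu'(\rho)-\mu(\rho))$. $p(\rho)=\rho^\gamma$, $h(\rho)=\rho^\gamma/(\gamma-1)$, and for a function $f$, $f(\rho|\bar\rho)=f(\rho)-f(\bar\rho)-f'(\bar\rho)(\rho-\bar\rho)$. The Lamé functions satisfy $\mu_L\ge0$ and $\frac23\mu_L+\lambda_L\ge0$. $\{b_{i,j}\}$ is symmetric with $b_{i,j}\ge0$ for $i\neq j$, $M_i\ge0$, $\nu\ge0$. Define $\operatorname{div}S_i=\operatorname{div}(\mu(\rho_i)\nabla v_i)+\frac12\nabla(\lambda(\rho_i)\operatorname{div}v_i)$ and $\operatorname{div}K_i=\operatorname{div}(\mu(\rho_i)\,{}^t\nabla u_i)+\frac12\nabla(\lambda(\rho_i)\operatorname{div}u_i)$;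 $\bar S_i,\bar K_i$ denote the same expressions evaluated at $(\bar\rho_i,\bar u_i,\bar v_i)$. System (S$_\epsilon$): $$\partial_t\rho_i+\tfrac1\epsilon\operatorname{div}(\rho_iu_i)=0,$$ $$\partial_t(\rho_iu_i)+\tfrac1\epsilon\operatorname{div}(\rho_iu_i\otimes u_i)-\tfrac{2\nu}\epsilon\operatorname{div}(\mu_L(\rho_i)D(u_i))-\tfrac\nu\epsilon\nabla(\lambda_L(\rho_i)\operatorname{div}u_i)+\tfrac1\epsilon\nabla\rho_i^\gamma=\tfrac1\epsilon\operatorname{div}S_i-\tfrac1{\epsilon^2}\sum_jb_{i,j}\rho_i\rho_j(u_i-u_j)-\tfrac{M_i}{\epsilon^2}\rho_iu_i,$$ $$\partial_t(\rho_iv_i)+\tfrac1\epsilon\operatorname{div}(\rho_iv_i\otimes u_i)+\tfrac1\epsilon\operatorname{div}K_i=0.$$ Equilibrium system (E$_\epsilon$). For $\bar\rho_i>0$ let $\tau^M$ be the $n\times n$ matrix (depending on $\bar\rho$) with entries $\tau^M_{i,j}=\delta_{i,j}\big(\sum_kb_{i,k}\bar\rho_i\bar\rho_k+M_i\bar\rho_i\big)-b_{i,j}\bar\rho_i\bar\rho_j$ (invertible under the assumptions). Let $\bar v_i=\nabla\mu(\bar\rho_i)/\bar\rho_i$ and $\bar u_i=\epsilon\sum_k(\tau^M)^{-1}_{i,k}\big(-\nabla p(\bar\rho_k)+\operatorname{div}\bar S_k\big)\in\mathbb{R}^3$. The functions $\bar\rho_i>0$ (independent of $\epsilon$) solve $\partial_t\bar\rho_i+\frac1\epsilon\operatorname{div}(\bar\rho_i\bar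 u_i)=0$. Equivalently, with $\bar e_i:=\partial_t(\bar\rho_i\bar u_i)+\frac1\epsilon\operatorname{div}(\bar\rho_i\bar u_i\otimes\bar u_i)$, which is $O(\epsilon)$, $$\partial_t\bar\rho_i+\tfrac1\epsilon\operatorname{div}(\bar\rho_i\bar u_i)=0,$$ $$\partial_t(\bar\rho_i\bar u_i)+\tfrac1\epsilon\operatorname{div}(\bar\rho_i\bar u_i\otimes\bar u_i)+\tfrac1\epsilon\nabla\bar\rho_i^\gamma=\tfrac1\epsilon\operatorname{div}\bar S_i-\tfrac1{\epsilon^2}\sum_jb_{i,j}\bar\rho_i\bar\rho_j(\bar u_i-\bar u_j)-\tfrac{M_i}{\epsilon^2}\bar\rho_i\bar u_i+\bar e_i,$$ $$\partial_t(\bar\rho_i\bar v_i)+\tfrac1\epsilon\operatorname{div}(\bar\rho_i\bar v_i\otimes\bar u_i)+\tfrac1\epsilon\operatorname{div}\bar K_i=0.$$ Here $\bar m_i=\bar\rho_i\bar u_i$, $\bar J_i=\bar\rho_i\bar v_i$. A smooth solution on $[0,T]$ means that $\bar\rho_i>0$ is smooth on $[0,T]\times\mathbb{T}^3$; in particular, with $\bar w_i=(\bar\rho_i,\bar u_i,\bar v_i)$, the functions $\bar w_i,\partial_t\bar w_i,\nabla\bar w_i,D^2\bar w_i,D^3\bar\rho_i$ are bounded. Weak solutions of (S$_\epsilon$). $(\hat\rho^\epsilon,\hat m^\epsilon,\hat J^\epsilon)$ is a periodic weak solution if for each $i$ (and every $T>0$): $0\le\rho_i^\epsilon\in C^0([0,\infty);L^1\cap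 L^\gamma(\mathbb{T}^3))$; $\rho_i^\epsilon u_i^\epsilon,\rho_i^\epsilon v_i^\epsilon\in C^0([0,\infty);L^1(\mathbb{T}^3)^3)$; $\sqrt{\rho_i^\epsilon}u_i^\epsilon,\sqrt{\rho_i^\epsilon}v_i^\epsilon\in L^\infty((0,T);L^2(\mathbb{T}^3)^3)$; $\mu_L(\rho_i^\epsilon)D(u_i^\epsilon)\in L^1((0,T)\times\mathbb{T}^3)^{3\times3}$; $\lambda_L(\rho_i^\epsilon)\operatorname{div}u_i^\epsilon\in L^1((0,T)\times\mathbb{T}^3)$; $(\rho_i^\epsilon)^2u_i^\epsilon\in L^\infty((0,T);L^1(\mathbb{T}^3)^3)$; and (omitting superscripts $\epsilon$; all integrals understood to be well defined) for all scalar $\psi_i$ and vector $\phi_i,\varphi_i$ that are $C^1$ in time, $C^2$ in space, periodic in $x$ and compactly supported in $[0,\infty)$ in time: $$-\int_0^\infty\!\!\int\sum_i\Big(\rho_i\partial_t\psi_i+\tfrac1\epsilon\rho_iu_i\cdot\nabla\psi_i\Big)=\int\sum_i\rho_i(x,0)\psi_i(x,0)dx;$$ $$-\int_0^\infty\!\!\int\sum_i\Big(\rho_iu_i\cdot\partial_t\phi_i+\tfrac1\epsilon\rho_iu_i\otimes u_i:\nabla\phi_i+\tfrac1\epsilon\rho_i^\gamma\operatorname{div}\phi_i+\tfrac1\epsilon\mu(\rho_i)v_i\cdot\nabla\operatorname{div}\phi_i+\tfrac1\epsilon\nabla\mu(\rho_i)\cdot(\nabla\phi_i\,v_i)+\tfrac1{2\epsilon}\nabla\lambda(\rho_i)\cdot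 v_i\operatorname{div}\phi_i+\tfrac1{2\epsilon}\lambda(\rho_i)v_i\cdot\nabla\operatorname{div}\phi_i\Big)$$ $$+\int_0^\infty\!\!\int\sum_i\Big(\tfrac{2\nu}\epsilon\mu_L(\rho_i)D(u_i):D(\phi_i)+\tfrac\nu\epsilon\lambda_L(\rho_i)\operatorname{div}u_i\operatorname{div}\phi_i\Big)+\tfrac1{\epsilon^2}\int_0^\infty\!\!\int\Big(\sum_{i,j}b_{i,j}\rho_i\rho_j(u_i-u_j)\cdot\phi_i+\sum_iM_i\rho_iu_i\cdot\phi_i\Big)=\int\sum_i(\rho_iu_i)(x,0)\cdot\phi_i(x,0)dx;$$ $$-\int_0^\infty\!\!\int\sum_i\Big(\rho_iv_i\cdot\partial_t\varphi_i+\tfrac1\epsilon\rho_iv_i\otimes u_i:\nabla\varphi_i\Big)+\tfrac1\epsilon\int_0^\infty\!\!\int\sum_i\Big(\mu(\rho_i)u_i\cdot\nabla\operatorname{div}\varphi_i+\nabla\mu(\rho_i)\cdot(\nabla\varphi_i\,u_i)+\tfrac12\nabla\lambda(\rho_i)\cdot u_i\operatorname{div}\varphi_i+\tfrac12\lambda(\rho_i)u_i\cdot\nabla\operatorname{div}\varphi_i\Big)=\int\sum_i(\rho_iv_i)(x,0)\cdot\varphi_i(x,0)dx.$$ Let $\eta_{tot}(\hat\rho,\hat m,\hat J)=\sum_i\big(\frac12\frac{|m_i|^2}{\rho_i}+\frac12\frac{|J_i|^2}{\rho_i}+h(\rho_i)\big)$ and $\Sigma_{tot}=\int_{\mathbb{T}^3}\eta_{tot}dx$.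 The weak solution is dissipative if $\eta_{tot}(\hat\rho,\hat m,\hat J)\in C([0,\infty);L^1(\mathbb{T}^3))$ and for every nonnegative $\theta\in W^{1,\infty}([0,\infty))$ with compact support in $[0,\infty)$ $$-\int_0^\infty\Sigma_{tot}(t)\theta'(t)dt+\tfrac\nu\epsilon\int_0^\infty\!\!\int\sum_i\big(2\mu_L(\rho_i)|D(u_i)|^2+\lambda_L(\rho_i)|\operatorname{div}u_i|^2\big)\theta+\tfrac1{2\epsilon^2}\int_0^\infty\!\!\int\sum_{i,j}b_{i,j}\rho_i\rho_j|u_i-u_j|^2\theta+\tfrac1{\epsilon^2}\int_0^\infty\!\!\int\sum_iM_i\rho_i|u_i|^2\theta\le\Sigma_{tot}(0)\theta(0).$$ It has finite total mass and energy if for every $T>0$ there is $K>0$ independent of $\epsilon$ with $\sup_{t\in(0,T)}\int\sum_i\rho_idx\le K$ and $\sup_{t\in(0,T)}\Sigma_{tot}(t)\le K$. *)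

(* Defs.v *)
From HB Require Import structures.
From mathcomp Require Import all_boot all_order all_algebra.
From mathcomp Require Import all_classical all_reals all_analysis.

Set Implicit Arguments.
Unset Strict Implicit.
Unset Printing Implicit Defensive.

Import Order.TTheory GRing.Theory Num.Theory.
Import numFieldNormedType.Exports.

Local Open Scope classical_set_scope.
Local Open Scope ring_scope.

(* The library's sigma-finite instance for [m1 \x m2] applies only to
   subprobability measures; this alias carries the general one. *)
Section sigma_finite_product.
Context d1 d2 (T1 : measurableType d1) (T2 : measurableType d2) (R : realType).
Variable m1 : {sigma_finite_measure set T1 -> \bar R}.
Variable m2 : {sigma_finite_measure set T2 -> \bar R}.

Definition prodm : set (T1 * T2) -> \bar R := (m1 \x m2)%E.

HB.instance Definition _ := Measure.on prodm.

Lemma prodm_sigma_finite : sigma_finite setT prodm.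
Proof.
have /sigma_finiteP[F [TF ndF Foo]] := sigma_finiteT m1.
have /sigma_finiteP[G [TG ndG Goo]] := sigma_finiteT m2.
exists (fun n => F n `*` G n).
  rewrite -setXTT TF TG predeqE => -[x y]; split.
    move=> [/= [n _ Fnx] [k _ Gky]]; exists (maxn n k) => //; split.
    - by move: x Fnx; exact/subsetPset/ndF/leq_maxl.
    - by move: y Gky; exact/subsetPset/ndG/leq_maxr.
  by move=> [n _ []/= ? ?]; split; exists n.
move=> k; have [? ?] := Foo k; have [? ?] := Goo k.
split; first exact: measurableX.
by rewrite /prodm product_measure1E// lte_mul_pinfty// ge0_fin_numE.
Qed.

HB.instance Definition _ :=
  @Measure_isSigmaFinite.Build _ _ _ prodm prodm_sigma_finite.
End sigma_finite_product.
Arguments prodm {d1 d2 T1 T2 R}.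

Notation coords R := (R * R * R)%type.
(* [coords R] again, but with the sigma-algebra on which [lebesgue_measure]
   is defined. *)
Notation mcoords R :=
  (measurableTypeR R * measurableTypeR R * measurableTypeR R)%type.
Notation scalar_field R := (R -> coords R -> R).
Notation vector_field R := ('I_3 -> scalar_field R).
Notation matrix_field R := ('I_3 -> 'I_3 -> scalar_field R).

Section torus.
Variable R : realType.
Implicit Types (f g : scalar_field R) (w : vector_field R).

Definition leb3 : {sigma_finite_measure set (mcoords R) -> \bar R} :=
  prodm (prodm lebesgue_measure lebesgue_measure) lebesgue_measure.

Definition leb4 :
    {sigma_finite_measure set (measurableTypeR R * mcoords R)%type -> \bar R} :=
  prodm lebesgue_measure leb3.

(* The torus is R^3/Z^3: functions on it are 1-periodic functions on R^3, and
   integrals over it are integrals over the unit cell. *)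
Definition cell : set (coords R) := `[0, 1[ `*` `[0, 1[ `*` `[0, 1[.

Definition evec (l : 'I_3) : coords R :=
  ((l == 0)%:R, (l == 1)%:R, (l == 2%:R)%:R).

Definition periodic_on (I : set R) f :=
  forall t x l, I t -> f t (x + evec l) = f t x.

Definition int_x (g : coords R -> R) : R := \int[leb3]_(x in cell) g x.

Definition int_tx f : R :=
  \int[leb4]_(z in `]0, +oo[ `*` cell) f z.1 z.2.

Definition measurable_on (I : set R) f :=
  measurable_fun (I `*` cell : set (measurableTypeR R * mcoords R))
    (uncurry f).

Definition integrable_on (I : set R) f :=
  leb4.-integrable (I `*` cell) (EFin \o uncurry f).

Definition dx (l : 'I_3) f : scalar_field R := fun t x => 'D_(evec l) (f t) x.
Definition dt f : scalar_field R := fun t x => derive1 (f^~ x) t.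
Definition divg w : scalar_field R := fun t x => \sum_l dx l (w l) t x.
Definition symgrad w : matrix_field R :=
  fun k l t x => (dx l (w k) t x + dx k (w l) t x) / 2.

Definition sqn (a : 'I_3 -> R) : R := \sum_k a k ^+ 2.

Definition continuous_on (I : set R) f :=
  {within I `*` setT, continuous (uncurry f)}.

Definition x_derivable_on (I : set R) (l : 'I_3) f :=
  forall t x, I t -> derivable (f t) x (evec l).

(* g is the time derivative of f inside I; together with continuity of f and g
   on I it is also the one-sided derivative at the end points. *)
Definition t_derivative_on (I : set R) f g :=
  forall t x, interior I t -> is_derive t 1 (f^~ x) (g t x).

Fixpoint Ck_on (k : nat) (I : set R) f : Prop :=
  continuous_on I f /\
  match k with
  | 0%N => True
  | k'.+1 =>
      (forall l, x_derivable_on I l f /\ Ck_on k' I (dx l f)) /\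
      (exists g, t_derivative_on I f g /\ Ck_on k' I g)
  end.

Definition smooth_on (I : set R) f := forall k, Ck_on k I f.

(* C^1 in time, C^2 in space, periodic, compactly supported in [0, oo). *)
Definition test_function f :=
  [/\ periodic_on `[0, +oo[ f,
      continuous_on `[0, +oo[ f /\
        (exists g, t_derivative_on `[0, +oo[ f g /\ continuous_on `[0, +oo[ g),
      forall l, x_derivable_on `[0, +oo[ l f /\ continuous_on `[0, +oo[ (dx l f),
      forall l m, x_derivable_on `[0, +oo[ l (dx m f) /\
        continuous_on `[0, +oo[ (dx l (dx m f)) &
      exists b, forall t x, b <= t -> f t x = 0].

(* Test functions compactly supported in the open half-line, used for
   distributional derivatives. *)
Definition interior_test_function f :=
  test_function f /\ exists2 a, 0 < a & forall t x, t <= a -> f t x = 0.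

Definition weak_dx (l : 'I_3) f g :=
  (forall T, 0 < T -> integrable_on `]0, T[ f /\ integrable_on `]0, T[ g) /\
  forall xi, interior_test_function xi ->
    int_tx (fun t x => g t x * xi t x) =
    - int_tx (fun t x => f t x * dx l xi t x).

(* D is the distributional symmetric gradient of w wherever w is locally
   integrable. A velocity is determined by density and momentum off the vacuum
   only, so local integrability everywhere is not imposed; it does hold as long
   as the density is bounded away from 0. *)
Definition weak_symgrad w (D : matrix_field R) :=
  forall k l xi, interior_test_function xi ->
    let supp := (`]0, +oo[ `*` cell) `&` closure [set z | uncurry xi z != 0] in
    leb4.-integrable supp (EFin \o uncurry (w k)) ->
    leb4.-integrable supp (EFin \o uncurry (w l)) ->
    leb4.-integrable supp (EFin \o uncurry (D k l)) /\
    int_tx (fun t x => D k l t x * xi t x) =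
    - int_tx (fun t x => (w k t x * dx l xi t x + w l t x * dx k xi t x) / 2).

Definition Lp_norm (p : R) (g : coords R -> R) : \bar R :=
  'N[leb3]_(p%:E)[EFin \o (fun x => g x * \1_cell x)].

(* f in C^0([0, oo); L^p) *)
Definition C0_Lp (p : R) f :=
  forall t, 0 <= t ->
    [/\ measurable_fun (cell : set (mcoords R)) (f t), (Lp_norm p (f t) < +oo)%E &
        Lp_norm p (fun x => f r x - f t x) @[r --> within `[0, +oo[ (nbhs t)]
          --> 0%E].

(* f in L^oo((0, T); L^p) with norm at most C *)
Definition Linf_Lp_le (T p : R) f (C : R) :=
  measurable_on `]0, T[ f /\
  {ae lebesgue_measure, forall t : R, 0 < t < T -> (Lp_norm p (f t) <= C%:E)%E}.

Definition Linf_Lp (T p : R) f := exists C, Linf_Lp_le T p f C.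

(* theta in W^{1,oo}([0, oo)) (continuous representative) with weak
   derivative dtheta *)
Definition W1inf (theta dtheta : R -> R) :=
  [/\ {within `[0, +oo[, continuous theta},
      (exists L, forall t, 0 <= t -> `|theta t| <= L),
      measurable_fun (`]0, +oo[ : set (measurableTypeR R)) dtheta,
      (exists L, {ae lebesgue_measure, forall t : R, 0 < t -> `|dtheta t| <= L}) &
      forall zeta : R -> R,
        (forall t, derivable zeta t 1) -> continuous (derive1 zeta) ->
        (exists a b, 0 < a /\ forall t, ~~ (a <= t <= b) -> zeta t = 0) ->
        \int[lebesgue_measure]_(t in `]0, +oo[) (dtheta t * zeta t) =
        - \int[lebesgue_measure]_(t in `]0, +oo[) (theta t * derive1 zeta t)].

End torus.

Section NSK.
Variables (R : realType) (n : nat).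
(* gamma: pressure exponent; s: capillarity exponent *)
Variables gamma s : R.
Variables (b : 'I_n -> 'I_n -> R) (M : 'I_n -> R).

Definition press (r : R) : R := r `^ gamma.
Definition henergy (r : R) : R := r `^ gamma / (gamma - 1).
Definition mu (r : R) : R := r `^ ((s + 3) / 2).
Definition lambda (r : R) : R := 2 * (r * derive1 mu r - mu r).

(* f(r | rb) *)
Definition relative (f : R -> R) (r rb : R) : R :=
  f r - f rb - derive1 f rb * (r - rb).

Definition friction_condition :=
  [/\ forall i j, b i j = b j i,
      forall i j, i != j -> 0 <= b i j &
      forall r : 'I_n -> R, (forall i, 0 < r i) ->
        (forall u : 'I_n -> R,
           (forall i, \sum_j b i j * r i * r j * (u i - u j) = 0) <->
           (exists c, forall i, u i = c)) /\
        (forall i, 0 < M i * r i)].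

Definition lame_condition (muL lamL : R -> R) :=
  forall r, 0 <= r -> 0 <= muL r /\ 0 <= 2 / 3 * muL r + lamL r.

(* Dvel stands for D(vel), gradmu for grad mu(rho), gradlam for
   grad lambda(rho); [weak_solution] ties them to vel and rho. *)
Record state := State {
  rho : 'I_n -> scalar_field R;
  vel : 'I_n -> vector_field R;
  drift : 'I_n -> vector_field R;
  Dvel : 'I_n -> matrix_field R;
  gradmu : 'I_n -> vector_field R;
  gradlam : 'I_n -> vector_field R }.

Definition mom (w : state) i k : scalar_field R :=
  fun t x => rho w i t x * vel w i k t x.
Definition dmom (w : state) i k : scalar_field R :=
  fun t x => rho w i t x * drift w i k t x.
Definition divu (w : state) i : scalar_field R :=
  fun t x => \sum_k Dvel w i k k t x.

Definition weak_mass eps (w : state) :=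
  forall psi : 'I_n -> scalar_field R, (forall i, test_function (psi i)) ->
  let F := fun t x => \sum_i
    (rho w i t x * dt (psi i) t x
     + eps^-1 * \sum_k rho w i t x * vel w i k t x * dx k (psi i) t x) in
  integrable_on `]0, +oo[ F /\
  - int_tx F = int_x (fun x => \sum_i rho w i 0 x * psi i 0 x).

Definition weak_momentum eps nu (muL lamL : R -> R) (w : state) :=
  forall phi : 'I_n -> vector_field R, (forall i k, test_function (phi i k)) ->
  let F := fun t x => \sum_i
    (\sum_k mom w i k t x * dt (phi i k) t x
     + eps^-1 * (\sum_k \sum_l rho w i t x * vel w i k t x * vel w i l t x
                   * dx l (phi i k) t x)
     + eps^-1 * (press (rho w i t x) * divg (phi i) t x)
     + eps^-1 * (mu (rho w i t x)
                   * \sum_k drift w i k t x * dx k (divg (phi i)) t x)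
     + eps^-1 * (\sum_k gradmu w i k t x
                   * \sum_l dx l (phi i k) t x * drift w i l t x)
     + (2 * eps)^-1 * ((\sum_k gradlam w i k t x * drift w i k t x)
                   * divg (phi i) t x)
     + (2 * eps)^-1 * (lambda (rho w i t x)
                   * \sum_k drift w i k t x * dx k (divg (phi i)) t x)) in
  let G := fun t x => \sum_i
    (2 * nu / eps * (muL (rho w i t x)
        * \sum_k \sum_l Dvel w i k l t x * symgrad (phi i) k l t x)
     + nu / eps * (lamL (rho w i t x) * divu w i t x * divg (phi i) t x)) in
  let H := fun t x =>
    \sum_i \sum_j b i j * rho w i t x * rho w j t x
        * (\sum_k (vel w i k t x - vel w j k t x) * phi i k t x)
    + \sum_i M i * (\sum_k mom w i k t x * phi i k t x) in
  [/\ integrable_on `]0, +oo[ F, integrable_on `]0, +oo[ G,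
      integrable_on `]0, +oo[ H &
      - int_tx F + int_tx G + (eps ^+ 2)^-1 * int_tx H =
      int_x (fun x => \sum_i \sum_k mom w i k 0 x * phi i k 0 x)].

Definition weak_drift eps (w : state) :=
  forall phi : 'I_n -> vector_field R, (forall i k, test_function (phi i k)) ->
  let F := fun t x => \sum_i
    (\sum_k dmom w i k t x * dt (phi i k) t x
     + eps^-1 * (\sum_k \sum_l rho w i t x * drift w i k t x * vel w i l t x
                   * dx l (phi i k) t x)) in
  let G := fun t x => \sum_i
    (mu (rho w i t x) * (\sum_k vel w i k t x * dx k (divg (phi i)) t x)
     + \sum_k gradmu w i k t x * (\sum_l dx l (phi i k) t x * vel w i l t x)
     + 2^-1 * ((\sum_k gradlam w i k t x * vel w i k t x) * divg (phi i) t x)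
     + 2^-1 * (lambda (rho w i t x)
                 * \sum_k vel w i k t x * dx k (divg (phi i)) t x)) in
  [/\ integrable_on `]0, +oo[ F, integrable_on `]0, +oo[ G &
      - int_tx F + eps^-1 * int_tx G =
      int_x (fun x => \sum_i \sum_k dmom w i k 0 x * phi i k 0 x)].

Record weak_solution eps nu (muL lamL : R -> R) (w : state) : Prop := {
  ws_periodic : forall i, periodic_on `[0, +oo[ (rho w i) /\
    forall k, periodic_on `[0, +oo[ (vel w i k) /\ periodic_on `[0, +oo[ (drift w i k);
  ws_measurable : forall i, measurable_on `[0, +oo[ (rho w i) /\
    forall k, [/\ measurable_on `[0, +oo[ (vel w i k),
      measurable_on `[0, +oo[ (drift w i k) &
      forall l, measurable_on `[0, +oo[ (Dvel w i k l)];
  ws_rho_ge0 : forall i t, 0 <= t ->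
    {ae @leb3 R, forall x : coords R, cell x -> 0 <= rho w i t x};
  ws_rho : forall i, C0_Lp 1 (rho w i) /\ C0_Lp gamma (rho w i);
  ws_mom : forall i k, C0_Lp 1 (mom w i k) /\ C0_Lp 1 (dmom w i k);
  ws_sqrt : forall i k T, 0 < T ->
    Linf_Lp T 2 (fun t x => Num.sqrt (rho w i t x) * vel w i k t x) /\
    Linf_Lp T 2 (fun t x => Num.sqrt (rho w i t x) * drift w i k t x);
  ws_muL : forall i k l T, 0 < T ->
    integrable_on `]0, T[ (fun t x => muL (rho w i t x) * Dvel w i k l t x);
  ws_lamL : forall i T, 0 < T ->
    integrable_on `]0, T[ (fun t x => lamL (rho w i t x) * divu w i t x);
  ws_rho2u : forall i k T, 0 < T ->
    Linf_Lp T 1 (fun t x => rho w i t x ^+ 2 * vel w i k t x);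
  ws_D : forall i, weak_symgrad (vel w i) (Dvel w i);
  ws_gmu : forall i k, weak_dx k (fun t x => mu (rho w i t x)) (gradmu w i k);
  ws_glam : forall i k, weak_dx k (fun t x => lambda (rho w i t x)) (gradlam w i k);
  ws_drift_def : forall i k, {ae @leb4 R, forall z : R * coords R,
    0 < z.1 -> cell z.2 -> dmom w i k z.1 z.2 = gradmu w i k z.1 z.2};
  ws_eq_mass : weak_mass eps w;
  ws_eq_momentum : weak_momentum eps nu muL lamL w;
  ws_eq_drift : weak_drift eps w }.

Definition eta_tot (r : 'I_n -> R) (m J : 'I_n -> 'I_3 -> R) : R :=
  \sum_i (2^-1 * (sqn (m i) / r i) + 2^-1 * (sqn (J i) / r i) + henergy (r i)).

Definition eta_state (w : state) : scalar_field R := fun t x =>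
  eta_tot (fun i => rho w i t x) (fun i k => mom w i k t x)
    (fun i k => dmom w i k t x).

Definition Sigma_tot (w : state) (t : R) : R := int_x (eta_state w t).

(* The dissipation integrals are of nonnegative functions, taken in [0, +oo]. *)
Definition dissipative eps nu (muL lamL : R -> R) (w : state) :=
  C0_Lp 1 (eta_state w) /\
  forall theta dtheta : R -> R, W1inf theta dtheta ->
    (forall t, 0 <= t -> 0 <= theta t) ->
    (exists a, forall t, a <= t -> theta t = 0) ->
    let I (f : scalar_field R) :=
      (\int[@leb4 R]_(z in `]0%R, +oo[%classic `*` @cell R)
          (f z.1 z.2 * theta z.1)%:E)%E in
    ((- \int[lebesgue_measure]_(t in `]0, +oo[) (Sigma_tot w t * dtheta t))%:E
     + (nu / eps)%:E * I (fun t x => \sum_i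
         (2 * muL (rho w i t x) * (\sum_k \sum_l Dvel w i k l t x ^+ 2)
          + lamL (rho w i t x) * divu w i t x ^+ 2))%R
     + (2 * eps ^+ 2)^-1%:E * I (fun t x => \sum_i \sum_j
         b i j * rho w i t x * rho w j t x
         * sqn (fun k => vel w i k t x - vel w j k t x))%R
     + (eps ^+ 2)^-1%:E * I (fun t x => \sum_i
         M i * rho w i t x * sqn (fun k => vel w i k t x))%R
     <= (Sigma_tot w 0 * theta 0)%:E)%E.

Definition mass_energy_le (T K : R) (w : state) :=
  forall t, 0 < t < T ->
    int_x (fun x => \sum_i rho w i t x) <= K /\ Sigma_tot w t <= K.

Section equilibrium.
Variable rb : 'I_n -> scalar_field R.

Definition vbar i : vector_field R := fun k t x =>
  dx k (fun t' x' => mu (rb i t' x')) t x / rb i t x.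

Definition divS (r : scalar_field R) (w : vector_field R) : vector_field R :=
  fun k t x =>
    \sum_l dx l (fun t' x' => mu (r t' x') * dx l (w k) t' x') t x
    + 2^-1 * dx k (fun t' x' => lambda (r t' x') * divg w t' x') t x.

Definition tauM (r : 'I_n -> R) : 'M[R]_n := \matrix_(i, j)
  ((i == j)%:R * (\sum_k b i k * r i * r k + M i * r i) - b i j * r i * r j).

Definition ubar eps i : vector_field R := fun k t x =>
  eps * \sum_j invmx (tauM (fun a => rb a t x)) i j *
    (- dx k (fun t' x' => press (rb j t' x')) t x
     + divS (rb j) (vbar j) k t x).

Definition mbar eps i k : scalar_field R :=
  fun t x => rb i t x * ubar eps i k t x.
Definition Jbar i k : scalar_field R :=
  fun t x => rb i t x * vbar i k t x.

(* ubar is proportional to eps, so that eps cancels from the equation. The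
   momentum and drift equations with remainder are identities for ubar and
   vbar as defined above. *)
Definition smooth_equilibrium (T : R) :=
  [/\ forall i, smooth_on `[0, T] (rb i) /\ periodic_on `[0, T] (rb i),
      forall i t x, 0 <= t <= T -> 0 < rb i t x &
      forall eps, 0 < eps -> forall i t x, 0 < t < T ->
        dt (rb i) t x + eps^-1 * divg (mbar eps i) t x = 0].

(* Extended-real valued: the integrand is nonnegative. *)
Definition Psi eps (w : state) (t : R) : \bar R :=
  (\int[@leb3 R]_(x in @cell R) (\sum_i
    (2^-1 * rho w i t x * sqn (fun k =>
        mom w i k t x / rho w i t x - mbar eps i k t x / rb i t x)
     + 2^-1 * rho w i t x * sqn (fun k =>
        dmom w i k t x / rho w i t x - Jbar i k t x / rb i t x)
     + relative henergy (rho w i t x) (rb i t x)))%:E)%E.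

End equilibrium.
End NSK.

(* Main.v *)
(** The relative energy of a dissipative solution with respect to the equilibrium is,
    off the vacuum, the total energy plus terms linear in density, momentum and drift
    momentum.  Testing the weak equations with the corresponding equilibrium fields and
    adding the energy inequality therefore controls its growth.  Pointwise, all cross
    terms either combine into quadratic expressions in the velocity, drift and density
    differences, hence are bounded by the relative energy density (the density being
    bounded away from 0 and infinity), or are absorbed by damping and viscosity, or are
    of size [nu * eps] and [eps ^+ 4]; the remaining Korteweg terms vanish because
    [rho v] is the gradient of [mu rho].  Letting cutoffs in time tend to indicator
    functions and using continuity in time with values in [L^1] gives Gronwall's
    inequality at every time. *)

(* The scaling is what makes the constants independent of [eps]. The equilibrium velocity is
   [eps * U] with [U] fixed. Viscosity apart, every term of order 1/eps contains the velocity
   difference w, hence is a product of w/eps with a factor free of negative powers of eps. Young's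
   inequality charges |w/eps|^2 to the damping, whose coefficient is precisely [M] / eps^2, and
   leaves the square of the other factor. That factor is linear in the density and drift
   differences, up to eps^2 times the acceleration of [U]: this is the origin of eps^4. In the
   viscous form, completing the square at D(u) - (eps/2) D(U) leaves (nu/eps) eps^2.

   Two obstacles shape the rest. The equilibrium is smooth on [0, T] only, so the cutoffs vanish
   near 0 and near T, and the end points are recovered by continuity. Moreover the density bounds
   hold almost everywhere in space-time, and grad mu(rho) and grad lambda(rho) are distributional:
   the bounds are carried to every time by continuity in L^1, and the two gradients are compared
   pointwise by the fundamental lemma of the calculus of variations, with periodic test functions
   built from sines. *)
Require Import Defs.
From HB Require Import structures.
From mathcomp Require Import all_boot all_order all_algebra.
From mathcomp Require Import all_classical all_reals all_analysis.
From mathcomp Require Import measurable_realfun.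
From mathcomp Require Import ring lra.

Import Order.TTheory GRing.Theory Num.Theory.
Import numFieldNormedType.Exports.

Local Open Scope classical_set_scope.
Local Open Scope ring_scope.

Set Implicit Arguments.
Unset Strict Implicit.
Unset Printing Implicit Defensive.

(** * Smooth fields *)

Section directional.
Context (R : realType) (V : normedModType R).
Implicit Types (f g : V -> R) (x v : V).

(** Both difference quotients are the same function of the increment, so directional calculus
    reduces to calculus in one real variable. *)
Lemma is_derive_line f x v (h df : R) :
  is_derive (h *: v + x) v f df <->
  is_derive h 1 (fun r : R => f (r *: v + x)) df.
Proof.
have E : (fun r => r^-1 *: (f (r *: v + (h *: v + x)) - f (h *: v + x))) =
         (fun r => r^-1 *: ((fun r => f (r *: v + x)) (r *: (1:R) + h)
             - (fun r => f (r *: v + x)) h)).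
  by apply/funext => r /=; rewrite [r *: 1]mulr1 addrA -scalerDl.
by split=> -[D1 D2]; split; rewrite /derivable /derive ?E in D1 D2 *.
Qed.

Lemma is_derive_line0 f x v (df : R) :
  is_derive x v f df <-> is_derive (0 : R) 1 (fun r : R => f (r *: v + x)) df.
Proof. by rewrite -is_derive_line scale0r add0r. Qed.

Lemma is_derive_comp_dir (g : R -> R) f x v (df dg : R) :
  is_derive x v f df -> is_derive (f x) 1 g dg ->
  is_derive x v (g \o f) (dg * df).
Proof.
move=> /is_derive_line0 Df Dg; apply/is_derive_line0.
have := @is_derive1_comp _ g (fun r => f (r *: v + x)) 0 dg df.
rewrite scale0r add0r => /(_ Dg Df) h.
exact: h.
Qed.

Lemma is_derive_deriv f x v (df : R) : is_derive x v f df -> 'D_v f x = df.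
Proof. by move=> h; rewrite derive_val. Qed.

End directional.

Section Ck.
Context (R : realType).
Implicit Types (f g : scalar_field R) (I : set R) (k : nat) (t : R) (x : coords R).

Lemma interior_nbhs I t : interior I t -> \forall s \near t, I s.
Proof. by []. Qed.

Lemma eq_dx I f g l t x : (forall t x, I t -> f t x = g t x) -> I t ->
  dx l f t x = dx l g t x.
Proof.
move=> fg It; rewrite /dx; congr ('D_ _ _ _).
by apply/funext => y; exact: fg.
Qed.

Lemma eq_t_derivative_on I f g h : (forall t x, I t -> f t x = g t x) ->
  t_derivative_on I f h -> t_derivative_on I g h.
Proof.
move=> fg dh t x It; have := dh t x It.
apply: near_eq_is_derive.
by near=> s; rewrite fg//; near: s; exact: interior_nbhs.
Unshelve. all: by end_near. Qed.

(** Regularity on [I] ignores the values at other times. A field may therefore be replaced by a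
    closed form that is valid only where the density is positive. *)
Lemma eq_Ck_on k I f g : (forall t x, I t -> f t x = g t x) ->
  Ck_on k I f -> Ck_on k I g.
Proof.
elim: k f g => [|k IH] f g fg /= [cf df].
  split=> //; apply: subspace_eq_continuous cf => -[t x] /set_mem[/= It _].
  exact: fg.
split.
  apply: subspace_eq_continuous cf => -[t x] /set_mem[/= It _].
  exact: fg.
case: df => dfx [h [dfh ch]]; split; last first.
  by exists h; split=> //; exact: eq_t_derivative_on dfh.
move=> l; have [xd cd] := dfx l; split.
  move=> t x It; have := xd t x It; suff -> : f t = g t by [].
  by apply/funext => y; exact: fg.
by apply: IH cd => t x It; exact: (@eq_dx I).
Qed.

Lemma Ck_onS k I f : Ck_on k.+1 I f -> Ck_on k I f.
Proof.
elim: k f => [|k IH] f; first by case.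
move=> [cf [dfx [h [dfh ch]]]]; split=> //; split.
  by move=> l; have [? ?] := dfx l; split=> //; exact: IH.
by exists h; split=> //; exact: IH.
Qed.

Lemma Ck_on_cont k I f : Ck_on k I f -> continuous_on I f.
Proof. by case: k => [|k] []. Qed.

Lemma dx_is_derive I f l t x : x_derivable_on I l f -> I t ->
  is_derive x (evec R l) (f t) (dx l f t x).
Proof. by move=> h It; apply: derivableP; exact: h. Qed.

Lemma continuous_onD I f g : continuous_on I f -> continuous_on I g ->
  continuous_on I (fun t x => f t x + g t x).
Proof.
move=> /subspace_continuousP cf /subspace_continuousP cg.
have E : uncurry (fun t x => f t x + g t x) = uncurry f \+ uncurry g.
  by apply/funext => -[].
apply/subspace_continuousP => z Iz; rewrite E.
by apply: cvgD; [exact: cf|exact: cg].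
Qed.

Lemma continuous_onM I f g : continuous_on I f -> continuous_on I g ->
  continuous_on I (fun t x => f t x * g t x).
Proof.
move=> /subspace_continuousP cf /subspace_continuousP cg.
have E : uncurry (fun t x => f t x * g t x) = uncurry f \* uncurry g.
  by apply/funext => -[].
apply/subspace_continuousP => z Iz; rewrite E.
by apply: cvgM; [exact: cf|exact: cg].
Qed.

Lemma continuous_on_cst I (c : R) : continuous_on I (fun _ _ => c).
Proof.
apply/subspace_continuousP => -[t x] _.
have -> : uncurry (fun (_ : R) (_ : coords R) => c) = cst c by apply/funext => -[].
exact: cvg_cst.
Qed.

Lemma continuous_on_comp I f (g : R -> R) : continuous_on I f ->
  (forall t x, I t -> {for f t x, continuous g}) ->
  continuous_on I (fun t x => g (f t x)).
Proof.
move=> /subspace_continuousP cf cg.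
have E : uncurry (fun t x => g (f t x)) = g \o uncurry f.
  by apply/funext => -[].
apply/subspace_continuousP => -[t x] [/= It _]; rewrite E.
apply: (@cvg_comp _ _ _ (uncurry f) g); first by apply: cf.
exact: cg.
Qed.

Lemma Ck_on_cst k I (c : R) : Ck_on k I (fun _ _ => c).
Proof.
elim: k c => [|k IH] c; first by split=> //; exact: continuous_on_cst.
split; first exact: continuous_on_cst; split=> [l|].
  split; first by move=> t x It; exact: derivable_cst.
  have -> : dx l (fun (_ : R) (_ : coords R) => c) = (fun _ _ => 0).
    by apply/funext => t; apply/funext => x; exact: derive_cst.
  exact: IH.
exists (fun _ _ => 0); split; last exact: IH.
by move=> t x It; exact: is_derive_cst.
Qed.

Lemma dxD I f g l t x : x_derivable_on I l f -> x_derivable_on I l g -> I t ->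
  dx l (fun t x => f t x + g t x) t x = dx l f t x + dx l g t x.
Proof. by move=> df dg It; rewrite -[RHS]deriveD//; [exact: df|exact: dg]. Qed.

Lemma dxM I f g l t x : x_derivable_on I l f -> x_derivable_on I l g -> I t ->
  dx l (fun t x => f t x * g t x) t x =
  dx l f t x * g t x + f t x * dx l g t x.
Proof.
move=> df dg It; rewrite addrC mulrC [X in _ + X]mulrC mulrC -[RHS]deriveM//; [exact: df|exact: dg].
Qed.

Lemma Ck_onD k I f g : Ck_on k I f -> Ck_on k I g ->
  Ck_on k I (fun t x => f t x + g t x).
Proof.
elim: k f g => [|k IH] f g.
  by move=> [cf _] [cg _]; split => //; exact: continuous_onD.
move=> [cf [dfx [f' [df' cf']]]] [cg [dgx [g' [dg' cg']]]]; split.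
  exact: continuous_onD.
split=> [l|].
  have [xf kf] := dfx l; have [xg kg] := dgx l; split.
    by move=> t x It; apply: derivableD; [exact: xf|exact: xg].
  apply: eq_Ck_on (IH _ _ kf kg) => t x It.
  by rewrite (@dxD I).
exists (fun t x => f' t x + g' t x); split; last exact: IH.
by move=> t x It; apply: is_deriveD; [exact: df'|exact: dg'].
Qed.

Lemma Ck_onM k I f g : Ck_on k I f -> Ck_on k I g ->
  Ck_on k I (fun t x => f t x * g t x).
Proof.
elim: k f g => [|k IH] f g.
  by move=> [cf _] [cg _]; split => //; exact: continuous_onM.
move=> Cf Cg; have [Cf0 Cg0] := (Ck_onS Cf, Ck_onS Cg).
move: Cf Cg => [cf [dfx [f' [df' cf']]]] [cg [dgx [g' [dg' cg']]]]; split.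
  exact: continuous_onM.
split=> [l|].
  have [xf kf] := dfx l; have [xg kg] := dgx l; split.
    by move=> t x It; apply: derivableM; [exact: xf|exact: xg].
  apply: eq_Ck_on (Ck_onD (IH _ _ kf Cg0) (IH _ _ Cf0 kg)) => t x It.
  by rewrite (@dxM I).
exists (fun t x => f' t x * g t x + f t x * g' t x); split.
  move=> t x It; rewrite addrC [X in _ + X]mulrC; apply: is_deriveM; [exact: df'|exact: dg'].
exact: Ck_onD (IH _ _ _ _) (IH _ _ _ _).
Qed.

Lemma Ck_onZ k I (c : R) f : Ck_on k I f -> Ck_on k I (fun t x => c * f t x).
Proof. by move=> cf; apply: Ck_onM cf; exact: Ck_on_cst. Qed.

Lemma Ck_onN k I f : Ck_on k I f -> Ck_on k I (fun t x => - f t x).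
Proof.
by move=> /(Ck_onZ (-1)); apply: eq_Ck_on => t x _; rewrite mulN1r.
Qed.

Lemma Ck_on_sum k I (J : Type) (r : seq J) (P : pred J) (f : J -> scalar_field R) :
  (forall j, Ck_on k I (f j)) ->
  Ck_on k I (fun t x => \sum_(j <- r | P j) f j t x).
Proof.
move=> cf; elim: r => [|j r IH].
  by apply: eq_Ck_on (Ck_on_cst k I 0) => t x _; rewrite big_nil.
case: (boolP (P j)) => Pj.
  by apply: eq_Ck_on (Ck_onD (cf j) IH) => t x _; rewrite big_cons Pj.
by apply: eq_Ck_on IH => t x _; rewrite big_cons (negbTE Pj).
Qed.

Lemma Ck_on_prod k I (J : Type) (r : seq J) (P : pred J) (f : J -> scalar_field R) :
  (forall j, Ck_on k I (f j)) ->
  Ck_on k I (fun t x => \prod_(j <- r | P j) f j t x).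
Proof.
move=> cf; elim: r => [|j r IH].
  by apply: eq_Ck_on (Ck_on_cst k I 1) => t x _; rewrite big_nil.
case: (boolP (P j)) => Pj.
  by apply: eq_Ck_on (Ck_onM (cf j) IH) => t x _; rewrite big_cons Pj.
by apply: eq_Ck_on IH => t x _; rewrite big_cons (negbTE Pj).
Qed.

Lemma dx_powR I f p l t x : x_derivable_on I l f -> I t -> 0 < f t x ->
  is_derive x (evec R l) (fun x => f t x `^ p)
    (p * f t x `^ (p - 1) * dx l f t x).
Proof.
move=> df It f0; apply: (@is_derive_comp_dir _ _ (fun r => r `^ p)).
  exact: dx_is_derive df It.
exact: is_derive1_powR.
Qed.

(** The induction keeps the exponent general, because differentiation replaces [p] by [p - 1]. *)
Lemma Ck_on_powR k I f p : (forall t x, I t -> 0 < f t x) -> Ck_on k I f ->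
  Ck_on k I (fun t x => f t x `^ p).
Proof.
move=> f0; have cp q : continuous_on I f -> continuous_on I (fun t x => f t x `^ q).
  move=> cf; apply: (@continuous_on_comp I f (fun r => r `^ q)) => // t x It.
  apply/differentiable_continuous/derivable1_diffP.
  by have [] := is_derive1_powR q (f0 t x It).
elim: k p => [|k IH] p; first by move=> [cf _]; split => //; exact: cp.
move=> Cf; have Cf0 := Ck_onS Cf.
move: Cf => [cf [dfx [f' [df' cf']]]]; split; first exact: cp.
split=> [l|].
  have [xf kf] := dfx l; split.
    by move=> t x It; have [] := dx_powR p xf It (f0 t x It).
  apply: eq_Ck_on (Ck_onM (Ck_onZ p (IH (p - 1) Cf0)) kf) => t x It.
  by rewrite /dx (is_derive_deriv (dx_powR p xf It (f0 t x It))).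
exists (fun t x => p * f t x `^ (p - 1) * f' t x); split; last first.
  by apply: Ck_onM cf'; apply: Ck_onZ; exact: IH.
move=> t x It; apply: (@is_derive_comp_dir _ _ (fun r => r `^ p) (f^~ x)).
  exact: df'.
apply: is_derive1_powR; apply: f0; exact: interior_subset It.
Qed.

(** Here [f] may be negative, as a determinant may be. The reciprocal is written as [f] times the
    power -1 of the positive field [f * f]. *)
Lemma Ck_onV k I f : (forall t x, I t -> f t x != 0) -> Ck_on k I f ->
  Ck_on k I (fun t x => (f t x)^-1).
Proof.
move=> f0 Cf.
have sq0 t x : I t -> 0 < f t x * f t x.
  by move=> It; rewrite -expr2 exprn_even_gt0//= f0.
apply: eq_Ck_on (Ck_onM Cf (Ck_on_powR (-1) sq0 (Ck_onM Cf Cf))) => t x It.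
rewrite powR_inv1 ?(ltW (sq0 _ _ It))//.
by rewrite invfM mulrA mulfV ?mul1r// f0.
Qed.

Lemma Ck_on_dx k I f l : Ck_on k.+1 I f -> Ck_on k I (dx l f).
Proof. by move=> [_ [/(_ l)[]]]. Qed.

Lemma Ck_on_xd k I f l : Ck_on k.+1 I f -> x_derivable_on I l f.
Proof. by move=> [_ [/(_ l)[]]]. Qed.

Lemma smooth_onD I f g : smooth_on I f -> smooth_on I g ->
  smooth_on I (fun t x => f t x + g t x).
Proof. by move=> sf sg k; exact: Ck_onD. Qed.

Lemma smooth_onM I f g : smooth_on I f -> smooth_on I g ->
  smooth_on I (fun t x => f t x * g t x).
Proof. by move=> sf sg k; exact: Ck_onM. Qed.

Lemma smooth_onN I f : smooth_on I f -> smooth_on I (fun t x => - f t x).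
Proof. by move=> sf k; exact: Ck_onN. Qed.

Lemma smooth_on_cst I c : smooth_on I (fun _ _ => c).
Proof. by move=> k; exact: Ck_on_cst. Qed.

Lemma smooth_on_sum I (J : Type) (r : seq J) (P : pred J) (f : J -> scalar_field R) :
  (forall j, smooth_on I (f j)) ->
  smooth_on I (fun t x => \sum_(j <- r | P j) f j t x).
Proof. by move=> sf k; apply: Ck_on_sum => j; exact: sf. Qed.

Lemma smooth_on_prod I (J : Type) (r : seq J) (P : pred J) (f : J -> scalar_field R) :
  (forall j, smooth_on I (f j)) ->
  smooth_on I (fun t x => \prod_(j <- r | P j) f j t x).
Proof. by move=> sf k; apply: Ck_on_prod => j; exact: sf. Qed.

Lemma smooth_on_powR I f p : (forall t x, I t -> 0 < f t x) -> smooth_on I f ->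
  smooth_on I (fun t x => f t x `^ p).
Proof. by move=> f0 sf k; exact: Ck_on_powR. Qed.

Lemma smooth_onV I f : (forall t x, I t -> f t x != 0) -> smooth_on I f ->
  smooth_on I (fun t x => (f t x)^-1).
Proof. by move=> f0 sf k; exact: Ck_onV. Qed.

Lemma smooth_on_dx I f l : smooth_on I f -> smooth_on I (dx l f).
Proof. by move=> sf k; exact/Ck_on_dx/sf. Qed.

Lemma eq_smooth_on I f g : (forall t x, I t -> f t x = g t x) ->
  smooth_on I f -> smooth_on I g.
Proof. by move=> fg sf k; exact: eq_Ck_on (sf k). Qed.

Lemma smooth_on_xd I f l : smooth_on I f -> x_derivable_on I l f.
Proof. by move=> sf; exact: Ck_on_xd (sf 1%N). Qed.

Lemma smooth_on_cont I f : smooth_on I f -> continuous_on I f.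
Proof. by move=> sf; exact: Ck_on_cont (sf 0%N). Qed.

(** At an end point of [I], [dt f] is a two-sided limit that involves values of [f] outside [I], and
    nothing is known about it. The continuous representative [g] replaces it in bounds and in
    integrability arguments. *)
Lemma smooth_on_td I f : smooth_on I f -> exists2 g, continuous_on I g &
  forall t x, interior I t -> is_derive t 1 (f^~ x) (g t x) /\ dt f t x = g t x.
Proof.
move=> sf; have [_ [_ [g [dg cg]]]] := sf 1%N.
exists g; first exact: cg.1.
move=> t x It; split; first exact: dg.
by rewrite /dt derive1E; have /is_derive_deriv := dg t x It.
Qed.

Lemma smooth_on_dt_derive I f t x : smooth_on I f -> interior I t ->
  is_derive t 1 (f^~ x) (dt f t x).
Proof.
by move=> /smooth_on_td[g _ /(_ t x) h] It; have [h1 ->] := h It.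
Qed.

End Ck.

(** * Symmetry of mixed derivatives *)

Section schwarz.
Context (R : realType).

Lemma MVT_cc (f df : R -> R) (a b : R) : a < b ->
  (forall x, a <= x <= b -> is_derive x 1 f (df x)) ->
  exists2 c : R, a < c < b & f b - f a = df c * (b - a).
Proof.
move=> ab fdf; have [||c] := @MVT R f df a b ab.
- by move=> x; rewrite in_itv/= => /andP[/ltW ? /ltW ?]; apply: fdf; apply/andP.
- apply: derivable_within_continuous => x; rewrite in_itv/= => xab.
  by have [] := fdf x xab.
- by rewrite in_itv/= => cab ->; exists c.
Qed.

Variables (F F1 F2 F12 F21 : R -> R -> R) (d : R).
Hypothesis d0 : 0 < d.
Hypothesis dF1 : forall a b : R, `|a| < d -> `|b| < d -> is_derive a 1 (F^~ b) (F1 a b).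
Hypothesis dF2 : forall a b : R, `|a| < d -> `|b| < d -> is_derive b 1 (F a) (F2 a b).
Hypothesis dF12 : forall a b : R, `|a| < d -> `|b| < d -> is_derive b 1 (F1 a) (F12 a b).
Hypothesis dF21 : forall a b : R, `|a| < d -> `|b| < d -> is_derive a 1 (F2^~ b) (F21 a b).
Hypothesis cF12 : forall e : R, 0 < e -> exists2 r : R, 0 < r &
  forall a b : R, `|a| < r -> `|b| < r -> `|F12 a b - F12 0 0| < e.
Hypothesis cF21 : forall e : R, 0 < e -> exists2 r : R, 0 < r &
  forall a b : R, `|a| < r -> `|b| < r -> `|F21 a b - F21 0 0| < e.

(** The double difference of [F] over the square of side h, treated by two mean value theorems in
    either order, equals h^2 times [F12] at one point of the square and h^2 times [F21] at another.
    Continuity of both at 0 then forces equality there. *)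
Lemma mixed_partials : F12 0 0 = F21 0 0.
Proof.
apply/eqP; rewrite -subr_eq0 -normr_le0; apply/ler_addgt0Pl => e e0; rewrite addr0.
have [r1 r10 h1] := cF12 (divr_gt0 e0 (ltr0n _ 2)).
have [r2 r20 h2] := cF21 (divr_gt0 e0 (ltr0n _ 2)).
(* Half of the smallest radius, so that the closed square of side [h] stays in the open region where
   all hypotheses apply. *)
pose h : R := Num.min d (Num.min r1 r2) / 2.
have h0 : 0 < h by rewrite divr_gt0// !lt_min d0 r10.
have m0 : h * 2 = Num.min d (Num.min r1 r2) by rewrite /h divfK.
have [hd hr1 hr2] : [/\ h < d, h < r1 & h < r2].
  have : h < h * 2 by lra.
  by rewrite m0 !lt_min => /and3P[].
have hh (c : R) : 0 <= c <= h -> [/\ `|c| < d, `|c| < r1 & `|c| < r2].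
  by move=> /andP[c0 ch]; rewrite ger0_norm//; split; apply: le_lt_trans ch _.
have hhe : `|h| < d by have [] := hh h; rewrite ?lexx ?ltW.
have h0e : `|0 : R| < d by rewrite normr0.
have [c1 c1h E1] : exists2 c : R, 0 < c < h &
    (F h h - F h 0) - (F 0 h - F 0 0) = (F1 c h - F1 c 0) * (h - 0).
  apply: (@MVT_cc (fun a => F a h - F a 0) (fun a => F1 a h - F1 a 0)) => // c /hh[? _ _].
  by apply: is_deriveB; exact: dF1.
have c1hh : 0 <= c1 <= h by move: c1h => /andP[? ?]; rewrite !ltW.
have [c1d c1r1 c1r2] := hh _ c1hh.
have [c2 c2h E2] : exists2 c : R, 0 < c < h & F1 c1 h - F1 c1 0 = F12 c1 c * (h - 0).
  by apply: MVT_cc => // c /hh[? _ _]; exact: dF12.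
have [c3 c3h E3] : exists2 c : R, 0 < c < h &
    (F h h - F 0 h) - (F h 0 - F 0 0) = (F2 h c - F2 0 c) * (h - 0).
  apply: (@MVT_cc (fun b => F h b - F 0 b) (fun b => F2 h b - F2 0 b)) => // c /hh[? _ _].
  by apply: is_deriveB; exact: dF2.
have c3hh : 0 <= c3 <= h by move: c3h => /andP[? ?]; rewrite !ltW.
have [c3d c3r1 c3r2] := hh _ c3hh.
have [c4 c4h E4] : exists2 c : R, 0 < c < h & F2 h c3 - F2 0 c3 = F21 c c3 * (h - 0).
  by apply: (@MVT_cc (F2^~ c3) (F21^~ c3)) => // c /hh[? _ _]; exact: dF21.
have c2hh : 0 <= c2 <= h by move: c2h => /andP[? ?]; rewrite !ltW.
have [c2d c2r1 c2r2] := hh _ c2hh.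
have c4hh : 0 <= c4 <= h by move: c4h => /andP[? ?]; rewrite !ltW.
have [c4d c4r1 c4r2] := hh _ c4hh.
have E : F12 c1 c2 = F21 c4 c3.
  have : F12 c1 c2 * (h * h) = F21 c4 c3 * (h * h).
    rewrite !subr0 in E1 E2 E3 E4.
    have A1 := congr1 (fun z : R => z * h) E2.
    have A2 := congr1 (fun z : R => z * h) E4.
    by move: A1 A2 => /= A1 A2; lra.
  by apply: mulIf; rewrite mulf_neq0// gt_eqF.
have := h1 c1 c2 c1r1 c2r1; have := h2 c4 c3 c4r2 c3r2; rewrite E.
set u := F21 c4 c3; rewrite distrC => A B.
have -> : F12 0 0 - F21 0 0 = (F21 0 0 - u) * -1 + (u - F12 0 0) * -1 by ring.
rewrite (le_trans (ler_normD _ _))// !normrM normrN1 !mulr1; lra.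
Qed.

End schwarz.

Section schwarz_fields.
Context (R : realType).
Implicit Types (f g : scalar_field R) (I : set R) (t : R) (x : coords R).

(* Continuity of a field on I at an interior time, in epsilon-delta form along
   two-parameter deformations. *)
Lemma continuous_on_path I f t x (p : R * R -> R * coords R) :
  continuous_on I f -> interior I t -> p (0, 0) = (t, x) ->
  {for (0, 0), continuous p} ->
  forall e : R, 0 < e -> exists2 r : R, 0 < r &
  forall a b : R, `|a| < r -> `|b| < r ->
    `|uncurry f (p (a, b)) - uncurry f (p (0, 0))| < e.
Proof.
move=> /subspace_continuousP cf It p0 cp e e0.
have cfz : {for (t, x), continuous (uncurry f)}.
  have := cf (t, x) (conj (interior_subset It) Logic.I).
  rewrite /prop_for /continuous_at /cvg_to.
  have -> : within (I `*` setT) (nbhs (t, x)) = nbhs (t, x); last by [].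
  rewrite eqEsubset; split; last exact: cvg_within.
  move=> A wA; have nI : nbhs (t, x) (I `*` [set: coords R]).
    by exists (I, setT) => //=; split => //; exact: filterT.
  have {}wA : nbhs (t, x) (fun z => (I `*` [set: coords R]) z -> A z) := wA.
  by apply: filterS (filterI wA nI) => z [h1 h2]; exact: h1.
have : {for (0, 0), continuous (uncurry f \o p)}.
  by apply: continuous_comp => //; rewrite p0.
rewrite /prop_for /continuous_at => /cvgrPdist_lt/(_ e e0) [[A B]/= [nA nB] AB].
move: nA nB => /nbhs_ballP[r1/= r10 r1A] /nbhs_ballP[r2/= r20 r2B].
exists (Num.min r1 r2); first by rewrite lt_min r10.
move=> a b; rewrite !lt_min => /andP[ar1 _] /andP[_ br2].
rewrite distrC; apply: (AB (a, b)); split => /=.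
  by apply: r1A; rewrite /ball/= sub0r normrN.
by apply: r2B; rewrite /ball/= sub0r normrN.
Qed.

Lemma continuous_affine2 (V W : normedModType R) (v1 v2 v0 : V) (w1 w2 w0 : W) :
  continuous (fun q : R * R => (q.1 *: v1 + q.2 *: v2 + v0, q.1 *: w1 + q.2 *: w2 + w0)).
Proof.
move=> q; apply: cvg_pair => /=.
  apply: cvgD; last exact: cvg_cst.
  by apply: cvgD; apply: cvgZr_tmp; [exact: cvg_fst|exact: cvg_snd].
apply: cvgD; last exact: cvg_cst.
by apply: cvgD; apply: cvgZr_tmp; [exact: cvg_fst|exact: cvg_snd].
Qed.

Lemma dx_swap I f l m t x : Ck_on 2 I f -> interior I t ->
  dx l (dx m f) t x = dx m (dx l f) t x.
Proof.
move=> Cf It; have It0 := interior_subset It.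
pose P (q : R * R) := (t, q.1 *: evec R m + q.2 *: evec R l + x).
have Pc : {for (0, 0), continuous P}.
  have := @continuous_affine2 R (coords R) 0 0 t (evec R m) (evec R l) x (0, 0).
  rewrite /prop_for.
  by under eq_fun do rewrite !scaler0 !add0r.
have P0 : P (0, 0) = (t, x) by rewrite /P/= !scale0r !add0r.
pose G f (a b : R) := uncurry f (P (a, b)).
have G0 g : G g 0 0 = g t x by rewrite /G P0.
have dG1 g : x_derivable_on I m g -> forall a b : R, is_derive a 1 (fun a => G g a b) (G (dx m g) a b).
  move=> dg a b; rewrite /G/= -addrA.
  have := dx_is_derive (a *: evec R m + (b *: evec R l + x)) dg It0.
  move=> /is_derive_line; under eq_fun do rewrite addrA.
  by [].
have dG2 g : x_derivable_on I l g -> forall a b : R, is_derive b 1 (fun b => G g a b) (G (dx l g) a b).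
  move=> dg a b; rewrite /G/= (addrC (a *: _)) -addrA.
  have := dx_is_derive (b *: evec R l + (a *: evec R m + x)) dg It0.
  move=> /is_derive_line; under eq_fun do rewrite addrA (addrC (_ *: evec R l)).
  by [].
have cG g : continuous_on I g -> forall e : R, 0 < e -> exists2 r : R, 0 < r &
    forall a b : R, `|a| < r -> `|b| < r -> `|G g a b - G g 0 0| < e.
  by move=> cg; exact: continuous_on_path cg It P0 Pc.
clearbody G; clear P0 Pc P.
have Cm := Ck_on_dx m Cf; have Cl := Ck_on_dx l Cf.
have H := @mixed_partials R (G f) (G (dx m f)) (G (dx l f))
  (G (dx l (dx m f))) (G (dx m (dx l f))) 1 ltr01.
rewrite -[LHS](G0 (dx l (dx m f))) -[RHS](G0 (dx m (dx l f))); apply: H.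
- by move=> a b _ _; apply: dG1; exact: Ck_on_xd Cf.
- by move=> a b _ _; apply: dG2; exact: Ck_on_xd Cf.
- by move=> a b _ _; apply: dG2; exact: Ck_on_xd Cm.
- by move=> a b _ _; apply: dG1; exact: Ck_on_xd Cl.
- by apply: cG; exact: Ck_on_cont (Ck_on_dx l Cm).
- by apply: cG; exact: Ck_on_cont (Ck_on_dx m Cl).
Qed.

(** Near [t] the derivative [dt f] coincides with the field [g] provided by [Ck_on], which has the
    regularity needed for the symmetry of mixed derivatives. The radius [d] keeps the deformed times
    inside [I]. *)
Lemma dt_dx_swap I f l t x : Ck_on 2 I f -> interior I t ->
  dt (dx l f) t x = dx l (dt f) t x.
Proof.
move=> Cf It.
have [d d0 dI] : exists2 d : R, 0 < d & forall s, `|s| < d -> interior I (s + t).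
  have : nbhs t (interior I) by exact: open_nbhs_nbhs (conj (open_interior I) It).
  move=> /nbhs_ballP[d /= d0 h]; exists d => // s sd; apply: h.
  by rewrite /ball/= distrC addrK.
pose P (q : R * R) := (q.1 + t, q.2 *: evec R l + x).
have Pc : {for (0, 0), continuous P}.
  have := @continuous_affine2 R (coords R) 1 0 t 0 (evec R l) x (0, 0).
  rewrite /prop_for.
  by under eq_fun do rewrite !scaler0 addr0 add0r [_ *: 1]mulr1.
have P0 : P (0, 0) = (t, x) by rewrite /P/= scale0r !add0r.
have [_ [dfx [g [dg Cg]]]] := Cf.
have {}Cg : Ck_on 1 I g by [].
have Cl : Ck_on 1 I (dx l f) by exact: Ck_on_dx.
have [_ [_ [h [dh ch]]]] := Cl.
have gE s y : interior I s -> dt f s y = g s y.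
  by move=> Is; rewrite /dt derive1E (is_derive_deriv (dg s y Is)).
have hE s y : interior I s -> dt (dx l f) s y = h s y.
  by move=> Is; rewrite /dt derive1E (is_derive_deriv (dh s y Is)).
rewrite hE//.
have -> : dx l (dt f) t x = dx l g t x by exact: (eq_dx (I := interior I)).
pose G f (a b : R) := uncurry f (P (a, b)).
have G0 g' : G g' 0 0 = g' t x by rewrite /G P0.
have dG1 f1 f2 : t_derivative_on I f1 f2 -> forall a b : R, `|a| < d -> is_derive a 1 (fun a => G f1 a b) (G f2 a b).
  move=> df a b ad; rewrite /G/=.
  have := df (a + t) (b *: evec R l + x) (dI _ ad).
  rewrite -{1}[a]mulr1 => /is_derive_line.
  by under eq_fun do rewrite [_ *: _]mulr1.
have dG2 f1 : x_derivable_on I l f1 -> forall a b : R, `|a| < d -> is_derive b 1 (fun b => G f1 a b) (G (dx l f1) a b).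
  move=> df a b ad; rewrite /G/=.
  have := dx_is_derive (b *: evec R l + x) df (interior_subset (dI _ ad)).
  by move=> /is_derive_line.
have cG f1 : continuous_on I f1 -> forall e : R, 0 < e -> exists2 r : R, 0 < r &
    forall a b : R, `|a| < r -> `|b| < r -> `|G f1 a b - G f1 0 0| < e.
  by move=> cf; exact: continuous_on_path cf It P0 Pc.
clearbody G; clear P0 Pc P.
have H := @mixed_partials R (G f) (G g) (G (dx l f))
  (G (dx l g)) (G h) d d0.
rewrite -[LHS](G0 h) -[RHS](G0 (dx l g)); apply/esym; apply: H.
- by move=> a b ad _; exact: dG1.
- by move=> a b ad _; apply: dG2 => //; exact: Ck_on_xd Cf.
- by move=> a b ad _; apply: dG2 => //; exact: Ck_on_xd Cg.
- by move=> a b ad _; exact: dG1.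
- by apply: cG; exact: Ck_on_cont (Ck_on_dx l Cg).
- by apply: cG; exact: ch.1.
Qed.

End schwarz_fields.

(** * Measurability and integration over the cell *)

Section measurable_base.

(** Second countability witnessed by sets of [M], which need not be open. It is stable under
    products of topologies, whereas the sigma-algebra of a product is generated by rectangles; this
    is the bridge between the two. *)
Definition measurable_base (X : topologicalType) (M : set (set X)) :=
  exists (I : countType) (B : I -> set X), (forall k, M (B k)) /\
    forall x U, nbhs x U -> exists k, B k x /\ B k `<=` U.

Lemma measurable_base_prod (X Y : topologicalType) (M1 : set (set X))
    (M2 : set (set Y)) (M : set (set (X * Y))) :
  (forall A B, M1 A -> M2 B -> M (A `*` B)) ->
  measurable_base M1 -> measurable_base M2 -> measurable_base M.
Proof.
move=> MM [I [B [mB hB]]] [J [C [mC hC]]].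
exists (I * J)%type, (fun k => B k.1 `*` C k.2); split.
  by move=> k; exact: MM.
move=> [x y] U [[P Q] /= [nP nQ] PQU].
have [i [Bi iP]] := hB _ _ nP; have [j [Cj jQ]] := hC _ _ nQ.
exists (i, j); split => // -[a b] [/= Ba Cb]; apply: PQU; split => /=.
  exact: iP.
exact: jQ.
Qed.

(** An open set is the union of the base sets that it contains, and there are countably many of
    them. *)
Lemma open_measurable_base (X : topologicalType) d (Y : measurableType d)
    (f : X -> Y) (g : Y -> X) :
  cancel f g -> cancel g f ->
  measurable_base [set A : set X | measurable (g @^-1` A)] ->
  forall U : set X, open U -> measurable (g @^-1` U).
Proof.
move=> fg gf [I [B [mB hB]]] U oU.
have -> : U = \bigcup_(k in [set k | B k `<=` U]) B k.
  apply/seteqP; split => [x Ux|x [k kU Bk]]; last exact: kU.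
  have [k [Bk kU]] := hB x U (open_nbhs_nbhs (conj oU Ux)).
  by exists k.
rewrite preimage_bigcup bigcup_mkcond.
apply: countable_bigcupT_measurable; first exact: countableP.
by move=> k; case: ifPn => // _; exact: mB.
Qed.

Context (R : realType).

Lemma measurable_base_R :
  measurable_base [set A : set R | measurable (A : set (measurableTypeR R))].
Proof.
exists (rat * rat)%type, (fun k => `]ratr k.1, ratr k.2[%classic); split.
  by move=> k /=; exact: measurable_itv.
move=> x U /nbhs_ballP[e /= e0 xU].
have [p] := @rat_in_itvoo R (x - e) x ltac:(by rewrite ltrBlDr ltrDl).
have [q] := @rat_in_itvoo R x (x + e) ltac:(by rewrite ltrDl).
rewrite !in_itv/= => /andP[q1 q2] /andP[p1 p2].
exists (p, q); split; first by rewrite /= in_itv/= p2.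
move=> y /=; rewrite in_itv/= => /andP[py yq]; apply: xU; rewrite /ball/=.
by rewrite ltr_distlC; apply/andP; split; [exact: lt_trans py|exact: lt_trans q2].
Qed.

Lemma measurable_base_coords :
  measurable_base [set A : set (coords R) | measurable (A : set (mcoords R))].
Proof.
apply: measurable_base_prod measurable_base_R; first by move=> A B; exact: measurableX.
apply: measurable_base_prod measurable_base_R measurable_base_R.
by move=> A B; exact: measurableX.
Qed.

Lemma open_measurable_coords (U : set (coords R)) : open U ->
  measurable (U : set (mcoords R)).
Proof.
move=> oU.
exact: (@open_measurable_base (coords R) _ (mcoords R) id id _ _ measurable_base_coords).
Qed.

Lemma open_measurable_tx (U : set (R * coords R)) : open U ->
  measurable (U : set (measurableTypeR R * mcoords R)%type).
Proof.
move=> oU.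
apply: (@open_measurable_base (R * coords R)%type _ (measurableTypeR R * mcoords R)%type id id) => //.
apply: measurable_base_prod measurable_base_R measurable_base_coords.
by move=> A B; exact: measurableX.
Qed.

Lemma measurable_cell : measurable (@cell R : set (mcoords R)).
Proof. by do 2?apply: measurableX; exact: measurable_itv. Qed.

Lemma continuous_measurable_coords (f : coords R -> R) : continuous f ->
  measurable_fun [set: mcoords R] f.
Proof.
move=> /continuousP cf; apply: (measurability _ (RGenOpens.measurableE R)).
move=> _ [_ [a [b ->] <-]]; rewrite setTI; apply: open_measurable_coords.
exact/cf/interval_open.
Qed.

Lemma continuous_on_measurable (I J : set R) (f : scalar_field R) :
  measurable (I : set (measurableTypeR R)) ->
  measurable (J : set (measurableTypeR R)) -> J `<=` I -> continuous_on I f -> measurable_on J f.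
Proof.
move=> mI mJ JI cf.
have mIT : measurable (I `*` setT : set (measurableTypeR R * mcoords R)) by exact: measurableX.
have mJC : measurable (J `*` @cell R : set (measurableTypeR R * mcoords R)).
  by apply: measurableX => //; exact: measurable_cell.
apply: (@measurable_funS _ _ _ _ (I `*` setT)) => //; first by move=> [t x] [/= /JI].
apply: (measurability _ (RGenOpens.measurableE R)).
move=> _ [_ [a [b ->] <-]].
move/continuousP : cf => /(_ `]a, b[%classic (interval_open _ _)) oU.
have /open_subspaceP [V oV VD] : open (uncurry f @^-1` `]a, b[ : set (subspace (I `*` [set: coords R]))) by exact: oU.
rewrite setIC -VD; apply: measurableI => //.
exact: open_measurable_tx.
Qed.

Lemma continuous_on_section (I : set R) (f : scalar_field R) t :
  I t -> continuous_on I f -> continuous (f t).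
Proof.
move=> It /subspace_continuousP cf x.
have := cf (t, x) (conj It Logic.I).
rewrite /= => h.
have : (fun y => (t, y)) y @[y --> x] --> within (I `*` [set: coords R]) (nbhs (t, x)).
  move=> A wA; have {}wA : nbhs (t, x) (fun z => (I `*` [set: coords R]) z -> A z) := wA.
  move: wA => [[P Q] /= [nP nQ] PQ].
  apply: filterS nQ => y Qy; apply: (PQ (t, y)) => //; split => //.
  exact: nbhs_singleton.
by move=> /cvg_comp/(_ h).
Qed.

Lemma continuous_on_measurable_section (I : set R) (f : scalar_field R) t :
  I t -> continuous_on I f -> measurable_fun (@cell R : set (mcoords R)) (f t).
Proof.
move=> It cf; apply: (@measurable_funS _ _ _ _ setT) => //.
exact: continuous_measurable_coords (continuous_on_section It cf).
Qed.

Lemma continuous_on_bounded (a b : R) (f : scalar_field R) :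
  continuous_on `[a, b] f -> exists2 C : R, 0 < C & forall t x, a <= t <= b -> cell x -> `|f t x| <= C.
Proof.
move=> cf.
(* The cell is half open; compactness is applied to the closed cube, on which the field is
   continuous as well. *)
pose K := `[a, b]%classic `*` (`[0:R, 1]%classic `*` `[0:R, 1]%classic `*` `[0:R, 1]%classic).
have cK : compact K.
  have c01 := @segment_compact R 0 1.
  exact: compact_setX (@segment_compact R a b) (compact_setX (compact_setX c01 c01) c01).
have : {within K, continuous (uncurry f)}.
  apply: continuous_subspaceW cf => -[t x] [/= ? _]; split => //.
move=> /continuous_compact/(_ cK)/compact_bounded[C [_ hC]].
exists (`|C| + 1); first by rewrite ltr_pwDr.
move=> t x tab [[/= x1 x2] x3]; apply: (hC (`|C| + 1)).
  by rewrite (le_lt_trans (ler_norm _))// ltrDl.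
exists (t, x) => //.
have W y : y \in `[0, 1[ -> `[0:R, 1]%classic y by rewrite /= !in_itv/= => /andP[-> /ltW].
do ![split => /=]; rewrite ?in_itv//=; [exact: W x1|exact: W x2|exact: W x3].
Qed.

End measurable_base.

(** * Fubini and Tonelli on rectangles *)

Section fubini_rect.
Context d1 d2 (T1 : measurableType d1) (T2 : measurableType d2) (R : realType).
Variables (m1 : {sigma_finite_measure set T1 -> \bar R})
          (m2 : {sigma_finite_measure set T2 -> \bar R}).
Variables (A : set T1) (B : set T2).
Hypotheses (mA : measurable A) (mB : measurable B).
Local Open Scope ereal_scope.
Implicit Types f : T1 * T2 -> \bar R.

Lemma patch_setX f x y : (f \_ (A `*` B)) (x, y) =
  if (x \in A) && (y \in B) then f (x, y) else 0.
Proof.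
by rewrite /patch in_setX.
Qed.

Let F1E f x : \int[m2]_y (f \_ (A `*` B)) (x, y) =
  ((fun x => \int[m2]_(y in B) f (x, y)) \_ A) x.
Proof.
rewrite [RHS]/patch; case: ifPn => xA.
  rewrite [RHS]integral_mkcond; apply: eq_integral => y _.
  by rewrite patch_setX xA /patch.
by rewrite integral0_eq// => y _; rewrite patch_setX (negbTE xA).
Qed.

Let F2E f y : \int[m1]_x (f \_ (A `*` B)) (x, y) =
  ((fun y => \int[m1]_(x in A) f (x, y)) \_ B) y.
Proof.
rewrite [RHS]/patch; case: ifPn => yB.
  rewrite [RHS]integral_mkcond; apply: eq_integral => x _.
  by rewrite patch_setX yB andbT /patch.
by rewrite integral0_eq// => x _; rewrite patch_setX (negbTE yB) andbF.
Qed.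

Lemma fubini_rect1 f : (prodm m1 m2).-integrable (A `*` B) f ->
  \int[prodm m1 m2]_(z in A `*` B) f z =
  \int[m1]_(x in A) \int[m2]_(y in B) f (x, y).
Proof.
move=> /(integrable_mkcond _ (measurableX mA mB)) fi.
rewrite integral_mkcond [RHS]integral_mkcond.
rewrite -(integral12_prod_meas1 fi).
by apply: eq_integral => x _; exact: F1E.
Qed.

Lemma fubini_rect2 f : (prodm m1 m2).-integrable (A `*` B) f ->
  \int[prodm m1 m2]_(z in A `*` B) f z =
  \int[m2]_(y in B) \int[m1]_(x in A) f (x, y).
Proof.
move=> /(integrable_mkcond _ (measurableX mA mB)) fi.
rewrite integral_mkcond [RHS]integral_mkcond.
rewrite -(integral21_prod_meas1 fi).
by apply: eq_integral => x _; exact: F2E.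
Qed.

Lemma tonelli_rect1 f : measurable_fun (A `*` B : set (T1 * T2)%type) f ->
  (forall z, (A `*` B) z -> 0 <= f z) ->
  \int[prodm m1 m2]_(z in A `*` B) f z =
  \int[m1]_(x in A) \int[m2]_(y in B) f (x, y).
Proof.
move=> /(measurable_restrictT _ (measurableX mA mB)) mf f0.
rewrite integral_mkcond [RHS]integral_mkcond.
rewrite /prodm fubini_tonelli1//; last by move=> z; exact: erestrict_ge0.
by apply: eq_integral => x _; exact: F1E.
Qed.

Lemma tonelli_rect_le f K : measurable_fun (A `*` B : set (T1 * T2)%type) f ->
  (forall z, (A `*` B) z -> 0 <= f z) -> 0 <= K ->
  {ae m1, forall x, A x -> \int[m2]_(y in B) f (x, y) <= K} ->
  \int[prodm m1 m2]_(z in A `*` B) f z <= \int[m1]_(x in A) K.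
Proof.
move=> mf f0 K0 fK; rewrite tonelli_rect1//.
apply: ae_ge0_le_integral => //.
- by move=> x Ax; apply: integral_ge0 => y By; exact: f0.
- apply/(measurable_restrictT _ mA).
  have mf' := (measurable_restrictT _ (measurableX mA mB)).1 mf.
  have := @measurable_fun_fubini_tonelli_F _ _ _ _ _ m2 _ mf' (erestrict_ge0 f0).
  by apply: eq_measurable_fun => x _; rewrite -F1E.
Qed.

(** By Tonelli the measures of the sections of a null set integrate to 0, so almost every section is
    null. *)
Lemma ae_prodm (P : T1 * T2 -> Prop) :
  {ae prodm m1 m2, forall z, P z} ->
  {ae m1, forall x, {ae m2, forall y, P (x, y)}}.
Proof.
move=> [N [mN N0 sN]].
have mi : measurable_fun setT (EFin \o \1_N : T1 * T2 -> \bar R) by exact/measurable_EFinP.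
have H : \int[m1]_x `|\int[m2]_y (EFin \o \1_N) (x, y)| = 0.
  rewrite -[RHS]N0 -[in RHS](setIT N) -(@integral_indic _ _ _ (prodm m1 m2) setT measurableT N mN).
  rewrite [RHS](fubini_tonelli1 _ mi) => [|z]; last by rewrite lee_fin.
  apply: eq_integral => x _; rewrite gee0_abs//; apply: integral_ge0 => y _.
  by rewrite lee_fin.
have mF : measurable_fun setT (fun x => \int[m2]_y (EFin \o \1_N) (x, y)).
  have h z : 0 <= (EFin \o \1_N : T1 * T2 -> \bar R) z by rewrite lee_fin.
  exact: (measurable_fun_fubini_tonelli_F _ mi h).
move/(ae_eq_integral_abs m1 measurableT mF) : H.
apply: filterS => x /(_ Logic.I) /= H.
exists (xsection N x); split; first exact: measurable_xsection.
  rewrite -H -(setIT (xsection N x)) -integral_indic//; last exact: measurable_xsection.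
  apply: eq_integral => y _; congr EFin; rewrite !indicE; congr (_ %:R); congr nat_of_bool.
  by apply/idP/idP; rewrite !inE /xsection/= ?inE.
by move=> y nP; rewrite /xsection/= inE; exact: sN.
Qed.

End fubini_rect.

Section cell_integrals.
Context (R : realType).
Implicit Types (f g : scalar_field R) (F G : coords R -> R) (t : R) (x : coords R).
Local Notation leb := (@lebesgue_measure R).

Lemma bounded_on_le (T : Type) (h : T -> R) (D : set T) C :
  (forall z, D z -> `|h z| <= C) -> [bounded h z | z in D].
Proof.
move=> hC; exists C; split; first exact: num_real.
by move=> M CM x Dx /=; rewrite (le_trans (hC x Dx))// ltW.
Qed.

Lemma ftc_itv (g dg : R -> R) (a b : R) : a < b -> continuous dg ->
  (forall y : R, is_derive y 1 g (dg y)) ->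
  (\int[leb]_(y in `[a, b]) (dg y)%:E = (g b - g a)%:E)%E.
Proof.
move=> ab cdg dgg; rewrite (@continuous_FTC2 _ dg g)//.
- exact: continuous_subspaceT.
- have cg y : {for y, continuous g}.
    by apply/differentiable_continuous/derivable1_diffP; have [] := dgg y.
  split; first by move=> y _; have [] := dgg y.
  + exact/cvg_at_right_filter/cg.
  + exact/cvg_at_left_filter/cg.
- by move=> y _; rewrite derive1E; have /is_derive_deriv := dgg y.
Qed.

Lemma ftc_itvoo (g dg : R -> R) (a b : R) : a < b -> continuous dg ->
  (forall y : R, is_derive y 1 g (dg y)) ->
  (\int[leb]_(y in `]a, b[) (dg y)%:E = (g b - g a)%:E)%E.
Proof.
move=> ab cdg dgg; rewrite -(ftc_itv ab cdg dgg).
have mdg D : measurable_fun D (fun y => (dg y)%:E).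
  by apply/measurable_EFinP; apply: measurable_funTS; exact: continuous_measurable_fun.
by rewrite integral_itv_bndo_bndc// integral_itv_obnd_cbnd.
Qed.

Lemma ftc_itvco (g dg : R -> R) (a b : R) : a < b -> continuous dg ->
  (forall y : R, is_derive y 1 g (dg y)) ->
  (\int[leb]_(y in `[a, b[) (dg y)%:E = (g b - g a)%:E)%E.
Proof.
move=> ab cdg dgg; rewrite -(ftc_itv ab cdg dgg).
have mdg D : measurable_fun D (fun y => (dg y)%:E).
  by apply/measurable_EFinP; apply: measurable_funTS; exact: continuous_measurable_fun.
by rewrite integral_itv_bndo_bndc.
Qed.

Lemma leb2_square : prodm leb leb (`[0%R, 1%R[%classic `*` `[0%R, 1%R[%classic) = 1%E.
Proof.
have h : leb `[0%R, 1%R[%classic = 1%E.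
  by rewrite lebesgue_measure_itv/= lte_fin ltr01 oppr0 adde0.
transitivity ((leb \x leb)%E (`[0%R, 1%R[%classic `*` `[0%R, 1%R[%classic)); first by [].
have m01 : measurable (`[0:R, 1[%classic : set (measurableTypeR R)) by exact: measurable_itv.
rewrite product_measure1E//; transitivity (1 * 1 : \bar R)%E; last exact: mule1.
by congr (_ * _)%E; exact: h.
Qed.

Lemma leb3_cell : leb3 R (@cell R) = 1%E.
Proof.
have h : leb `[0%R, 1%R[%classic = 1%E.
  by rewrite lebesgue_measure_itv/= lte_fin ltr01 oppr0 adde0.
have m01 : measurable (`[0:R, 1[%classic : set (measurableTypeR R)) by exact: measurable_itv.
transitivity ((prodm leb leb \x leb)%E (@cell R)); first by [].
rewrite product_measure1E//; last exact: measurableX.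
transitivity (1 * 1 : \bar R)%E; last exact: mule1.
by congr (_ * _)%E; [exact: leb2_square|exact: h].
Qed.

Lemma continuous_integrable_cell F : continuous F ->
  (leb3 R).-integrable (@cell R) (EFin \o F).
Proof.
move=> cF.
have c01 := @segment_compact R 0 1.
have cK := compact_setX (compact_setX c01 c01) c01.
have : {within `[0:R, 1]%classic `*` `[0:R, 1]%classic `*` `[0:R, 1]%classic, continuous F}.
  exact: continuous_subspaceT.
move=> /continuous_compact/(_ cK)/compact_bounded[C [_ hC]].
apply: measurable_bounded_integrable.
- exact: measurable_cell.
- by move: (ltry (1 : R)); rewrite -leb3_cell.
- exact: measurable_funTS (continuous_measurable_coords cF).
- apply: (@bounded_on_le _ F _ (`|C| + 1)) => -[[x1 x2] x3] [[/= h1 h2] h3].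
  apply: (hC (`|C| + 1)); first by rewrite (le_lt_trans (ler_norm _))// ltrDl.
  exists (x1, x2, x3) => //.
  have W y : y \in `[0, 1[ -> `[0:R, 1]%classic y by rewrite /= !in_itv/= => /andP[-> /ltW].
  by do ![split => /=]; [exact: W h1|exact: W h2|exact: W h3].
Qed.

(** Fubini is arranged so that the coordinate [l] is integrated first. Along each line the
    fundamental theorem of calculus gives a difference of boundary values, which periodicity
    cancels. *)
Lemma integral_cell_dx F G l : continuous G ->
  (forall x, is_derive x (evec R l) F (G x)) ->
  (forall x, F (x + evec R l) = F x) ->
  (\int[leb3 R]_(x in @cell R) (G x)%:E = 0)%E.
Proof.
move=> cG dF pF.
have iG := continuous_integrable_cell cG.
have m01 : measurable (`[0:R, 1[%classic : set (measurableTypeR R)) by exact: measurable_itv.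
have m2 : measurable (`[0:R, 1[%classic `*` `[0:R, 1[%classic : set (measurableTypeR R * measurableTypeR R)) by exact: measurableX.
have line x : (\int[leb]_(y in `[0%R, 1%R[) (G (y *: evec R l + x))%:E = 0)%E.
  have h1 : continuous (fun y : R => G (y *: evec R l + x)).
    move=> y; apply: (@continuous_comp _ _ _ (fun y : R => y *: evec R l + x) G); last exact: cG.
    by apply: cvgD; [apply: cvgZr_tmp; exact: cvg_id|exact: cvg_cst].
  have h2 (y : R) : is_derive y 1 (fun y => F (y *: evec R l + x)) (G (y *: evec R l + x)).
    by have := dF (y *: evec R l + x); move=> /is_derive_line.
  by rewrite (ftc_itvco ltr01 h1 h2) scale1r scale0r add0r [evec R l + x]addrC pF subrr.
have leq P : (forall y, P y = y *: evec R l + P 0) ->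
  (\int[leb]_(y in `[0%R, 1%R[) (G (P y))%:E)%E = 0%E.
  by move=> h; rewrite -[RHS](line (P 0)); apply: eq_integral => y _; rewrite -h.
move: m01 m2 => m01 m2.
have lin (y a b c e1 e2 e3 : R) :
  y *: ((e1, e2, e3) : coords R) + (a, b, c) = (y * e1 + a, y * e2 + b, y * e3 + c) by [].
have E l0 : evec R l0 = ((l0 == 0)%:R, (l0 == 1)%:R, (l0 == 2%:R)%:R) by [].
have i2 (x3 : R) : (prodm leb leb).-integrable (`[0:R, 1[%classic `*` `[0:R, 1[%classic) (fun z => (G (z, x3))%:E).
  have c01 := @segment_compact R 0 1.
  have cK := compact_setX c01 c01.
  have cG3 : continuous (fun z : R * R => G (z, x3)).
    move=> z; apply: (@continuous_comp _ _ _ (fun z : R * R => (z, x3)) G); last exact: cG.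
    move=> A [[P Q] /= [nP nQ] PQ]; apply: filterS nP => w Pw.
    by apply: (PQ (w, x3)); split => //=; exact: nbhs_singleton.
  have : {within `[0:R, 1]%classic `*` `[0:R, 1]%classic, continuous (fun z : R * R => G (z, x3))}.
    exact: continuous_subspaceT.
  move=> /continuous_compact/(_ cK)/compact_bounded[C [_ hC]].
  apply: measurable_bounded_integrable => //.
  - by move: (ltry (1 : R)); rewrite -leb2_square.
  - apply: measurable_funTS.
    exact: measurable_fun_pair1 (continuous_measurable_coords cG).
  - apply: (@bounded_on_le _ _ _ (`|C| + 1)) => -[x1 x2] [/= h1 h2].
    apply: (hC (`|C| + 1)); first by rewrite (le_lt_trans (ler_norm _))// ltrDl.
    exists (x1, x2) => //.
    have W y : y \in `[0, 1[ -> `[0:R, 1]%classic y by rewrite /= !in_itv/= => /andP[-> /ltW].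
    by split => /=; [exact: W h1|exact: W h2].
have [l2|l2] := eqVneq l 2%:R.
  rewrite (fubini_rect1 m2 m01 iG); apply: integral0_eq => -[x1 x2] _.
  apply: (leq (fun y => (x1, x2, y))) => y.
  by rewrite E l2 lin/= ?mulr0 ?mulr1 ?add0r ?addr0.
rewrite (fubini_rect2 m2 m01 iG); apply: integral0_eq => x3 _.
have [l1|l1] := eqVneq l 1.
  rewrite (fubini_rect1 m01 m01 (i2 x3)); apply: integral0_eq => x1 _.
  apply: (leq (fun y => (x1, y, x3))) => y.
  by rewrite E l1 lin/= ?mulr0 ?mulr1 ?add0r ?addr0.
rewrite (fubini_rect2 m01 m01 (i2 x3)); apply: integral0_eq => x2 _.
apply: (leq (fun y => (y, x2, x3))) => y.
have -> : l = 0 by apply/val_inj; case: l l1 l2 {line leq dF pF} => -[|[|[|]]].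
by rewrite E lin/= ?mulr0 ?mulr1 ?add0r ?addr0.
Qed.

End cell_integrals.

(** * Fields cut off in time *)

Section cutoff.
Context (R : realType).
Implicit Types (f g : scalar_field R) (h : R -> R) (t : R) (x : coords R).

Definition cutf h f : scalar_field R := fun t x => h t * f t x.

Variables (T a b : R).
Hypotheses (a0 : 0 < a) (bT : b < T).

Lemma interior_cc t : 0 < t < T -> interior `[0, T]%classic t.
Proof. by move=> tT; rewrite interior_itv/= in_itv. Qed.

(** The dichotomy behind all regularity statements for cut-off fields: either the field is regular
    near [t], or the cutoff vanishes near [t] and the product is locally 0, whatever the field does
    outside [0, T]. *)
Lemma cutoff_cases t : (0 < t < T) \/ (\forall s \near t, ~~ (a <= s <= b)).
Proof.
have [t0|t0] := ltP 0 t; last first.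
  right; near=> s; rewrite negb_and -ltNge; apply/orP; left.
  by near: s; apply: lt_nbhsl; exact: le_lt_trans t0 a0.
have [tT|tT] := ltP t T; first by left.
right; near=> s; rewrite negb_and -!ltNge; apply/orP; right.
by near: s; apply: lt_nbhsr; exact: lt_le_trans bT tT.
Unshelve. all: by end_near. Qed.

Lemma near_fst (P : R -> Prop) t x : (\forall s \near t, P s) ->
  \forall z \near (t, x), P z.1.
Proof.
move=> Pt; exists (P, setT) => /=; first by split => //; exact: filterT.
by move=> [s y] [].
Qed.

Lemma continuous_on_at f t x : continuous_on `[0, T] f -> 0 < t < T ->
  {for (t, x), continuous (uncurry f)}.
Proof.
move=> cf tT; have It := interior_cc tT.
have := (subspace_continuousP _ _).1 cf (t, x) (conj (interior_subset It) Logic.I).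
move=> h A /h wA; have {}wA : nbhs (t, x) (fun z => (`[0, T] `*` setT) z -> A (uncurry f z)) := wA.
have nI : \forall z \near (t, x), `[0, T]%classic z.1.
  exact: (@near_fst (fun s => `[0, T]%classic s) t x It).
apply: filterS (filterI wA nI) => -[s y] [h1 h2]; apply: h1; split => //.
Qed.

Lemma cutoff_continuous h f : continuous h ->
  (forall t, ~~ (a <= t <= b) -> h t = 0) ->
  continuous_on `[0, T] f -> continuous (uncurry (cutf h f)).
Proof.
move=> ch h0 cf [t x]; have [tT|nt] := cutoff_cases t.
  have cft := continuous_on_at cf tT.
  have -> : uncurry (cutf h f) = (h \o fst) \* uncurry f by apply/funext => -[].
  apply: cvgM; last exact: cft.
  by apply: (@cvg_comp _ _ _ fst h); [exact: cvg_fst|exact: ch].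
have E : \forall z \near (t, x), cst 0 z = uncurry (cutf h f) z.
  apply: filterS (near_fst x nt) => -[s y] /= ns.
  by rewrite /cutf/= h0// mul0r.
apply: cvg_trans (near_eq_cvg E) _.
by rewrite /= /cutf h0 ?mul0r; [exact: cvg_cst|exact: nbhs_singleton nt].
Qed.

Lemma continuous_continuous_on (I : set R) f :
  continuous (uncurry f) -> continuous_on I f.
Proof. by move=> cf; exact: continuous_subspaceT. Qed.

Lemma dx_cutf h f l t x : (forall t, ~~ (a <= t <= b) -> h t = 0) ->
  x_derivable_on `[0, T] l f ->
  is_derive x (evec R l) (cutf h f t) (h t * dx l f t x).
Proof.
move=> h0 df; have [tT|nt] := cutoff_cases t.
  have It : `[0, T]%classic t := interior_subset (interior_cc tT).
  have := dx_is_derive x df It; exact: is_deriveZ.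
have ht := h0 _ (nbhs_singleton nt).
have -> : cutf h f t = cst 0 by apply/funext => y; rewrite /cutf ht mul0r.
by rewrite ht mul0r; exact: is_derive_cst.
Qed.

Lemma dx_cutfE h f l : (forall t, ~~ (a <= t <= b) -> h t = 0) ->
  x_derivable_on `[0, T] l f -> dx l (cutf h f) = cutf h (dx l f).
Proof.
move=> h0 df; apply/funext => t; apply/funext => x.
exact: is_derive_deriv (dx_cutf t x h0 df).
Qed.

Variables (th dth : R -> R).
Hypotheses (dthE : forall t : R, is_derive t 1 th (dth t)) (cdth : continuous dth).
Hypotheses (th0 : forall t, ~~ (a <= t <= b) -> th t = 0)
           (dth0 : forall t, ~~ (a <= t <= b) -> dth t = 0).

Lemma th_continuous : continuous th.
Proof.
by move=> t; apply/differentiable_continuous/derivable1_diffP; have [] := dthE t.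
Qed.

Lemma dt_cutf f g t x : t_derivative_on `[0, T] f g ->
  is_derive t 1 (fun s => cutf th f s x) (dth t * f t x + th t * g t x).
Proof.
move=> dfg; have [tT|nt] := cutoff_cases t.
  have It := interior_cc tT.
  have h := dfg t x It.
  have := @is_deriveM _ _ th (f^~ x) t 1 _ _ (dthE t) h.
  rewrite addrC ![_ *: _]mulrC; rewrite [X in _ -> is_derive _ _ _ (_ + X)]mulrC => H.
  by apply: is_derive_eq H _; congr (_ + _); rewrite mulrC.
have -> : dth t * f t x + th t * g t x = 0.
  by rewrite dth0 ?th0 ?mul0r ?addr0//; exact: nbhs_singleton nt.
have H : is_derive t 1 (cst 0 : R -> R) 0 by exact: is_derive_cst.
apply: near_eq_is_derive H.
by apply: filterS nt => s ns; rewrite /cutf th0// mul0r.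
Qed.

Lemma dt_cutfE f t x : smooth_on `[0, T] f -> 0 < t < T ->
  dt (cutf th f) t x = dth t * f t x + th t * dt f t x.
Proof.
move=> sf tT; have [g cg h] := smooth_on_td sf.
have dg : t_derivative_on `[0, T] f g by move=> s y /(h s y)[].
rewrite /dt derive1E (is_derive_deriv (dt_cutf t x dg)).
by have [_ <-] := h t x (interior_cc tT).
Qed.

Lemma cutf_test f : smooth_on `[0, T] f -> periodic_on `[0, T] f ->
  interior_test_function (cutf th f).
Proof.
move=> sf pf; have [g cg h] := smooth_on_td sf.
have dg : t_derivative_on `[0, T] f g by move=> s y /(h s y)[].
have ccut h' f' : continuous h' -> (forall t, ~~ (a <= t <= b) -> h' t = 0) ->
    smooth_on `[0, T] f' -> continuous_on `[0, +oo[ (cutf h' f').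
  by move=> ? ? /smooth_on_cont ?; apply: continuous_continuous_on; exact: cutoff_continuous.
have xd f' : smooth_on `[0, T] f' -> forall l, x_derivable_on `[0, +oo[ l (cutf th f').
  by move=> sf' l t x _; have [] := dx_cutf t x th0 (@smooth_on_xd _ _ _ l sf').
split; last first.
  exists (a / 2); first by rewrite divr_gt0.
  move=> t x ta; rewrite /cutf th0 ?mul0r// negb_and -ltNge.
  by apply/orP; left; rewrite (le_lt_trans ta)// ltr_pdivrMr// ltr_pMr// ltr1n.
split.
- move=> t x l _; rewrite /cutf; have [tI|tI] := boolP (a <= t <= b).
    rewrite pf//= in_itv/=; move: tI => /andP[h1 h2]; apply/andP; split.
      exact: le_trans (ltW a0) h1.
    exact: le_trans h2 (ltW bT).
  by rewrite th0// !mul0r.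
- split; first exact: ccut th_continuous th0 sf.
  exists (fun t x => cutf dth f t x + cutf th g t x); split.
    by move=> t x _; exact: dt_cutf.
  apply: continuous_onD; first exact: ccut.
  by apply: continuous_continuous_on; apply: cutoff_continuous => //; exact: th_continuous.
- move=> l; split; first exact: xd.
  rewrite dx_cutfE//; last exact: smooth_on_xd.
  apply: ccut => //; [exact: th_continuous|exact: smooth_on_dx].
- move=> l m; rewrite dx_cutfE//; last exact: smooth_on_xd.
  split; first exact/xd/smooth_on_dx.
  rewrite dx_cutfE//; last exact/smooth_on_xd/smooth_on_dx.
  apply: ccut => //; [exact: th_continuous|exact/smooth_on_dx/smooth_on_dx].
- exists T => t x Tt; rewrite /cutf th0 ?mul0r// negb_and -!ltNge.
  by apply/orP; right; exact: lt_le_trans bT Tt.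
Qed.

End cutoff.

(** * Bump functions in time *)

Section bump.
Context (R : realType).
Implicit Types (s t : R).

Definition possq s : R := Num.max 0 s ^+ 2.

Lemma is_derive_possq s : is_derive s 1 possq (2 * Num.max 0 s).
Proof.
have [s0|s0|->] := ltgtP s 0.
- rewrite mulr0.
  have H : is_derive s 1 (cst 0 : R -> R) 0 by exact: is_derive_cst.
  apply: near_eq_is_derive H; near=> y; rewrite /possq max_l ?expr0n//.
  by apply/ltW; near: y; exact: lt_nbhsl.
- have H : is_derive s 1 (fun y : R => y ^+ 2) (2 * s).
    have := @is_deriveX _ _ (@id R) 2 s 1 1 (is_derive_id _ _).
    move=> h; apply: is_derive_eq h _.
    by rewrite /= [_ *: _]mulr1 expr1.
  apply: near_eq_is_derive H; near=> y; rewrite /possq max_r//.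
  by apply/ltW; near: y; exact: lt_nbhsr.
- rewrite mulr0.
  have H : h^-1 *: (possq (h *: (1:R) + 0) - possq 0) @[h --> 0^'] --> (0 : R).
    apply/cvgrPdist_le => e e0; near=> h.
    have h0 : h != 0 by near: h; exact: nbhs_dnbhs_neq.
    rewrite /possq addr0 [h *: 1]mulr1 maxxx expr0n subr0 sub0r normrN.
    rewrite normrM normfV ler_pdivrMl ?normr_gt0// ger0_norm ?sqr_ge0//.
    have he : `|h| <= e.
      near: h; exists e => //= z ze _; move: ze; rewrite /ball_/= sub0r normrN; exact: ltW.
    apply: (@le_trans _ _ (`|h| * `|h|)); last by rewrite ler_wpM2l.
    have [h1|h1] := leP 0 h; first by rewrite expr2 ger0_norm.
    by rewrite expr0n mulr_ge0.
  split; first by apply/cvg_ex; exists 0.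
  exact: cvg_lim H.
Unshelve. all: by end_near. Qed.

(** A quadratic spline whose derivative [dstep] is the tent of height 2 and area 1 over [0, 1]. Test
    functions only have to be C^1 in time, so that no smoother transition is needed. *)
Definition step s : R := 2 * (possq s - 2 * possq (s - 2^-1) + possq (s - 1)).
Definition dstep s : R :=
  4 * (Num.max 0 s - 2 * Num.max 0 (s - 2^-1) + Num.max 0 (s - 1)).

Lemma is_derive_affine (f : R -> R) (u v t : R) df :
  is_derive (u * t + v) 1 f df -> is_derive t 1 (fun t => f (u * t + v)) (u * df).
Proof.
move=> H; rewrite mulrC.
apply: (@is_derive1_comp _ f (fun t => u * t + v)).
have H1 := @is_deriveZ _ _ _ (@id R) u t 1 1 (is_derive_id _ _).
have H2 := @is_deriveD _ _ _ _ (cst v) t 1 _ _ H1 (is_derive_cst _ _ _).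
by apply: is_derive_eq H2 _; rewrite addr0 [_ *: _]mulr1.
Qed.

Lemma is_derive_step s : is_derive s 1 step (dstep s).
Proof.
have h c : is_derive s 1 (fun s => possq (s - c)) (2 * Num.max 0 (s - c)).
  have := @is_derive_affine possq 1 (- c) s _ (is_derive_possq _).
  by rewrite !mul1r; under eq_fun do rewrite mul1r.
have h1 := @is_deriveZ _ _ _ _ 2 s 1 _ (h 2^-1).
have h2 := @is_deriveB _ _ _ _ _ s 1 _ _ (is_derive_possq s) h1.
have h3 := @is_deriveD _ _ _ _ _ s 1 _ _ h2 (h 1).
have h4 := @is_deriveZ _ _ _ _ 2 s 1 _ h3.
apply: is_derive_eq h4 _; rewrite /dstep.
rewrite [LHS](_ : _ = 2 * (2 * Num.max 0 s - 2 * (2 * Num.max 0 (s - 2^-1)) + 2 * Num.max 0 (s - 1)))//.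
by lra.
Qed.

Lemma continuous_dstep : continuous dstep.
Proof.
have h c : continuous (fun s : R => Num.max 0 (s - c)).
  move=> s; apply: (@continuous_max R R (cst 0) (fun s => s - c) s); first exact: cvg_cst.
  by apply: cvgB; [exact: cvg_id|exact: cvg_cst].
have h0 : continuous (fun s : R => Num.max 0 s).
  by have := h 0; under eq_fun do rewrite subr0.
move=> s; apply: cvgM; first exact: cvg_cst.
apply: cvgD; last exact: h.
apply: cvgB; first exact: h0.
by apply: cvgM; [exact: cvg_cst|exact: h].
Qed.

Lemma possq_le0 s : s <= 0 -> possq s = 0.
Proof. by move=> s0; rewrite /possq max_l// expr0n. Qed.

Lemma possq_ge0E s : 0 <= s -> possq s = s ^+ 2.
Proof. by move=> s0; rewrite /possq max_r. Qed.

Lemma step_le0 s : s <= 0 -> step s = 0.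
Proof.
move=> s0; rewrite /step !possq_le0 ?mulr0 ?subr0 ?addr0 ?mulr0//; lra.
Qed.

Lemma step_ge1 s : 1 <= s -> step s = 1.
Proof. move=> s1; rewrite /step !possq_ge0E; lra. Qed.

Lemma dstep_ge0 s : 0 <= dstep s.
Proof. rewrite /dstep; case: (leP 0 s); case: (leP 0 (s - 2^-1)); case: (leP 0 (s - 1)); lra. Qed.

Lemma dstep_out s : ~~ (0 <= s <= 1) -> dstep s = 0.
Proof.
rewrite negb_and -!ltNge /dstep.
by case: (leP 0 s); case: (leP 0 (s - 2^-1)); case: (leP 0 (s - 1)); case: (ltP 1 s); rewrite ?orbF//=; lra.
Qed.

Lemma step_ge0 s : 0 <= step s.
Proof.
rewrite /step; have [s0|s0] := leP s 0.
  by rewrite !possq_le0; lra.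
rewrite (possq_ge0E (ltW s0)); have [s1|s1] := leP (s - 2^-1) 0.
  by rewrite (possq_le0 s1) possq_le0; nra.
rewrite (possq_ge0E (ltW s1)); have [s2|s2] := leP (s - 1) 0.
  by rewrite (possq_le0 s2); nra.
by rewrite (possq_ge0E (ltW s2)); nra.
Qed.

Lemma step_le1 s : step s <= 1.
Proof.
rewrite /step; have [s0|s0] := leP s 0.
  by rewrite !possq_le0; lra.
rewrite (possq_ge0E (ltW s0)); have [s1|s1] := leP (s - 2^-1) 0.
  by rewrite (possq_le0 s1) possq_le0; nra.
rewrite (possq_ge0E (ltW s1)); have [s2|s2] := leP (s - 1) 0.
  by rewrite (possq_le0 s2); nra.
by rewrite (possq_ge0E (ltW s2)); nra.
Qed.

(* Rises from 0 to 1 on [al, al + d] and falls back to 0 on [be, be + d]. *)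
Definition bump (al be d : R) t : R := step ((t - al) / d) - step ((t - be) / d).
Definition dbump (al be d : R) t : R :=
  d^-1 * dstep ((t - al) / d) - d^-1 * dstep ((t - be) / d).

Variables (al be d : R).
Hypotheses (d0 : 0 < d) (ab : al + d <= be).

Lemma is_derive_bump t : is_derive t 1 (bump al be d) (dbump al be d t).
Proof.
have h c : is_derive t 1 (fun s => step ((s - c) / d)) (d^-1 * dstep ((t - c) / d)).
  have E s : (s - c) / d = d^-1 * s + - c / d by rewrite mulrDl mulrC.
  under eq_fun do rewrite E; rewrite E.
  exact/is_derive_affine/is_derive_step.
exact: is_deriveB.
Qed.

Lemma continuous_dbump : continuous (dbump al be d).
Proof.
have h c : continuous (fun s => d^-1 * dstep ((s - c) / d)).
  move=> s; apply: cvgM; first exact: cvg_cst.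
  apply: (@continuous_comp _ _ _ (fun s : R => (s - c) / d) dstep); last exact: continuous_dstep.
  by apply: cvgM; [apply: cvgB; [exact: cvg_id|exact: cvg_cst]|exact: cvg_cst].
by move=> s; apply: cvgB; exact: h.
Qed.

Lemma step_scale t c : (t <= c -> step ((t - c) / d) = 0) /\
  (c + d <= t -> step ((t - c) / d) = 1).
Proof.
split=> tc.
  by rewrite step_le0// pmulr_lle0 ?invr_gt0// subr_le0.
by rewrite step_ge1// ler_pdivlMr// mul1r lerBrDl.
Qed.

Lemma bump_out t : ~~ (al <= t <= be + d) -> bump al be d t = 0.
Proof.
have [d0' ab'] : 0 < d /\ al + d <= be by [].
rewrite negb_and -!ltNge => /orP[ta|tb]; rewrite /bump.
  have h1 : t <= al by exact: ltW.
  have h2 : t <= be by lra.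
  by rewrite (proj1 (step_scale t al) h1) (proj1 (step_scale t be) h2) subrr.
have h1 : al + d <= t by lra.
have h2 : be + d <= t by exact: ltW.
by rewrite (proj2 (step_scale t al) h1) (proj2 (step_scale t be) h2) subrr.
Qed.

Lemma dbump_out t : ~~ (al <= t <= be + d) -> dbump al be d t = 0.
Proof.
have [d0' ab'] : 0 < d /\ al + d <= be by [].
rewrite negb_and -!ltNge => h; rewrite /dbump.
have H c : ~~ (c <= t <= c + d) -> dstep ((t - c) / d) = 0.
  move=> ntc; apply: dstep_out; apply: contra ntc => /andP[h1 h2].
  rewrite pmulr_lge0 ?invr_gt0// in h1; rewrite ler_pdivrMr// mul1r in h2.
  by apply/andP; split; lra.
have h1 : ~~ (al <= t <= al + d).
  by rewrite negb_and -!ltNge; case/orP: h => h; apply/orP; [left|right]; lra.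
have h2 : ~~ (be <= t <= be + d).
  by rewrite negb_and -!ltNge; case/orP: h => h; apply/orP; [left|right]; lra.
by rewrite (H _ h1) (H _ h2) mulr0 subrr.
Qed.

Lemma bump_ge0 t : 0 <= bump al be d t.
Proof.
have [d0' ab'] : 0 < d /\ al + d <= be by [].
rewrite /bump; have [h|h] := leP t be.
  by rewrite (proj1 (step_scale _ be))// subr0 step_ge0.
have h2 : al + d <= t by lra.
by rewrite (proj2 (step_scale t al) h2) subr_ge0 step_le1.
Qed.

Lemma bump_le1 t : bump al be d t <= 1.
Proof. by rewrite /bump lerBlDr (le_trans (step_le1 _))// lerDl step_ge0. Qed.

Lemma bump_eq1 t : al + d <= t <= be -> bump al be d t = 1.
Proof.
move=> /andP[h1 h2]; rewrite /bump.
by rewrite (proj2 (step_scale _ al))// (proj1 (step_scale _ be))// subr0.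
Qed.

End bump.

(** * Integration by parts over a time slab *)

Section time_space_parts.
Context (R : realType).
Implicit Types (f g : scalar_field R).
Variables (T : R).
Hypothesis T0 : 0 < T.
Let OT : set (measurableTypeR R * mcoords R) := `]0, T[%classic `*` @cell R.

Lemma measurable_OT : measurable OT.
Proof. by apply: measurableX; [exact: measurable_itv|exact: measurable_cell]. Qed.

Lemma leb4_OT : leb4 R OT = T%:E.
Proof.
transitivity ((lebesgue_measure \x leb3 R)%E OT); first by [].
have mI : measurable (`]0, T[%classic : set (measurableTypeR R)) by exact: measurable_itv.
rewrite (product_measure1E _ _ mI (@measurable_cell R)).
transitivity (T%:E * 1 : \bar R)%E; last exact: mule1.
congr (_ * _)%E; last exact: leb3_cell.
have : lebesgue_measure `]0:R, T[%classic = T%:E by rewrite lebesgue_measure_itv/= lte_fin T0 oppr0 adde0.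
by [].
Qed.

Lemma continuous_on_measurable_OT f : continuous_on `[0, T] f -> measurable_fun OT (uncurry f).
Proof.
move=> cf; apply: (@continuous_on_measurable R `[0, T]%classic) => //; try exact: measurable_itv.
exact: subset_itv_oo_cc.
Qed.

Lemma bounded_OT f : continuous_on `[0, T] f -> [bounded uncurry f z | z in OT].
Proof.
move=> /continuous_on_bounded[C C0 hC]; apply: (@bounded_on_le _ _ _ _ C) => -[t x] [/= tT cx].
by apply: hC => //; move: tT; rewrite in_itv/= => /andP[/ltW -> /ltW ->].
Qed.

Lemma continuous_on_integrable f : continuous_on `[0, T] f ->
  (leb4 R).-integrable OT (EFin \o uncurry f).
Proof.
move=> cf; apply: measurable_bounded_integrable.
- exact: measurable_OT.
- by move: (ltry T); rewrite -leb4_OT.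
- exact: continuous_on_measurable_OT.
- exact: bounded_OT.
Qed.

Variables (a b : R).
Hypotheses (a0 : 0 < a) (bT : b < T).
Variables (th dth : R -> R).
Hypotheses (dthE : forall t : R, is_derive t 1 th (dth t)) (cdth : continuous dth).
Hypotheses (th0 : forall t, ~~ (a <= t <= b) -> th t = 0)
           (dth0 : forall t, ~~ (a <= t <= b) -> dth t = 0).

Lemma integral_cutf_dx f l : smooth_on `[0, T] f -> periodic_on `[0, T] f ->
  (\int[leb4 R]_(z in OT) (th z.1 * dx l f z.1 z.2)%:E = 0)%E.
Proof.
move=> sf pf.
have cc : continuous_on `[0, T] (cutf th (dx l f)).
  apply/continuous_continuous_on/(cutoff_continuous a0 bT (th_continuous dthE) th0).
  exact/smooth_on_cont/smooth_on_dx.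
have ii := continuous_on_integrable cc.
have E z : (EFin \o uncurry (cutf th (dx l f))) z = (th z.1 * dx l f z.1 z.2)%:E by case: z.
have mI : measurable (`]0, T[%classic : set (measurableTypeR R)) by exact: measurable_itv.
have {}ii : (leb4 R).-integrable OT (fun z => (th z.1 * dx l f z.1 z.2)%:E).
  by apply: eq_integrable ii => [|z _]; [exact: measurable_OT|rewrite E].
rewrite (fubini_rect1 mI (@measurable_cell R) ii).
apply: integral0_eq => t; rewrite /= in_itv/= => /andP[t0 tT].
have It : `[0, T]%classic t by rewrite /= in_itv/= !ltW.
have xd := @smooth_on_xd _ _ _ l sf.
have h1 : continuous (fun x => th t * dx l f t x).
  exact: (@continuous_on_section R `[0, T]%classic (cutf th (dx l f)) t).
have h2 x : is_derive x (evec R l) (fun x => th t * f t x) (th t * dx l f t x).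
  by have := dx_is_derive x xd It; exact: is_deriveZ.
have h3 x : th t * f t (x + evec R l) = th t * f t x by rewrite pf.
exact: (integral_cell_dx h1 h2 h3).
Qed.

(** The integrand is the time derivative of the cut-off field, continuous once [dt f] is replaced by
    its continuous representative; integrating in time first leaves boundary values at 0 and [T],
    where the cutoff vanishes. *)
Lemma integral_cutf_dt f : smooth_on `[0, T] f ->
  (\int[leb4 R]_(z in OT) (dth z.1 * f z.1 z.2 + th z.1 * dt f z.1 z.2)%:E = 0)%E.
Proof.
move=> sf; have [g cg h] := smooth_on_td sf.
have dg : t_derivative_on `[0, T] f g by move=> s y /(h s y)[].
have cc1 : continuous (uncurry (cutf dth f)).
  exact: (cutoff_continuous a0 bT cdth dth0 (smooth_on_cont sf)).
have cc2 : continuous (uncurry (cutf th g)).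
  exact: (cutoff_continuous a0 bT (th_continuous dthE) th0 cg).
pose k : scalar_field R := fun t x => cutf dth f t x + cutf th g t x.
have ck : continuous (uncurry k).
  have -> : uncurry k = uncurry (cutf dth f) \+ uncurry (cutf th g) by apply/funext => -[].
  by move=> z; apply: cvgD; [exact: cc1|exact: cc2].
have ii := continuous_on_integrable (continuous_continuous_on (I := `[0, T]%classic) ck).
transitivity (\int[leb4 R]_(z in OT) (k z.1 z.2)%:E)%E.
  apply: eq_integral => -[t x]; rewrite inE => -[/=]; rewrite in_itv/= => tT cx.
  by rewrite /k /cutf; have [_ ->] := h t x (interior_cc tT).
have mI : measurable (`]0, T[%classic : set (measurableTypeR R)) by exact: measurable_itv.
have {}ii : (leb4 R).-integrable OT (fun z => (k z.1 z.2)%:E).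
  by apply: eq_integrable ii => [|[t x] _]; [exact: measurable_OT|].
rewrite (fubini_rect2 mI (@measurable_cell R) ii).
apply: integral0_eq => x _.
have kx : continuous (fun t => k t x).
  move=> t A nA; have [[P Q] /= [nP nQ] PQ] := ck (t, x) A nA; apply: filterS nP => s Ps.
  by apply: (PQ (s, x)); split => //=; exact: nbhs_singleton.
have dk (t : R) : is_derive t 1 (fun t => cutf th f t x) (k t x).
  exact: (dt_cutf a0 bT dthE th0 dth0 t x dg).
apply: etrans (ftc_itvoo T0 kx dk) _.
by rewrite /cutf !th0 ?mul0r ?subrr// negb_and -!ltNge ?a0 ?bT ?orbT.
Qed.

End time_space_parts.

(** * The fundamental lemma of the calculus of variations *)

Section product_generators.
Context d1 d2 (T1 : measurableType d1) (T2 : measurableType d2).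
Variables (G1 : set (set T1)) (G2 : set (set T2)).
Hypotheses (g1 : @measurable _ T1 = <<s G1 >>) (g2 : @measurable _ T2 = <<s G2 >>).
Hypotheses (c1 : exists F : nat -> set T1, (forall k, G1 (F k)) /\ \bigcup_k F k = setT)
           (c2 : exists F : nat -> set T2, (forall k, G2 (F k)) /\ \bigcup_k F k = setT).

Definition rectangles : set (set (T1 * T2)) := [set A `*` B | A in G1 & B in G2].

(** The covers [c1] and [c2] are what makes strips available: the product of a generator of one
    factor with the whole other space is a countable union of rectangles of generators. A general
    rectangle is the intersection of two strips. *)
Lemma rectangles_generate : @measurable _ (T1 * T2)%type = <<s rectangles >>.
Proof.
have mG1 A : G1 A -> measurable A by move=> ?; rewrite g1; exact: sub_sigma_algebra.
have mG2 A : G2 A -> measurable A by move=> ?; rewrite g2; exact: sub_sigma_algebra.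
have [F [GF FT]] := c1; have [H [GH HT]] := c2.
pose S := g_sigma_algebraType rectangles.
have sE (C : set (T1 * T2)) : <<s rectangles >> C = measurable (C : set S) by [].
have h1 A : measurable A -> measurable (A `*` setT : set S).
  rewrite g1 => mA; apply: (mA [set A | measurable (A `*` setT : set S)]); split.
    split => /=.
    - by rewrite set0X; exact: measurable0.
    - move=> B mB; rewrite setTD.
      have -> : ~` B `*` [set: T2] = ~` (B `*` setT).
        by apply/seteqP; split => -[x y] /=; [move=> [? _] [? _]|move=> h; split => // ?; exact: h].
      exact: measurableC.
    - move=> B mB.
      have -> : (\bigcup_k B k) `*` [set: T2] = \bigcup_k (B k `*` setT).
        by apply/seteqP; split => -[x y] /=; [move=> [[k _ ?] _]; exists k|move=> [k _ [? _]]; split => //; exists k].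
      exact: bigcupT_measurable.
  move=> B GB /=; rewrite -HT.
  have -> : B `*` \bigcup_k H k = \bigcup_k (B `*` H k).
    by apply/seteqP; split => -[x y] /=; [move=> [? [k _ ?]]; exists k|move=> [k _ [? ?]]; split => //; exists k].
  apply: bigcupT_measurable => k; apply: sub_sigma_algebra.
  by exists B => //; exists (H k).
have h2 A : measurable A -> measurable (setT `*` A : set S).
  rewrite g2 => mA; apply: (mA [set A | measurable (setT `*` A : set S)]); split.
    split => /=.
    - by rewrite setX0; exact: measurable0.
    - move=> B mB; rewrite setTD.
      have -> : [set: T1] `*` ~` B = ~` (setT `*` B).
        by apply/seteqP; split => -[x y] /=; [move=> [_ ?] [_ ?]|move=> h; split => // ?; exact: h].
      exact: measurableC.
    - move=> B mB.
      have -> : [set: T1] `*` (\bigcup_k B k) = \bigcup_k (setT `*` B k).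
        by apply/seteqP; split => -[x y] /=; [move=> [_ [k _ ?]]; exists k|move=> [k _ [_ ?]]; split => //; exists k].
      exact: bigcupT_measurable.
  move=> B GB /=; rewrite -FT.
  have -> : (\bigcup_k F k) `*` B = \bigcup_k (F k `*` B).
    by apply/seteqP; split => -[x y] /=; [move=> [[k _ ?] ?]; exists k|move=> [k _ [? ?]]; split => //; exists k].
  apply: bigcupT_measurable => k; apply: sub_sigma_algebra.
  by exists (F k) => //; exists B.
rewrite eqEsubset; split; last first.
  apply: smallest_sub; first exact: sigma_algebra_measurable.
  move=> _ [A GA [B GB <-]]; apply: measurableX; [exact: mG1|exact: mG2].
rewrite measurable_prod_measurableType; apply: smallest_sub.
  exact: smallest_sigma_algebra.
move=> _ [A mA [B mB <-]].
have -> : A `*` B = (A `*` setT) `&` (setT `*` B).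
  by apply/seteqP; split => -[x y] /= [] // [? ?] [? ?].
by apply: (@measurableI _ S); [exact: h1|exact: h2].
Qed.

Lemma rectangles_cover :
  exists F : nat -> set (T1 * T2), (forall k, rectangles (F k)) /\ \bigcup_k F k = setT.
Proof.
have [F [GF FT]] := c1; have [H [GH HT]] := c2.
(* Pairs of indices are enumerated by their codes; a number that codes no pair falls back to (0, 0),
   which is harmless for a union. *)
exists (fun n => let: (i, j) := odflt (0%N, 0%N) (unpickle n) in F i `*` H j); split.
  by move=> n; case: (odflt _ _) => i j; exists (F i) => //; exists (H j).
apply/seteqP; split => // -[x y] _.
have [i _ Fi] : (\bigcup_k F k) x by rewrite FT.
have [j _ Hj] : (\bigcup_k H k) y by rewrite HT.
by exists (pickle (i, j)) => //; rewrite pickleK.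
Qed.

Lemma rectangles_setI : setI_closed G1 -> setI_closed G2 -> setI_closed rectangles.
Proof.
move=> h1 h2 _ _ [A GA [B GB <-]] [A' GA' [B' GB' <-]]; rewrite -setXI.
by exists (A `&` A'); [exact: h1|exists (B `&` B') => //; exact: h2].
Qed.

End product_generators.

Section boxes.
Context (R : realType).
Local Notation mR := (measurableTypeR R).

Definition oitv : set (set mR) := [set A | exists x y : R, A = `]x, y[%classic].

Lemma oitv_generate : @measurable _ mR = <<s oitv >>.
Proof. exact: RGenOpens.measurableE. Qed.

Lemma oitv_cover : exists F : nat -> set mR, (forall k, oitv (F k)) /\ \bigcup_k F k = setT.
Proof.
exists (fun k => `]- k%:R, k%:R[%classic); split; first by move=> k; exists (- k%:R), k%:R.
apply/seteqP; split => // x _; exists (Num.bound `|x|) => //=; rewrite in_itv/=.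
by rewrite -ltr_norml; exact: archi_boundP.
Qed.

Lemma oitv_setI : setI_closed oitv.
Proof.
move=> _ _ [x [y ->]] [x' [y' ->]]; exists (Num.max x x'), (Num.min y y').
apply/seteqP; split => z /=; rewrite !in_itv/= gt_max lt_min.
  by move=> [/andP[-> ->] /andP[-> ->]].
by move=> /andP[/andP[-> ->] /andP[-> ->]].
Qed.

Definition boxes3 := rectangles (rectangles oitv oitv) oitv.
Definition boxes4 := rectangles oitv boxes3.

Lemma boxes4_generate : @measurable _ (mR * mcoords R)%type = <<s boxes4 >>.
Proof.
have g2 := rectangles_generate oitv_generate oitv_generate oitv_cover oitv_cover.
have c2 := rectangles_cover oitv_cover oitv_cover.
have g3 := rectangles_generate g2 oitv_generate c2 oitv_cover.
have c3 := rectangles_cover c2 oitv_cover.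
exact: rectangles_generate oitv_generate g3 oitv_cover c3.
Qed.

Lemma boxes4_setI : setI_closed boxes4.
Proof.
have i2 := rectangles_setI oitv_setI oitv_setI.
exact: rectangles_setI oitv_setI (rectangles_setI i2 oitv_setI).
Qed.

(** The measurable sets over which [g] has integral 0 within [D] form a Dynkin system: complements
    use the vanishing of the integral over [D] itself. The system contains the boxes, which are
    closed under intersection and generate the sigma-algebra. *)
Lemma integral_boxes_eq0 (mu : {measure set (mR * mcoords R)%type -> \bar R})
    (D : set (mR * mcoords R)%type) (g : mR * mcoords R -> \bar R) :
  measurable D -> mu.-integrable D g ->
  (\int[mu]_(z in D) g z = 0)%E ->
  (forall B, boxes4 B -> \int[mu]_(z in D `&` B) g z = 0)%E ->
  ae_eq mu D g (cst 0%E).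
Proof.
move=> mD ig gD gB; apply: integral_ae_eq => // E ED mE.
rewrite [RHS]integral0.
suff : (\int[mu]_(z in D `&` E) g z = 0)%E by rewrite setIidr.
have sI A : measurable A -> mu.-integrable (D `&` A) g.
  by move=> mA; apply: integrableS ig => //; exact: measurableI.
apply: (dynkin_induction (P := [set E | (\int[mu]_(z in D `&` E) g z = 0)%E]) boxes4_generate boxes4_setI) => //=.
- by rewrite setIT.
- move=> S mS S0; have /eqP := gD.
  rewrite -{1}(setIT D) -(setUv S) setIUr integral_setU => [||||].
  + by rewrite S0 add0e => /eqP.
  + exact: measurableI.
  + by apply: measurableI => //; exact: measurableC.
  + by rewrite -setIUr setUv setIT; case/integrableP : ig.
  + by apply/disj_setPS => z [[_ ?] [_]].
- move=> F mF tF F0; rewrite setI_bigcupr integral_bigcup.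
  + by rewrite eseries0// => k _ _; exact: F0.
  + apply/trivIsetP => i j _ _ ij; rewrite setIACA.
    by move/trivIsetP : tF => /(_ i j Logic.I Logic.I ij) ->; rewrite setI0.
  + by move=> k; exact: measurableI.
  + by rewrite -setI_bigcupr; apply: sI; exact: bigcupT_measurable.
- by rewrite -boxes4_generate.
Qed.

End boxes.

(** * Periodic approximations of indicators of boxes *)

Section trig_fields.
Context (R : realType).
Implicit Types (I : set R) (t : R) (x : coords R).

Definition pr (i : 'I_3) x : R :=
  if i == 0 then x.1.1 else if i == 1 then x.1.2 else x.2.

Lemma pr_lin i (h : R) (v x : coords R) : pr i (h *: v + x) = pr i v * h + pr i x.
Proof. by rewrite /pr; case: eqP => _; [|case: eqP => _]; rewrite mulrC. Qed.

Lemma continuous_pr i : continuous (pr i).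
Proof.
move=> x; rewrite /pr; case: eqP => _; [|case: eqP => _].
- by apply: (@continuous_comp _ _ _ fst fst); apply: cvg_fst.
- by apply: (@continuous_comp _ _ _ fst snd); [exact: cvg_fst|exact: cvg_snd].
- exact: cvg_snd.
Qed.

Lemma is_derive_pr_comp (f df : R -> R) (u c : R) i l x :
  (forall y : R, is_derive y 1 f (df y)) ->
  is_derive x (evec R l) (fun x => f (u * pr i x + c))
    (u * pr i (evec R l) * df (u * pr i x + c)).
Proof.
move=> dfE; apply/is_derive_line0.
have E h : u * pr i (h *: evec R l + x) + c = (u * pr i (evec R l)) * h + (u * pr i x + c).
  by rewrite pr_lin; ring.
under eq_fun do rewrite E.
by apply: is_derive_affine; rewrite mulr0 add0r; exact: dfE.
Qed.

Definition sinf (u c : R) i : scalar_field R := fun _ x => sin (u * pr i x + c).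
Definition cosf (u c : R) i : scalar_field R := fun _ x => cos (u * pr i x + c).

Lemma continuous_on_pr_comp (f : R -> R) u c i I : continuous f ->
  continuous_on I (fun _ x => f (u * pr i x + c)).
Proof.
move=> cf; apply: continuous_continuous_on.
have -> : uncurry (fun (_ : R) x => f (u * pr i x + c)) =
    (fun y => f (u * y + c)) \o (pr i \o snd) by apply/funext => -[].
move=> z; apply: (@continuous_comp _ _ _ (pr i \o snd)).
  by apply: continuous_comp; [exact: cvg_snd|exact: continuous_pr].
apply: (@continuous_comp _ _ _ (fun y : R => u * y + c) f); last exact: cf.
by apply: cvgD; [apply: cvgM; [exact: cvg_cst|exact: cvg_id]|exact: cvg_cst].
Qed.

Lemma Ck_on_trig k I u c i : Ck_on k I (sinf u c i) /\ Ck_on k I (cosf u c i).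
Proof.
have cs : continuous_on I (sinf u c i).
  by apply: continuous_on_pr_comp; exact: continuous_sin.
have cc : continuous_on I (cosf u c i).
  by apply: continuous_on_pr_comp; exact: continuous_cos.
elim: k => [|k [IHs IHc]]; first by [].
have ds x l := @is_derive_pr_comp (@sin R) (@cos R) u c i l x (fun y => is_derive_sin y).
have dc x l := @is_derive_pr_comp (@cos R) (fun y => - sin y) u c i l x (fun y => is_derive_cos y).
split; split.
- exact: cs.
- split=> [l|].
    split; first by move=> t x _; have [] := ds x l.
    apply: eq_Ck_on (Ck_onZ (u * pr i (evec R l)) IHc) => t x It.
    by rewrite /dx (is_derive_deriv (ds x l)).
  exists (fun _ _ => 0); split; last exact: Ck_on_cst.
  by move=> t x _; exact: is_derive_cst.
- exact: cc.
- split=> [l|].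
    split; first by move=> t x _; have [] := dc x l.
    apply: eq_Ck_on (Ck_onZ (u * pr i (evec R l)) (Ck_onN IHs)) => t x It.
    by rewrite /dx (is_derive_deriv (dc x l)).
  exists (fun _ _ => 0); split; last exact: Ck_on_cst.
  by move=> t x _; exact: is_derive_cst.
Qed.

Lemma smooth_on_sinf I u c i : smooth_on I (sinf u c i).
Proof. by move=> k; have [] := Ck_on_trig k I u c i. Qed.

(* On [0, 1[, the sign of y |-> sin (pi (y - p)) sin (pi (q - y)), which is
   1-periodic, tells whether y lies in ]p, q[. *)
Definition arc (p q y : R) : R :=
  1 + 2^-1 * (sin (pi * y + - (pi * p)) * sin (- pi * y + pi * q)).

Lemma sin_abs_le1 (y : R) : `|sin y| <= 1.
Proof. exact: sin_max. Qed.

Lemma arc_gt0 p q y : 0 < arc p q y.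
Proof.
rewrite /arc; set s1 := sin _; set s2 := sin _.
have : `|s1 * s2| <= 1 by rewrite normrM mulr_ile1// sin_abs_le1.
by rewrite ler_norml => /andP[? ?]; lra.
Qed.

Lemma arc_gt1 p q y : 0 <= p -> q <= 1 -> p < y < q -> 1 < arc p q y.
Proof.
move=> p0 q1 /andP[py yq]; rewrite /arc ltrDl mulr_gt0// mulr_gt0//; apply: sin_gt0_pi.
  have -> : pi * y + - (pi * p) = pi * (y - p) by ring.
  by rewrite mulr_gt0 ?pi_gt0 ?subr_gt0//= gtr_pMr ?pi_gt0//; lra.
have -> : - pi * y + pi * q = pi * (q - y) by ring.
by rewrite mulr_gt0 ?pi_gt0 ?subr_gt0//= gtr_pMr ?pi_gt0//; lra.
Qed.

(** Both y - p and q - y stay in [-1, 1], where sin(pi z) has the sign of z. Off the interval the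
    two arguments cannot both be positive, nor both negative because p < q, so the product of the
    sines is nonpositive. *)
Lemma arc_le1 p q y : 0 <= p -> p < q -> q <= 1 -> 0 <= y < 1 -> ~~ (p < y < q) -> arc p q y <= 1.
Proof.
move=> p0 pq q1 /andP[y0 y1]; rewrite negb_and -!leNgt /arc => h.
rewrite gerDl pmulr_rle0 ?invr_gt0//.
have E1 : pi * y + - (pi * p) = pi * (y - p) by ring.
have E2 : - pi * y + pi * q = pi * (q - y) by ring.
rewrite E1 E2.
have sge (z : R) : 0 <= z <= 1 -> 0 <= sin (pi * z).
  move=> /andP[z0 z1]; apply: sin_ge0_pi; rewrite mulr_ge0 ?pi_ge0//=.
  by rewrite ger_pMr ?pi_gt0.
have sle (z : R) : -1 <= z <= 0 -> sin (pi * z) <= 0.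
  move=> /andP[z0 z1]; rewrite -[z]opprK mulrN sinN oppr_le0; apply: sge.
  by apply/andP; split; lra.
case/orP: h => h.
  by apply: mulr_le0_ge0; [apply: sle|apply: sge]; apply/andP; split; lra.
by apply: mulr_ge0_le0; [apply: sge|apply: sle]; apply/andP; split; lra.
Qed.

Definition arcf p q i : scalar_field R := fun _ x => arc p q (pr i x).

Lemma smooth_on_arcf I p q i : smooth_on I (arcf p q i).
Proof.
apply: smooth_onD; first exact: smooth_on_cst.
apply: smooth_onM; first exact: smooth_on_cst.
exact: smooth_onM (smooth_on_sinf _ _ _ _) (smooth_on_sinf _ _ _ _).
Qed.

Lemma pr_evec i l : pr i (evec R l) = (l == i)%:R.
Proof. by case: i => -[|[|[|]]]//= ?; case: l => -[|[|[|]]]//= ?; rewrite /pr/=. Qed.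

(** A unit shift changes the sign of each sine, so the product is 1-periodic although neither factor
    is. *)
Lemma periodic_arcf I p q i : periodic_on I (arcf p q i).
Proof.
move=> t x l _; rewrite /arcf.
have -> : pr i (x + evec R l) = pr i x + (l == i)%:R.
  by rewrite addrC -[evec R l]scale1r pr_lin mulr1 addrC pr_evec.
case: (l == i); last by rewrite addr0.
rewrite /arc; set y := pr i x.
have -> : pi * (y + 1%:R) + - (pi * p) = (pi * y + - (pi * p)) + pi by ring.
have -> : - pi * y + pi * q = (- pi * (y + 1%:R) + pi * q) + pi by ring.
by rewrite !sinDpi; ring.
Qed.

(* Converges to the indicator of [1 < u] as k goes to infinity. *)
Definition sig (k : nat) (u : R) : R := (1 + k.+1%:R * u^-1 ^+ (k.+1 ^ 2))^-1.

Lemma sig_ge0 k u : 0 < u -> 0 <= sig k u.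
Proof. by move=> u0; rewrite invr_ge0 addr_ge0// mulr_ge0// exprn_ge0// invr_ge0 ltW. Qed.

Lemma sig_le1 k u : 0 < u -> sig k u <= 1.
Proof.
move=> u0; rewrite invf_le1 ?lerDl.
  by rewrite mulr_ge0// exprn_ge0// invr_ge0 ltW.
by rewrite ltr_pwDl// mulr_ge0// exprn_ge0// invr_ge0 ltW.
Qed.

Lemma bernoulli (y : R) (m : nat) : 0 <= y -> 1 + m%:R * y <= (1 + y) ^+ m.
Proof.
move=> y0; elim: m => [|m IH]; first by rewrite mul0r addr0.
rewrite exprS (le_trans _ (ler_wpM2l _ IH)) ?addr_ge0//.
have : 0 <= m%:R * (y * y) by rewrite !mulr_ge0.
by rewrite -natr1; nra.
Qed.

(** The factor [k.+1] brings the value at u = 1 down to 1/(1 + [k.+1]), so that the limit at the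
    threshold is 0. The exponent, the square of [k.+1], beats this factor when u > 1, by Bernoulli's
    inequality. *)
Lemma sig_cvg (u : R) : 0 < u ->
  sig k u @[k --> \oo] --> ((1 < u)%R%:R : R).
Proof.
move=> u0.
have hc : (k.+1%:R : R)^-1 @[k --> \oo] --> (0 : R) by exact: cvg_harmonic.
have [u1|u1] := ltP 1 u.
  pose y := u - 1; have y0 : 0 < y by rewrite subr_gt0.
  have hy : 1 - y^-1 * (k.+1%:R : R)^-1 @[k --> \oo] --> (1 : R).
    rewrite -[X in _ --> X]subr0; apply: cvgB; first exact: cvg_cst.
    by rewrite -[X in _ --> X](mulr0 y^-1); apply: cvgM => //; exact: cvg_cst.
  apply: (squeeze_cvgr _ hy); last exact: cvg_cst.
  apply: nearW => k; rewrite sig_le1// andbT /sig.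
  set w := k.+1%:R * _.
  have w0 : 0 <= w by rewrite mulr_ge0// exprn_ge0// invr_ge0 ltW.
  have : w <= y^-1 / k.+1%:R.
    have B := @bernoulli y (k.+1 ^ 2) (ltW y0).
    have B2 : k.+1%:R * k.+1%:R * y <= u ^+ (k.+1 ^ 2).
      by rewrite -natrM mulnn (le_trans _ (le_trans B _))// ?lerDr// /y addrC subrK.
    rewrite /w exprVn -invfM [y * _]mulrC.
    rewrite ler_pdivrMr ?exprn_gt0// ler_pdivlMl ?mulr_gt0//.
    by rewrite mulrAC.
  move=> wle; rewrite (@le_trans _ _ (1 - w))//; first by rewrite lerB.
  rewrite -[leRHS]mul1r ler_pdivlMr; last by rewrite ltr_pwDl.
  by nra.
apply: (squeeze_cvgr _ (cvg_cst 0) hc).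
apply: nearW => k; rewrite sig_ge0//= lef_pV2 ?posrE//; last first.
  by rewrite ltr_pwDl// mulr_ge0// exprn_ge0// invr_ge0 ltW.
have : 1 <= u^-1 ^+ (k.+1 ^ 2) by rewrite exprn_ege1// invf_ge1.
have : (0:R) <= k.+1%:R by [].
by nra.
Qed.

Lemma smooth_on_sig I k (f : scalar_field R) : (forall t x, I t -> 0 < f t x) ->
  smooth_on I f -> smooth_on I (fun t x => sig k (f t x)).
Proof.
move=> f0 sf; apply: smooth_onV.
  move=> t x It; rewrite gt_eqF// ltr_pwDl// mulr_ge0// exprn_ge0// invr_ge0 ltW//.
  exact: f0.
apply: smooth_onD; first exact: smooth_on_cst.
apply: smooth_onM; first exact: smooth_on_cst.
have sV : smooth_on I (fun t x => (f t x)^-1).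
  by apply: smooth_onV sf => t x It; rewrite gt_eqF// f0.
elim: (k.+1 ^ 2)%N => [|m IH]; first exact: smooth_on_cst.
by apply: eq_smooth_on (smooth_onM sV IH) => t x _; rewrite exprS.
Qed.

End trig_fields.

Section fundamental_lemma.
Context (R : realType) (T : R).
Hypothesis T0 : 0 < T.
Local Notation mR := (measurableTypeR R).
Let OT : set (mR * mcoords R) := `]0, T[%classic `*` @cell R.

(** A bump supported in [t0 + d, t1 - d], strictly inside the interval, and equal to 1 on
    [t0 + 2 d, t1 - 2 d]. The factor 4 in [d] keeps this plateau from being reversed, already for
    [k] equal to 0. *)
Definition tcut (t0 t1 : R) (k : nat) : R -> R :=
  let d := (t1 - t0) / (4 * k.+1%:R) in bump (t0 + d) (t1 - 2 * d) d.

Lemma tcut_step (t0 t1 : R) (k : nat) : t0 < t1 ->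
  4 * ((t1 - t0) / (4 * k.+1%:R)) <= t1 - t0.
Proof.
move=> t01; have k0 : (0 : R) < k.+1%:R by [].
have -> : 4 * ((t1 - t0) / (4 * k.+1%:R)) = (t1 - t0) / k.+1%:R.
  by field; rewrite gt_eqF.
have k1 : (1 : R) <= k.+1%:R by rewrite ler1n.
by rewrite ler_pdivrMr//; nra.
Qed.

Lemma tcut_cvg t0 t1 t : t0 < t1 ->
  tcut t0 t1 k t @[k --> \oo] --> ((t0 < t < t1)%R%:R : R).
Proof.
move=> t01; pose d (k : nat) : R := (t1 - t0) / (4 * k.+1%:R).
have d0 k : 0 < d k by rewrite divr_gt0 ?subr_gt0// mulr_gt0.
have d4 k : 4 * d k <= t1 - t0.
  exact: tcut_step.
have dc : d k @[k --> \oo] --> (0 : R).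
  have E k : d k = (t1 - t0) / 4 * (k.+1%:R)^-1 by rewrite /d invfM mulrA.
  rewrite (_ : d = fun k => (t1 - t0) / 4 * (k.+1%:R)^-1); last exact/funext.
  rewrite -[X in _ --> X](mulr0 ((t1 - t0) / 4)).
  by apply: cvgM; [exact: cvg_cst|exact: cvg_harmonic].
have [tt|ntt] := boolP (t0 < t < t1).
  have /andP[h1 h2] := tt.
  have e0 : 0 < Num.min (t - t0) (t1 - t) / 2 by rewrite divr_gt0// lt_min !subr_gt0 h1.
  apply: cvg_near_cst; near=> k; apply: bump_eq1; first exact: d0.
  have dk : d k < Num.min (t - t0) (t1 - t) / 2.
    near: k; have /cvgrPdist_lt/(_ _ e0) := dc; apply: filterS => k.
    by rewrite sub0r normrN gtr0_norm.
  have {dk}: d k * 2 < Num.min (t - t0) (t1 - t) by rewrite -ltr_pdivlMr.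
  by rewrite lt_min -/(d k) => /andP[h3 h4]; apply/andP; split; lra.
apply: cvg_near_cst; apply: nearW => k; apply: bump_out; rewrite -/(d k).
- exact: d0.
- have := d4 k; lra.
- apply: contra ntt => /andP[h1 h2]; have dk0 := d0 k; apply/andP; split; lra.
Unshelve. all: by end_near. Qed.

Lemma tcut_bound t0 t1 k t : t0 < t1 -> 0 <= tcut t0 t1 k t <= 1.
Proof.
move=> t01; rewrite /tcut; set d := (_ / _).
have d0 : 0 < d by rewrite divr_gt0 ?subr_gt0// mulr_gt0.
have d4 : 4 * d <= t1 - t0.
  exact: tcut_step.
apply/andP; split; first by apply: bump_ge0 => //; lra.
by apply: bump_le1 => //; lra.
Qed.

Lemma tcut_test t0 t1 k (f : scalar_field R) : 0 <= t0 -> t0 < t1 -> t1 <= T ->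
  smooth_on `[0, T] f -> periodic_on `[0, T] f ->
  interior_test_function (cutf (tcut t0 t1 k) f) /\
  (forall t x, T <= t -> cutf (tcut t0 t1 k) f t x = 0).
Proof.
move=> t00 t01 t1T sf pf; rewrite /tcut; set d := (_ / _).
have d0 : 0 < d by rewrite divr_gt0 ?subr_gt0// mulr_gt0.
have d4 : 4 * d <= t1 - t0.
  exact: tcut_step.
have ab : t0 + d + d <= t1 - 2 * d by lra.
have a0 : 0 < t0 + d by lra.
have bT : t1 - 2 * d + d < T by lra.
split.
  apply: (cutf_test a0 bT (is_derive_bump _ _ _)) => //.
  - exact: continuous_dbump.
  - by move=> t; exact: bump_out.
  - by move=> t; exact: dbump_out.
move=> t x Tt; rewrite /cutf bump_out ?mul0r// negb_and -!ltNge.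
by apply/orP; right; lra.
Qed.

Let O3 : set (mcoords R) :=
  (`]0%R, 1%R[ `*` `]0%R, 1%R[ `*` `]0%R, 1%R[)%classic.
Let OTi : set (mR * mcoords R) := `]0%R, T[%classic `*` O3.

(** The test functions at hand only reach indicators of open boxes. A box cut by the half-open cell
    may contain part of a face, whereas within the open cube every such intersection is again an
    open box; the faces removed form a null set. *)
Lemma leb4_faces : (leb4 R (OT `\` OTi) = 0)%E.
Proof.
have h1 : lebesgue_measure (`]0%R, 1%R[%classic : set mR) = (1%:E : \bar R).
  by rewrite lebesgue_measure_itv/= lte_fin ltr01 oppr0 adde0.
have m1 : measurable (`]0%R, 1%R[%classic : set mR) by exact: measurable_itv.
have hT : lebesgue_measure (`]0%R, T[%classic : set mR) = T%:E.
  by rewrite lebesgue_measure_itv/= lte_fin T0 oppr0 adde0.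
have mT : measurable (`]0%R, T[%classic : set mR) by exact: measurable_itv.
have m2 : measurable (`]0%R, 1%R[%classic `*` `]0%R, 1%R[%classic : set (mR * mR)) by exact: measurableX.
have m3 : measurable O3 by exact: measurableX.
have e2 : prodm lebesgue_measure lebesgue_measure (`]0%R, 1%R[%classic `*` `]0%R, 1%R[%classic : set (mR * mR)) = (1%:E : \bar R).
  apply: etrans (product_measure1E _ _ m1 m1) _.
  by apply: etrans (congr2 mule h1 h1) _; rewrite mule1.
have e3 : leb3 R O3 = 1%:E.
  apply: etrans (product_measure1E _ _ m2 m1) _.
  by apply: etrans (congr2 mule e2 h1) _; rewrite mule1.
have e4 : leb4 R OTi = T%:E.
  apply: etrans (product_measure1E _ _ mT m3) _.
  by apply: etrans (congr2 mule hT e3) _; rewrite mule1.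
have sub : OTi `<=` OT.
  move=> [t [[x1 x2] x3]] [/= tT [[/= a1 a2] a3]]; split => //=.
  have W y : y \in `]0%R, 1%R[ -> `[0%R, 1%R[%classic y by rewrite /= !in_itv/= => /andP[/ltW -> ->].
  by do ![split => /=]; [exact: W a1|exact: W a2|exact: W a3].
have mOT : measurable OT by exact: measurable_OT.
have mOTi : measurable OTi by exact: measurableX.
rewrite measureD// ?setIidr//.
  apply: etrans (congr2 (fun x y => (x - y)%E) (leb4_OT T0) e4) _.
  by rewrite subee.
by move: (ltry T); rewrite -(leb4_OT T0).
Qed.

(** Products of [tcut] and of [sig] applied to [arcf] are bounded test functions that converge to
    indicators of open boxes. Dominated convergence makes [g] integrate to 0 over each box, and
    boxes determine an integrable function almost everywhere. *)
Lemma fundamental_lemma (g : scalar_field R) : integrable_on `]0, T[%classic g ->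
  (forall xi, interior_test_function xi -> (forall t x, (T <= t)%R -> xi t x = 0%R) ->
    \int[leb4 R]_(z in OT) (g z.1 z.2 * xi z.1 z.2)%:E = 0)%E ->
  ae_eq (leb4 R) OT (EFin \o uncurry g) (cst 0%E).
Proof.
move=> ig gxi.
have mOT : measurable OT by exact: measurable_OT.
have key t0 t1 p1 q1 p2 q2 p3 q3 : 0 <= t0 -> t0 < t1 -> t1 <= T ->
    0 <= p1 -> p1 < q1 -> q1 <= 1 -> 0 <= p2 -> p2 < q2 -> q2 <= 1 ->
    0 <= p3 -> p3 < q3 -> q3 <= 1 ->
    (\int[leb4 R]_(z in OT `&` (`]t0, t1[ `*` (`]p1, q1[ `*` `]p2, q2[ `*` `]p3, q3[))%classic) (uncurry g z)%:E = 0)%E.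
  move=> t00 t01 t1T p10 pq1 q11 p20 pq2 q21 p30 pq3 q31.
  pose f k : scalar_field R := fun t x => sig k (arcf p1 q1 0 t x) *
    (sig k (arcf p2 q2 1 t x) * sig k (arcf p3 q3 2%:R t x)).
  have sgf k p q i I : smooth_on I (fun t x => sig k (arcf p q i t x)).
    by apply: smooth_on_sig; [move=> t x _; exact: arc_gt0|exact: smooth_on_arcf].
  have sf k : smooth_on `[0, T] (f k) by apply: smooth_onM => //; exact: smooth_onM.
  have pf k : periodic_on `[0, T] (f k).
    by move=> t x l It; rewrite /f !(periodic_arcf _ _ _ (I := `[0, T]%classic)).
  pose B : set (mR * mcoords R) := (`]t0, t1[ `*` (`]p1, q1[ `*` `]p2, q2[ `*` `]p3, q3[))%classic.
  have mB : measurable B.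
    by do !(apply: measurableX; try exact: measurable_itv).
  pose h k (z : mR * mcoords R) : \bar R := (g z.1 z.2 * cutf (tcut t0 t1 k) (f k) z.1 z.2)%:E.
  pose h0 (z : mR * mcoords R) : \bar R := (g z.1 z.2 * \1_B z)%:E.
  have hz k : (\int[leb4 R]_(z in OT) h k z = 0)%E.
    by have [h1 h2] := tcut_test k t00 t01 t1T (sf k) (pf k); exact: gxi.
  have mg : measurable_fun OT (uncurry g) by case/integrableP : ig => /measurable_EFinP.
  have mh k : measurable_fun OT (h k).
    apply/measurable_EFinP; apply: (eq_measurable_fun (uncurry g \* uncurry (cutf (tcut t0 t1 k) (f k)))).
      by move=> -[].
    apply: measurable_funM => //.
    have [[[_ [cc _] _ _ _] _] _] := tcut_test k t00 t01 t1T (sf k) (pf k).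
    apply: (@continuous_on_measurable R `[0, +oo[%classic) => //; try exact: measurable_itv.
    by move=> t; rewrite /= !in_itv/= => /andP[/ltW ->].
  have mh0 : measurable_fun OT h0.
    apply/measurable_EFinP; apply: (eq_measurable_fun (uncurry g \* \1_B)).
      by move=> -[].
    apply: measurable_funM => //; exact: measurable_indic.
  have fb k t x : 0 <= f k t x <= 1.
    rewrite /f; set s1 := sig _ _; set s2 := sig _ _; set s3 := sig _ _.
    have [a1 a2 a3] : [/\ 0 <= s1 <= 1, 0 <= s2 <= 1 & 0 <= s3 <= 1].
      by split; rewrite sig_ge0 ?sig_le1//; exact: arc_gt0.
    move: a1 a2 a3 => /andP[a1 b1] /andP[a2 b2] /andP[a3 b3].
    by rewrite !mulr_ge0//= !mulr_ile1// mulr_ge0.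
  have hcv z : OT z -> h k z @[k --> \oo] --> h0 z.
    case: z => t [[x1 x2] x3] [/= tT [[/= c1 c2] c3]]; apply: cvg_EFin; first exact: nearW.
    apply: cvgM; first exact: cvg_cst.
    rewrite /= /cutf /f /arcf /pr/=.
    have -> : (\1_B (t, (x1, x2, x3)) : R) = (t0 < t < t1)%R%:R * ((1 < arc p1 q1 x1)%R%:R *
       ((1 < arc p2 q2 x2)%R%:R * (1 < arc p3 q3 x3)%R%:R)).
      have A p q (y : R) : 0 <= p -> p < q -> q <= 1 -> y \in `[0, 1[ -> (1 < arc p q y)%R = (p < y < q)%R.
        rewrite in_itv/= => p0 pq q1' y01; have [pyq|pyq] := boolP (p < y < q).
          by rewrite arc_gt1.
        by apply/negbTE; rewrite -leNgt arc_le1.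
      rewrite !A// indicE -!natrM !mulnb; congr (nat_of_bool _)%:R.
      apply/idP/idP; rewrite inE /B/= !in_itv/=.
        by move=> [-> [[-> ->] ->]].
      by move=> /and4P[-> -> -> ->].
    apply: cvgM; first exact: tcut_cvg.
    by do 2?[apply: cvgM]; apply: sig_cvg; exact: arc_gt0.
  have hdom z k : OT z -> (`|h k z| <= `|(uncurry g z)%:E|)%E.
    case: z => t x _; rewrite lee_fin/= normrM ler_piMr// /cutf.
    have /andP[a1 a2] := tcut_bound k t t01; have /andP[b1 b2] := fb k t x.
    by rewrite ger0_norm; [exact: mulr_ile1|exact: mulr_ge0].
  have [] := @dominated_convergence _ _ _ (leb4 R) OT mOT h h0 (abse \o (EFin \o uncurry g)) mh mh0.
  - by apply: aeW => z; exact: hcv.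
  - exact: integrable_abse.
  - by apply: aeW => z k Oz; exact: hdom.
  move=> _ _ cvh; have E : (\int[leb4 R]_(z in OT) h0 z = 0)%E.
    apply: (cvg_unique (@ereal_hausdorff R) cvh).
    by apply: cvg_near_cst; apply: nearW => k; exact: hz.
  rewrite integral_mkcondr -[RHS]E.
  apply: eq_integral => -[t x] _; rewrite /h0 /patch indicE/=.
  by case: ifPn => zB; rewrite ?mulr1 ?mulr0// /B.
have mOTi : measurable OTi by do !(apply: measurableX; try exact: measurable_itv).
have sub : OTi `<=` OT.
  move=> [t [[x1 x2] x3]] [/= tT [[/= a1 a2] a3]]; split => //=.
  have W y : y \in `]0%R, 1%R[ -> `[0%R, 1%R[%classic y by rewrite /= !in_itv/= => /andP[/ltW -> ->].
  by do ![split => /=]; [exact: W a1|exact: W a2|exact: W a3].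
have ae : ae_eq (leb4 R) OTi (EFin \o uncurry g) (cst 0%E).
  apply: integral_boxes_eq0 => //.
  - exact: integrableS ig.
  - have -> : OTi = OT `&` OTi by rewrite setIidr.
    exact: (key 0 T 0 1 0 1 0 1).
  - move=> _ [_ [x [y ->]] [_ [_ [_ [x1 [y1 ->]] [_ [x2 [y2 ->]] <-]] [_ [x3 [y3 ->]] <-]] <-]].
    (* Clipping the sides puts the intersection into the form handled by [key]; a box with an empty
       clipped side contributes nothing and is discarded below. *)
    have E : OTi `&` (`]x, y[ `*` (`]x1, y1[ `*` `]x2, y2[ `*` `]x3, y3[))%classic =
       OT `&` (`]Num.max x 0, Num.min y T[ `*` (`]Num.max x1 0, Num.min y1 1[ `*`
         `]Num.max x2 0, Num.min y2 1[ `*` `]Num.max x3 0, Num.min y3 1[))%classic.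
      apply/seteqP; split => -[t [[z1 z2] z3]] /=; rewrite /OTi /OT /O3 /cell /= !in_itv/= !gt_max !lt_min.
        move=> [[/andP[-> ->] [[/andP[a1 ->] /andP[a2 ->]] /andP[a3 ->]]]].
        by rewrite a1 a2 a3 (ltW a1) (ltW a2) (ltW a3) => -[/andP[-> ->] [[/andP[-> ->] /andP[-> ->]] /andP[-> ->]]].
      move=> [_ [/andP[/andP[-> ->] /andP[-> ->]] [[/andP[/andP[-> ->] /andP[-> ->]] /andP[/andP[-> ->] /andP[-> ->]]] /andP[/andP[-> ->] /andP[-> ->]]]]].
      by [].
    rewrite E.
    have emp (a c z : R) : c <= a -> z \in `]a, c[ -> False.
      by move=> ca; rewrite in_itv/= => /andP[h1 h2]; have := lt_trans h1 h2; rewrite ltNge ca.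
    have [c0|c0] := ltP (Num.max x 0) (Num.min y T); last first.
      rewrite (_ : _ `&` _ = set0) ?integral_set0//; apply/seteqP; split => //.
      by move=> [t [[z1 z2] z3]] [_ [/= /(emp _ _ _ c0)]].
    have [c1|c1] := ltP (Num.max x1 0) (Num.min y1 1); last first.
      rewrite (_ : _ `&` _ = set0) ?integral_set0//; apply/seteqP; split => //.
      by move=> [t [[z1 z2] z3]] [_ [/= _ [[/= /(emp _ _ _ c1)]]]].
    have [c2|c2] := ltP (Num.max x2 0) (Num.min y2 1); last first.
      rewrite (_ : _ `&` _ = set0) ?integral_set0//; apply/seteqP; split => //.
      by move=> [t [[z1 z2] z3]] [_ [/= _ [[/= _ /(emp _ _ _ c2)]]]].
    have [c3|c3] := ltP (Num.max x3 0) (Num.min y3 1); last first.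
      rewrite (_ : _ `&` _ = set0) ?integral_set0//; apply/seteqP; split => //.
      by move=> [t [[z1 z2] z3]] [_ [/= _ [_ /(emp _ _ _ c3)]]].
    by apply: key => //; rewrite ?le_max ?lexx ?orbT// ge_min lexx orbT.
have nN : (leb4 R).-negligible (OT `\` OTi).
  by exists (OT `\` OTi); split => //; [exact: measurableD|exact: leb4_faces].
have aN : {ae leb4 R, forall z, ~ (OT `\` OTi) z}.
  by apply: negligibleS nN => z /= /contrapT.
apply: filterS2 ae aN => z h1 h2 Oz; apply: h1.
by apply: contrapT => nz; apply: h2.
Qed.

End fundamental_lemma.

(** * Powers and friction *)

Section powers.
Context (R : realType).
Implicit Types (r x y p q m N : R).

Lemma powR_between p m N x : 0 < m -> m <= x <= N ->
  Num.min (m `^ p) (N `^ p) <= x `^ p <= Num.max (m `^ p) (N `^ p).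
Proof.
move=> m0 /andP[mx xN]; have x0 : 0 < x by exact: lt_le_trans mx.
have N0 : 0 < N by exact: lt_le_trans xN.
have mono q u v : 0 <= q -> 0 < u -> u <= v -> u `^ q <= v `^ q.
  move=> q0 u0 uv; apply: ge0_ler_powR => //; rewrite nnegrE; first exact: ltW.
  by apply: ltW; exact: lt_le_trans uv.
have [p0|p0] := leP 0 p.
  by rewrite ge_min le_max (mono _ _ _ p0 m0 mx) (mono _ _ _ p0 x0 xN) orbT.
have q0 : 0 <= - p by rewrite oppr_ge0 ltW.
have E z : 0 < z -> z `^ p = (z `^ (- p))^-1.
  by move=> z0; rewrite powRN invrK.
rewrite !E// ge_min le_max !lef_pV2 ?posrE ?powR_gt0//.
by rewrite (mono _ _ _ q0 m0 mx) (mono _ _ _ q0 x0 xN) orbT.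
Qed.

Lemma powR_step p x : 0 < x -> x * x `^ (p - 1) = x `^ p.
Proof.
move=> x0; rewrite -[X in X * _](powRr1 (ltW x0)) -powRD; last by apply/implyP => _; rewrite gt_eqF.
by rewrite addrC subrK.
Qed.

Lemma powR_lip p m N : 0 < m -> exists2 L, 0 < L &
  forall x y, m <= x <= N -> m <= y <= N -> `|x `^ p - y `^ p| <= L * `|x - y|.
Proof.
(* The mean value theorem gives |p| times the largest value of x^(p-1), attained at an end point of
   [m, N]; the added 1 keeps the constant positive for p = 0. *)
move=> m0; exists (1 + `|p| * Num.max (m `^ (p - 1)) (N `^ (p - 1))).
  by rewrite ltr_pwDl// mulr_ge0// le_max powR_ge0.
move=> x y.
wlog xy : x y / x < y => [H mx my|mx my].
  have [xy|yx|->] := ltgtP x y; first exact: H.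
    by rewrite distrC [`|x - y|]distrC; exact: H.
  by rewrite !subrr !normr0 mulr0.
have dp z : x <= z <= y -> is_derive z 1 (@powR R ^~ p) (p * z `^ (p - 1)).
  move=> /andP[xz _]; apply: is_derive1_powR.
  by move: mx => /andP[mx _]; exact: lt_le_trans (le_trans mx xz).
have [c /andP[c1 c2] E] := MVT_cc xy dp.
rewrite distrC [`|x - y|]distrC E normrM ler_wpM2r// normrM.
rewrite ler_wpDl// ler_wpM2l// ger0_norm ?powR_ge0//.
have mcN : m <= c <= N.
  move: mx my => /andP[mx _] /andP[_ yN].
  by rewrite (le_trans mx (ltW c1)) (le_trans (ltW c2) yN).
by have /andP[] := powR_between (p - 1) m0 mcN.
Qed.

Variable gamma : R.
Hypothesis g1 : 1 < gamma.

Lemma is_derive_henergy x : 0 < x ->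
  is_derive x 1 (henergy gamma) (gamma / (gamma - 1) * x `^ (gamma - 1)).
Proof.
move=> x0; have H := is_derive1_powR gamma x0.
have -> : henergy gamma = (fun y => (gamma - 1)^-1 * y `^ gamma).
  by apply/funext => y; rewrite /henergy mulrC.
have -> : gamma / (gamma - 1) * x `^ (gamma - 1) = (gamma - 1)^-1 * (gamma * x `^ (gamma - 1)) by ring.
exact: is_deriveZ.
Qed.

Lemma derive1_henergy x : 0 < x ->
  derive1 (henergy gamma) x = gamma / (gamma - 1) * x `^ (gamma - 1).
Proof. by move=> x0; rewrite derive1E (is_derive_deriv (is_derive_henergy x0)). Qed.

Lemma relative_henergyE x y : 0 < x -> 0 < y ->
  (gamma - 1) * relative (henergy gamma) x y =
  x `^ gamma - y `^ gamma - gamma * y `^ (gamma - 1) * (x - y).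
Proof.
move=> x0 y0; rewrite /relative derive1_henergy// /henergy.
by field; rewrite subr_eq0 gt_eqF.
Qed.

Lemma slope_le A B k x y : k * (y - x) <= B - A -> A - B - k * (x - y) <= 0.
Proof. lra. Qed.

(** Strong convexity of the internal energy away from vacuum: [c0] is the minimum over [m, N] of its
    second derivative gamma r^(gamma-2), attained at an end point because a power is monotone. *)
Lemma relative_henergy_quad m N : 0 < m -> exists2 c, 0 < c &
  forall x y, m <= x <= N -> m <= y <= N ->
  c * (x - y) ^+ 2 <= relative (henergy gamma) x y.
Proof.
move=> m0.
pose c0 := gamma * Num.min (m `^ (gamma - 2)) (N `^ (gamma - 2)).
have [mN|Nm] := leP m N; last first.
  exists 1 => // x y /andP[h1 h2].
  by have := le_lt_trans (le_trans h1 h2) Nm; rewrite ltxx.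
have N0 : 0 < N by exact: lt_le_trans mN.
have g0 : 0 < gamma by exact: lt_trans g1.
have c00 : 0 < c0 by rewrite mulr_gt0// lt_min !powR_gt0.
exists (c0 / 2); first by rewrite divr_gt0.
(* The derivative of h is strongly monotone on [m, N]. *)
have mono x y : m <= x -> x < y -> y <= N ->
    c0 * (y - x) <= derive1 (henergy gamma) y - derive1 (henergy gamma) x.
  move=> mx xy yN.
  have x0 : 0 < x by exact: lt_le_trans mx.
  have dp z : x <= z <= y -> is_derive z 1 (fun z => gamma / (gamma - 1) * z `^ (gamma - 1))
      (gamma * z `^ (gamma - 2)).
    move=> /andP[xz _]; have z0 := lt_le_trans x0 xz.
    have H := is_derive1_powR (gamma - 1) z0.
    have -> : gamma * z `^ (gamma - 2) = gamma / (gamma - 1) * ((gamma - 1) * z `^ (gamma - 1 - 1)).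
      have -> : gamma - 1 - 1 = gamma - 2 by ring.
      by field; rewrite subr_eq0 gt_eqF.
    exact: is_deriveZ.
  have [c /andP[c1 c2] E] := MVT_cc xy dp.
  rewrite !derive1_henergy//; last exact: lt_trans xy.
  rewrite E; apply: ler_wpM2r; first by rewrite subr_ge0 ltW.
  rewrite /c0; apply: ler_wpM2l; first exact: ltW.
  have mcN : m <= c <= N by rewrite (le_trans mx (ltW c1)) (le_trans (ltW c2) yN).
  by have /andP[] := powR_between (gamma - 2) m0 mcN.
move=> x y /andP[mx xN] /andP[my yN].
have x0 : 0 < x by exact: lt_le_trans mx.
have y0 : 0 < y by exact: lt_le_trans my.
(* [G] vanishes at [y], and by strong monotonicity its derivative at z has the sign of z - y, so [y]
   is a minimum of [G]. *)
pose G z := relative (henergy gamma) z y - c0 / 2 * (z - y) ^+ 2.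
have dG (z : R) : 0 < z -> is_derive z 1 G
    (derive1 (henergy gamma) z - derive1 (henergy gamma) y - c0 * (z - y)).
  move=> z0; rewrite {1}derive1_henergy// /G /relative.
  have H1 := is_derive_henergy z0.
  have H2 : is_derive z 1 (fun z : R => z - y) 1.
    have := @is_deriveB _ _ _ _ (cst y) z 1 _ _ (is_derive_id _ _) (is_derive_cst _ _ _).
    by rewrite subr0.
  set D := derive1 _ y.
  have H3 := @is_deriveZ _ _ _ (fun z : R => z - y) D z 1 1 H2.
  have H4 := @is_deriveX _ _ (fun z : R => z - y) 2 z 1 1 H2.
  have H5 := @is_deriveZ _ _ _ _ (c0 / 2) z 1 _ H4.
  have H6 := @is_deriveB _ _ _ _ (cst (henergy gamma y)) z 1 _ _ H1 (is_derive_cst _ _ _).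
  have H7 := @is_deriveB _ _ _ _ _ z 1 _ _ (@is_deriveB _ _ _ _ _ z 1 _ _ H6 H3) H5.
  apply: is_derive_eq H7 _ => /=.
  rewrite [LHS](_ : _ = gamma / (gamma - 1) * z `^ (gamma - 1) - 0 - D * 1 -
     c0 / 2 * (2 * (z - y) ^+ 1 * 1))//.
  by rewrite expr1; field; rewrite subr_eq0 gt_eqF.
have Gy : G y = 0 by rewrite /G /relative !subrr mulr0 subr0 expr0n mulr0 subrr.
rewrite -subr_ge0 -/(G x) -Gy -subr_ge0.
have [xy|yx|->] := ltgtP x y; last by rewrite subrr.
- have dp z : x <= z <= y -> is_derive z 1 G
      (derive1 (henergy gamma) z - derive1 (henergy gamma) y - c0 * (z - y)).
    by move=> /andP[xz _]; apply: dG; exact: lt_le_trans xz.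
  have [c /andP[c1 c2] E] := MVT_cc xy dp.
  rewrite -opprB E oppr_ge0; apply: mulr_le0_ge0; last by rewrite subr_ge0 ltW.
  apply: (slope_le (@mono c y (le_trans mx (ltW c1)) c2 yN)).
- have dp z : y <= z <= x -> is_derive z 1 G
      (derive1 (henergy gamma) z - derive1 (henergy gamma) y - c0 * (z - y)).
    by move=> /andP[xz _]; apply: dG; exact: lt_le_trans xz.
  have [c /andP[c1 c2] E] := MVT_cc yx dp.
  rewrite E; apply: mulr_ge0; last by rewrite subr_ge0 ltW.
  by rewrite subr_ge0; exact: (@mono y c my c1 (le_trans (ltW c2) xN)).
Qed.

Variable s : R.
Local Notation a := ((s + 3) / 2).

Lemma derive1_mu x : 0 < x -> derive1 (mu s) x = a * x `^ (a - 1).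
Proof. by move=> x0; rewrite derive1E (is_derive_deriv (is_derive1_powR a x0)). Qed.

(** For a power law, r mu'(r) = (s + 3)/2 mu(r), so lambda is a multiple of mu. Every Korteweg term
    in lambda thereby reduces to one in mu. *)
Lemma lambdaE x : 0 < x -> lambda s x = (s + 1) * mu s x.
Proof.
move=> x0; rewrite /lambda derive1_mu// mulrCA powR_step// /mu.
set y := x `^ _; lra.
Qed.

End powers.

(** * The friction matrix *)

Section friction.
Context (R : realType) (n : nat) (b : 'I_n -> 'I_n -> R) (M : 'I_n -> R).
Hypothesis fc : friction_condition b M.

Lemma friction_sym i j : b i j = b j i.
Proof. by have [h _ _] := fc. Qed.

Lemma friction_M_gt0 i : 0 < M i.
Proof.
have [_ _ h] := fc; have [|_ hM] := h (fun _ => 1) _; first by move=> ?; exact: ltr01.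
by have := hM i; rewrite mulr1.
Qed.

(** The sign of [b i i] is unconstrained, so diagonal terms are only harmless because the quantity
    they multiply vanishes. *)
Lemma friction_ge0 i j (z : R) : 0 <= z -> (i = j -> z = 0) -> 0 <= b i j * z.
Proof.
move=> z0 zij; have [ij|ij] := eqVneq i j; first by rewrite (zij ij) mulr0.
by have [_ h _] := fc; rewrite mulr_ge0// h.
Qed.

Lemma tauM_apply (r : 'I_n -> R) (u : 'I_n -> R) i :
  \sum_j tauM b M r i j * u j =
  r i * (\sum_j b i j * r j * (u i - u j) + M i * u i).
Proof.
under eq_bigr do rewrite mxE mulrBl.
rewrite sumrB (bigD1 i)//= eqxx mul1r [X in _ + X - _]big1 ?addr0; last first.
  by move=> j ji; rewrite eq_sym (negbTE ji) !mul0r.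
have -> : \sum_j b i j * r j * (u i - u j) = (\sum_j b i j * r j) * u i - \sum_j b i j * r j * u j.
  by rewrite mulr_suml -sumrB; apply: eq_bigr => j _; rewrite mulrBr.
have -> : \sum_k b i k * r i * r k = r i * \sum_k b i k * r k.
  by rewrite mulr_sumr; apply: eq_bigr => k _; ring.
have -> : \sum_j b i j * r i * r j * u j = r i * \sum_j b i j * r j * u j.
  by rewrite mulr_sumr; apply: eq_bigr => k _; ring.
ring.
Qed.

Lemma symm_sum (f : 'I_n -> 'I_n -> R) (u : 'I_n -> R) :
  (forall i j, f i j = f j i) ->
  \sum_i \sum_j f i j * (u i - u j) * u i = 2^-1 * \sum_i \sum_j f i j * (u i - u j) ^+ 2.
Proof.
move=> fs.
have E : \sum_i \sum_j f i j * (u i - u j) * u i = \sum_i \sum_j f i j * (u j - u i) * u j.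
  by rewrite exchange_big/=; apply: eq_bigr => i _; apply: eq_bigr => j _; rewrite fs.
have : \sum_i \sum_j f i j * (u i - u j) * u i + \sum_i \sum_j f i j * (u j - u i) * u j =
   \sum_i \sum_j f i j * (u i - u j) ^+ 2.
  rewrite -big_split/=; apply: eq_bigr => i _; rewrite -big_split/=.
  by apply: eq_bigr => j _; ring.
by rewrite -E => <-; lra.
Qed.

(** A vector of the kernel, tested against itself, gives a nonnegative friction part plus the
    damping part; the latter must vanish, and since every [M i] is positive the vector is 0.
    Symmetry of the matrix turns the left kernel into the right one. *)
Lemma tauM_unit (r : 'I_n -> R) : (forall i, 0 < r i) -> tauM b M r \in unitmx.
Proof.
move=> r0; rewrite unitmxE unitfE; apply/negP => /det0P[v v0 vt].
have tsym i j : tauM b M r i j = tauM b M r j i.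
  rewrite !mxE friction_sym eq_sym; congr (_ - _); last by rewrite mulrAC.
  by have [->//|ij] := eqVneq i j; rewrite !mul0r.
pose u i := v 0 i.
have tu i : \sum_j tauM b M r i j * u j = 0.
  have /matrixP/(_ 0 i) := vt; rewrite !mxE => h; rewrite -[RHS]h.
  by apply: eq_bigr => j _; rewrite tsym mulrC.
have : \sum_i (\sum_j tauM b M r i j * u j) * u i = 0.
  by rewrite big1// => i _; rewrite tu mul0r.
under eq_bigr do rewrite tauM_apply.
have -> : \sum_i r i * (\sum_j b i j * r j * (u i - u j) + M i * u i) * u i =
  \sum_i \sum_j (b i j * r i * r j) * (u i - u j) * u i + \sum_i M i * r i * u i ^+ 2.
  rewrite -big_split/=; apply: eq_bigr => i _.
  rewrite mulrDr mulrDl; congr (_ + _); last by ring.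
  by rewrite mulr_sumr mulr_suml; apply: eq_bigr => j _; ring.
rewrite symm_sum; last by move=> i j; rewrite friction_sym; ring.
have h1 : 0 <= 2^-1 * \sum_i \sum_j (b i j * r i * r j) * (u i - u j) ^+ 2.
  rewrite mulr_ge0//; apply: sumr_ge0 => i _; apply: sumr_ge0 => j _.
  rewrite -!mulrA; apply: friction_ge0.
    by do 2!(apply: mulr_ge0; first exact: ltW); exact: sqr_ge0.
  by move=> ->; rewrite subrr expr0n !mulr0.
have h2 i : 0 <= M i * r i * u i ^+ 2.
  apply: mulr_ge0; last exact: sqr_ge0.
  by apply: mulr_ge0; apply: ltW; [exact: friction_M_gt0|exact: r0].
move=> /eqP; rewrite paddr_eq0 ?sumr_ge0// => /andP[_].
rewrite psumr_eq0// => /allP hu.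
move/eqP : v0; apply; apply/rowP => i; rewrite mxE.
have := hu i (mem_index_enum _); rewrite /= !mulf_eq0 (gt_eqF (friction_M_gt0 i)) (gt_eqF (r0 i))/=.
by rewrite orbb => /eqP.
Qed.

(** Turns the definition of the equilibrium velocity by an inverse matrix back into a force
    balance. *)
Lemma tauM_solve (r : 'I_n -> R) (f : 'I_n -> R) i : (forall i, 0 < r i) ->
  let u i := \sum_j invmx (tauM b M r) i j * f j in
  r i * (\sum_j b i j * r j * (u i - u j) + M i * u i) = f i.
Proof.
move=> r0 u; rewrite -tauM_apply.
have h := mulmxV (tauM_unit r0).
rewrite /u; under eq_bigr do rewrite mulr_sumr.
rewrite exchange_big/=.
have E j : \sum_i0 tauM b M r i i0 * (invmx (tauM b M r) i0 j * f j) = (i == j)%:R * f j.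
  have /matrixP/(_ i j) := h; rewrite !mxE => <-.
  by rewrite mulr_suml; apply: eq_bigr => k _; rewrite mulrA.
under eq_bigr do rewrite E.
rewrite (bigD1 i)//= eqxx mul1r big1 ?addr0// => j ji.
by rewrite eq_sym (negbTE ji) mul0r.
Qed.

End friction.

(** * The equilibrium fields *)

Section derivation_rules.
Context (R : realType).
Implicit Types (I : set R) (f g : scalar_field R) (t : R) (x : coords R).

Lemma dx_add I f g l t x : smooth_on I f -> smooth_on I g -> I t ->
  dx l (fun t x => f t x + g t x) t x = dx l f t x + dx l g t x.
Proof. by move=> sf sg; apply: dxD; exact: smooth_on_xd. Qed.

Lemma dx_mul I f g l t x : smooth_on I f -> smooth_on I g -> I t ->
  dx l (fun t x => f t x * g t x) t x = dx l f t x * g t x + f t x * dx l g t x.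
Proof. by move=> sf sg; apply: dxM; exact: smooth_on_xd. Qed.

Lemma dx_cst l (c : R) t x : dx l (fun _ _ => c) t x = 0.
Proof. exact: derive_cst. Qed.

Lemma dx_scale I (c : R) f l t x : smooth_on I f -> I t ->
  dx l (fun t x => c * f t x) t x = c * dx l f t x.
Proof.
move=> sf It; have := dx_mul l x (smooth_on_cst I c) sf It.
by rewrite dx_cst mul0r add0r.
Qed.

Lemma dx_opp I f l t x : smooth_on I f -> I t ->
  dx l (fun t x => - f t x) t x = - dx l f t x.
Proof.
move=> sf It; rewrite -mulN1r -(dx_scale (-1) l x sf It).
by apply: (eq_dx (I := I)) => // s y _; rewrite mulN1r.
Qed.

Lemma dx_sum I (J : Type) (r : seq J) (F : J -> scalar_field R) l t x :
  (forall j, smooth_on I (F j)) -> I t ->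
  dx l (fun t x => \sum_(j <- r) F j t x) t x = \sum_(j <- r) dx l (F j) t x.
Proof.
move=> sF It; elim: r => [|j r IH].
  rewrite big_nil -[RHS](dx_cst l 0 t x).
  by apply: (eq_dx (I := I)) => // s y _; rewrite big_nil.
rewrite big_cons -IH -(dx_add _ _ (sF j) (smooth_on_sum r xpredT sF) It).
by apply: (eq_dx (I := I)) => // s y _; rewrite big_cons.
Qed.

Lemma dx_pow I f p l t x : (forall t x, I t -> 0 < f t x) -> smooth_on I f -> I t ->
  dx l (fun t x => f t x `^ p) t x = p * f t x `^ (p - 1) * dx l f t x.
Proof.
move=> f0 sf It.
by have /is_derive_deriv := dx_powR p (@smooth_on_xd _ _ _ l sf) It (f0 t x It).
Qed.

Lemma dt_add I f g t x : smooth_on I f -> smooth_on I g -> interior I t ->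
  dt (fun t x => f t x + g t x) t x = dt f t x + dt g t x.
Proof.
move=> sf sg It.
have h1 := smooth_on_dt_derive x sf It; have h2 := smooth_on_dt_derive x sg It.
by rewrite {1}/dt derive1E (is_derive_deriv (@is_deriveD _ _ _ _ _ _ _ _ _ h1 h2)).
Qed.

Lemma dt_mul I f g t x : smooth_on I f -> smooth_on I g -> interior I t ->
  dt (fun t x => f t x * g t x) t x = dt f t x * g t x + f t x * dt g t x.
Proof.
move=> sf sg It.
have h1 := smooth_on_dt_derive x sf It; have h2 := smooth_on_dt_derive x sg It.
rewrite {1}/dt derive1E (is_derive_deriv (@is_deriveM _ _ _ _ _ _ _ _ h1 h2)).
by rewrite addrC mulrC.
Qed.

Lemma dt_cst (c : R) t x : dt (fun _ _ => c) t x = 0 :> R.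
Proof. by rewrite /dt derive1_cst. Qed.

Lemma eq_dt I f g t x : (forall t x, I t -> f t x = g t x) -> interior I t ->
  dt f t x = dt g t x.
Proof.
move=> fg It; rewrite /dt !derive1E; apply: near_eq_derive.
by apply: filterS It => s Is; exact: fg.
Qed.

Lemma dt_scale I (c : R) f t x : smooth_on I f -> interior I t ->
  dt (fun t x => c * f t x) t x = c * dt f t x.
Proof.
move=> sf It; have := dt_mul x (smooth_on_cst I c) sf It.
by rewrite dt_cst mul0r add0r.
Qed.

Lemma dt_sum I (J : Type) (r : seq J) (F : J -> scalar_field R) t x :
  (forall j, smooth_on I (F j)) -> interior I t ->
  dt (fun t x => \sum_(j <- r) F j t x) t x = \sum_(j <- r) dt (F j) t x.
Proof.
move=> sF It; elim: r => [|j r IH].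
  rewrite big_nil -[RHS](dt_cst 0 t x).
  by apply: (eq_dt (I := I)) => // s y _; rewrite big_nil.
rewrite big_cons -IH -(dt_add _ (sF j) (smooth_on_sum r xpredT sF) It).
by apply: (eq_dt (I := I)) => // s y _; rewrite big_cons.
Qed.

Lemma dt_pow I f p t x : (forall t x, I t -> 0 < f t x) -> smooth_on I f -> interior I t ->
  dt (fun t x => f t x `^ p) t x = p * f t x `^ (p - 1) * dt f t x.
Proof.
move=> f0 sf It.
have h1 := smooth_on_dt_derive x sf It.
have h2 := is_derive1_powR p (f0 t x (interior_subset It)).
have H := @is_derive_comp_dir _ _ (fun y => y `^ p) (f^~ x) t 1 _ _ h1 h2.
by rewrite {1}/dt derive1E; exact: is_derive_deriv H.
Qed.

Lemma smooth_on_divg I (w : vector_field R) : (forall k, smooth_on I (w k)) ->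
  smooth_on I (divg w).
Proof. by move=> sw; apply: smooth_on_sum => l; exact: smooth_on_dx. Qed.

Lemma smooth_on_det I m (A : R -> coords R -> 'M[R]_m) :
  (forall i j, smooth_on I (fun t x => A t x i j)) ->
  smooth_on I (fun t x => \det (A t x)).
Proof.
move=> sA; apply: smooth_on_sum => p; apply: smooth_onM; first exact: smooth_on_cst.
by apply: smooth_on_prod => i; exact: sA.
Qed.

(** By Cramer's rule an entry of the inverse is a cofactor divided by the determinant, a quotient of
    polynomials in the entries. *)
Lemma smooth_on_invmx I m (A : R -> coords R -> 'M[R]_m) :
  (forall i j, smooth_on I (fun t x => A t x i j)) ->
  (forall t x, I t -> A t x \in unitmx) ->
  forall i j, smooth_on I (fun t x => invmx (A t x) i j).
Proof.
move=> sA uA i j.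
apply: (@eq_smooth_on _ _ (fun t x => (\det (A t x))^-1 * ((-1) ^+ (j + i) * \det (row' j (col' i (A t x)))))).
  by move=> t x It; rewrite /invmx uA// !mxE.
apply: smooth_onM.
  apply: smooth_onV; last exact: smooth_on_det.
  by move=> t x It; have := uA t x It; rewrite unitmxE unitfE.
apply: smooth_onM; first exact: smooth_on_cst.
apply: smooth_on_det => k l.
apply: (@eq_smooth_on _ _ (fun t x => A t x (lift j k) (lift i l))); last exact: sA.
by move=> t x _; rewrite !mxE.
Qed.

Lemma periodic_on_cst I (c : R) : periodic_on I (fun _ _ => c).
Proof. by []. Qed.

Lemma periodic_on_comp I f (h : R -> R) : periodic_on I f ->
  periodic_on I (fun t x => h (f t x)).
Proof. by move=> pf t x l It; rewrite (pf t x l It). Qed.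

Lemma periodic_onD I f g : periodic_on I f -> periodic_on I g ->
  periodic_on I (fun t x => f t x + g t x).
Proof. by move=> pf pg t x l It; rewrite (pf t x l It) (pg t x l It). Qed.

Lemma periodic_onM I f g : periodic_on I f -> periodic_on I g ->
  periodic_on I (fun t x => f t x * g t x).
Proof. by move=> pf pg t x l It; rewrite (pf t x l It) (pg t x l It). Qed.

Lemma periodic_onN I f : periodic_on I f -> periodic_on I (fun t x => - f t x).
Proof. by move=> pf t x l It; rewrite (pf t x l It). Qed.

Lemma periodic_on_sum I (J : Type) (r : seq J) (F : J -> scalar_field R) :
  (forall j, periodic_on I (F j)) -> periodic_on I (fun t x => \sum_(j <- r) F j t x).
Proof. by move=> pF t x l It; apply: eq_bigr => j _; exact: pF. Qed.

Lemma periodic_dx I f l : periodic_on I f -> periodic_on I (dx l f).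
Proof.
move=> pf t x m It; rewrite /dx /derive.
suff -> : (fun h : R => h^-1 *: (f t (h *: evec R l + (x + evec R m)) - f t (x + evec R m))) =
  (fun h : R => h^-1 *: (f t (h *: evec R l + x) - f t x)) by [].
apply/funext => h.
by rewrite (pf t x m It) addrA (pf t (h *: evec R l + x) m It).
Qed.

Lemma periodic_divg I (w : vector_field R) : (forall k, periodic_on I (w k)) ->
  periodic_on I (divg w).
Proof.
by move=> pw t x l It; apply: eq_bigr => k _; exact: (periodic_dx k (pw k)).
Qed.

Lemma divgE (w : vector_field R) t x : divg w t x = \sum_l dx l (w l) t x.
Proof. by []. Qed.

Lemma dx_ext l f g t x : (forall y, f t y = g t y) -> dx l f t x = dx l g t x.
Proof. by move=> fg; rewrite /dx (_ : f t = g t)//; apply/funext. Qed.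

Lemma sum3E (F : 'I_3 -> R) : \sum_k F k = F 0 + F 1 + F 2%:R.
Proof.
rewrite !big_ord_recl big_ord0 addr0 addrA; congr (_ + F _ + F _); exact/val_inj.
Qed.

End derivation_rules.

Section equilibrium_fields.
Local Opaque dx dt divg.
Context (R : realType) (n : nat) (gamma s : R) (b : 'I_n -> 'I_n -> R) (M : 'I_n -> R).
Hypothesis fc : friction_condition b M.
Variables (T : R) (rb : 'I_n -> scalar_field R).
Hypothesis hrb : smooth_equilibrium gamma s b M rb T.

Local Notation I := `[0, T]%classic.
Local Notation a := ((s + 3) / 2).
Local Notation kap := ((s + 1) / 2).
Implicit Types (i j : 'I_n) (k l : 'I_3) (t : R) (x : coords R).

(* Equilibrium velocities are proportional to [eps]; this is the factor. *)
Definition ubar1 i : vector_field R := fun k t x => ubar gamma s b M rb 1 i k t x.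
Local Notation U := ubar1.
Local Notation V := (vbar s rb).
Definition mu_deriv (r : R) : R := a * r `^ (a - 1).

Lemma ubarE eps i k t x : ubar gamma s b M rb eps i k t x = eps * U i k t x.
Proof. by rewrite /ubar1 /ubar mul1r. Qed.

Lemma rb_smooth i : smooth_on I (rb i). Proof. by have [/(_ i)[]] := hrb. Qed.
Lemma rb_periodic i : periodic_on I (rb i). Proof. by have [/(_ i)[]] := hrb. Qed.
Lemma rb_gt0 i t x : I t -> 0 < rb i t x.
Proof. by have [_ h _] := hrb; rewrite /= in_itv/=; exact: h. Qed.

Lemma smooth_mu i : smooth_on I (fun t x => mu s (rb i t x)).
Proof. by apply: smooth_on_powR; [exact: rb_gt0|exact: rb_smooth]. Qed.

Lemma vbar_smooth i k : smooth_on I (V i k).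
Proof.
apply: smooth_onM; first exact/smooth_on_dx/smooth_mu.
by apply: smooth_onV; [move=> t x It; rewrite gt_eqF// rb_gt0|exact: rb_smooth].
Qed.

Lemma vbar_periodic i k : periodic_on I (V i k).
Proof.
move=> t x l It; have h1 := @rb_periodic i t x l It.
have p1 : periodic_on I (fun t' x' => mu s (rb i t' x')).
  by move=> t' x' l' It'; rewrite (@rb_periodic i t' x' l' It').
have h2 := periodic_dx k p1 x l It.
rewrite /vbar; move: (x + evec R l) h1 h2 => y h1 h2.
by rewrite h1 h2.
Qed.

Lemma lambda_smooth i : smooth_on I (fun t x => lambda s (rb i t x)).
Proof.
apply: (@eq_smooth_on _ _ (fun t x => (s + 1) * mu s (rb i t x))).
  by move=> t x It; rewrite lambdaE// rb_gt0.
by apply: smooth_onM; [exact: smooth_on_cst|exact: smooth_mu].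
Qed.

Lemma divS_smooth i k : smooth_on I (divS s (rb i) (V i) k).
Proof.
apply: smooth_onD.
  apply: smooth_on_sum => l; apply: smooth_on_dx.
  by apply: smooth_onM; [exact: smooth_mu|exact/smooth_on_dx/vbar_smooth].
apply: smooth_onM; first exact: smooth_on_cst.
apply: smooth_on_dx; apply: smooth_onM; first exact: lambda_smooth.
by apply: smooth_on_divg => l; exact: vbar_smooth.
Qed.

Lemma press_smooth i : smooth_on I (fun t x => press gamma (rb i t x)).
Proof. by apply: smooth_on_powR; [exact: rb_gt0|exact: rb_smooth]. Qed.

Lemma ubar1_smooth i k : smooth_on I (U i k).
Proof.
apply: smooth_onM; first exact: smooth_on_cst.
apply: smooth_on_sum => j; apply: smooth_onM.
  apply: (smooth_on_invmx (A := fun t x => tauM b M (fun a => rb a t x))).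
    move=> i' j'; apply: (@eq_smooth_on _ _ (fun t x =>
      (i' == j')%:R * (\sum_k b i' k * rb i' t x * rb k t x + M i' * rb i' t x)
         + - (b i' j' * rb i' t x * rb j' t x))).
      by move=> t x _; rewrite mxE.
    have sb c p q : smooth_on I (fun t x => c * rb p t x * rb q t x).
      apply: smooth_onM; last exact: rb_smooth.
      by apply: smooth_onM; [exact: smooth_on_cst|exact: rb_smooth].
    apply: smooth_onD; last exact: smooth_onN.
    apply: smooth_onM; first exact: smooth_on_cst.
    apply: smooth_onD; first by apply: smooth_on_sum => q.
    by apply: smooth_onM; [exact: smooth_on_cst|exact: rb_smooth].
  by move=> t x It; apply: (tauM_unit fc) => q; exact: rb_gt0.
apply: smooth_onD; last exact: divS_smooth.
exact/smooth_onN/smooth_on_dx/press_smooth.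
Qed.

Lemma ubar1_periodic i k : periodic_on I (U i k).
Proof.
move=> t x l It.
have h1 : (fun a => rb a t (x + evec R l)) = (fun a => rb a t x).
  by apply/funext => q; exact: rb_periodic.
have h2 j : dx k (fun t' x' => press gamma (rb j t' x')) t (x + evec R l) =
    dx k (fun t' x' => press gamma (rb j t' x')) t x.
  have p1 : periodic_on I (fun t' x' => press gamma (rb j t' x')).
    by move=> t' x' l' It'; rewrite (@rb_periodic j t' x' l' It').
  exact: (periodic_dx k p1 x l It).
have h3 j m : dx m (fun t' x' => mu s (rb j t' x') * dx m (vbar s rb j k) t' x') t (x + evec R l) =
    dx m (fun t' x' => mu s (rb j t' x') * dx m (vbar s rb j k) t' x') t x.
  have p1 : periodic_on I (fun t' x' => mu s (rb j t' x') * dx m (vbar s rb j k) t' x').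
    move=> t' x' l' It'; rewrite (@rb_periodic j t' x' l' It').
    by rewrite (periodic_dx m (@vbar_periodic j k) x' l' It').
  exact: (periodic_dx m p1 x l It).
have h4 j : dx k (fun t' x' => lambda s (rb j t' x') * divg (vbar s rb j) t' x') t (x + evec R l) =
    dx k (fun t' x' => lambda s (rb j t' x') * divg (vbar s rb j) t' x') t x.
  have p1 : periodic_on I (fun t' x' => lambda s (rb j t' x') * divg (vbar s rb j) t' x').
    move=> t' x' l' It'; rewrite (@rb_periodic j t' x' l' It').
    by rewrite (periodic_divg (fun q => @vbar_periodic j q) x' l' It').
  exact: (periodic_dx k p1 x l It).
rewrite /ubar1 /ubar; move: (x + evec R l) h1 h2 h3 h4 => y h1 h2 h3 h4.
rewrite h1; apply: (congr1 (fun z => 1 * z)); apply: eq_bigr => j _.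
rewrite h2 /divS h4; under [in LHS]eq_bigr do rewrite h3.
by [].
Qed.

Lemma interiorI t : 0 < t < T -> interior I t. Proof. exact: interior_cc. Qed.
Lemma inI t : 0 < t < T -> I t. Proof. by move=> /interiorI/interior_subset. Qed.

Lemma dt_rb i t x : 0 < t < T ->
  dt (rb i) t x = - (rb i t x * divg (U i) t x + \sum_l U i l t x * dx l (rb i) t x).
Proof.
move=> tT; have [_ _ h] := hrb.
(* The equilibrium flux is proportional to [eps], which cancels from the continuity equation; its
   instance at 1 carries all the information. *)
have /eqP := h 1 ltr01 i t x tT; rewrite invr1 mul1r addr_eq0 => /eqP ->.
congr (- _); rewrite !divgE mulr_sumr -big_split/=; apply: eq_bigr => l _.
rewrite (dx_mul (I := I) l x (rb_smooth i) (ubar1_smooth i l) (inI tT)) addrC.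
by rewrite [dx l (rb i) t x * _]mulrC.
Qed.

Lemma vbarE i k t x : I t ->
  V i k t x = a * rb i t x `^ (a - 2) * dx k (rb i) t x.
Proof.
move=> It; have r0 := rb_gt0 i x It.
rewrite /vbar /mu (dx_pow a k x (@rb_gt0 i) (rb_smooth i) It).
have -> : rb i t x `^ (a - 1) = rb i t x * rb i t x `^ (a - 2).
  by rewrite -(powR_step (a - 1) r0); congr (_ * _ `^ _); ring.
by field; rewrite gt_eqF.
Qed.

Let powsm p i : smooth_on I (fun t x => rb i t x `^ p).
Proof. by apply: smooth_on_powR; [exact: rb_gt0|exact: rb_smooth]. Qed.

Lemma dx_vbar i k l t x : I t -> dx l (V i k) t x =
  a * (a - 2) * rb i t x `^ (a - 3) * dx l (rb i) t x * dx k (rb i) t x +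
  a * rb i t x `^ (a - 2) * dx l (dx k (rb i)) t x.
Proof.
move=> It.
rewrite (eq_dx (I := I) (g := fun t x => (a * rb i t x `^ (a - 2)) * dx k (rb i) t x))//; last first.
  by move=> t' x'; exact: vbarE.
have s1 : smooth_on I (fun t x => a * rb i t x `^ (a - 2)).
  by apply: smooth_onM; [exact: smooth_on_cst|exact: powsm].
rewrite (dx_mul l x s1 (smooth_on_dx k (rb_smooth i)) It) (dx_scale a l x (powsm _ i) It).
rewrite (dx_pow (a - 2) l x (@rb_gt0 i) (rb_smooth i) It).
have -> : a - 2 - 1 = a - 3 by ring.
by ring.
Qed.

(** The drift is a function of the density times the density gradient, hence curl free. *)
Lemma dx_vbar_sym i k l t x : 0 < t < T -> dx l (V i k) t x = dx k (V i l) t x.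
Proof.
move=> tT; have It := inI tT; rewrite (dx_vbar i k l x It) (dx_vbar i l k x It).
by rewrite (dx_swap l k x (rb_smooth i 2) (interiorI tT)); ring.
Qed.

(** With the continuity equation the drift obeys dt V = - grad (mu'(rho) div U + U . V). This is the
    expanded form: mu''(rho) grad rho equals [kap] V, and V is curl free. *)
Lemma dt_vbar i k t x : 0 < t < T -> dt (V i k) t x =
  - (mu_deriv (rb i t x) * dx k (divg (U i)) t x + kap * V i k t x * divg (U i) t x
     + \sum_l (dx k (U i l) t x * V i l t x + U i l t x * dx l (V i k) t x)).
Proof.
move=> tT; have It := inI tT; have iI := interiorI tT.
rewrite (eq_dt (I := I) (g := fun t x => (a * rb i t x `^ (a - 2)) * dx k (rb i) t x))//; last first.
  by move=> t' x'; exact: vbarE.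
have s1 : smooth_on I (fun t x => a * rb i t x `^ (a - 2)).
  by apply: smooth_onM; [exact: smooth_on_cst|exact: powsm].
rewrite (dt_mul x s1 (smooth_on_dx k (rb_smooth i)) iI) (dt_scale a x (powsm _ i) iI).
rewrite (dt_pow (a - 2) x (@rb_gt0 i) (rb_smooth i) iI).
rewrite (dt_dx_swap k x (rb_smooth i 2) iI).
have sD : smooth_on I (divg (U i)) by apply: smooth_on_divg => l; exact: ubar1_smooth.
have sUd l : smooth_on I (fun t x => U i l t x * dx l (rb i) t x).
  by apply: smooth_onM; [exact: ubar1_smooth|exact/smooth_on_dx/rb_smooth].
have srD : smooth_on I (fun t x => rb i t x * divg (U i) t x).
  by apply: smooth_onM => //; exact: rb_smooth.
have E : dx k (dt (rb i)) t x = - (dx k (rb i) t x * divg (U i) t x + rb i t x * dx k (divg (U i)) t x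
   + \sum_l (dx k (U i l) t x * dx l (rb i) t x + U i l t x * dx k (dx l (rb i)) t x)).
  have -> : dx k (dt (rb i)) t x = dx k (fun t x => - (rb i t x * divg (U i) t x + \sum_l U i l t x * dx l (rb i) t x)) t x.
    by apply: dx_ext => y; exact: dt_rb.
  rewrite (dx_opp (I := I))//; last by apply: smooth_onD => //; exact: smooth_on_sum.
  rewrite (dx_add (I := I))//; last exact: smooth_on_sum.
  rewrite (dx_mul (I := I))//; last exact: rb_smooth.
  have E0 : dx k (fun t x => \sum_l U i l t x * dx l (rb i) t x) t x =
      \sum_l (dx k (U i l) t x * dx l (rb i) t x + U i l t x * dx k (dx l (rb i)) t x).
    apply: etrans (dx_sum _ k x (fun l => sUd l) It) _; apply: eq_bigr => l _.
    exact: (dx_mul k x (ubar1_smooth i l) (smooth_on_dx l (rb_smooth i)) It).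
  by rewrite E0.
rewrite E dt_rb//.
have p1 : rb i t x `^ (a - 2 - 1) * rb i t x = rb i t x `^ (a - 2).
  by rewrite mulrC powR_step ?rb_gt0.
have p2 : rb i t x `^ (a - 2) * rb i t x = rb i t x `^ (a - 1).
  by rewrite mulrC -(powR_step (a - 1)) ?rb_gt0//; congr (_ * _ `^ _); ring.
rewrite /mu_deriv -p2 -p1.
have e3 : a - 3 = a - 2 - 1 by ring.
have vbarE' l : V i l t x = a * (rb i t x `^ (a - 2 - 1) * rb i t x) * dx l (rb i) t x.
  by rewrite vbarE// p1.
have dVE' l : dx l (V i k) t x = a * (a - 2) * rb i t x `^ (a - 2 - 1) * dx l (rb i) t x * dx k (rb i) t x +
   a * (rb i t x `^ (a - 2 - 1) * rb i t x) * dx k (dx l (rb i)) t x.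
  apply: etrans (dx_vbar i k l x It) _; rewrite -(dx_swap l k x (rb_smooth i 2) iI).
  by rewrite p1 -e3.
(* Here q stands for the density to the power a - 3. All other powers of the density are then
   monomials in q and r, and a polynomial identity remains. *)
have aux (A q r rk D Dk vk : R) (u ul rl vl dv rkl : 'I_3 -> R) :
    vk = A * (q * r) * rk -> (forall l, vl l = A * (q * r) * rl l) ->
    (forall l, dv l = A * (A - 2) * q * rl l * rk + A * (q * r) * rkl l) ->
    A * ((A - 2) * q * - (r * D + \sum_l u l * rl l)) * rk +
      A * (q * r) * - (rk * D + r * Dk + \sum_l (ul l * rl l + u l * rkl l)) =
    - (A * (q * r * r) * Dk + (A - 1) * vk * D + \sum_l (ul l * vl l + u l * dv l)).
  by move=> -> hv hd; rewrite !sum3E !hv !hd; ring.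
have kapE : kap = a - 1 by field.
rewrite kapE; exact: (aux a _ _ _ _ _ _ (fun l => U i l t x) (fun l => dx k (U i l) t x)
  (fun l => dx l (rb i) t x) (fun l => V i l t x) (fun l => dx l (V i k) t x) _ (vbarE' k) vbarE' dVE').
Qed.

(** A Bohm identity: per unit mass the capillary force is the gradient of |V|^2/2 + mu'(rho) div V.
    The expansion uses that V is curl free, that mu''(rho) grad rho equals [kap] V, and that lambda
    is (s + 1) mu. *)
Lemma divS_bohm i k t x : 0 < t < T -> divS s (rb i) (V i) k t x =
  rb i t x * (\sum_l V i l t x * dx l (V i k) t x + mu_deriv (rb i t x) * dx k (divg (V i)) t x
     + kap * V i k t x * divg (V i) t x).
Proof.
move=> tT; have It := inI tT; have iI := interiorI tT.
have r0 := rb_gt0 i x It.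
have dmu l : dx l (fun t x => mu s (rb i t x)) t x = rb i t x * V i l t x.
  by rewrite /vbar mulrC divfK// gt_eqF.
have sD : smooth_on I (divg (V i)) by apply: smooth_on_divg => l; exact: vbar_smooth.
rewrite /divS.
have E1 l : dx l (fun t' x' => mu s (rb i t' x') * dx l (V i k) t' x') t x =
   rb i t x * V i l t x * dx l (V i k) t x + mu s (rb i t x) * dx k (dx l (V i l)) t x.
  apply: etrans (dx_mul l x (smooth_mu i) (smooth_on_dx l (vbar_smooth i k)) It) _.
  have e1 : dx l (dx l (V i k)) t x = dx l (dx k (V i l)) t x.
    by apply: dx_ext => y; exact: dx_vbar_sym.
  by rewrite dmu e1 (dx_swap l k x (vbar_smooth i l 2) iI).
under eq_bigr do rewrite E1.
have E2 : dx k (fun t' x' => lambda s (rb i t' x') * divg (V i) t' x') t x =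
   (s + 1) * (rb i t x * V i k t x * divg (V i) t x + mu s (rb i t x) * dx k (divg (V i)) t x).
  rewrite (eq_dx (I := I) (g := fun t x => (s + 1) * (mu s (rb i t x) * divg (V i) t x)))//; last first.
    by move=> t' x' It'; rewrite lambdaE ?rb_gt0// mulrA.
  rewrite (dx_scale (s + 1) k x (smooth_onM (smooth_mu i) sD) It).
  by rewrite (dx_mul k x (smooth_mu i) sD It) dmu.
rewrite E2.
have -> : dx k (divg (V i)) t x = \sum_l dx k (dx l (V i l)) t x.
  exact: (dx_sum _ k x (fun l => smooth_on_dx l (vbar_smooth i l)) It).
have mE : mu s (rb i t x) = rb i t x * rb i t x `^ (a - 1) by rewrite powR_step.
rewrite mE /mu_deriv.
have aux (r q v D : R) (vl dv ddv : 'I_3 -> R) :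
    \sum_l (r * vl l * dv l + r * q * ddv l) + 2^-1 * ((s + 1) * (r * v * D + r * q * \sum_l ddv l)) =
    r * (\sum_l vl l * dv l + a * q * \sum_l ddv l + kap * v * D).
  by rewrite !sum3E; field.
exact: aux.
Qed.

(** The friction and damping force of the equilibrium flow per unit mass, divided by the scale of
    its velocity so that no [eps] remains. *)
Definition friction i k : scalar_field R := fun t x =>
  \sum_j b i j * rb j t x * (U i k t x - U j k t x) + M i * U i k t x.

(* Equals the gradient of [h'(rb)], i.e. of the pressure divided by the density. *)
Definition gradh i k : scalar_field R := fun t x =>
  gamma * rb i t x `^ (gamma - 2) * dx k (rb i) t x.

(** The balance that defines [U], divided by the density, with the capillary force in Bohm form.
    Acceleration is absent from it, and reappears later as the only source of eps^4. *)
Lemma equilibrium_momentum i k t x : 0 < t < T ->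
  friction i k t x = - gradh i k t x + \sum_l V i l t x * dx l (V i k) t x
    + mu_deriv (rb i t x) * dx k (divg (V i)) t x + kap * V i k t x * divg (V i) t x.
Proof.
move=> tT; have It := inI tT; have r0 := rb_gt0 i x It.
pose f j := - dx k (fun t' x' => press gamma (rb j t' x')) t x + divS s (rb j) (V j) k t x.
have h := tauM_solve fc f i (fun j => rb_gt0 j x It).
have {}h : rb i t x * friction i k t x = f i.
  rewrite -h /friction /ubar1 /ubar; congr (_ * (_ + _)).
    by apply: eq_bigr => j _; rewrite !mul1r.
  by rewrite mul1r.
have rn0 : rb i t x != 0 by rewrite gt_eqF.
apply: (mulfI rn0) => /=; rewrite h /f (divS_bohm i k x tT).
rewrite (dx_pow gamma k x (@rb_gt0 i) (rb_smooth i) It) /gradh.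
have -> : rb i t x `^ (gamma - 1) = rb i t x * rb i t x `^ (gamma - 2).
  by rewrite -(powR_step (gamma - 1) r0); congr (_ * _ `^ _); ring.
by ring.
Qed.

(* The cross terms of the two momentum equations add up to
   [- rho v . Y - (1 + kap)^-1 rho mu'(rho) div Y], which vanishes weakly because
   [rho v] is the gradient of [mu rho]. *)
Definition crossY i k : scalar_field R := fun t x =>
  \sum_l (U i l t x * dx l (V i k) t x - V i l t x * dx l (U i k) t x)
  + kap * (U i k t x * divg (V i) t x - V i k t x * divg (U i) t x).

Let divU_smooth i : smooth_on I (divg (U i)).
Proof. by apply: smooth_on_divg => l; exact: ubar1_smooth. Qed.
Let divV_smooth i : smooth_on I (divg (V i)).
Proof. by apply: smooth_on_divg => l; exact: vbar_smooth. Qed.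

Let smU1 i k l : smooth_on I (fun t x => U i l t x * dx l (V i k) t x).
Proof. by apply: smooth_onM; [exact: ubar1_smooth|exact/smooth_on_dx/vbar_smooth]. Qed.
Let smU2 i k l : smooth_on I (fun t x => V i l t x * dx l (U i k) t x).
Proof. by apply: smooth_onM; [exact: vbar_smooth|exact/smooth_on_dx/ubar1_smooth]. Qed.
Let smU3 i k : smooth_on I (fun t x => U i k t x * divg (V i) t x).
Proof. by apply: smooth_onM => //; exact: ubar1_smooth. Qed.
Let smU4 i k : smooth_on I (fun t x => V i k t x * divg (U i) t x).
Proof. by apply: smooth_onM => //; exact: vbar_smooth. Qed.

Lemma smooth_onB J f g : smooth_on J f -> smooth_on J g ->
  smooth_on J (fun t x => f t x - g t x : R).
Proof. by move=> sf sg; apply: smooth_onD => //; exact: smooth_onN. Qed.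

Lemma dx_sub J f g l t x : smooth_on J f -> smooth_on J g -> J t ->
  dx l (fun t x => f t x - g t x : R) t x = dx l f t x - dx l g t x.
Proof.
by move=> sf sg Jt; rewrite -(dx_opp l x sg Jt) -(dx_add l x sf (smooth_onN sg) Jt).
Qed.

Lemma crossY_smooth i k : smooth_on I (crossY i k).
Proof.
apply: smooth_onD; first by apply: smooth_on_sum => l; exact: smooth_onB.
by apply: smooth_onM; [exact: smooth_on_cst|exact: smooth_onB].
Qed.

Lemma crossY_periodic i k : periodic_on I (crossY i k).
Proof.
have pV m := @vbar_periodic i m; have pU m := @ubar1_periodic i m.
apply: periodic_onD; last apply: periodic_onM; first apply: periodic_on_sum => l.
- exact: (periodic_onD (periodic_onM (pU l) (periodic_dx l (pV k)))
    (periodic_onN (periodic_onM (pV l) (periodic_dx l (pU k))))).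
- exact: periodic_on_cst.
- exact: (periodic_onD (periodic_onM (pU k) (periodic_divg pV))
    (periodic_onN (periodic_onM (pV k) (periodic_divg pU)))).
Qed.

(** Products of first derivatives cancel: the double sum by exchanging its indices, the other part
    termwise after summation. The transport terms U . grad div V - V . grad div U survive once from
    the first part and [kap] times from the second, whence the factor a = 1 + [kap]. *)
Lemma divg_crossY i t x : 0 < t < T -> divg (crossY i) t x =
  a * \sum_l (U i l t x * dx l (divg (V i)) t x - V i l t x * dx l (divg (U i)) t x).
Proof.
move=> tT; have It := inI tT; have iI := interiorI tT.
have E k : dx k (crossY i k) t x =
   \sum_l ((dx k (U i l) t x * dx l (V i k) t x + U i l t x * dx l (dx k (V i k)) t x)
        - (dx k (V i l) t x * dx l (U i k) t x + V i l t x * dx l (dx k (U i k)) t x))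
   + kap * ((dx k (U i k) t x * divg (V i) t x + U i k t x * dx k (divg (V i)) t x)
        - (dx k (V i k) t x * divg (U i) t x + V i k t x * dx k (divg (U i)) t x)).
  have s1 : smooth_on I (fun t x => \sum_l (U i l t x * dx l (V i k) t x - V i l t x * dx l (U i k) t x)).
    by apply: smooth_on_sum => l; exact: smooth_onB.
  have s2 : smooth_on I (fun t x => U i k t x * divg (V i) t x - V i k t x * divg (U i) t x).
    exact: smooth_onB.
  apply: etrans (dx_add k x s1 (smooth_onM (smooth_on_cst I kap) s2) It) _.
  congr (_ + _).
    apply: etrans (dx_sum _ k x (fun l => smooth_onB (smU1 i k l) (smU2 i k l)) It) _.
    apply: eq_bigr => l _.
    apply: etrans (dx_sub k x (smU1 i k l) (smU2 i k l) It) _.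
    rewrite (dx_mul k x (ubar1_smooth i l) (smooth_on_dx l (vbar_smooth i k)) It).
    rewrite (dx_mul k x (vbar_smooth i l) (smooth_on_dx l (ubar1_smooth i k)) It).
    by rewrite (dx_swap k l x (vbar_smooth i k 2) iI) (dx_swap k l x (ubar1_smooth i k 2) iI).
  apply: etrans (dx_scale kap k x s2 It) _; congr (_ * _).
  apply: etrans (dx_sub k x (smU3 i k) (smU4 i k) It) _.
  rewrite (dx_mul k x (ubar1_smooth i k) (divV_smooth i) It).
  by rewrite (dx_mul k x (vbar_smooth i k) (divU_smooth i) It).
have Ed l : dx l (divg (V i)) t x = \sum_k dx l (dx k (V i k)) t x.
  exact: (dx_sum _ l x (fun k => smooth_on_dx k (vbar_smooth i k)) It).
have Ed' l : dx l (divg (U i)) t x = \sum_k dx l (dx k (U i k)) t x.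
  exact: (dx_sum _ l x (fun k => smooth_on_dx k (ubar1_smooth i k)) It).
rewrite divgE; under eq_bigr do rewrite E.
rewrite big_split/= -mulr_sumr.
have aux1 (u v : 'I_3 -> R) (du dv : 'I_3 -> 'I_3 -> R) (ddu ddv : 'I_3 -> 'I_3 -> R) (gu gv : 'I_3 -> R) :
    (forall l, gv l = \sum_k ddv l k) -> (forall l, gu l = \sum_k ddu l k) ->
    \sum_k \sum_l ((du k l * dv l k + u l * ddv l k) - (dv k l * du l k + v l * ddu l k)) =
    \sum_l (u l * gv l - v l * gu l).
  by move=> hv hu; rewrite !sum3E !hv !hu !sum3E; ring.
have aux2 (u v : 'I_3 -> R) (du dv : 'I_3 -> R) (gu gv : 'I_3 -> R) (Du Dv : R) :
    Du = \sum_k du k -> Dv = \sum_k dv k ->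
    \sum_k ((du k * Dv + u k * gv k) - (dv k * Du + v k * gu k)) =
    \sum_l (u l * gv l - v l * gu l).
  by move=> -> ->; rewrite !sum3E; ring.
have -> : a = 1 + kap by field.
rewrite (mulrDl 1 kap) mul1r; congr (_ + _).
  exact: (aux1 (fun l => U i l t x) (fun l => V i l t x) (fun k l => dx k (U i l) t x)
   (fun l k => dx l (V i k) t x) (fun l k => dx l (dx k (U i k)) t x)
   (fun l k => dx l (dx k (V i k)) t x) _ _ Ed Ed').
congr (_ * _).
exact: (aux2 (fun l => U i l t x) (fun l => V i l t x) (fun l => dx l (U i l) t x)
   (fun l => dx l (V i l) t x) (fun l => dx l (divg (U i)) t x) (fun l => dx l (divg (V i)) t x)
   _ _ (divgE _ _ _) (divgE _ _ _)).
Qed.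

Variable eps : R.

(* The relative energy is the energy plus a linear combination of density,
   momentum and drift momentum, with coefficients [- massQ], [- eps * U] and [- V],
   plus [press rb]; see [rel_energy_eta]. *)
Definition massQ i : scalar_field R := fun t x =>
  gamma / (gamma - 1) * rb i t x `^ (gamma - 1)
  - 2^-1 * (eps ^+ 2 * \sum_k U i k t x * U i k t x + \sum_k V i k t x * V i k t x).

Let sUU i k : smooth_on I (fun t x => U i k t x * U i k t x).
Proof. by apply: smooth_onM; exact: ubar1_smooth. Qed.
Let sVV i k : smooth_on I (fun t x => V i k t x * V i k t x).
Proof. by apply: smooth_onM; exact: vbar_smooth. Qed.
Let sQ1 i : smooth_on I (fun t x => gamma / (gamma - 1) * rb i t x `^ (gamma - 1)).
Proof. by apply: smooth_onM; [exact: smooth_on_cst|exact: powsm]. Qed.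
Let sQ3 i : smooth_on I (fun t x => \sum_k U i k t x * U i k t x).
Proof. by apply: smooth_on_sum => k. Qed.
Let sQ4 i : smooth_on I (fun t x => \sum_k V i k t x * V i k t x).
Proof. by apply: smooth_on_sum => k. Qed.
Let sQ5 i : smooth_on I (fun t x => eps ^+ 2 * \sum_k U i k t x * U i k t x).
Proof. by apply: smooth_onM; [exact: smooth_on_cst|]. Qed.
Let sQ6 i : smooth_on I (fun t x => eps ^+ 2 * \sum_k U i k t x * U i k t x + \sum_k V i k t x * V i k t x).
Proof. exact: smooth_onD. Qed.
Let sQ2 i : smooth_on I (fun t x => 2^-1 * (eps ^+ 2 * \sum_k U i k t x * U i k t x + \sum_k V i k t x * V i k t x)).
Proof. by apply: smooth_onM; [exact: smooth_on_cst|]. Qed.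

Lemma massQ_smooth i : smooth_on I (massQ i).
Proof. exact: smooth_onB. Qed.

Lemma massQ_periodic i : periodic_on I (massQ i).
Proof.
apply: periodic_onD; last apply: periodic_onN; apply: periodic_onM; try exact: periodic_on_cst.
  by apply: (periodic_on_comp (fun r => r `^ (gamma - 1))); exact: rb_periodic.
apply: periodic_onD; first (apply: periodic_onM; first exact: periodic_on_cst).
  by apply: periodic_on_sum => k; apply: periodic_onM; exact: ubar1_periodic.
by apply: periodic_on_sum => k; apply: periodic_onM; exact: vbar_periodic.
Qed.

Hypothesis hgamma : 1 < gamma.

Lemma dx_massQ i l t x : I t -> dx l (massQ i) t x =
  gradh i l t x - eps ^+ 2 * (\sum_k U i k t x * dx l (U i k) t x)
  - \sum_k V i k t x * dx l (V i k) t x.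
Proof.
move=> It; apply: etrans (dx_sub l x (sQ1 i) (sQ2 i) It) _.
rewrite (dx_scale _ l x (powsm _ i) It) (dx_scale _ l x (sQ6 i) It).
rewrite (dx_add l x (sQ5 i) (sQ4 i) It) (dx_scale _ l x (sQ3 i) It).
rewrite (dx_sum _ l x (sUU i) It) (dx_sum _ l x (sVV i) It).
rewrite (dx_pow (gamma - 1) l x (@rb_gt0 i) (rb_smooth i) It) /gradh.
have -> : gamma - 1 - 1 = gamma - 2 by ring.
have EU : \sum_k dx l (fun t x => U i k t x * U i k t x) t x = 2 * \sum_k U i k t x * dx l (U i k) t x.
  rewrite mulr_sumr; apply: eq_bigr => k _.
  by rewrite (dx_mul l x (ubar1_smooth i k) (ubar1_smooth i k) It); ring.
have EV : \sum_k dx l (fun t x => V i k t x * V i k t x) t x = 2 * \sum_k V i k t x * dx l (V i k) t x.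
  rewrite mulr_sumr; apply: eq_bigr => k _.
  by rewrite (dx_mul l x (vbar_smooth i k) (vbar_smooth i k) It); ring.
rewrite EU EV; have g0 : gamma - 1 != 0 by rewrite subr_eq0 gt_eqF.
move: (\sum_k _) (\sum_k _) (rb i t x `^ _) (dx l (rb i) t x) => A B p d.
by field.
Qed.

Lemma dt_massQ i t x : 0 < t < T -> dt (massQ i) t x =
  gamma * rb i t x `^ (gamma - 2) * dt (rb i) t x
  - eps ^+ 2 * (\sum_k U i k t x * dt (U i k) t x)
  - \sum_k V i k t x * dt (V i k) t x.
Proof.
move=> tT; have iI := interiorI tT.
have E1 : dt (massQ i) t x = dt (fun t x => gamma / (gamma - 1) * rb i t x `^ (gamma - 1)) t x
   + dt (fun t x => - (2^-1 * (eps ^+ 2 * \sum_k U i k t x * U i k t x + \sum_k V i k t x * V i k t x))) t x.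
  exact: (dt_add x (sQ1 i) (smooth_onN (sQ2 i)) iI).
have E2 : dt (fun t x => - (2^-1 * (eps ^+ 2 * \sum_k U i k t x * U i k t x + \sum_k V i k t x * V i k t x))) t x =
   - 2^-1 * dt (fun t x => (eps ^+ 2 * \sum_k U i k t x * U i k t x + \sum_k V i k t x * V i k t x)) t x.
  rewrite -(dt_scale (- 2^-1) x (sQ6 i) iI); apply: (eq_dt (I := I)) => // t' x' _.
  by rewrite mulNr.
rewrite E1 E2 (dt_scale _ x (powsm _ i) iI).
rewrite (dt_add x (sQ5 i) (sQ4 i) iI) (dt_scale _ x (sQ3 i) iI).
rewrite (dt_sum _ x (sUU i) iI) (dt_sum _ x (sVV i) iI).
rewrite (dt_pow (gamma - 1) x (@rb_gt0 i) (rb_smooth i) iI).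
have -> : gamma - 1 - 1 = gamma - 2 by ring.
have EU : \sum_k dt (fun t x => U i k t x * U i k t x) t x = 2 * \sum_k U i k t x * dt (U i k) t x.
  rewrite mulr_sumr; apply: eq_bigr => k _.
  by rewrite (dt_mul x (ubar1_smooth i k) (ubar1_smooth i k) iI); ring.
have EV : \sum_k dt (fun t x => V i k t x * V i k t x) t x = 2 * \sum_k V i k t x * dt (V i k) t x.
  rewrite mulr_sumr; apply: eq_bigr => k _.
  by rewrite (dt_mul x (vbar_smooth i k) (vbar_smooth i k) iI); ring.
rewrite EU EV; have g0 : gamma - 1 != 0 by rewrite subr_eq0 gt_eqF.
move: (\sum_k _) (\sum_k _) (rb i t x `^ _) (dt (rb i) t x) => A B p d.
by field.
Qed.

End equilibrium_fields.
Local Transparent dx dt divg.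

(** * The weak equations tested with equilibrium fields *)

Section slab_integrals.
Context (R : realType).
Variable T : R.
Hypothesis T0 : 0 < T.
Implicit Types (f g : scalar_field R) (t : R) (x : coords R).
Local Notation OT := (`]0, T[%classic `*` @cell R : set (measurableTypeR R * mcoords R)).

Definition slab_int f : \bar R := (\int[leb4 R]_(z in OT) (f z.1 z.2)%:E)%E.

Lemma uncurryE f : EFin \o uncurry f = (fun z => (f z.1 z.2)%:E).
Proof. by apply/funext => -[]. Qed.

Lemma integrable_onP (I : set R) f : integrable_on I f <->
  (leb4 R).-integrable (I `*` @cell R) (fun z => (f z.1 z.2)%:E).
Proof. by rewrite /integrable_on uncurryE. Qed.

Lemma eq_slab f g : (forall t x, 0 < t < T -> cell x -> f t x = g t x) ->
  integrable_on `]0, T[ f -> integrable_on `]0, T[ g /\ slab_int f = slab_int g.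
Proof.
move=> fg /integrable_onP fi.
have E z : OT z -> (f z.1 z.2)%:E = (g z.1 z.2)%:E.
  by case: z => t x [/= tT cx]; rewrite fg//; move: tT; rewrite in_itv.
split; last by apply: eq_integral => z; rewrite inE => /E.
apply/integrable_onP; apply: eq_integrable fi => [|z]; first exact: measurable_OT.
by rewrite inE => /E.
Qed.

Lemma integrable_onD f g : integrable_on `]0, T[ f -> integrable_on `]0, T[ g ->
  integrable_on `]0, T[ (fun t x => f t x + g t x) /\
  slab_int (fun t x => f t x + g t x) = (slab_int f + slab_int g)%E.
Proof.
move=> /integrable_onP fi /integrable_onP gi; split.
  apply/integrable_onP; have := integrableD (@measurable_OT R T) fi gi.
  by apply: eq_integrable => [|z _]; [exact: measurable_OT|rewrite /= EFinD].
rewrite /slab_int; under eq_integral do rewrite EFinD.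
by rewrite integralD//; exact: measurable_OT.
Qed.

Lemma integrable_onZ c f : integrable_on `]0, T[ f ->
  integrable_on `]0, T[ (fun t x => c * f t x) /\
  slab_int (fun t x => c * f t x) = (c%:E * slab_int f)%E.
Proof.
move=> /integrable_onP fi; split.
  apply/integrable_onP; have := integrableZl (@measurable_OT R T) c fi.
  by apply: eq_integrable => [|z _]; [exact: measurable_OT|rewrite /= EFinM].
rewrite /slab_int; under eq_integral do rewrite EFinM.
by rewrite integralZl//; exact: measurable_OT.
Qed.

Lemma integrable_on0 : integrable_on `]0, T[ (fun _ _ => 0 : R) /\
  slab_int (fun _ _ => 0) = 0%E.
Proof.
split; first exact/integrable_onP/integrable0.
by rewrite /slab_int; exact: integral0_eq.
Qed.

Lemma integral_slabE F : (forall t x, T <= t -> F t x = 0) ->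
  (\int[leb4 R]_(z in `]0%R, +oo[%classic `*` @cell R) (F z.1 z.2)%:E)%E = slab_int F.
Proof.
move=> F0.
have sub : OT `<=` `]0%R, +oo[%classic `*` @cell R.
  by move=> [t x] [/=]; rewrite !in_itv/= => /andP[-> _].
rewrite /slab_int integral_mkcond [RHS]integral_mkcond; apply: eq_integral => -[t x] _.
rewrite /patch; case: ifPn => h1; case: ifPn => h2 //.
- move: h1 h2; rewrite inE => -[/=]; rewrite in_itv/= andbT => t0 cx.
  rewrite notin_setE => h2; rewrite F0// leNgt; apply/negP => tT.
  by apply: h2; split => //=; rewrite in_itv/= t0.
- by move: h1; rewrite notin_setE => h1; move: h2; rewrite inE => /sub.
Qed.

Lemma slab_fin_num f : integrable_on `]0, T[ f -> slab_int f \is a fin_num.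
Proof. by move=> /integrable_onP; apply: integrable_fin_num; exact: measurable_OT. Qed.

Lemma int_tx_slabE F f : integrable_on `]0, T[ f ->
  (forall t x, 0 < t < T -> cell x -> f t x = F t x) ->
  (forall t x, T <= t -> F t x = 0) -> (int_tx F)%:E = slab_int f.
Proof.
move=> fi fF F0; have [Fi ->] := eq_slab fF fi.
rewrite /int_tx /Rintegral fineK; last by rewrite integral_slabE// slab_fin_num.
exact: integral_slabE.
Qed.

Lemma int_tx_slab F f : integrable_on `]0, +oo[ F ->
  (forall t x, 0 < t < T -> cell x -> F t x = f t x) ->
  (forall t x, T <= t -> F t x = 0) ->
  integrable_on `]0, T[ f /\ (int_tx F)%:E = slab_int f.
Proof.
move=> /integrable_onP Fi Ff F0.
have FiT : integrable_on `]0, T[ F.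
  apply/integrable_onP; apply: integrableS Fi; [|exact: measurable_OT|].
    by apply: measurableX; [exact: measurable_itv|exact: measurable_cell].
  by move=> [t x] [/=]; rewrite !in_itv/= => /andP[-> _].
have [fi Ef] := eq_slab Ff FiT; split=> //.
by apply: int_tx_slabE => // t x tT cx; rewrite Ff.
Qed.

(** The common form of a tested equation. Integrability is part of it so that tested equations can
    be added and multiplied by constants freely. *)
Definition null_slab f := integrable_on `]0, T[ f /\ slab_int f = 0%E.

Lemma eq_null_slab f g : (forall t x, 0 < t < T -> cell x -> f t x = g t x) ->
  null_slab f -> null_slab g.
Proof. by move=> fg [fi f0]; have [gi E] := eq_slab fg fi; split; rewrite // -E. Qed.

Lemma null_slabD f g : null_slab f -> null_slab g -> null_slab (fun t x => f t x + g t x).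
Proof.
by move=> [fi f0] [gi g0]; have [h1 h2] := integrable_onD fi gi; split; rewrite // h2 f0 g0 adde0.
Qed.

Lemma null_slabZ c f : null_slab f -> null_slab (fun t x => c * f t x).
Proof. by move=> [fi f0]; have [h1 h2] := integrable_onZ c fi; split; rewrite // h2 f0 mule0. Qed.

Lemma null_slab_sum (J : Type) (r : seq J) (F : J -> scalar_field R) :
  (forall j, null_slab (F j)) -> null_slab (fun t x => \sum_(j <- r) F j t x).
Proof.
move=> nF; elim: r => [|j r IH].
  by apply: eq_null_slab integrable_on0 => t x _ _; rewrite big_nil.
by apply: eq_null_slab (null_slabD (nF j) IH) => t x _ _; rewrite big_cons.
Qed.

Lemma measurable_onE f : measurable_on `]0, T[ f ->
  measurable_fun OT (fun z => (f z.1 z.2)%:E).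
Proof. by move=> mf; rewrite -uncurryE; exact: measurableT_comp. Qed.

Lemma le_slab_int f g : integrable_on `]0, T[ f -> integrable_on `]0, T[ g ->
  {ae leb4 R, forall z : R * coords R, OT z -> f z.1 z.2 <= g z.1 z.2} ->
  (slab_int f <= slab_int g)%E.
Proof.
move=> fi gi fg.
have [ki kE] := integrable_onZ (-1) fi.
have [hi hE] := integrable_onD gi ki.
have mh := measurable_int (leb4 R) hi.
have fin := slab_fin_num fi; have fin' := slab_fin_num gi.
suff : (0 <= slab_int (fun t x => g t x + -1 * f t x)%R)%E.
  by rewrite hE kE -(fineK fin) -(fineK fin') -EFinM -EFinD !lee_fin; lra.
set h := fun t x => _; pose hp : scalar_field R := fun t x => Num.max (h t x) 0.
have mhp : measurable_fun OT (fun z => (hp z.1 z.2)%:E).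
  have : measurable_fun OT (fun z => maxe (h z.1 z.2)%:E 0%E).
    by apply: measurable_maxe => //; rewrite -uncurryE.
  by apply: eq_measurable_fun => z _; rewrite EFin_max.
have -> : slab_int h = slab_int hp.
  apply: ae_eq_integral => //; first exact: measurable_OT.
    by rewrite -uncurryE.
  apply: negligibleS fg => -[t x] /= H; apply/contra_not : H => H Dz.
  by rewrite /hp max_l// /h; have := H Dz; lra.
by apply: integral_ge0 => z _; rewrite lee_fin /hp le_max lexx orbT.
Qed.

End slab_integrals.

Lemma dt_cutf_out (R : realType) (T a0 b0 : R) (th : R -> R) (f : scalar_field R) t x :
  0 < a0 -> b0 < T -> (forall t, ~~ (a0 <= t <= b0) -> th t = 0) ->
  T <= t -> dt (cutf th f) t x = 0.
Proof.
move=> ha0 hb0 th0 tT; have [tT'|nt] := cutoff_cases ha0 hb0 t.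
  by move: tT' => /andP[_]; rewrite ltNge tT.
have -> : dt (cutf th f) t x = derive1 (cst 0 : R -> R) t.
  rewrite /dt !derive1E; apply: near_eq_derive.
  by near=> y; rewrite /cutf th0 ?mul0r//; near: y.
exact: derive1_cst.
Unshelve. all: by end_near. Qed.

Section weak_pieces.
Local Opaque dx dt divg.
Context (R : realType) (n : nat) (gamma s : R) (b : 'I_n -> 'I_n -> R) (M : 'I_n -> R).
Variables (T : R) (eps nu : R) (muL lamL : R -> R) (w : state R n).
Hypothesis T0 : 0 < T.
Hypothesis ws : weak_solution gamma s b M eps nu muL lamL w.
Local Notation I := `[0, T]%classic.

Variables (a0 b0 : R).
Hypotheses (ha0 : 0 < a0) (hb0 : b0 < T).
Variables (th dth : R -> R).
Hypotheses (dthE : forall t : R, is_derive t 1 th (dth t)) (cdth : continuous dth).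
Hypotheses (th0 : forall t, ~~ (a0 <= t <= b0) -> th t = 0)
           (dth0 : forall t, ~~ (a0 <= t <= b0) -> dth t = 0).

Let outT t : T <= t -> ~~ (a0 <= t <= b0).
Proof. by move=> tT; rewrite negb_and -!ltNge (lt_le_trans hb0 tT) orbT. Qed.

Let out0 : ~~ (a0 <= 0 <= b0).
Proof. by rewrite negb_and -!ltNge ha0. Qed.

Let cut_out f t x : T <= t -> cutf th f t x = 0.
Proof. by move=> tT; rewrite /cutf th0 ?mul0r// outT. Qed.

Let dt_cut_out f t x : T <= t -> dt (cutf th f) t x = 0.
Proof. exact: (dt_cutf_out f x ha0 hb0 th0). Qed.

Let dx_cut f l : smooth_on I f -> dx l (cutf th f) = cutf th (dx l f).
Proof. by move=> sf; apply: (dx_cutfE ha0 hb0 th0); exact: smooth_on_xd. Qed.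

Let divg_cut (W : vector_field R) : (forall k, smooth_on I (W k)) ->
  divg (fun k => cutf th (W k)) = cutf th (divg W).
Proof.
move=> sW; apply/funext => t; apply/funext => x; rewrite /cutf !divgE mulr_sumr.
by apply: eq_bigr => l _; rewrite dx_cut.
Qed.

Let test f : smooth_on I f -> periodic_on I f -> test_function (cutf th f).
Proof. by move=> sf pf; have [] := cutf_test ha0 hb0 dthE cdth th0 dth0 sf pf. Qed.

Let int_x0 : int_x (fun _ => 0 : R) = 0.
Proof. by rewrite /int_x /Rintegral integral0_eq. Qed.

(** The cutoff vanishes at time 0, so the initial datum drops out; it also vanishes from [T] on, so
    the half-line integral is an integral over the slab. *)
Lemma mass_piece (Q : 'I_n -> scalar_field R) :
  (forall i, smooth_on I (Q i)) -> (forall i, periodic_on I (Q i)) ->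
  null_slab T (fun t x =>
    dth t * (\sum_i rho w i t x * Q i t x)
    + th t * (\sum_i (rho w i t x * dt (Q i) t x
         + eps^-1 * \sum_k rho w i t x * vel w i k t x * dx k (Q i) t x))).
Proof.
move=> sQ pQ.
have [Fi F0] := ws_eq_mass ws (fun i => test (sQ i) (pQ i)).
set f := fun t x => dth t * _ + _.
have [||fi E] := @int_tx_slab _ T _ f Fi.
- move=> t x tT _; rewrite /f !mulr_sumr -big_split/=; apply: eq_bigr => i _.
  rewrite (dt_cutfE ha0 hb0 dthE th0 dth0 x (sQ i) tT).
  have -> : \sum_k rho w i t x * vel w i k t x * dx k (cutf th (Q i)) t x =
      th t * \sum_k rho w i t x * vel w i k t x * dx k (Q i) t x.
    by rewrite mulr_sumr; apply: eq_bigr => k _; rewrite dx_cut// /cutf mulrCA.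
  by move: (\sum_k _) => S; ring.
- move=> t x tT; apply: big1 => i _; rewrite dt_cut_out// big1 ?mulr0 ?addr0// => k _.
  by rewrite dx_cut// cut_out// mulr0.
split=> //; rewrite -E; congr EFin.
apply/eqP; rewrite -oppr_eq0 F0 -[X in _ == X]int_x0; apply/eqP; congr int_x.
by apply/funext => x; apply: big1 => i _; rewrite /cutf th0// mul0r mulr0.
Qed.

(** This and the other flux definitions are the integrands of the weak equations at a field [W] that
    is not cut off: the cutoff depends on time only and factors out of every space derivative. *)
Definition momentum_flux (W : 'I_n -> vector_field R) : scalar_field R := fun t x => \sum_i
    (\sum_k mom w i k t x * dt (W i k) t x
     + eps^-1 * (\sum_k \sum_l rho w i t x * vel w i k t x * vel w i l t x
                   * dx l (W i k) t x)
     + eps^-1 * (press gamma (rho w i t x) * divg (W i) t x)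
     + eps^-1 * (mu s (rho w i t x)
                   * \sum_k drift w i k t x * dx k (divg (W i)) t x)
     + eps^-1 * (\sum_k gradmu w i k t x
                   * \sum_l dx l (W i k) t x * drift w i l t x)
     + (2 * eps)^-1 * ((\sum_k gradlam w i k t x * drift w i k t x)
                   * divg (W i) t x)
     + (2 * eps)^-1 * (lambda s (rho w i t x)
                   * \sum_k drift w i k t x * dx k (divg (W i)) t x)).

Definition viscous_flux (W : 'I_n -> vector_field R) : scalar_field R := fun t x => \sum_i
    (2 * nu / eps * (muL (rho w i t x)
        * \sum_k \sum_l Dvel w i k l t x * symgrad (W i) k l t x)
     + nu / eps * (lamL (rho w i t x) * divu w i t x * divg (W i) t x)).

Definition friction_work (W : 'I_n -> vector_field R) : scalar_field R := fun t x =>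
    \sum_i \sum_j b i j * rho w i t x * rho w j t x
        * (\sum_k (vel w i k t x - vel w j k t x) * W i k t x)
    + \sum_i M i * (\sum_k mom w i k t x * W i k t x).

Lemma momentum_piece (W : 'I_n -> vector_field R) :
  (forall i k, smooth_on I (W i k)) -> (forall i k, periodic_on I (W i k)) ->
  null_slab T (fun t x =>
    dth t * (\sum_i \sum_k mom w i k t x * W i k t x)
    + th t * (momentum_flux W t x - viscous_flux W t x
              - (eps ^+ 2)^-1 * friction_work W t x)).
Proof.
move=> sW pW.
have [Fi Gi Hi E] := ws_eq_momentum ws (fun i k => test (sW i k) (pW i k)).
have sD i : smooth_on I (divg (W i)) by exact: smooth_on_divg.
have cD i : divg (fun k => cutf th (W i k)) = cutf th (divg (W i)) by exact: divg_cut.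
pose F t x := dth t * (\sum_i \sum_k mom w i k t x * W i k t x) + th t * momentum_flux W t x.
pose G t x := th t * viscous_flux W t x.
pose H t x := th t * friction_work W t x.
have [||{}Fi EF] := @int_tx_slab _ T _ F Fi.
- move=> t x tT _; rewrite /F /momentum_flux !mulr_sumr -big_split/=; apply: eq_bigr => i _.
  rewrite cD.
  have -> : \sum_k mom w i k t x * dt (cutf th (W i k)) t x =
     dth t * (\sum_k mom w i k t x * W i k t x) + th t * \sum_k mom w i k t x * dt (W i k) t x.
    rewrite !mulr_sumr -big_split/=; apply: eq_bigr => k _.
    by rewrite (dt_cutfE ha0 hb0 dthE th0 dth0 x (sW i k) tT); ring.
  have -> : \sum_k \sum_l rho w i t x * vel w i k t x * vel w i l t x * dx l (cutf th (W i k)) t x =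
     th t * \sum_k \sum_l rho w i t x * vel w i k t x * vel w i l t x * dx l (W i k) t x.
    rewrite mulr_sumr; apply: eq_bigr => k _; rewrite mulr_sumr; apply: eq_bigr => l _.
    by rewrite dx_cut// /cutf mulrCA.
  have -> : \sum_k drift w i k t x * dx k (cutf th (divg (W i))) t x =
     th t * \sum_k drift w i k t x * dx k (divg (W i)) t x.
    by rewrite mulr_sumr; apply: eq_bigr => k _; rewrite dx_cut// /cutf mulrCA.
  have -> : \sum_k gradmu w i k t x * \sum_l dx l (cutf th (W i k)) t x * drift w i l t x =
     th t * \sum_k gradmu w i k t x * \sum_l dx l (W i k) t x * drift w i l t x.
    rewrite mulr_sumr; apply: eq_bigr => k _; rewrite mulrCA; congr (_ * _).
    by rewrite mulr_sumr; apply: eq_bigr => l _; rewrite dx_cut// /cutf mulrA.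
  rewrite /cutf.
  move: (\sum_k _) (\sum_k _) (\sum_k _) (\sum_k _) (\sum_k _) (\sum_k _) => S1 S2 S3 S4 S5 S6.
  by ring.
- move=> t x tT; apply: big1 => i _; rewrite cD cut_out// !mulr0.
  rewrite big1 => [|k _]; last by rewrite dt_cut_out// mulr0.
  rewrite big1 => [|k _]; last by rewrite big1// => l _; rewrite dx_cut// cut_out// mulr0.
  rewrite big1 => [|k _]; last by rewrite dx_cut// cut_out// mulr0.
  rewrite big1 => [|k _]; last by rewrite big1 ?mulr0// => l _; rewrite dx_cut// cut_out// mul0r.
  by rewrite !mulr0 !addr0.
have [||{}Gi EG] := @int_tx_slab _ T _ G Gi.
- move=> t x tT _; rewrite /G /viscous_flux mulr_sumr; apply: eq_bigr => i _.
  rewrite cD.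
  have -> : \sum_k \sum_l Dvel w i k l t x * symgrad (fun k => cutf th (W i k)) k l t x =
    th t * \sum_k \sum_l Dvel w i k l t x * symgrad (W i) k l t x.
    rewrite mulr_sumr; apply: eq_bigr => k _; rewrite mulr_sumr; apply: eq_bigr => l _.
    by rewrite /symgrad !dx_cut// /cutf; ring.
  by rewrite /cutf; ring.
- move=> t x tT; apply: big1 => i _; rewrite cD cut_out// !mulr0.
  rewrite big1 => [|k _]; last first.
    by rewrite big1// => l _; rewrite /symgrad !dx_cut// !cut_out// addr0 mul0r mulr0.
  by rewrite !mulr0 addr0.
have [||{}Hi EH] := @int_tx_slab _ T _ H Hi.
- move=> t x tT _; rewrite /H /friction_work mulrDr !mulr_sumr; congr (_ + _).
    apply: eq_bigr => i _; rewrite mulr_sumr; apply: eq_bigr => j _.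
    rewrite mulrCA; congr (_ * _); rewrite mulr_sumr; apply: eq_bigr => k _.
    by rewrite /cutf mulrCA.
  apply: eq_bigr => i _; rewrite mulrCA; congr (_ * _); rewrite mulr_sumr; apply: eq_bigr => k _.
  by rewrite /cutf mulrCA.
- move=> t x tT; rewrite big1 ?add0r => [|i _]; last first.
    rewrite big1// => j _; rewrite big1 ?mulr0// => k _.
    by rewrite cut_out// mulr0.
  by rewrite big1// => i _; rewrite big1 ?mulr0// => k _; rewrite cut_out// mulr0.
have [K1 KE1] := integrable_onZ (-1) Gi.
have [K2 KE2] := integrable_onZ (- (eps ^+ 2)^-1) Hi.
have [K3 KE3] := integrable_onD Fi K1.
have [K4 KE4] := integrable_onD K3 K2.
apply: (@eq_null_slab _ _ (fun t x => F t x + -1 * G t x + - (eps ^+ 2)^-1 * H t x)).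
  by move=> t x _ _; rewrite /F /G /H; ring.
split=> //; rewrite KE4 KE3 KE2 KE1 -EF -EG -EH -!EFinM -!EFinD; congr EFin.
suff : int_x (fun x => \sum_i \sum_k mom w i k 0 x * cutf th (W i k) 0 x) = 0.
  by move=> E0; move: E; rewrite E0; move: (int_tx _) (int_tx _) (int_tx _) => x y z; lra.
rewrite -[RHS]int_x0; congr int_x; apply/funext => x; apply: big1 => i _; apply: big1 => k _.
by rewrite /cutf th0// mul0r mulr0.
Qed.

Definition drift_flux (W : 'I_n -> vector_field R) : scalar_field R := fun t x => \sum_i
    (\sum_k dmom w i k t x * dt (W i k) t x
     + eps^-1 * (\sum_k \sum_l rho w i t x * drift w i k t x * vel w i l t x
                   * dx l (W i k) t x)).

Definition korteweg_flux (W : 'I_n -> vector_field R) : scalar_field R := fun t x => \sum_i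
    (mu s (rho w i t x) * (\sum_k vel w i k t x * dx k (divg (W i)) t x)
     + \sum_k gradmu w i k t x * (\sum_l dx l (W i k) t x * vel w i l t x)
     + 2^-1 * ((\sum_k gradlam w i k t x * vel w i k t x) * divg (W i) t x)
     + 2^-1 * (lambda s (rho w i t x)
                 * \sum_k vel w i k t x * dx k (divg (W i)) t x)).

Lemma drift_piece (W : 'I_n -> vector_field R) :
  (forall i k, smooth_on I (W i k)) -> (forall i k, periodic_on I (W i k)) ->
  null_slab T (fun t x =>
    dth t * (\sum_i \sum_k dmom w i k t x * W i k t x)
    + th t * (drift_flux W t x - eps^-1 * korteweg_flux W t x)).
Proof.
move=> sW pW.
have [Fi Gi E] := ws_eq_drift ws (fun i k => test (sW i k) (pW i k)).
have sD i : smooth_on I (divg (W i)) by exact: smooth_on_divg.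
have cD i : divg (fun k => cutf th (W i k)) = cutf th (divg (W i)) by exact: divg_cut.
pose F t x := dth t * (\sum_i \sum_k dmom w i k t x * W i k t x) + th t * drift_flux W t x.
pose G t x := th t * korteweg_flux W t x.
have [||{}Fi EF] := @int_tx_slab _ T _ F Fi.
- move=> t x tT _; rewrite /F /drift_flux !mulr_sumr -big_split/=; apply: eq_bigr => i _.
  have -> : \sum_k dmom w i k t x * dt (cutf th (W i k)) t x =
     dth t * (\sum_k dmom w i k t x * W i k t x) + th t * \sum_k dmom w i k t x * dt (W i k) t x.
    rewrite !mulr_sumr -big_split/=; apply: eq_bigr => k _.
    by rewrite (dt_cutfE ha0 hb0 dthE th0 dth0 x (sW i k) tT); ring.
  have -> : \sum_k \sum_l rho w i t x * drift w i k t x * vel w i l t x * dx l (cutf th (W i k)) t x =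
     th t * \sum_k \sum_l rho w i t x * drift w i k t x * vel w i l t x * dx l (W i k) t x.
    rewrite mulr_sumr; apply: eq_bigr => k _; rewrite mulr_sumr; apply: eq_bigr => l _.
    by rewrite dx_cut// /cutf mulrCA.
  by ring.
- move=> t x tT; apply: big1 => i _.
  rewrite big1 => [|k _]; last by rewrite dt_cut_out// mulr0.
  rewrite big1 => [|k _]; last by rewrite big1// => l _; rewrite dx_cut// cut_out// mulr0.
  by rewrite !mulr0 !addr0.
have [||{}Gi EG] := @int_tx_slab _ T _ G Gi.
- move=> t x tT _; rewrite /G /korteweg_flux mulr_sumr; apply: eq_bigr => i _.
  rewrite cD.
  have -> : \sum_k vel w i k t x * dx k (cutf th (divg (W i))) t x =
     th t * \sum_k vel w i k t x * dx k (divg (W i)) t x.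
    by rewrite mulr_sumr; apply: eq_bigr => k _; rewrite dx_cut// /cutf mulrCA.
  have -> : \sum_k gradmu w i k t x * \sum_l dx l (cutf th (W i k)) t x * vel w i l t x =
     th t * \sum_k gradmu w i k t x * \sum_l dx l (W i k) t x * vel w i l t x.
    rewrite mulr_sumr; apply: eq_bigr => k _; rewrite mulrCA; congr (_ * _).
    by rewrite mulr_sumr; apply: eq_bigr => l _; rewrite dx_cut// /cutf mulrA.
  rewrite /cutf.
  by ring.
- move=> t x tT; apply: big1 => i _; rewrite cD cut_out// !mulr0.
  rewrite big1 => [|k _]; last by rewrite dx_cut// cut_out// mulr0.
  rewrite big1 => [|k _]; last by rewrite big1 ?mulr0// => l _; rewrite dx_cut// cut_out// mul0r.
  by rewrite !mulr0 !addr0.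
have [K1 KE1] := integrable_onZ (- eps^-1) Gi.
have [K2 KE2] := integrable_onD Fi K1.
apply: (@eq_null_slab _ _ (fun t x => F t x + - eps^-1 * G t x)).
  by move=> t x _ _; rewrite /F /G; ring.
split=> //; rewrite KE2 KE1 -EF -EG -!EFinM -!EFinD; congr EFin.
suff : int_x (fun x => \sum_i \sum_k dmom w i k 0 x * cutf th (W i k) 0 x) = 0.
  by move=> E0; move: E; rewrite E0; move: (int_tx _) (int_tx _) => x y; lra.
rewrite -[RHS]int_x0; congr int_x; apply/funext => x; apply: big1 => i _; apply: big1 => k _.
by rewrite /cutf th0// mul0r mulr0.
Qed.

End weak_pieces.
Local Transparent dx dt divg.

Lemma ae_sub d (X : measurableType d) (R : realType) (m : {measure set X -> \bar R})
  (P Q : X -> Prop) : {ae m, forall x, P x} -> (forall x, P x -> Q x) ->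
  {ae m, forall x, Q x}.
Proof. by move=> mP PQ; apply: negligibleS mP => x /=; exact/contra_not/PQ. Qed.

Section measurable_fields.
Context (R : realType).
Implicit Types (I : set R) (f g : scalar_field R) (t : R) (x : coords R).

Lemma eq_measurable_on I f g : (forall t x, I t -> cell x -> f t x = g t x) ->
  measurable_on I f -> measurable_on I g.
Proof.
move=> fg; apply: eq_measurable_fun => -[t x]; rewrite inE => -[/= It cx].
exact: fg.
Qed.

Lemma measurable_onS I J f : measurable (I : set (measurableTypeR R)) ->
  J `<=` I -> measurable_on I f -> measurable_on J f.
Proof.
move=> mI JI; apply: measurable_funS; last by move=> [t x] [/= /JI].
by apply: measurableX => //; exact: measurable_cell.
Qed.

Lemma measurable_onD I f g : measurable_on I f -> measurable_on I g ->
  measurable_on I (fun t x => f t x + g t x).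
Proof.
move=> mf mg; have := measurable_funD mf mg.
by apply: eq_measurable_fun => -[t x] _.
Qed.

Lemma measurable_onM I f g : measurable_on I f -> measurable_on I g ->
  measurable_on I (fun t x => f t x * g t x).
Proof.
move=> mf mg; have := measurable_funM mf mg.
by apply: eq_measurable_fun => -[t x] _.
Qed.

Lemma measurable_on_cst I (c : R) : measurable_on I (fun _ _ => c).
Proof.
have := @measurable_cst _ _ (measurableTypeR R * mcoords R)%type R (I `*` @cell R) c.
by apply: eq_measurable_fun => -[t x] _.
Qed.

Lemma measurable_on_comp I (h : R -> R) f : measurable_fun setT h ->
  measurable_on I f -> measurable_on I (fun t x => h (f t x)).
Proof.
move=> mh mf; have := measurableT_comp mh mf.
by apply: eq_measurable_fun => -[t x] _.
Qed.

Lemma measurable_on_sum I (J : Type) (r : seq J) (F : J -> scalar_field R) :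
  (forall j, measurable_on I (F j)) -> measurable_on I (fun t x => \sum_(j <- r) F j t x).
Proof.
move=> mF; elim: r => [|j r IH].
  apply: (@eq_measurable_on I (fun _ _ => 0)); last exact: measurable_on_cst.
  by move=> t x _ _; rewrite big_nil.
apply: (@eq_measurable_on I (fun t x => F j t x + \sum_(j0 <- r) F j0 t x)).
  by move=> t x _ _; rewrite big_cons.
exact: measurable_onD.
Qed.

Lemma measurable_on_time I (h : R -> R) : continuous h -> measurable_on I (fun t _ => h t).
Proof.
move=> ch; have m1 : measurable_fun setT (h \o (fst : measurableTypeR R * mcoords R -> R)).
  by apply: measurableT_comp; [exact: continuous_measurable_fun|exact: measurable_fst].
have := measurable_funS measurableT (@subsetT _ (I `*` @cell R)) m1.
by apply: eq_measurable_fun => -[t x] _.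
Qed.

End measurable_fields.

Section slab_more.
Context (R : realType).
Variable T : R.
Hypothesis T0 : 0 < T.
Implicit Types (f g : scalar_field R) (t : R) (x : coords R).
Local Notation OT := (`]0, T[%classic `*` @cell R : set (measurableTypeR R * mcoords R)).

Lemma eq_integrable_on f g : (forall t x, 0 < t < T -> cell x -> f t x = g t x) ->
  integrable_on `]0, T[ f -> integrable_on `]0, T[ g.
Proof. by move=> fg fi; have [] := eq_slab fg fi. Qed.

Lemma continuous_onS (I J : set R) f : J `<=` I -> continuous_on I f -> continuous_on J f.
Proof. by move=> JI; apply: continuous_subspaceW => -[t x] [/= /JI]. Qed.

Lemma integrable_on_bounded f g C : measurable_on `]0, T[ f ->
  (forall t x, 0 < t < T -> cell x -> `|f t x| <= C) ->
  integrable_on `]0, T[ g -> integrable_on `]0, T[ (fun t x => f t x * g t x).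
Proof.
move=> mf fC /integrable_onP gi; apply/integrable_onP.
have bf : [bounded uncurry f z | z in OT].
  by apply: (@bounded_on_le _ _ _ _ C) => -[t x] [/=]; rewrite in_itv/=; exact: fC.
have := integrableMr (measurable_OT T) mf bf gi.
by apply: eq_integrable => [|[t x] _]; [exact: measurable_OT|rewrite /= EFinM].
Qed.

Lemma integrable_on_continuous_mul f g : continuous_on `[0, T] f ->
  integrable_on `]0, T[ g -> integrable_on `]0, T[ (fun t x => f t x * g t x).
Proof.
move=> cf gi; have [C _ fC] := continuous_on_bounded cf.
apply: (integrable_on_bounded (C := C)) gi; first exact: continuous_on_measurable_OT.
by move=> t x /andP[t0 tT] cx; apply: fC => //; rewrite !ltW.
Qed.

Lemma integrable_on_sum (J : Type) (r : seq J) (F : J -> scalar_field R) :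
  (forall j, integrable_on `]0, T[ (F j)) ->
  integrable_on `]0, T[ (fun t x => \sum_(j <- r) F j t x).
Proof.
move=> iF; elim: r => [|j r IH].
  apply: (@eq_integrable_on (fun _ _ => 0)); last by have [] := integrable_on0 T.
  by move=> t x _ _; rewrite big_nil.
apply: (@eq_integrable_on (fun t x => F j t x + \sum_(j0 <- r) F j0 t x)).
  by move=> t x _ _; rewrite big_cons.
by have [] := integrable_onD (iF j) IH.
Qed.

Lemma integrable_on_ge0 f : measurable_on `]0, T[ f ->
  {ae leb4 R, forall z : R * coords R, OT z -> 0 <= f z.1 z.2} ->
  (slab_int T f < +oo)%E -> integrable_on `]0, T[ f.
Proof.
move=> mf f0 foo; apply/integrable_onP; apply/integrableP; split; first exact: measurable_onE.
suff -> : (\int[leb4 R]_(z in OT) `|(f z.1 z.2)%:E|)%E = slab_int T f by [].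
apply: ae_eq_integral; first exact: measurable_OT.
- by apply: measurableT_comp => //; exact: measurable_onE.
- exact: measurable_onE.
- apply: negligibleS f0 => -[t x] /= H; apply/contra_not : H => H Dz.
  by rewrite ger0_norm//; exact: H.
Qed.

Lemma slab_int_ge0 f : measurable_on `]0, T[ f ->
  {ae leb4 R, forall z : R * coords R, OT z -> 0 <= f z.1 z.2} ->
  (0 <= slab_int T f)%E.
Proof.
move=> mf f0.
have -> : slab_int T f = slab_int T (fun t x => `|f t x|).
  apply: ae_eq_integral; first exact: measurable_OT.
  - exact: measurable_onE.
  - by apply: (measurable_onE (f := fun t x => `|f t x|)); apply: measurable_on_comp.
  - apply: negligibleS f0 => -[t x] /= H; apply/contra_not : H => H Dz.
    by rewrite ger0_norm//; exact: H.
by apply: integral_ge0 => z _; rewrite lee_fin.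
Qed.

End slab_more.

(** * Gradients of mu(rho) and lambda(rho) *)

Section gradient_pieces.
Context (R : realType) (n : nat) (gamma s : R) (b : 'I_n -> 'I_n -> R) (M : 'I_n -> R).
Variables (T : R) (eps nu : R) (muL lamL : R -> R) (w : state R n).
Hypothesis T0 : 0 < T.
Hypothesis ws : weak_solution gamma s b M eps nu muL lamL w.
Local Notation I := `[0, T]%classic.
Local Notation OT := (`]0, T[%classic `*` @cell R : set (measurableTypeR R * mcoords R)).
Variables (kst N : R).
Hypothesis k0 : 0 < kst.
Hypothesis bnd : forall i, {ae @leb4 R, forall z : R * coords R,
            0 < z.1 < T -> cell z.2 -> kst <= rho w i z.1 z.2 <= N}.

Lemma weak_dx_slab f g l (xi : scalar_field R) : weak_dx l f g ->
  interior_test_function xi -> (forall t x, T <= t -> xi t x = 0) ->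
  null_slab T (fun t x => g t x * xi t x + f t x * dx l xi t x).
Proof.
move=> [/(_ T T0)[fi gi] h] xit xi0.
have [[_ [cxi _] /(_ l)[_ cdxi] _ _] _] := xit.
have sub : `[0, T]%classic `<=` `[0, +oo[%classic by move=> t /=; rewrite !in_itv/= => /andP[->].
have c1 := continuous_onS sub cxi; have c2 := continuous_onS sub cdxi.
have i1 := integrable_on_continuous_mul c1 gi.
have i2 := integrable_on_continuous_mul c2 fi.
have z1 t x : T <= t -> g t x * xi t x = 0 by move=> /xi0 ->; rewrite mulr0.
have z2 t x : T <= t -> f t x * dx l xi t x = 0.
  move=> tT; have -> : dx l xi t x = 0; last by rewrite mulr0.
  rewrite /dx (_ : xi t = cst 0); last by apply/funext => y; exact: xi0.
  exact: derive_cst.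
have e1 := int_tx_slabE i1 (fun t x _ _ => mulrC _ _) z1.
have e2 := int_tx_slabE i2 (fun t x _ _ => mulrC _ _) z2.
have [i3 e3] := integrable_onD i1 i2.
apply: (@eq_null_slab _ _ (fun t x => xi t x * g t x + dx l xi t x * f t x)).
  by move=> t x _ _; rewrite mulrC [f t x * _]mulrC.
by split=> //; rewrite e3 -e1 -e2 h// -EFinD addNr.
Qed.

(** The distributional identity that defines [gradmu], tested with a vector field. Its use is with
    [crossY], where it supplies the cancellation between the momentum and drift equations. *)
Lemma gradmu_piece i (W : vector_field R) a0 b0 (th dth : R -> R) :
  0 < a0 -> b0 < T ->
  (forall t : R, is_derive t 1 th (dth t)) -> continuous dth ->
  (forall t, ~~ (a0 <= t <= b0) -> th t = 0) ->
  (forall t, ~~ (a0 <= t <= b0) -> dth t = 0) ->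
  (forall k, smooth_on I (W k)) -> (forall k, periodic_on I (W k)) ->
  null_slab T (fun t x => th t * (\sum_k gradmu w i k t x * W k t x
     + mu s (rho w i t x) * divg W t x)).
Proof.
move=> ha0 hb0 dthE cdth th0 dth0 sW pW.
have test k := cutf_test ha0 hb0 dthE cdth th0 dth0 (sW k) (pW k).
have out k t x : T <= t -> cutf th (W k) t x = 0.
  by move=> tT; rewrite /cutf th0 ?mul0r// negb_and -!ltNge (lt_le_trans hb0 tT) orbT.
have := null_slab_sum (index_enum 'I_3) (fun k => weak_dx_slab (ws_gmu ws i k) (test k) (@out k)).
apply: eq_null_slab => t x _ _.
rewrite mulrDr /divg !mulr_sumr -big_split/=; apply: eq_bigr => k _.
rewrite (dx_cutfE ha0 hb0 th0); last exact: smooth_on_xd.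
by rewrite /cutf; ring.
Qed.

Lemma bounds_all_species : {ae @leb4 R, forall z : R * coords R,
  OT z -> forall i, kst <= rho w i z.1 z.2 <= N}.
Proof.
(* The exceptional sets of the species are united over all naturals; an index that names no species
   contributes the empty set. *)
have := negligible_bigcup (fun k : nat => _ : (leb4 R).-negligible
  (if insub k is Some i then ~` [set z : R * coords R | 0 < z.1 < T -> cell z.2 -> kst <= rho w i z.1 z.2 <= N] else set0)).
have H (k : nat) : (leb4 R).-negligible
  (if insub k is Some i then ~` [set z : R * coords R | 0 < z.1 < T -> cell z.2 -> kst <= rho w i z.1 z.2 <= N] else set0).
  by case: (insub k) => [i|]; [exact: bnd|exact: negligible_set0].
move=> /(_ H); apply: negligibleS => -[t x]/= /not_implyP[[/= tT cx] /existsNP[i hi]].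
exists (val i) => //; rewrite valK; apply/not_implyP; split; first by move: tT; rewrite in_itv.
by apply/not_implyP.
Qed.

(** The weak formulation treats [gradlam] and [gradmu] as separate fields. Where the density is
    positive lambda is (s + 1) mu, so the combination of both gradients annihilates every test
    function, and the fundamental lemma makes the relation pointwise. *)
Lemma gradlam_ae i k : {ae @leb4 R, forall z : R * coords R,
  OT z -> gradlam w i k z.1 z.2 = (s + 1) * gradmu w i k z.1 z.2}.
Proof.
have [/(_ T T0)[mi gmi] _] := ws_gmu ws i k.
have [/(_ T T0)[li gli] _] := ws_glam ws i k.
have [zi _] := integrable_onZ (- (s + 1)) gmi.
have [gi _] := integrable_onD gli zi.
suff FL xi : interior_test_function xi -> (forall t x, T <= t -> xi t x = 0) ->
    (\int[leb4 R]_(z in OT) ((gradlam w i k z.1 z.2 + - (s + 1) * gradmu w i k z.1 z.2)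
       * xi z.1 z.2)%:E = 0)%E.
  apply: negligibleS (fundamental_lemma T0 gi FL) => -[t x] /= H; apply/contra_not : H => H Dz.
  by have [] := H Dz; lra.
move=> xit xi0.
have [i1 n1] := weak_dx_slab (ws_gmu ws i k) xit xi0.
have [i2 n2] := weak_dx_slab (ws_glam ws i k) xit xi0.
have [i3 n3] := integrable_onZ (- (s + 1)) i1.
have [i4 n4] := integrable_onD i2 i3.
have [[_ [cxi _] _ _ _] _] := xit.
have sub : `[0, T]%classic `<=` `[0, +oo[%classic by move=> t /=; rewrite !in_itv/= => /andP[->].
have i5 := integrable_on_continuous_mul (continuous_onS sub cxi) gi.
have n40 : slab_int T (fun t x => gradlam w i k t x * xi t x + lambda s (rho w i t x) * dx k xi t x +
   - (s + 1) * (gradmu w i k t x * xi t x + mu s (rho w i t x) * dx k xi t x)) = 0%E.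
  by rewrite n4 n2 n3 n1 mule0 adde0.
rewrite -n40; apply: etrans (_ : slab_int T (fun t x => xi t x * (gradlam w i k t x + - (s + 1) * gradmu w i k t x)) = _).
  by apply: eq_integral => z _; rewrite mulrC.
have E : {ae @leb4 R, forall z : R * coords R, OT z ->
   xi z.1 z.2 * (gradlam w i k z.1 z.2 + - (s + 1) * gradmu w i k z.1 z.2) =
   gradlam w i k z.1 z.2 * xi z.1 z.2 + lambda s (rho w i z.1 z.2) * dx k xi z.1 z.2 +
   - (s + 1) * (gradmu w i k z.1 z.2 * xi z.1 z.2 + mu s (rho w i z.1 z.2) * dx k xi z.1 z.2)}.
  apply: negligibleS bounds_all_species => -[t x] /= H; apply/contra_not : H => H Dz.
  have /andP[kr _] := H Dz i.
  by rewrite lambdaE ?(lt_le_trans k0 kr)//; ring.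
apply/eqP; rewrite eq_le !le_slab_int//.
- by apply: negligibleS E => -[t x] /= H; apply/contra_not : H => H Dz; rewrite H.
- by apply: negligibleS E => -[t x] /= H; apply/contra_not : H => H Dz; rewrite H.
Qed.

End gradient_pieces.

(** * The energy inequality with a cutoff *)

Section dissipation.
Context (R : realType) (n : nat) (gamma s : R) (b : 'I_n -> 'I_n -> R) (M : 'I_n -> R).
Variables (T : R) (eps nu : R) (muL lamL : R -> R) (w : state R n).
Hypothesis T0 : 0 < T.
Hypotheses (hgamma : 1 < gamma) (hM : forall i, 0 <= M i) (fc : friction_condition b M).
Hypotheses (eps0 : 0 < eps) (nu0 : 0 <= nu) (lame : lame_condition muL lamL).
Hypothesis ws : weak_solution gamma s b M eps nu muL lamL w.
Hypothesis ds : dissipative gamma b M eps nu muL lamL w.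
Variable K : R.
Hypothesis hK : mass_energy_le gamma T K w.
Hypotheses (mmuL : forall i, measurable_on `]0, T[ (fun t x => muL (rho w i t x)))
  (mlamL : forall i, measurable_on `]0, T[ (fun t x => lamL (rho w i t x))).
Local Notation OT := (`]0, T[%classic `*` @cell R : set (measurableTypeR R * mcoords R)).
Variables (kst N : R).
Hypothesis k0 : 0 < kst.
Hypothesis bnd : forall i, {ae @leb4 R, forall z : R * coords R,
            0 < z.1 < T -> cell z.2 -> kst <= rho w i z.1 z.2 <= N}.

Variables (a0 b0 : R).
Hypotheses (ha0 : 0 < a0) (hb0 : b0 < T).
Variables (th dth : R -> R).
Hypotheses (dthE : forall t : R, is_derive t 1 th (dth t)) (cdth : continuous dth).
Hypotheses (th0 : forall t, ~~ (a0 <= t <= b0) -> th t = 0)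
           (dth0 : forall t, ~~ (a0 <= t <= b0) -> dth t = 0).
Hypothesis th_ge0 : forall t, 0 <= th t.

Let cut_time (h : R -> R) : continuous h -> continuous_on `[0, T] (fun t _ => h t).
Proof.
move=> ch; apply: continuous_continuous_on.
have -> : uncurry (fun t (_ : coords R) => h t) = h \o fst by apply/funext => -[].
by move=> z; apply: (@continuous_comp _ _ _ fst h z); [exact: cvg_fst|exact: ch].
Qed.

Let cell0 : cell (0, 0, 0 : R).
Proof. by rewrite /cell/=; split; [split|]; rewrite /= in_itv/= lexx ltr01. Qed.

Lemma cutoff_bounded (h : R -> R) : continuous h ->
  (forall t, ~~ (a0 <= t <= b0) -> h t = 0) ->
  exists L, forall t, `|h t| <= L.
Proof.
move=> ch h0; have [C C0 hC] := continuous_on_bounded (cut_time ch).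
exists C => t; have [tT|nt] := boolP (a0 <= t <= b0); last by rewrite h0// normr0 ltW.
apply: (hC t _ _ cell0); move: tT => /andP[h1 h2].
by rewrite (le_trans (ltW ha0) h1) (le_trans h2 (ltW hb0)).
Qed.

(** The weak derivative is identified by integrating the derivative of [th * zeta] up to a time [B]
    beyond which [th] vanishes. *)
Lemma W1inf_cutoff : W1inf th dth.
Proof.
have th_continuous' := th_continuous dthE.
split.
- exact: continuous_subspaceT.
- by have [L hL] := cutoff_bounded th_continuous' th0; exists L.
- by apply: measurable_funTS; exact: continuous_measurable_fun.
- by have [L hL] := cutoff_bounded cdth dth0; exists L; apply: nearW.
move=> zeta dz cz [a [c [a1 z0]]].
pose B := Num.max T (c + 1).
have TB : T <= B by rewrite le_max lexx.
have cB : c < B by rewrite lt_max [c < c + 1]ltrDl ltr01 orbT.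
have B0 : 0 < B := lt_le_trans T0 TB.
have dzE (t : R) : is_derive t 1 zeta (derive1 zeta t).
  by rewrite derive1E; split => //; exact: dz.
have czeta : continuous zeta by move=> t; apply/differentiable_continuous/derivable1_diffP.
have d1 (t : R) : is_derive t 1 (fun t => th t * zeta t) (dth t * zeta t + th t * derive1 zeta t).
  have := @is_deriveM _ _ _ _ t 1 _ _ (dthE t) (dzE t).
  by move=> h; apply: is_derive_eq h _; rewrite addrC; congr (_ + _); rewrite mulrC.
have c1 : continuous (fun t => dth t * zeta t) by move=> t; apply: cvgM; [exact: cdth|exact: czeta].
have c2 : continuous (fun t => th t * derive1 zeta t) by move=> t; apply: cvgM; [exact: th_continuous'|exact: cz].
have c12 : continuous (fun t => dth t * zeta t + th t * derive1 zeta t).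
  by move=> t; apply: cvgD; [exact: c1|exact: c2].
have out t : B <= t -> th t = 0 /\ dth t = 0.
  move=> tB; have nt : ~~ (a0 <= t <= b0).
    by rewrite negb_and -!ltNge (lt_le_trans hb0 (le_trans TB tB)) orbT.
  by rewrite th0// dth0.
have E (h : R -> R) : (forall t, B <= t -> h t = 0) ->
   (\int[lebesgue_measure]_(t in `]0%R, +oo[) (h t)%:E = \int[lebesgue_measure]_(t in `]0%R, B[) (h t)%:E)%E.
  move=> h0; rewrite integral_mkcond [RHS]integral_mkcond; apply: eq_integral => t _.
  rewrite /patch !mem_setE !in_itv/= andbT; case: (ltP 0 t) => //= t0.
  by case: (ltP t B) => // /h0 ->.
have ci (h : R -> R) : continuous h -> lebesgue_measure.-integrable `]0%R, B[ (fun t => (h t)%:E).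
  move=> ch; have : lebesgue_measure.-integrable `[0%R, B] (EFin \o h).
    by apply: continuous_compact_integrable; [exact: segment_compact|exact: continuous_subspaceT].
  by apply: integrableS; [exact: measurable_itv|exact: measurable_itv|exact: subset_itv_oo_cc].
rewrite /Rintegral -fineN; congr fine; rewrite !E; first last.
- by move=> t /out[_ ->]; rewrite mul0r.
- by move=> t /out[-> _]; rewrite mul0r.
have mB : measurable (`]0%R, B[%classic : set (measurableTypeR R)) by exact: measurable_itv.
have f1 := integrable_fin_num mB (ci _ c1).
have f2 := integrable_fin_num mB (ci _ c2).
have := ftc_itvoo B0 c12 d1.
rewrite th0; last by rewrite negb_and -!ltNge (lt_le_trans hb0 TB) orbT.
rewrite th0; last by rewrite negb_and -!ltNge ha0.
rewrite !mul0r subrr; under eq_integral do rewrite EFinD.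
rewrite (integralD mB (ci _ c1) (ci _ c2)).
by rewrite -(fineK f1) -(fineK f2) -EFinD => -[/eqP]; rewrite addr_eq0 => /eqP ->.
Qed.

Let sub0oo : `]0, T[%classic `<=` `[0, +oo[%classic.
Proof. by move=> t /=; rewrite !in_itv/= => /andP[/ltW ->]. Qed.

Lemma state_measurable i : measurable_on `]0, T[ (rho w i) /\
  forall k, [/\ measurable_on `]0, T[ (vel w i k), measurable_on `]0, T[ (drift w i k) &
      forall l, measurable_on `]0, T[ (Dvel w i k l)].
Proof.
have [h1 h2] := ws_measurable ws i.
have H f : measurable_on `[0, +oo[ f -> measurable_on `]0, T[ f.
  by apply: measurable_onS => //; exact: measurable_itv.
split=> [|k]; first exact: H.
by have [h3 h4 h5] := h2 k; split=> [||l]; exact: H.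
Qed.

Lemma measurable_henergy : measurable_fun setT (henergy gamma).
Proof. by apply: measurable_funM => //; exact: measurable_powR. Qed.

Lemma eta_stateE t x : eta_state gamma w t x =
  \sum_i (2^-1 * (rho w i t x * \sum_k vel w i k t x * vel w i k t x)
    + 2^-1 * (rho w i t x * \sum_k drift w i k t x * drift w i k t x)
    + henergy gamma (rho w i t x)).
Proof.
apply: eq_bigr => i _; rewrite /sqn /mom /dmom.
have E (u : 'I_3 -> R) r : (\sum_k (r * u k) ^+ 2) / r = r * \sum_k u k * u k.
  have [->|r0] := eqVneq r 0; first by rewrite invr0 mulr0 mul0r.
  rewrite mulr_suml mulr_sumr; apply: eq_bigr => k _.
  by field.
by rewrite !E.
Qed.

Lemma measurable_eta : measurable_on `]0, T[ (eta_state gamma w).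
Proof.
have E t x : `]0, T[%classic t -> cell x -> _ = eta_state gamma w t x := fun _ _ => esym (eta_stateE t x).
apply: eq_measurable_on E _; apply: measurable_on_sum => i.
have [h1 h2] := state_measurable i.
have sq (u : 'I_3 -> scalar_field R) : (forall k, measurable_on `]0, T[ (u k)) ->
  measurable_on `]0, T[ (fun t x => 2^-1 * (rho w i t x * \sum_k u k t x * u k t x)).
  move=> mu; apply: measurable_onM; first exact: measurable_on_cst.
  by apply: measurable_onM => //; apply: measurable_on_sum => k; exact: measurable_onM.
apply: measurable_onD; last exact: (measurable_on_comp measurable_henergy).
by apply: measurable_onD; apply: sq => k; have [] := h2 k.
Qed.

Lemma C0_Lp1_integrable f t : C0_Lp 1 f -> 0 <= t ->
  (leb3 R).-integrable (@cell R) (fun x => (f t x)%:E).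
Proof.
move=> /(_ t) h t0; have [mf foo _] := h t0; apply/integrableP; split.
  exact: measurableT_comp.
move: foo; rewrite /Lp_norm Lnorm1; congr (_ < _)%E.
rewrite [RHS]integral_mkcond; apply: eq_integral => x _.
rewrite /patch /= indicE; case: (x \in _); first by rewrite mulr1.
by rewrite mulr0 normr0.
Qed.

Let henergy_ge0 r : 0 <= henergy gamma r.
Proof. by apply: divr_ge0; [exact: powR_ge0|rewrite subr_ge0 ltW]. Qed.

Lemma eta_ge0 t x : (forall i, 0 <= rho w i t x) -> 0 <= eta_state gamma w t x.
Proof.
move=> r0; rewrite eta_stateE; apply: sumr_ge0 => i _.
have sq (u : 'I_3 -> R) : 0 <= \sum_k u k * u k by apply: sumr_ge0 => k _; rewrite -expr2 sqr_ge0.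
by apply: addr_ge0 => //; apply: addr_ge0; apply: mulr_ge0 => //; apply: mulr_ge0.
Qed.

Lemma ae_time (P : R * coords R -> Prop) : {ae @leb4 R, forall z : R * coords R, OT z -> P z} ->
  {ae lebesgue_measure, forall t : R, 0 < t < T ->
    {ae leb3 R, forall x : coords R, cell x -> P (t, x)}}.
Proof.
move=> h; have := @ae_prodm _ _ _ _ _ lebesgue_measure (leb3 R) _ h.
move=> /ae_sub; apply => t ht t0T; apply: ae_sub ht _ => x hx cx.
by apply: hx; split => //=; rewrite in_itv.
Qed.

(** The energy bound controls almost every time slice, where the energy density is nonnegative, and
    Tonelli turns this into a bound over the slab. *)
Lemma eta_integrable : integrable_on `]0, T[ (eta_state gamma w).
Proof.
have m1 := measurable_onE measurable_eta.
apply/integrable_onP/integrableP; split=> //.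
have mI : measurable (`]0, T[%classic : set (measurableTypeR R)) by exact: measurable_itv.
(* The comparison needs a nonnegative constant, and no sign of [K] is at hand in this section. *)
pose K' : R := Num.max 0 K.
apply: (@le_lt_trans _ _ (\int[lebesgue_measure]_(t in `]0%R, T[) K'%:E)%E).
  have mabs : measurable_fun OT (fun z => `|(eta_state gamma w z.1 z.2)%:E|%E) by exact: measurableT_comp.
  apply: (@tonelli_rect_le _ _ _ _ R lebesgue_measure (leb3 R) _ _ mI (@measurable_cell R) _ _ mabs) => //.
    by rewrite lee_fin le_max lexx.
  apply: ae_sub (ae_time (bounds_all_species bnd)) _ => t ht.
  rewrite /= in_itv/= => tT; have {}ht := ht tT.
  have ei : (leb3 R).-integrable (@cell R) (fun x => (eta_state gamma w t x)%:E).
    by apply: C0_Lp1_integrable; [case: ds|case/andP: tT => /ltW].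
  have -> : (\int[leb3 R]_(x in @cell R) `|(eta_state gamma w t x)%:E| =
    \int[leb3 R]_(x in @cell R) (eta_state gamma w t x)%:E)%E.
    have me := measurable_int _ ei.
    apply: ae_eq_integral => //; [exact: measurable_cell|exact: measurableT_comp|].
    apply: ae_sub ht _ => x hx cx; rewrite gee0_abs// lee_fin eta_ge0// => i.
    by have /andP[/(le_trans (ltW k0))] := hx cx i.
  have := (hK tT).2; rewrite /Sigma_tot /int_x /Rintegral => hS.
  rewrite -(fineK (integrable_fin_num (@measurable_cell R) ei)) lee_fin.
  by rewrite le_max hS orbT.
rewrite integral_cst//= lebesgue_measure_itv/= lte_fin T0 oppr0 adde0 -EFinM.
exact: ltry.
Qed.

Definition viscous_diss : scalar_field R := fun t x => \sum_i
  (2 * muL (rho w i t x) * (\sum_k \sum_l Dvel w i k l t x ^+ 2)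
   + lamL (rho w i t x) * divu w i t x ^+ 2).
Definition friction_diss : scalar_field R := fun t x => \sum_i \sum_j
  b i j * rho w i t x * rho w j t x * sqn (fun k => vel w i k t x - vel w j k t x).
Definition damping_diss : scalar_field R := fun t x => \sum_i
  M i * rho w i t x * sqn (fun k => vel w i k t x).

Let measurable_sqn (f : 'I_3 -> scalar_field R) : (forall k, measurable_on `]0, T[ (f k)) ->
  measurable_on `]0, T[ (fun t x => sqn (fun k => f k t x)).
Proof.
move=> mf; apply: measurable_on_sum => k.
by apply: (measurable_on_comp (h := fun r => r ^+ 2)) => //; exact: exprn_measurable.
Qed.

Lemma measurable_viscous : measurable_on `]0, T[ viscous_diss.
Proof.
apply: measurable_on_sum => i; have [h1 h2] := state_measurable i.
have m2 (f : scalar_field R) : measurable_on `]0, T[ f -> measurable_on `]0, T[ (fun t x => f t x ^+ 2).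
  by apply: (measurable_on_comp (h := fun r => r ^+ 2)); exact: exprn_measurable.
apply: measurable_onD; apply: measurable_onM => //.
- by apply: measurable_onM => //; exact: measurable_on_cst.
- apply: measurable_on_sum => k; apply: measurable_on_sum => l; apply: m2.
  by have [_ _] := h2 k.
- by apply: m2; apply: measurable_on_sum => k; have [_ _] := h2 k.
Qed.

Lemma measurable_friction : measurable_on `]0, T[ friction_diss.
Proof.
apply: measurable_on_sum => i; apply: measurable_on_sum => j.
have [h1 h2] := state_measurable i; have [h1' h2'] := state_measurable j.
apply: measurable_onM.
  apply: measurable_onM => //; apply: measurable_onM => //; exact: measurable_on_cst.
apply: measurable_sqn => k; have [h3 _ _] := h2 k; have [h3' _ _] := h2' k.
apply: (measurable_onD h3); have := measurable_onM (@measurable_on_cst R _ (-1)) h3'.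
by apply: eq_measurable_on => t x _ _; rewrite mulN1r.
Qed.

Lemma measurable_damping : measurable_on `]0, T[ damping_diss.
Proof.
apply: measurable_on_sum => i; have [h1 h2] := state_measurable i.
apply: measurable_onM.
  by apply: measurable_onM => //; exact: measurable_on_cst.
by apply: measurable_sqn => k; have [] := h2 k.
Qed.

(** The squared trace of a 3 by 3 matrix is at most 3 times its squared norm, so 2 muL |D|^2
    dominates (2/3) muL (tr D)^2; what is left is the combination that the Lame condition makes
    nonnegative. *)
Lemma viscous_form_ge0 r (D : 'I_3 -> 'I_3 -> R) : 0 <= r ->
  0 <= 2 * muL r * (\sum_k \sum_l D k l ^+ 2) + lamL r * (\sum_k D k k) ^+ 2.
Proof.
move=> /lame[m0 l0].
have tr : (\sum_k D k k) ^+ 2 <= 3 * \sum_k \sum_l D k l ^+ 2.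
  rewrite !sum3E; set d0 := D 0 0; set d1 := D 1 1; set d2 := D 2%:R 2%:R.
  have := sqr_ge0 (D 0 1); have := sqr_ge0 (D 0 2%:R); have := sqr_ge0 (D 1 0).
  have := sqr_ge0 (D 1 2%:R); have := sqr_ge0 (D 2%:R 0); have := sqr_ge0 (D 2%:R 1).
  have := sqr_ge0 (d0 - d1); have := sqr_ge0 (d0 - d2); have := sqr_ge0 (d1 - d2).
  move: (D 0 1 ^+ 2) (D 0 2%:R ^+ 2) (D 1 0 ^+ 2) (D 1 2%:R ^+ 2) (D 2%:R 0 ^+ 2) (D 2%:R 1 ^+ 2).
  rewrite !expr2 => *; nra.
have S0 := sqr_ge0 (\sum_k D k k).
move: (\sum_k \sum_l _) ((\sum_k D k k) ^+ 2) tr S0 => A B tr S0.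
have h1 : 2 / 3 * muL r * B <= 2 * muL r * A.
  have -> : 2 / 3 * muL r * B = 2 * muL r * (B / 3) by field.
  by apply: ler_wpM2l; [rewrite mulr_ge0|rewrite ler_pdivrMr// mulrC].
have h2 : 0 <= (2 / 3 * muL r + lamL r) * B by exact: mulr_ge0.
by move: h2; rewrite mulrDl; lra.
Qed.

Lemma viscous_ge0 t x : (forall i, 0 <= rho w i t x) -> 0 <= viscous_diss t x.
Proof. by move=> r0; apply: sumr_ge0 => i _; exact: viscous_form_ge0. Qed.

Lemma sqn_ge0 (a : 'I_3 -> R) : 0 <= sqn a.
Proof. by apply: sumr_ge0 => k _; exact: sqr_ge0. Qed.

Lemma friction_diss_ge0 t x : (forall i, 0 <= rho w i t x) -> 0 <= friction_diss t x.
Proof.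
move=> r0; apply: sumr_ge0 => i _; apply: sumr_ge0 => j _.
have [<-|ij] := eqVneq i j.
  by rewrite /sqn [\sum_k _]big1 ?mulr0// => k _; rewrite subrr expr0n.
by apply: mulr_ge0; [apply: mulr_ge0 => //; apply: mulr_ge0 => //; have [_ ->] := fc|exact: sqn_ge0].
Qed.

Lemma damping_ge0 t x : (forall i, 0 <= rho w i t x) -> 0 <= damping_diss t x.
Proof.
by move=> r0; apply: sumr_ge0 => i _; apply: mulr_ge0; [exact: mulr_ge0|exact: sqn_ge0].
Qed.

Lemma Sigma_tot_slab : (\int[lebesgue_measure]_(t in `]0%R, +oo[) (Sigma_tot gamma w t * dth t))%:E =
  slab_int T (fun t x => dth t * eta_state gamma w t x).
Proof.
have mI : measurable (`]0, T[%classic : set (measurableTypeR R)) by exact: measurable_itv.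
have [L hL] := cutoff_bounded cdth dth0.
have ii : integrable_on `]0, T[ (fun t x => dth t * eta_state gamma w t x).
  apply: (integrable_on_bounded (C := L)) eta_integrable => //.
  exact: measurable_on_time.
have E : (\int[lebesgue_measure]_(t in `]0%R, +oo[) (Sigma_tot gamma w t * dth t)%:E)%E =
  slab_int T (fun t x => dth t * eta_state gamma w t x).
  have -> : (\int[lebesgue_measure]_(t in `]0%R, +oo[) (Sigma_tot gamma w t * dth t)%:E =
     \int[lebesgue_measure]_(t in `]0%R, T[) (Sigma_tot gamma w t * dth t)%:E)%E.
    rewrite integral_mkcond [RHS]integral_mkcond; apply: eq_integral => t _.
    rewrite /patch !mem_setE !in_itv/= andbT; case: (ltP 0 t) => //= t0.
    case: (ltP t T) => // tT; rewrite dth0 ?mulr0//.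
    by rewrite negb_and -!ltNge (lt_le_trans hb0 tT) orbT.
  apply/esym; have /integrable_onP ii' := ii.
  apply: etrans (fubini_rect1 mI (@measurable_cell R) ii') _.
  apply: eq_integral => t; rewrite inE/= in_itv/= => /andP[t0 tT].
  have ei : (leb3 R).-integrable (@cell R) (fun x => (eta_state gamma w t x)%:E).
    by apply: C0_Lp1_integrable; [case: ds|exact: ltW].
  under eq_integral do rewrite EFinM.
  rewrite integralZl//; last exact: measurable_cell.
  rewrite EFinM muleC; congr (_ * _)%E.
  by rewrite /Sigma_tot /int_x /Rintegral fineK//; apply: integrable_fin_num => //; exact: measurable_cell.
by rewrite /Rintegral -E fineK// E slab_fin_num.
Qed.

(** The dissipation integrals are a priori only in [0, +oo]. Since the other terms of the inequality
    are finite, each integral with a positive coefficient is finite, which yields the integrability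
    needed to combine it with the tested equations. *)
Lemma dissipation_piece : [/\ integrable_on `]0, T[ (eta_state gamma w),
  integrable_on `]0, T[ (fun t x => - dth t * eta_state gamma w t x
    + th t * (nu / eps * viscous_diss t x + (2 * eps ^+ 2)^-1 * friction_diss t x
              + (eps ^+ 2)^-1 * damping_diss t x)) &
  (slab_int T (fun t x => (- dth t * eta_state gamma w t x
    + th t * (nu / eps * viscous_diss t x + (2 * eps ^+ 2)^-1 * friction_diss t x
              + (eps ^+ 2)^-1 * damping_diss t x))%R) <= 0)%E].
Proof.
have [_ D] := ds.
have outT t : T <= t -> ~~ (a0 <= t <= b0).
  by move=> tT; rewrite negb_and -!ltNge (lt_le_trans hb0 tT) orbT.
have {D} := D th dth W1inf_cutoff (fun t _ => th_ge0 t) _.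
have /[swap]/[apply] : exists a, forall t, a <= t -> th t = 0.
  by exists T => t tT; rewrite th0// outT.
rewrite [th 0]th0; last by rewrite negb_and -!ltNge ha0.
rewrite mulr0 EFinN Sigma_tot_slab /=.
have IE (f : scalar_field R) : (\int[leb4 R]_(z in `]0%R, +oo[%classic `*` @cell R) (f z.1 z.2 * th z.1)%:E)%E
   = slab_int T (fun t x => th t * f t x).
  rewrite (@integral_slabE _ T (fun t x => f t x * th t)); last first.
    by move=> t x tT; rewrite th0 ?mulr0// outT.
  by apply: eq_integral => z _; rewrite mulrC.
have -> := IE viscous_diss; have -> := IE friction_diss; have -> := IE damping_diss.
have mth : measurable_on `]0, T[ (fun t _ => th t) by apply: measurable_on_time; exact: th_continuous dthE.
have pos (f : scalar_field R) : measurable_on `]0, T[ f ->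
    (forall t x, (forall i, 0 <= rho w i t x) -> 0 <= f t x) ->
    (0 <= slab_int T (fun t x => th t * f t x)%R)%E /\
    ((slab_int T (fun t x => th t * f t x)%R < +oo)%E -> integrable_on `]0, T[ (fun t x => th t * f t x)).
  move=> mf f0; have m1 := measurable_onM mth mf.
  have a1 : {ae leb4 R, forall z : R * coords R, OT z -> 0 <= th z.1 * f z.1 z.2}.
    apply: ae_sub (bounds_all_species bnd) _ => -[t x] h Dz; apply: mulr_ge0 => //; apply: f0 => i.
    by have /andP[/(le_trans (ltW k0))] := h Dz i.
  by split; [exact: slab_int_ge0|move=> foo; exact: integrable_on_ge0].
have [p1 i1] := pos _ measurable_viscous viscous_ge0.
have [p2 i2] := pos _ measurable_friction friction_diss_ge0.
have [p3 i3] := pos _ measurable_damping damping_ge0.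
have [L hL] := cutoff_bounded cdth dth0.
have ie : integrable_on `]0, T[ (fun t x => dth t * eta_state gamma w t x).
  apply: (integrable_on_bounded (C := L)) eta_integrable => //.
  exact: measurable_on_time.
have fe := slab_fin_num ie.
have c1 : 0 <= nu / eps by rewrite divr_ge0// ltW.
have c2 : 0 < (2 * eps ^+ 2)^-1 by rewrite invr_gt0 mulr_gt0// exprn_gt0.
have c3 : 0 < (eps ^+ 2)^-1 by rewrite invr_gt0 exprn_gt0.
set S1 := slab_int T (fun t x => th t * viscous_diss t x) in p1 i1 *.
set S2 := slab_int T (fun t x => th t * friction_diss t x) in p2 i2 *.
set S3 := slab_int T (fun t x => th t * damping_diss t x) in p3 i3 *.
rewrite -(fineK fe) => H.
(* If [nu] is 0 nothing bounds the viscous integral, which may be infinite; the product with 0 is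
   then 0 in the extended reals, and this case is separated. *)
have C1 : exists2 S, ((nu / eps)%:E * S1 = S%:E)%E & integrable_on `]0, T[ (fun t x => nu / eps * (th t * viscous_diss t x)) /\
    slab_int T (fun t x => nu / eps * (th t * viscous_diss t x)) = S%:E.
  have [c0|cn0] := eqVneq (nu / eps) 0.
    exists 0; first by rewrite c0 mul0e.
    have [j1 j2] := integrable_on0 T.
    suff [q1 q2] : integrable_on `]0, T[ (fun t x => nu / eps * (th t * viscous_diss t x)) /\
        slab_int T (fun _ _ => 0) = slab_int T (fun t x => nu / eps * (th t * viscous_diss t x)).
      by split; rewrite // -q2.
    by apply: eq_slab j1 => t x _ _; rewrite c0 mul0r.
  have cp : 0 < nu / eps by rewrite lt0r cn0.
  have S1oo : (S1 < +oo)%E.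
    rewrite ltey; apply/eqP => S1E; move: H; rewrite S1E gt0_muley ?lte_fin//.
    have -> : ((- fine (slab_int T (fun t x => (dth t * eta_state gamma w t x)%R)))%:E + +oo = +oo :> \bar R)%E by [].
    have q2 : (0 <= (2 * eps ^+ 2)^-1%:E * S2)%E by rewrite mule_ge0// lee_fin ltW.
    have q3 : (0 <= (eps ^+ 2)^-1%:E * S3)%E by rewrite mule_ge0// lee_fin ltW.
    by rewrite !addye//; [apply/eqP; move: q3; case: (_ * S3)%E|apply/eqP; move: q2; case: (_ * S2)%E].
  have ii := i1 S1oo.
  have [j1 j2] := integrable_onZ (nu / eps) ii.
  exists (nu / eps * fine S1); last by split=> //; rewrite j2 -/S1 -{1}(@fineK _ S1) ?ge0_fin_numE.
  by rewrite -{1}(@fineK _ S1) ?ge0_fin_numE.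
have [S1' e1 [I1 F1]] := C1; rewrite e1 in H.
have S2oo : (S2 < +oo)%E.
  rewrite ltey; apply/eqP => S2E; move: H; rewrite S2E gt0_muley ?lte_fin//.
  have q3 : (0 <= (eps ^+ 2)^-1%:E * S3)%E by rewrite mule_ge0// lee_fin ltW.
  by move: q3; case: (_ * S3)%E.
have S3oo : (S3 < +oo)%E.
  rewrite ltey; apply/eqP => S3E; move: H; rewrite S3E [((eps ^+ 2)^-1%:E * _)%E]gt0_muley ?lte_fin//.
  have q3 : (0 <= (2 * eps ^+ 2)^-1%:E * S2)%E by rewrite mule_ge0// lee_fin ltW.
  by move: q3; case: (_ * S2)%E.
have [I2 F2] := integrable_onZ (2 * eps ^+ 2)^-1 (i2 S2oo).
have [I3 F3] := integrable_onZ (eps ^+ 2)^-1 (i3 S3oo).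
have [I0 F0] := integrable_onZ (-1) ie.
have [I01 F01] := integrable_onD I0 I1.
have [I012 F012] := integrable_onD I01 I2.
have [I0123 F0123] := integrable_onD I012 I3.
set f := (fun t x => _ + _ * (_ + _)).
have fE t x : 0 < t < T -> cell x -> -1 * (dth t * eta_state gamma w t x)
    + nu / eps * (th t * viscous_diss t x) + (2 * eps ^+ 2)^-1 * (th t * friction_diss t x)
    + (eps ^+ 2)^-1 * (th t * damping_diss t x) = f t x.
  by move=> _ _; rewrite /f; ring.
have [J1 J2] := eq_slab fE I0123.
split=> //; first exact: eta_integrable.
rewrite -J2 F0123 F012 F01 F0 F1 F2 F3.
by move: H; rewrite -(fineK fe) -EFinM mulN1r.
Qed.

End dissipation.

(** * Pointwise estimates *)

Section pointwise.
Context (R : realType).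
Implicit Types (u v U V : 'I_3 -> R).

Local Notation "<| u , v |>" := (\sum_k u k * v k) (at level 0, format "<| u ,  v |>").

(* The cross terms with [Y] and [mu div Y] come from testing the gradient of
   [mu rho] with [Y]; they turn the non-quadratic remainder into zero. *)
Lemma species_identity (e gamma kap rh r m mr mu lam p pr ph dtr divU divV : R)
    u v U V w z gm gl gh dr fr dtU dtV gU gV Y (dU dV : 'I_3 -> 'I_3 -> R) :
  e != 0 -> gamma != 0 -> 1 + kap != 0 ->
  (forall k, w k = u k - e * U k) -> (forall k, z k = v k - V k) ->
  (forall k, gm k = rh * v k) -> (forall k, gl k = 2 * kap * (rh * v k)) ->
  lam = 2 * kap * mu -> (1 + kap) * mu = rh * m ->
  divU = \sum_k dU k k -> divV = \sum_k dV k k ->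
  dtr = - (r * divU + \sum_k U k * dr k) -> (forall k, gh k = ph * dr k) ->
  ph * r * r = gamma * pr ->
  (forall k, dtV k = - (mr * gU k + kap * V k * divU
      + \sum_l (dU l k * V l + U l * dV k l))) ->
  (forall k l, dV k l = dV l k) ->
  (forall k, fr k = - gh k + \sum_l V l * dV k l + mr * gV k + kap * V k * divV) ->
  (forall k, Y k = \sum_l (U l * dV k l - V l * dU k l)
      + kap * (U k * divV - V k * divU)) ->
  (rh * (ph * dtr - e ^+ 2 * <|U, dtU|> - <|V, dtV|>)
    + e^-1 * \sum_k rh * u k * (gh k - e ^+ 2 * (\sum_j U j * dU j k) - \sum_j V j * dV j k))
  + e * (\sum_k rh * u k * dtU k
     + e^-1 * (\sum_k \sum_l rh * u k * u l * dU k l)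
     + e^-1 * (p * divU) + e^-1 * (mu * <|v, gU|>)
     + e^-1 * (\sum_k gm k * \sum_l dU k l * v l)
     + (2 * e)^-1 * (<|gl, v|> * divU) + (2 * e)^-1 * (lam * <|v, gU|>))
  + (\sum_k rh * v k * dtV k + e^-1 * (\sum_k \sum_l rh * v k * u l * dV k l)
     - e^-1 * (mu * <|u, gV|> + \sum_k gm k * (\sum_l dV k l * u l)
       + 2^-1 * (<|gl, u|> * divV) + 2^-1 * (lam * <|u, gV|>)))
  + (<|gm, Y|> + mu * ((1 + kap) * \sum_l (U l * gV l - V l * gU l)))
  - (1 - gamma) * pr * divU =
  e^-1 * rh * (\sum_k w k * (e ^+ 2 * (dtU k + \sum_l U l * dU k l)
      - kap * z k * divV - (m - mr) * gV k - fr k))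
  + rh * (\sum_k \sum_l w k * w l * dU k l + \sum_k \sum_l z k * z l * dU k l
      + kap * <|z, z|> * divU + (m - mr) * <|z, gU|>)
  + (p - pr - ph * r * (rh - r)) * divU.
Proof.
move=> e0 g0 k0 hw hz hgm hgl -> hm -> -> -> hgh hp hV hs hf hY.
have hu k : u k = w k + e * U k by rewrite hw; ring.
have hv k : v k = z k + V k by rewrite hz; ring.
(* The constitutive relations are used to eliminate [pr] and [mu], and the symmetry of [dV] to keep
   six of its entries; a rational identity in independent quantities remains. *)
have -> : pr = ph * r * r / gamma by rewrite hp mulrAC divff ?mul1r.
have -> : mu = rh * m / (1 + kap) by rewrite -hm mulrAC divff ?mul1r.
have E10 : dV 1 0 = dV 0 1 by rewrite hs.
have E20 : dV 2%:R 0 = dV 0 2%:R by rewrite hs.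
have E21 : dV 2%:R 1 = dV 1 2%:R by rewrite hs.
rewrite !sum3E !hgm !hgl !hf !hY !hgh !hV !hu !hv !sum3E !E10 !E20 !E21.
move: {hp hm hs} (dV 0 0) (dV 0 1) (dV 0 2%:R) (dV 1 1) (dV 1 2%:R) (dV 2%:R 2%:R) E10 E20 E21.
move=> V00 V01 V02 V11 V12 V22 _ _ _.
move: (dU 0 0) (dU 0 1) (dU 0 2%:R) (dU 1 0) (dU 1 1) (dU 1 2%:R) (dU 2%:R 0) (dU 2%:R 1) (dU 2%:R 2%:R).
move=> D00 D01 D02 D10 D11 D12 D20 D21 D22.
move: (w 0) (w 1) (w 2%:R) (z 0) (z 1) (z 2%:R) => w0 w1 w2 z0 z1 z2.
move: (U 0) (U 1) (U 2%:R) (V 0) (V 1) (V 2%:R) => U0 U1 U2 V0 V1 V2.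
move: (dtU 0) (dtU 1) (dtU 2%:R) (gU 0) (gU 1) (gU 2%:R) => t0 t1 t2 a0 a1 a2.
move: (gV 0) (gV 1) (gV 2%:R) (dr 0) (dr 1) (dr 2%:R) => b0 b1 b2 d0 d1 d2.
by field; rewrite e0 g0 k0.
Qed.

Lemma antisym_sum n (F : 'I_n -> 'I_n -> R) : (forall i j, F i j = - F j i) ->
  \sum_i \sum_j F i j = 0.
Proof.
move=> FN; have : \sum_i \sum_j F i j = - \sum_i \sum_j F i j.
  rewrite {1}exchange_big/= -sumrN; apply: eq_bigr => i _; rewrite -sumrN.
  by apply: eq_bigr => j _; rewrite FN.
lra.
Qed.

(** With u = w + e U, the friction dissipation minus the work done on the equilibrium flow is the
    dissipation of w, up to terms linear in w. The latter match the equilibrium friction except that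
    the true density of the partner species replaces the equilibrium one, and this mismatch is the
    last term. *)
Lemma friction_identity n (e : R) (b : 'I_n -> 'I_n -> R) (M rh r : 'I_n -> R)
    (u U w fr : 'I_n -> 'I_3 -> R) : e != 0 ->
  (forall i j, b i j = b j i) ->
  (forall i k, w i k = u i k - e * U i k) ->
  (forall i k, fr i k = \sum_j b i j * r j * (U i k - U j k) + M i * U i k) ->
  (2 * e ^+ 2)^-1 * (\sum_i \sum_j b i j * rh i * rh j * sqn (fun k => u i k - u j k))
  + (e ^+ 2)^-1 * (\sum_i M i * rh i * sqn (u i))
  - e * ((e ^+ 2)^-1 * (\sum_i \sum_j b i j * rh i * rh j
       * (\sum_k (u i k - u j k) * U i k)
     + \sum_i M i * (\sum_k rh i * u i k * U i k)))
  - e^-1 * (\sum_i rh i * \sum_k w i k * fr i k) =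
  (2 * e ^+ 2)^-1 * (\sum_i \sum_j b i j * rh i * rh j * sqn (fun k => w i k - w j k))
  + (e ^+ 2)^-1 * (\sum_i M i * rh i * sqn (w i))
  + e^-1 * (\sum_i rh i * \sum_k w i k * \sum_j b i j * (rh j - r j) * (U i k - U j k)).
Proof.
move=> e0 bs hw hf.
have hu i k : u i k = w i k + e * U i k by rewrite hw; ring.
(* The contribution of an ordered pair of species: exchanging the two changes its sign because [b]
   is symmetric, so the double sum vanishes. *)
pose F i j := b i j * rh i * rh j * ((2 * e ^+ 2)^-1 *
    (sqn (fun k => u i k - u j k) - sqn (fun k => w i k - w j k))
   - e^-1 * (\sum_k (u i k - u j k) * U i k)
   - e^-1 * (\sum_k w i k * (U i k - U j k))).
have /antisym_sum F0 : forall i j, F i j = - F j i.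
  move=> i j; rewrite /F (bs j i) /sqn !sum3E !hu.
  move: (w i 0) (w i 1) (w i 2%:R) (w j 0) (w j 1) (w j 2%:R) => w0 w1 w2 z0 z1 z2.
  move: (U i 0) (U i 1) (U i 2%:R) (U j 0) (U j 1) (U j 2%:R) => U0 U1 U2 V0 V1 V2.
  by field.
pose G i := (e ^+ 2)^-1 * (M i * rh i * sqn (u i)) - e^-1 * (M i * (\sum_k rh i * u i k * U i k))
   - e^-1 * (rh i * \sum_k w i k * (M i * U i k)) - (e ^+ 2)^-1 * (M i * rh i * sqn (w i)).
have G0 : \sum_i G i = 0.
  apply: big1 => i _; rewrite /G /sqn !sum3E !hu.
  move: (w i 0) (w i 1) (w i 2%:R) (U i 0) (U i 1) (U i 2%:R) => w0 w1 w2 U0 U1 U2.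
  by field.
have lin c1 c2 c5 (S1 S2 S3 S4 S5 T1 T2 T3 : 'I_n -> R) :
    c1 * (\sum_i S1 i) + c2 * (\sum_i S2 i) - e * (c2 * (\sum_i S3 i + \sum_i S4 i)) - c5 * (\sum_i S5 i)
    - (c1 * (\sum_i T1 i) + c2 * (\sum_i T2 i) + c5 * (\sum_i T3 i)) =
    \sum_i (c1 * S1 i + c2 * S2 i - e * (c2 * (S3 i + S4 i)) - c5 * S5 i
       - (c1 * T1 i + c2 * T2 i + c5 * T3 i)).
  rewrite !(sumrB, big_split)/= -!mulr_sumr.
  by rewrite big_split.
apply/eqP; rewrite -subr_eq0 lin; apply/eqP.
apply: etrans (_ : \sum_i (\sum_j F i j + G i) = 0); last by rewrite big_split/= F0 G0 addr0.
apply: eq_bigr => i _.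
have E1 : \sum_k w i k * fr i k = \sum_j b i j * (\sum_k w i k * (r j * (U i k - U j k))) + \sum_k w i k * (M i * U i k).
  under eq_bigr do rewrite hf mulrDr mulr_sumr.
  rewrite big_split/= exchange_big/=; congr (_ + _); apply: eq_bigr => j _.
  by rewrite mulr_sumr; apply: eq_bigr => k _; ring.
have E2 : \sum_k w i k * \sum_j b i j * (rh j - r j) * (U i k - U j k) =
    \sum_j b i j * rh j * (\sum_k w i k * (U i k - U j k))
    - \sum_j b i j * (\sum_k w i k * (r j * (U i k - U j k))).
  under eq_bigr do rewrite mulr_sumr.
  rewrite exchange_big/= -sumrB; apply: eq_bigr => j _.
  by rewrite !mulr_sumr -sumrB; apply: eq_bigr => k _; ring.
have E3 : \sum_j F i j = (2 * e ^+ 2)^-1 * (\sum_j b i j * rh i * rh j * sqn (fun k => u i k - u j k)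
      - \sum_j b i j * rh i * rh j * sqn (fun k => w i k - w j k))
    - e^-1 * (\sum_j b i j * rh i * rh j * (\sum_k (u i k - u j k) * U i k))
    - e^-1 * (rh i * \sum_j b i j * rh j * (\sum_k w i k * (U i k - U j k))).
  rewrite -sumrB !mulr_sumr -!sumrB; apply: eq_bigr => j _.
  by rewrite /F; ring.
rewrite E1 E2 E3 /G.
move: (\sum_j b i j * rh i * _ * _) (\sum_j b i j * rh i * _ * _) (\sum_j b i j * rh i * _ * _) => A1 A2 A3.
move: (\sum_j b i j * _ * _) (\sum_j b i j * _) => A4 A5.
move: (sqn _) (sqn _) (\sum_k _) (\sum_k _) => A6 A7 A8 A9.
by field.
Qed.

Lemma sqn_le B u : (forall k, `|u k| <= B) -> sqn u <= 3 * B ^+ 2.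
Proof.
move=> uB; have h k : u k ^+ 2 <= B ^+ 2.
  by rewrite -real_normK ?num_real// ler_sqr ?nnegrE ?(le_trans _ (uB k))// uB.
rewrite /sqn sum3E; have := h 0; have := h 1; have := h 2%:R.
move: (u 0 ^+ 2) (u 1 ^+ 2) (u 2%:R ^+ 2) (B ^+ 2) => *; lra.
Qed.

Lemma young_sum d u v : 0 < d -> - (d * sqn u) - (4 * d)^-1 * sqn v <= <|u, v|>.
Proof.
move=> d0; have h k : - (d * u k ^+ 2) - (4 * d)^-1 * v k ^+ 2 <= u k * v k.
  rewrite -subr_ge0.
  have -> : u k * v k - (- (d * u k ^+ 2) - (4 * d)^-1 * v k ^+ 2) = d * (u k + v k / (2 * d)) ^+ 2.
    by field; rewrite gt_eqF.
  by rewrite mulr_ge0 ?sqr_ge0// ltW.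
rewrite /sqn !mulr_sumr -sumrN -sumrB; apply: ler_sum => k _; exact: h.
Qed.

Lemma bilinear_ge B u (D : 'I_3 -> 'I_3 -> R) : (forall k l, `|D k l| <= B) ->
  - (3 * B * sqn u) <= \sum_k \sum_l u k * u l * D k l.
Proof.
move=> DB.
have h k l : - (B / 2 * (u k ^+ 2 + u l ^+ 2)) <= u k * u l * D k l.
  have B0 : 0 <= B := le_trans (normr_ge0 _) (DB k l).
  have h1 : `|u k * u l| <= (u k ^+ 2 + u l ^+ 2) / 2.
    rewrite ler_norml; have := sqr_ge0 (u k - u l); have := sqr_ge0 (u k + u l).
    by rewrite !expr2 => h1 h2; apply/andP; split; lra.
  have h2 : `|u k * u l * D k l| <= (u k ^+ 2 + u l ^+ 2) / 2 * B by rewrite normrM ler_pM.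
  by move: h2; rewrite ler_norml => /andP[+ _]; move: (u k ^+ 2 + u l ^+ 2) => q; lra.
apply: le_trans (ler_sum _ (fun k _ => ler_sum _ (fun l _ => h k l))).
rewrite !sum3E /sqn sum3E.
by move: (u 0 ^+ 2) (u 1 ^+ 2) (u 2%:R ^+ 2) => *; lra.
Qed.

Lemma sqr4_le (a b c d : R) : (a + b + c + d) ^+ 2 <= 4 * (a ^+ 2 + b ^+ 2 + c ^+ 2 + d ^+ 2).
Proof.
have := sqr_ge0 (a - b); have := sqr_ge0 (a - c); have := sqr_ge0 (a - d).
have := sqr_ge0 (b - c); have := sqr_ge0 (b - d); have := sqr_ge0 (c - d).
by rewrite !expr2 => *; lra.
Qed.

Lemma mul_sqr_le (a b B : R) : `|b| <= B -> (a * b) ^+ 2 <= B ^+ 2 * a ^+ 2.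
Proof.
move=> bB; rewrite exprMn mulrC ler_wpM2r ?sqr_ge0// -real_normK ?num_real//.
by rewrite ler_sqr ?nnegrE// (le_trans _ bB).
Qed.

(** The 1/e term is a product of w/e with four summands, so Young's inequality with weight [d]
    trades it for d |w/e|^2, which the damping pays for, plus the squares of the summands. The
    square of e^2 [A] is the e^4 term; the others are quadratic in [z], in the density difference
    and in the friction error [G]. *)
Lemma species_ge (e d B L kap g1 rh r m mr h divU divV : R) w z A G gU gV (dU : 'I_3 -> 'I_3 -> R) :
  0 < e -> 0 < d -> 0 <= rh -> 0 <= kap -> 0 <= L -> 0 <= g1 -> 0 <= h ->
  `|m - mr| <= L * `|rh - r| -> `|divU| <= B -> `|divV| <= B ->
  (forall k, `|A k| <= B) -> (forall k, `|gU k| <= B) -> (forall k, `|gV k| <= B) ->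
  (forall k l, `|dU k l| <= B) ->
  - (rh * (3 * B * sqn w + (3 * B + kap * B + 1 + kap ^+ 2 * B ^+ 2 / d) * sqn z
       + (3 * L ^+ 2 * B ^+ 2 + 3 * L ^+ 2 * B ^+ 2 / d) * (rh - r) ^+ 2
       + 3 * B ^+ 2 / d * e ^+ 4 + sqn G / d) + g1 * B * h) <=
  (e ^+ 2)^-1 * (d * rh * sqn w)
  + e^-1 * rh * (\sum_k w k * (e ^+ 2 * A k - kap * z k * divV - (m - mr) * gV k + G k))
  + rh * (\sum_k \sum_l w k * w l * dU k l + \sum_k \sum_l z k * z l * dU k l
      + kap * sqn z * divU + (m - mr) * <|z, gU|>)
  + g1 * h * divU.
Proof.
move=> e0 d0 r0 k0 L0 g0 h0 mL DU DV AB gUB gVB dUB.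
have B0 : 0 <= B := le_trans (normr_ge0 _) DU.
pose X k := e ^+ 2 * A k - kap * z k * divV - (m - mr) * gV k + G k.
have mm : (m - mr) ^+ 2 <= L ^+ 2 * (rh - r) ^+ 2.
  rewrite -exprMn -(real_normK (num_real (m - mr))) -(real_normK (num_real (L * _))).
  by rewrite ler_sqr ?nnegrE// normrM (ger0_norm L0).
have hX : sqn X <= 4 * (3 * B ^+ 2 * e ^+ 4 + kap ^+ 2 * B ^+ 2 * sqn z
     + 3 * B ^+ 2 * (L ^+ 2 * (rh - r) ^+ 2) + sqn G).
  have hk k : X k ^+ 2 <= 4 * (B ^+ 2 * e ^+ 4 + kap ^+ 2 * B ^+ 2 * z k ^+ 2
     + B ^+ 2 * (L ^+ 2 * (rh - r) ^+ 2) + G k ^+ 2).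
    apply: le_trans (sqr4_le _ _ _ _) _; rewrite ler_pM2l// lerD// lerD// ?lerD//.
    - by apply: le_trans (mul_sqr_le _ (AB k)) _; rewrite -exprM.
    - rewrite sqrrN; apply: le_trans (mul_sqr_le _ DV) _.
      by rewrite exprMn mulrCA mulrA.
    - rewrite sqrrN; apply: le_trans (mul_sqr_le _ (gVB k)) _.
      by rewrite ler_wpM2l ?sqr_ge0.
  apply: le_trans (ler_sum _ (fun k _ => hk k)) _.
  rewrite /sqn !sum3E; move: (z 0 ^+ 2) (z 1 ^+ 2) (z 2%:R ^+ 2) (G 0 ^+ 2) (G 1 ^+ 2) (G 2%:R ^+ 2).
  by move=> *; rewrite le_eqVlt; apply/orP; left; apply/eqP; ring.
have h1 : - ((e ^+ 2)^-1 * (d * rh * sqn w)) - rh / (4 * d) * sqn X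
   <= e^-1 * rh * (\sum_k w k * X k).
  have := ler_wpM2l r0 (young_sum (fun k => e^-1 * w k) X d0).
  have -> : sqn (fun k => e^-1 * w k) = (e ^+ 2)^-1 * sqn w.
    by rewrite /sqn mulr_sumr; apply: eq_bigr => k _; rewrite exprMn exprVn.
  have -> : \sum_k e^-1 * w k * X k = e^-1 * \sum_k w k * X k.
    by rewrite mulr_sumr; apply: eq_bigr => k _; rewrite mulrA.
  move: (\sum_k _) (sqn X) (sqn w) (e ^+ 2)^-1 e^-1 (4 * d)^-1 => s1 s2 s3 s4 s5 s6.
  by move=> H; apply: le_trans (le_trans H _); lra.
have h2 := bilinear_ge w dUB; have h3 := bilinear_ge z dUB.
have Z0 : 0 <= sqn z by apply: sumr_ge0 => k _; exact: sqr_ge0.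
have h4 : - (kap * B * sqn z) <= kap * sqn z * divU.
  have : `|kap * sqn z * divU| <= kap * sqn z * B.
    by rewrite normrM ger0_norm ?mulr_ge0// ler_wpM2l// mulr_ge0.
  by rewrite ler_norml => /andP[+ _]; lra.
have h5 : - (sqn z + 3 * B ^+ 2 * (L ^+ 2 * (rh - r) ^+ 2)) <= (m - mr) * <|z, gU|>.
  have -> : (m - mr) * <|z, gU|> = <|z, (fun k => (m - mr) * gU k)|>.
    by rewrite mulr_sumr; apply: eq_bigr => k _; rewrite mulrCA.
  have := young_sum z (fun k => (m - mr) * gU k) ltr01; rewrite mul1r mulr1.
  have : sqn (fun k => (m - mr) * gU k) <= 3 * B ^+ 2 * (L ^+ 2 * (rh - r) ^+ 2).
    have hk k : ((m - mr) * gU k) ^+ 2 <= B ^+ 2 * (L ^+ 2 * (rh - r) ^+ 2).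
      by apply: le_trans (mul_sqr_le _ (gUB k)) _; rewrite ler_wpM2l ?sqr_ge0.
    apply: le_trans (ler_sum _ (fun k _ => hk k)) _; rewrite sum3E.
    by rewrite le_eqVlt; apply/orP; left; apply/eqP; ring.
  have : 0 <= sqn (fun k => (m - mr) * gU k) by apply: sumr_ge0 => k _; exact: sqr_ge0.
  move: (sqn _) (sqn z) (3 * B ^+ 2 * _) (\sum_k _) => *; lra.
have h6 : - (g1 * B * h) <= g1 * h * divU.
  have : `|g1 * h * divU| <= g1 * h * B.
    by rewrite normrM ger0_norm ?mulr_ge0// ler_wpM2l// mulr_ge0.
  by rewrite ler_norml => /andP[+ _]; lra.
(* The factor 4 from squaring a sum of four terms cancels the 4 of Young's inequality. *)
have h7 : rh / (4 * d) * sqn X <= rh * (3 * B ^+ 2 / d * e ^+ 4 + kap ^+ 2 * B ^+ 2 / d * sqn z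
     + 3 * L ^+ 2 * B ^+ 2 / d * (rh - r) ^+ 2 + sqn G / d).
  have -> : rh * (3 * B ^+ 2 / d * e ^+ 4 + kap ^+ 2 * B ^+ 2 / d * sqn z
     + 3 * L ^+ 2 * B ^+ 2 / d * (rh - r) ^+ 2 + sqn G / d) = rh / (4 * d) *
     (4 * (3 * B ^+ 2 * e ^+ 4 + kap ^+ 2 * B ^+ 2 * sqn z
     + 3 * B ^+ 2 * (L ^+ 2 * (rh - r) ^+ 2) + sqn G)).
    by field; rewrite gt_eqF.
  by rewrite ler_wpM2l// divr_ge0// mulr_ge0// ltW.
have h8 : rh * (- (3 * B * sqn w) - 3 * B * sqn z - kap * B * sqn z
     - (sqn z + 3 * B ^+ 2 * (L ^+ 2 * (rh - r) ^+ 2))) <=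
  rh * (\sum_k \sum_l w k * w l * dU k l + \sum_k \sum_l z k * z l * dU k l
      + kap * sqn z * divU + (m - mr) * <|z, gU|>).
  rewrite ler_wpM2l//; move: h2 h3 h4 h5.
  move: (\sum_k \sum_l _) (\sum_k \sum_l _) (kap * sqn z * divU) ((m - mr) * _) => *; lra.
have -> : rh * (3 * B * sqn w + (3 * B + kap * B + 1 + kap ^+ 2 * B ^+ 2 / d) * sqn z
       + (3 * L ^+ 2 * B ^+ 2 + 3 * L ^+ 2 * B ^+ 2 / d) * (rh - r) ^+ 2
       + 3 * B ^+ 2 / d * e ^+ 4 + sqn G / d) =
  rh * (3 * B ^+ 2 / d * e ^+ 4 + kap ^+ 2 * B ^+ 2 / d * sqn z
     + 3 * L ^+ 2 * B ^+ 2 / d * (rh - r) ^+ 2 + sqn G / d)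
  - rh * (- (3 * B * sqn w) - 3 * B * sqn z - kap * B * sqn z
     - (sqn z + 3 * B ^+ 2 * (L ^+ 2 * (rh - r) ^+ 2))) by ring.
rewrite -/X; move: h1 h6 h7 h8 {h2 h3 h4 h5 hX mm mL}.
move: (e^-1 * rh * _) (rh / (4 * d) * _) ((e ^+ 2)^-1 * _) (g1 * h * divU) (g1 * B * h) => x1 x2 x3 x4 x5.
move: (rh * _) (rh * _) (rh * _) => x6 x7 x8; lra.
Qed.

Lemma sum_sqr_le n (f : 'I_n -> R) : (\sum_j f j) ^+ 2 <= n%:R * \sum_j f j ^+ 2.
Proof.
have h i j : f i * f j <= (f i ^+ 2 + f j ^+ 2) / 2.
  by have := sqr_ge0 (f i - f j); rewrite !expr2 => ?; lra.
rewrite expr2 big_distrlr/=.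
apply: le_trans (ler_sum _ (fun i _ => ler_sum _ (fun j _ => h i j))) _.
have E i : \sum_j (f i ^+ 2 + f j ^+ 2) / 2 = n%:R / 2 * f i ^+ 2 + (\sum_j f j ^+ 2) / 2.
  by rewrite -mulr_suml big_split/= sumr_const card_ord -[_ *+ n]mulr_natl; field.
rewrite (eq_bigr _ (fun i _ => E i)).
by rewrite big_split/= -mulr_sumr sumr_const card_ord -[_ *+ n]mulr_natl; lra.
Qed.

(** The constant collects the Cauchy-Schwarz inequality over the species, the bound (2 B)^2 for a
    squared difference of two velocities, and three coordinates: 12 = 3 * 4. *)
Lemma friction_error_le n (bb B : R) (b : 'I_n -> 'I_n -> R) (x : 'I_n -> R)
    (U : 'I_n -> 'I_3 -> R) i :
  (forall i j, `|b i j| <= bb) -> (forall i k, `|U i k| <= B) ->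
  sqn (fun k => \sum_j b i j * x j * (U i k - U j k)) <=
  12 * n%:R * bb ^+ 2 * B ^+ 2 * \sum_j x j ^+ 2.
Proof.
move=> hb hU.
have h k : (\sum_j b i j * x j * (U i k - U j k)) ^+ 2 <=
    n%:R * \sum_j 4 * bb ^+ 2 * B ^+ 2 * x j ^+ 2.
  apply: le_trans (sum_sqr_le _) _; rewrite ler_wpM2l// ler_sum// => j _.
  have -> : 4 * bb ^+ 2 * B ^+ 2 * x j ^+ 2 = (bb * (2 * B)) ^+ 2 * x j ^+ 2 by ring.
  have -> : b i j * x j * (U i k - U j k) = x j * (b i j * (U i k - U j k)) by ring.
  apply: mul_sqr_le; rewrite normrM ler_pM// (le_trans (ler_normB _ _))//.
  by have := hU i k; have := hU j k; lra.
rewrite /sqn sum3E; have := h 0; have := h 1; have := h 2%:R.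
rewrite -mulr_sumr.
have -> : 12 * n%:R * bb ^+ 2 * B ^+ 2 * (\sum_j x j ^+ 2) =
  3 * (n%:R * (4 * bb ^+ 2 * B ^+ 2 * (\sum_j x j ^+ 2))) by ring.
by move: (n%:R * _) ((\sum_j _) ^+ 2) ((\sum_j _) ^+ 2) ((\sum_j _) ^+ 2) => *; lra.
Qed.

(** Completing the square: the viscous form at D - (e/2) DU is nonnegative, and what has to be added
    back is (nu/e)(e^2/4) times the form at DU. Nine entries bounded by [B] give at most 9/2 for the
    shear part and 9/4 for the bulk part, both below 5. *)
Lemma viscous_ge (e nu B r : R) (muL lamL : R -> R) (D DU : 'I_3 -> 'I_3 -> R) divU :
  lame_condition muL lamL -> 0 <= r -> 0 < e -> 0 <= nu ->
  divU = \sum_k DU k k -> (forall k l, `|DU k l| <= B) ->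
  - (5 * B ^+ 2 * nu * e * (muL r + `|lamL r|)) <=
  nu / e * (2 * muL r * (\sum_k \sum_l D k l ^+ 2) + lamL r * (\sum_k D k k) ^+ 2)
  - e * (2 * nu / e * (muL r * \sum_k \sum_l D k l * DU k l)
     + nu / e * (lamL r * (\sum_k D k k) * divU)).
Proof.
move=> lame r0 e0 nu0 -> DUB.
have := viscous_form_ge0 lame (fun k l => D k l - e / 2 * DU k l) r0.
have -> : \sum_k \sum_l (D k l - e / 2 * DU k l) ^+ 2 = \sum_k \sum_l D k l ^+ 2
   - e * (\sum_k \sum_l D k l * DU k l) + e ^+ 2 / 4 * \sum_k \sum_l DU k l ^+ 2.
  by rewrite !sum3E; field.
have -> : \sum_k (D k k - e / 2 * DU k k) = \sum_k D k k - e / 2 * \sum_k DU k k.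
  by rewrite !sum3E; ring.
have m0 : 0 <= muL r by have [] := lame r r0.
have S1 : \sum_k \sum_l DU k l ^+ 2 <= 9 * B ^+ 2.
  have h k : \sum_l DU k l ^+ 2 <= 3 * B ^+ 2 by apply: (@sqn_le B (DU k)).
  by rewrite sum3E; have := h 0; have := h 1; have := h 2%:R; move: (\sum_l _) (\sum_l _) (\sum_l _) => *; lra.
have S2 : (\sum_k DU k k) ^+ 2 <= 9 * B ^+ 2.
  have -> : 9 * B ^+ 2 = (3 * B) ^+ 2 by ring.
  have h : `|\sum_k DU k k| <= 3 * B.
    rewrite sum3E; apply: le_trans (ler_normD _ _) _.
    have := ler_normD (DU 0 0) (DU 1 1); have := DUB 0 0; have := DUB 1 1; have := DUB 2%:R 2%:R.
    lra.
  by rewrite -real_normK ?num_real// ler_sqr ?nnegrE// (le_trans _ h).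
have S1p : 0 <= \sum_k \sum_l DU k l ^+ 2 by apply: sumr_ge0 => k _; apply: sumr_ge0 => l _; exact: sqr_ge0.
have S2p := sqr_ge0 (\sum_k DU k k).
move: (\sum_k \sum_l DU k l ^+ 2) S1 S1p => q1 S1 S1p.
move: (\sum_k DU k k) S2 S2p => q2 S2 S2p.
move: (\sum_k \sum_l D k l ^+ 2) (\sum_k \sum_l D k l * DU k l) (\sum_k D k k) => d1 d2 d3 H.
have {}H := mulr_ge0 (divr_ge0 nu0 (ltW e0)) H.
rewrite -subr_ge0.
have -> : nu / e * (2 * muL r * d1 + lamL r * d3 ^+ 2) -
 e * (2 * nu / e * (muL r * d2) + nu / e * (lamL r * d3 * q2)) -
 - (5 * B ^+ 2 * nu * e * (muL r + `|lamL r|)) =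
 nu / e * (2 * muL r * (d1 - e * d2 + e ^+ 2 / 4 * q1) + lamL r * (d3 - e / 2 * q2) ^+ 2)
 + nu * e * (5 * B ^+ 2 * (muL r + `|lamL r|) - (2 * muL r * q1 + lamL r * q2 ^+ 2) / 4).
  by field; rewrite gt_eqF.
apply: addr_ge0 => //; apply: mulr_ge0; first by rewrite mulr_ge0// ltW.
have h1 : muL r * q1 <= muL r * (9 * B ^+ 2) by rewrite ler_wpM2l.
have h2 : lamL r * q2 ^+ 2 <= `|lamL r| * (9 * B ^+ 2).
  by apply: le_trans (ler_norm _) _; rewrite normrM (ger0_norm S2p) ler_wpM2l.
have h3 : 0 <= muL r * B ^+ 2 by rewrite mulr_ge0// sqr_ge0.
have h4 : 0 <= `|lamL r| * B ^+ 2 by rewrite mulr_ge0// sqr_ge0.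
move: h1 h2 h3 h4; move: (muL r * q1) (lamL r * q2 ^+ 2) (muL r) `|lamL r| (B ^+ 2) => *; nra.
Qed.

End pointwise.

Lemma collect_bounds (R : realType) (B c2 c3 c4 g1 rh W Z S h q e En N D2 Cg m : R) :
  6 * B * (2^-1 * (rh * W)) <= 6 * B * En -> 2 * c2 * (2^-1 * (rh * Z)) <= 2 * c2 * En ->
  g1 * B * h <= g1 * B * En -> rh * (c3 * q) <= N * (c3 * q) ->
  rh * (c4 * e) <= N * (c4 * e) -> rh * (S / m) <= N * (Cg * D2 / m) ->
  rh * (3 * B * W + c2 * Z + c3 * q + c4 * e + S / m) + g1 * B * h <=
  (6 * B + 2 * c2 + g1 * B) * En + N * c3 * q + N * c4 * e + N / m * Cg * D2.
Proof. lra. Qed.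

Lemma sum_affine (R : realType) n (f g : 'I_n -> R) (p q y z : R) :
  \sum_i (p * f i + q * g i + y + z) =
  p * (\sum_i f i) + q * (\sum_i g i) + n%:R * y + n%:R * z.
Proof.
by rewrite !big_split/= -!mulr_sumr !sumr_const card_ord -[y *+ n]mulr_natl -[z *+ n]mulr_natl.
Qed.

Section density.
Local Opaque dx dt divg.
Context (R : realType) (n : nat) (gamma s : R) (b : 'I_n -> 'I_n -> R) (M : 'I_n -> R).
Hypotheses (hgamma : 1 < gamma) (hs : -1 <= s) (hM : forall i, 0 <= M i).
Hypothesis fc : friction_condition b M.
Variables (T : R) (rb : 'I_n -> scalar_field R).
Hypothesis hrb : smooth_equilibrium gamma s b M rb T.
Local Notation I := `[0, T]%classic.
Local Notation a := ((s + 3) / 2).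
Local Notation kap := ((s + 1) / 2).
Local Notation U := (ubar1 gamma s b M rb).
Local Notation V := (vbar s rb).

Lemma bounded_field (f : scalar_field R) : continuous_on I f ->
  exists C, forall t x, 0 < t < T -> cell x -> `|f t x| <= C.
Proof.
move=> /continuous_on_bounded[C _ hC]; exists C => t x /andP[t0 tT] cx.
by apply: hC => //; rewrite !ltW.
Qed.

Lemma bounded_family (J : finType) (F : J -> scalar_field R) :
  (forall j, exists C, forall t x, 0 < t < T -> cell x -> `|F j t x| <= C) ->
  exists C, forall j t x, 0 < t < T -> cell x -> `|F j t x| <= C.
Proof.
move=> /choice[C hC]; exists (\big[Num.max/0]_j C j) => j t x tT cx.
exact: le_trans (hC j t x tT cx) (le_bigmax _ _ _).
Qed.

(** By the continuity equation, [eps] times the density times this field is the remainder of the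
    equilibrium momentum equation. *)
Definition inertia i k : scalar_field R := fun t x =>
  dt (U i k) t x + \sum_l U i l t x * dx l (U i k) t x.

Definition equilibrium_bound B := forall i t x, 0 < t < T -> cell x ->
  [/\ forall k, `|U i k t x| <= B /\ `|inertia i k t x| <= B,
      forall k l, `|dx l (U i k) t x| <= B,
      `|divg (U i) t x| <= B, `|divg (V i) t x| <= B &
      forall k, `|dx k (divg (U i)) t x| <= B /\ `|dx k (divg (V i)) t x| <= B].

Lemma equilibrium_bounded : exists2 B, 0 <= B & equilibrium_bound B.
Proof.
have sU i k : smooth_on I (U i k) := ubar1_smooth fc hrb i k.
have sV i k : smooth_on I (V i k) := vbar_smooth hrb i k.
have sdU i : smooth_on I (divg (U i)) := smooth_on_divg (sU i).
have sdV i : smooth_on I (divg (V i)) := smooth_on_divg (sV i).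
have bs f : smooth_on I f -> exists C, forall t x, 0 < t < T -> cell x -> `|f t x| <= C.
  by move=> sf; apply: bounded_field; exact: smooth_on_cont.
have [B1 h1] := @bounded_family _ (fun p : 'I_n * 'I_3 => U p.1 p.2) (fun p => bs _ (sU p.1 p.2)).
have [B2 h2] := @bounded_family _ (fun p : 'I_n * 'I_3 * 'I_3 => dx p.2 (U p.1.1 p.1.2))
  (fun p => bs _ (smooth_on_dx _ (sU _ _))).
have [B3 h3] := @bounded_family _ (fun i => divg (U i)) (fun i => bs _ (sdU i)).
have [B4 h4] := @bounded_family _ (fun i => divg (V i)) (fun i => bs _ (sdV i)).
have [B5 h5] := @bounded_family _ (fun p : 'I_n * 'I_3 => dx p.2 (divg (U p.1)))
  (fun p => bs _ (smooth_on_dx _ (sdU _))).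
have [B6 h6] := @bounded_family _ (fun p : 'I_n * 'I_3 => dx p.2 (divg (V p.1)))
  (fun p => bs _ (smooth_on_dx _ (sdV _))).
(* The acceleration contains a time derivative, so its bound goes through the continuous
   representative of that derivative. *)
have [p|B7 h7] := @bounded_family _ (fun p : 'I_n * 'I_3 => inertia p.1 p.2).
  have [g cg hg] := smooth_on_td (sU p.1 p.2).
  have sS : smooth_on I (fun t x => \sum_l U p.1 l t x * dx l (U p.1 p.2) t x).
    by apply: smooth_on_sum => l; apply: smooth_onM; [exact: sU|exact/smooth_on_dx/sU].
  have [C hC] := bounded_field (continuous_onD cg (smooth_on_cont sS)).
  exists C => t x tT cx; rewrite /inertia; have [_ ->] := hg t x (interior_cc tT).
  exact: hC.
pose Bs := [:: B1; B2; B3; B4; B5; B6; B7].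
have Bm j (y : R) : `|y| <= nth 0 Bs j -> `|y| <= \sum_(z <- Bs) `|z|.
  have [j7|j7] := ltnP j (size Bs); last first.
    by rewrite nth_default// => /le_trans; apply; exact: sumr_ge0.
  move=> /le_trans; apply; apply: le_trans (ler_norm _) _.
  by rewrite (big_nth 0) big_mkord (bigD1 (Ordinal j7))//= lerDl sumr_ge0.
exists (\sum_(z <- Bs) `|z|); first by apply: sumr_ge0.
move=> i t x tT cx; split=> [k|k l|||k].
- have e1 : `|U i k t x| <= B1 := h1 (i, k) t x tT cx.
  have e2 : `|inertia i k t x| <= B7 := h7 (i, k) t x tT cx.
  by split; [exact: (Bm 0%N)|exact: (Bm 6%N)].
- have e : `|dx l (U i k) t x| <= B2 := h2 (i, k, l) t x tT cx.
  exact: (Bm 1%N).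
- by have := h3 i t x tT cx; exact: (Bm 2%N).
- by have := h4 i t x tT cx; exact: (Bm 3%N).
- have e1 : `|dx k (divg (U i)) t x| <= B5 := h5 (i, k) t x tT cx.
  have e2 : `|dx k (divg (V i)) t x| <= B6 := h6 (i, k) t x tT cx.
  by split; [exact: (Bm 4%N)|exact: (Bm 5%N)].
Qed.

Variables (eps nu : R) (muL lamL : R -> R) (w : state R n).
Hypotheses (eps0 : 0 < eps) (nu0 : 0 <= nu) (lame : lame_condition muL lamL).

(** The factor of the cutoff once all tested equations and the energy inequality are added; the
    factor of minus its derivative is the relative energy density. *)
Definition density : scalar_field R := fun t x =>
  \sum_i (rho w i t x * dt (massQ gamma s b M rb eps i) t x
    + eps^-1 * \sum_k rho w i t x * vel w i k t x * dx k (massQ gamma s b M rb eps i) t x)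
  + eps * (momentum_flux gamma s eps w U t x - viscous_flux eps nu muL lamL w U t x
           - (eps ^+ 2)^-1 * friction_work b M w U t x)
  + (drift_flux eps w V t x - eps^-1 * korteweg_flux s w V t x)
  + \sum_i (\sum_k gradmu w i k t x * crossY gamma s b M rb i k t x
            + mu s (rho w i t x) * divg (crossY gamma s b M rb i) t x)
  - \sum_i (1 - gamma) * press gamma (rb i t x) * divg (U i) t x
  + (nu / eps * viscous_diss muL lamL w t x + (2 * eps ^+ 2)^-1 * friction_diss b w t x
     + (eps ^+ 2)^-1 * damping_diss M w t x).

Definition rel_energy : scalar_field R := fun t x => \sum_i
  (2^-1 * rho w i t x * sqn (fun k =>
        mom w i k t x / rho w i t x - mbar gamma s b M rb eps i k t x / rb i t x)
   + 2^-1 * rho w i t x * sqn (fun k =>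
        dmom w i k t x / rho w i t x - Jbar s rb i k t x / rb i t x)
   + relative (henergy gamma) (rho w i t x) (rb i t x)).

Lemma rel_energy_vel t x : I t -> (forall i, 0 < rho w i t x) -> rel_energy t x = \sum_i
  (2^-1 * (rho w i t x * sqn (fun k => vel w i k t x - eps * U i k t x))
   + 2^-1 * (rho w i t x * sqn (fun k => drift w i k t x - V i k t x))
   + relative (henergy gamma) (rho w i t x) (rb i t x)).
Proof.
move=> It r0; apply: eq_bigr => i _.
have rb0 : rb i t x != 0 by rewrite gt_eqF// (rb_gt0 hrb).
have ri : rho w i t x != 0 by rewrite gt_eqF.
rewrite -!mulrA; congr (_ * (_ * _) + _ * (_ * _) + _); apply: eq_bigr => k _.
  by rewrite /mom /mbar ubarE; congr (_ ^+ 2); field; rewrite rb0 ri.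
by rewrite /dmom /Jbar; congr (_ ^+ 2); field; rewrite rb0 ri.
Qed.

(** Expanding the squares separates the energy from terms linear in the unknowns. Since r h'(r) -
    h(r) equals the pressure, the part free of the unknowns is the pressure of the equilibrium. *)
Lemma rel_energy_eta t x : I t -> (forall i, 0 < rho w i t x) -> rel_energy t x =
  eta_state gamma w t x - \sum_i rho w i t x * massQ gamma s b M rb eps i t x
  - eps * (\sum_i \sum_k mom w i k t x * U i k t x)
  - \sum_i \sum_k dmom w i k t x * V i k t x
  + \sum_i press gamma (rb i t x).
Proof.
move=> It r0; rewrite rel_energy_vel// eta_stateE mulr_sumr -!sumrB -big_split/=.
apply: eq_bigr => i _; have rb0 : 0 < rb i t x by apply: (rb_gt0 hrb).
rewrite /relative derive1_henergy// /massQ /press /henergy /mom /dmom /sqn !sum3E.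
have -> : rb i t x `^ gamma = rb i t x * rb i t x `^ (gamma - 1) by rewrite powR_step.
have g0 : gamma - 1 != 0 by rewrite subr_eq0 gt_eqF.
move: (rho w i t x) (rb i t x) (rb i t x `^ _) (rho w i t x `^ _) {rb0} => rh r p q.
move: (vel w i 0 t x) (vel w i 1 t x) (vel w i 2%:R t x) => u0 u1 u2.
move: (drift w i 0 t x) (drift w i 1 t x) (drift w i 2%:R t x) => v0 v1 v2.
move: (U i 0 t x) (U i 1 t x) (U i 2%:R t x) (V i 0 t x) (V i 1 t x) (V i 2%:R t x) => U0 U1 U2 V0 V1 V2.
by field.
Qed.

Variables (kst N B L c : R).
Hypotheses (hB : equilibrium_bound B) (k0 : 0 < kst) (L0 : 0 <= L) (c0 : 0 < c).
Hypothesis hL : forall i t x rh, 0 < t < T -> cell x -> kst <= rh <= N ->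
  `|mu_deriv s rh - mu_deriv s (rb i t x)| <= L * `|rh - rb i t x|.
Hypothesis hc : forall i t x rh, 0 < t < T -> cell x -> kst <= rh <= N ->
  c * (rh - rb i t x) ^+ 2 <= relative (henergy gamma) rh (rb i t x).
Variables (Mh bb : R).
Hypotheses (Mh0 : 0 < Mh) (MhM : forall i, Mh <= M i) (hbb : forall i j, `|b i j| <= bb).

(** Apart from friction and viscosity the species decouple, and for each one [species_identity]
    applies: its hypotheses are the equilibrium relations, the proportionality of lambda to mu, and
    grad mu(rho) = rho v. *)
Lemma density_species t x : 0 < t < T -> (forall i, 0 < rho w i t x) ->
  (forall i k, gradmu w i k t x = rho w i t x * drift w i k t x) ->
  (forall i k, gradlam w i k t x = (s + 1) * gradmu w i k t x) ->
  density t x =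
  \sum_i (eps^-1 * rho w i t x * (\sum_k (vel w i k t x - eps * U i k t x) *
         (eps ^+ 2 * inertia i k t x
      - kap * (drift w i k t x - V i k t x) * divg (V i) t x
      - (mu_deriv s (rho w i t x) - mu_deriv s (rb i t x)) * dx k (divg (V i)) t x - friction gamma s b M rb i k t x))
  + rho w i t x * (\sum_k \sum_l (vel w i k t x - eps * U i k t x) * (vel w i l t x - eps * U i l t x) * dx l (U i k) t x
     + \sum_k \sum_l (drift w i k t x - V i k t x) * (drift w i l t x - V i l t x) * dx l (U i k) t x
      + kap * (\sum_k (drift w i k t x - V i k t x) * (drift w i k t x - V i k t x)) * divg (U i) t x
     + (mu_deriv s (rho w i t x) - mu_deriv s (rb i t x)) * (\sum_k (drift w i k t x - V i k t x) * dx k (divg (U i)) t x))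
  + (gamma - 1) * relative (henergy gamma) (rho w i t x) (rb i t x) * divg (U i) t x)
  - eps * ((eps ^+ 2)^-1 * friction_work b M w U t x)
  + ((2 * eps ^+ 2)^-1 * friction_diss b w t x + (eps ^+ 2)^-1 * damping_diss M w t x)
  + (nu / eps * viscous_diss muL lamL w t x - eps * viscous_flux eps nu muL lamL w U t x).
Proof.
move=> tT r0 hgm hgl.
pose Sp i := (rho w i t x * dt (massQ gamma s b M rb eps i) t x
    + eps^-1 * \sum_k rho w i t x * vel w i k t x * dx k (massQ gamma s b M rb eps i) t x)
  + eps * (\sum_k mom w i k t x * dt (U i k) t x
     + eps^-1 * (\sum_k \sum_l rho w i t x * vel w i k t x * vel w i l t x
                   * dx l (U i k) t x)
     + eps^-1 * (press gamma (rho w i t x) * divg (U i) t x)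
     + eps^-1 * (mu s (rho w i t x)
                   * \sum_k drift w i k t x * dx k (divg (U i)) t x)
     + eps^-1 * (\sum_k gradmu w i k t x
                   * \sum_l dx l (U i k) t x * drift w i l t x)
     + (2 * eps)^-1 * ((\sum_k gradlam w i k t x * drift w i k t x)
                   * divg (U i) t x)
     + (2 * eps)^-1 * (lambda s (rho w i t x)
                   * \sum_k drift w i k t x * dx k (divg (U i)) t x))
  + (\sum_k dmom w i k t x * dt (V i k) t x
     + eps^-1 * (\sum_k \sum_l rho w i t x * drift w i k t x * vel w i l t x
                   * dx l (V i k) t x)
     - eps^-1 * (mu s (rho w i t x) * (\sum_k vel w i k t x * dx k (divg (V i)) t x)
     + \sum_k gradmu w i k t x * (\sum_l dx l (V i k) t x * vel w i l t x)
     + 2^-1 * ((\sum_k gradlam w i k t x * vel w i k t x) * divg (V i) t x)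
     + 2^-1 * (lambda s (rho w i t x)
                 * \sum_k vel w i k t x * dx k (divg (V i)) t x)))
  + (\sum_k gradmu w i k t x * crossY gamma s b M rb i k t x
            + mu s (rho w i t x) * divg (crossY gamma s b M rb i) t x)
  - (1 - gamma) * press gamma (rb i t x) * divg (U i) t x.
have -> : density t x = \sum_i Sp i
  - eps * ((eps ^+ 2)^-1 * friction_work b M w U t x)
  + ((2 * eps ^+ 2)^-1 * friction_diss b w t x + (eps ^+ 2)^-1 * damping_diss M w t x)
  + (nu / eps * viscous_diss muL lamL w t x - eps * viscous_flux eps nu muL lamL w U t x).
  have lin (A1 A2 A3 A4 A5 A6 : 'I_n -> R) v f q1 q2 q3 :
      \sum_i A1 i + eps * (\sum_i A2 i - v - f) + (\sum_i A3 i - eps^-1 * \sum_i A4 i)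
      + \sum_i A5 i - \sum_i A6 i + (q1 + q2 + q3) =
      \sum_i (A1 i + eps * A2 i + (A3 i - eps^-1 * A4 i) + A5 i - A6 i)
      - eps * f + (q2 + q3) + (q1 - eps * v).
    by rewrite !(sumrB, big_split)/= -!mulr_sumr; ring.
  by rewrite /density /momentum_flux /drift_flux /korteweg_flux lin.
congr (_ - _ + _ + _); apply: eq_bigr => i _.
have It := inI tT; have rb0 := rb_gt0 hrb i x It.
have e0 : eps != 0 by rewrite gt_eqF.
have g0 : gamma != 0 by rewrite gt_eqF// (lt_trans ltr01).
have kp0 : 1 + kap != 0 by rewrite gt_eqF//; have := hs; lra.
have hlam : lambda s (rho w i t x) = 2 * kap * mu s (rho w i t x).
  by rewrite lambdaE//; field.
have hmu : (1 + kap) * mu s (rho w i t x) = rho w i t x * mu_deriv s (rho w i t x).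
  by rewrite /mu -(powR_step _ (r0 i)) /mu_deriv; field.
have hph : gamma * rb i t x `^ (gamma - 2) * rb i t x * rb i t x = gamma * press gamma (rb i t x).
  rewrite /press -(powR_step gamma rb0) -(powR_step (gamma - 1) rb0).
  by have -> : gamma - 1 - 1 = gamma - 2 by [ring]; ring.
have E := @species_identity R eps gamma kap (rho w i t x) (rb i t x)
  (mu_deriv s (rho w i t x)) (mu_deriv s (rb i t x)) (mu s (rho w i t x)) (lambda s (rho w i t x))
  (press gamma (rho w i t x)) (press gamma (rb i t x)) (gamma * rb i t x `^ (gamma - 2))
  (dt (rb i) t x) (divg (U i) t x) (divg (V i) t x)
  (fun k => vel w i k t x) (fun k => drift w i k t x) (fun k => U i k t x) (fun k => V i k t x)
  (fun k => vel w i k t x - eps * U i k t x) (fun k => drift w i k t x - V i k t x)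
  (fun k => gradmu w i k t x) (fun k => gradlam w i k t x) (fun k => gradh gamma rb i k t x)
  (fun k => dx k (rb i) t x) (fun k => friction gamma s b M rb i k t x)
  (fun k => dt (U i k) t x) (fun k => dt (V i k) t x) (fun k => dx k (divg (U i)) t x)
  (fun k => dx k (divg (V i)) t x) (fun k => crossY gamma s b M rb i k t x)
  (fun k l => dx l (U i k) t x) (fun k l => dx l (V i k) t x) e0 g0 kp0
  (fun=> erefl) (fun=> erefl) (fun k => hgm i k) _ hlam hmu (divgE _ _ _) (divgE _ _ _)
  (dt_rb fc hrb i x tT) (fun=> erefl) hph (fun k => dt_vbar fc hrb i k x tT)
  (fun k l => dx_vbar_sym hrb i k l x tT) _ (fun=> erefl).
have hgl' k : gradlam w i k t x = 2 * kap * (rho w i t x * drift w i k t x).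
  by rewrite hgl hgm; field.
have hfr k := equilibrium_momentum fc hrb i k x tT.
have {}E := E hgl' hfr.
have hQ k : dx k (massQ gamma s b M rb eps i) t x = gradh gamma rb i k t x
   - eps ^+ 2 * (\sum_j U i j t x * dx k (U i j) t x) - \sum_j V i j t x * dx k (V i j) t x.
  exact: (dx_massQ fc hrb eps hgamma i k x It).
have S1 : \sum_k rho w i t x * vel w i k t x * dx k (massQ gamma s b M rb eps i) t x =
  \sum_k rho w i t x * vel w i k t x * (gradh gamma rb i k t x
   - eps ^+ 2 * (\sum_j U i j t x * dx k (U i j) t x) - \sum_j V i j t x * dx k (V i j) t x).
  by apply: eq_bigr => k _; rewrite hQ.
have hY : divg (crossY gamma s b M rb i) t x = (1 + kap) *
   \sum_l (U i l t x * dx l (divg (V i)) t x - V i l t x * dx l (divg (U i)) t x).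
  by rewrite (divg_crossY fc hrb i x tT); congr (_ * _); field.
rewrite /Sp S1 (dt_massQ fc hrb eps hgamma i x tT) hY.
apply: etrans E _.
have -> : (gamma - 1) * relative (henergy gamma) (rho w i t x) (rb i t x) =
  press gamma (rho w i t x) - press gamma (rb i t x)
  - gamma * rb i t x `^ (gamma - 2) * rb i t x * (rho w i t x - rb i t x).
  rewrite relative_henergyE//; congr (_ - _ - _ * _).
  rewrite -(powR_step (gamma - 1) rb0); have -> : gamma - 1 - 1 = gamma - 2 by ring.
  by ring.
by [].
Qed.

Lemma viscous_density_ge t x : 0 < t < T -> cell x -> (forall i, 0 < rho w i t x) ->
  - (5 * B ^+ 2 * nu * eps * \sum_i (muL (rho w i t x) + `|lamL (rho w i t x)|)) <=
  nu / eps * viscous_diss muL lamL w t x - eps * viscous_flux eps nu muL lamL w U t x.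
Proof.
move=> tT cx r0; rewrite /viscous_diss /viscous_flux !mulr_sumr -sumrN -sumrB.
apply: ler_sum => i _.
have [_ hd _ _ _] := hB i tT cx.
apply: (@viscous_ge R eps nu B (rho w i t x) muL lamL (fun k l => Dvel w i k l t x)
  (fun k l => symgrad (U i) k l t x)) => //.
- exact: ltW.
- by rewrite divgE; apply: eq_bigr => k _; rewrite /symgrad; move: (dx _ _ _ _) => y; field.
- move=> k l; rewrite /symgrad normrM [`|2^-1|]ger0_norm// ler_pdivrMr//.
  apply: le_trans (ler_normD _ _) _; apply: le_trans (lerD (hd k l) (hd l k)) _.
  by rewrite mulr_natr mulr2n.
Qed.

Let Cg : R := 12 * n%:R * bb ^+ 2 * B ^+ 2.
Let c2 : R := 3 * B + kap * B + 1 + kap ^+ 2 * B ^+ 2 / Mh.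
Let c3 : R := 3 * L ^+ 2 * B ^+ 2 + 3 * L ^+ 2 * B ^+ 2 / Mh.
Let c4 : R := 3 * B ^+ 2 / Mh.

(** The coefficients 6 B and 2 [c2] undo the factor 1/2 in the two kinetic parts, and (gamma - 1) B
    comes from the relative pressure. Squared density differences are converted to relative internal
    energy through division by [c]; the friction error sees the differences of all species, once for
    each species, whence the factor n. *)
Definition growth_rate : R :=
  6 * B + 2 * c2 + (gamma - 1) * B + (N * c3 + n%:R * (N / Mh * Cg)) / c.

(** The coefficient of eps^4: for each species, the squared acceleration of the equilibrium left
    over by Young's inequality, weighted by the largest density. *)
Definition residual_rate : R := n%:R * (N * c4).

Hypotheses (B0 : 0 <= B) (N0 : 0 <= N).

(** Three estimates are put together: the viscous deficit, the friction identity, whose relative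
    dissipation is nonnegative, and the estimate for each species, which consumes the relative
    damping. The velocity differences are then measured by the relative energy. *)
Lemma density_ge t x : 0 < t < T -> cell x -> (forall i, kst <= rho w i t x <= N) ->
  (forall i k, gradmu w i k t x = rho w i t x * drift w i k t x) ->
  (forall i k, gradlam w i k t x = (s + 1) * gradmu w i k t x) ->
  - (growth_rate * rel_energy t x + residual_rate * eps ^+ 4
     + 5 * B ^+ 2 * nu * eps * \sum_i (muL (rho w i t x) + `|lamL (rho w i t x)|)) <=
  density t x.
Proof.
move=> tT cx hkN hgm hgl.
have r0 i : 0 < rho w i t x by have /andP[h _] := hkN i; exact: lt_le_trans h.
have rN i : rho w i t x <= N by have /andP[] := hkN i.
rewrite density_species//; have := viscous_density_ge tT cx r0.
set vd := (nu / eps * _ - _); move=> hvd.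
pose W i k := vel w i k t x - eps * U i k t x.
pose Z i k := drift w i k t x - V i k t x.
pose G i k := \sum_j b i j * (rho w j t x - rb j t x) * (U i k t x - U j k t x).
pose H i := relative (henergy gamma) (rho w i t x) (rb i t x).
pose D2 := \sum_j (rho w j t x - rb j t x) ^+ 2.
have hH i : c * (rho w i t x - rb i t x) ^+ 2 <= H i by exact: hc.
have H0 i : 0 <= H i by apply: le_trans (hH i); rewrite mulr_ge0 ?sqr_ge0// ltW.
have kp : 0 <= kap by rewrite divr_ge0//; have := hs; lra.
have g10 : 0 <= gamma - 1 by rewrite subr_ge0 ltW.
have Es : rel_energy t x = \sum_i (2^-1 * (rho w i t x * sqn (W i)) + 2^-1 * (rho w i t x * sqn (Z i)) + H i).
  by rewrite rel_energy_vel//; exact: inI tT.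
have SW i : 0 <= sqn (W i) by apply: sumr_ge0 => k _; exact: sqr_ge0.
have SZ i : 0 <= sqn (Z i) by apply: sumr_ge0 => k _; exact: sqr_ge0.
have hD2 : c * D2 <= rel_energy t x.
  rewrite Es /D2 mulr_sumr; apply: ler_sum => i _; apply: le_trans (hH i) _.
  by rewrite lerDr addr_ge0// mulr_ge0// mulr_ge0// ltW.
have hG i : sqn (G i) <= Cg * D2.
  by apply: friction_error_le => // j k; have [/(_ k)[]] := hB j tT cx.
have fi := @friction_identity R n eps b M (fun i => rho w i t x) (fun i => rb i t x)
  (fun i k => vel w i k t x) (fun i k => U i k t x) W (fun i k => friction gamma s b M rb i k t x)
  (lt0r_neq0 eps0) (friction_sym fc) (fun _ _ => erefl) (fun _ _ => erefl).
have sp i := @species_ge R eps Mh B L kap (gamma - 1) (rho w i t x) (rb i t x)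
  (mu_deriv s (rho w i t x)) (mu_deriv s (rb i t x)) (H i) (divg (U i) t x) (divg (V i) t x) (W i) (Z i)
  (fun k => inertia i k t x) (G i) (fun k => dx k (divg (U i)) t x) (fun k => dx k (divg (V i)) t x)
  (fun k l => dx l (U i k) t x) eps0 Mh0 (ltW (r0 i)) kp L0 g10 (H0 i) (hL i tT cx (hkN i)).
have {}sp i := sp i (let: And5 _ _ p _ _ := hB i tT cx in p)
  (let: And5 _ _ _ p _ := hB i tT cx in p)
  (fun k => (let: And5 p _ _ _ _ := hB i tT cx in (p k).2))
  (fun k => (let: And5 _ _ _ _ p := hB i tT cx in (p k).1))
  (fun k => (let: And5 _ _ _ _ p := hB i tT cx in (p k).2))
  (let: And5 _ p _ _ _ := hB i tT cx in p).
pose X i k := eps ^+ 2 * inertia i k t x - kap * Z i k * divg (V i) t x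
   - (mu_deriv s (rho w i t x) - mu_deriv s (rb i t x)) * dx k (divg (V i)) t x.
pose Q i := rho w i t x * (\sum_k \sum_l W i k * W i l * dx l (U i k) t x
     + \sum_k \sum_l Z i k * Z i l * dx l (U i k) t x
      + kap * sqn (Z i) * divg (U i) t x
     + (mu_deriv s (rho w i t x) - mu_deriv s (rb i t x)) * (\sum_k Z i k * dx k (divg (U i)) t x)).
have sq i : \sum_k Z i k * Z i k = sqn (Z i) by apply: eq_bigr => k _; rewrite expr2.
set lhs := (X in _ <= X - _ + _ + _).
(* The friction error [G] is inserted and subtracted so that the same use of Young's inequality
   covers it; the subtracted copy cancels the error term of [friction_identity]. *)
have -> : lhs = \sum_i (eps^-1 * rho w i t x * (\sum_k W i k * (X i k + G i k)) + Q i
     + (gamma - 1) * H i * divg (U i) t x)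
   - eps^-1 * (\sum_i rho w i t x * \sum_k W i k * friction gamma s b M rb i k t x)
   - eps^-1 * (\sum_i rho w i t x * \sum_k W i k * G i k).
  have lin (A1 A2 A3 A4 : 'I_n -> R) q : (forall i, A1 i = A2 i - q * A3 i - q * A4 i) ->
      \sum_i A1 i = \sum_i A2 i - q * (\sum_i A3 i) - q * (\sum_i A4 i).
    by move=> h; rewrite (eq_bigr _ (fun i _ => h i)) !sumrB -!mulr_sumr.
  apply: lin => i.
  have -> : \sum_k W i k * (X i k + G i k) = \sum_k W i k * X i k + \sum_k W i k * G i k.
    by rewrite -big_split; apply: eq_bigr => k _; rewrite mulrDr.
  have -> : \sum_k (vel w i k t x - eps * U i k t x) *
         (eps ^+ 2 * inertia i k t x
      - kap * (drift w i k t x - V i k t x) * divg (V i) t x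
      - (mu_deriv s (rho w i t x) - mu_deriv s (rb i t x)) * dx k (divg (V i)) t x - friction gamma s b M rb i k t x)
    = \sum_k W i k * X i k - \sum_k W i k * friction gamma s b M rb i k t x.
    by rewrite -sumrB; apply: eq_bigr => k _; exact: mulrBr.
  rewrite /Q -sq /H.
  by move: (\sum_k _ * X _ _) (\sum_k _ * G _ _) (\sum_k _ * friction _ _ _ _ _ _ _ _ _) => y1 y2 y3; ring.
pose FW := \sum_i \sum_j b i j * rho w i t x * rho w j t x * sqn (fun k => W i k - W j k).
pose DW := \sum_i M i * rho w i t x * sqn (W i).
pose SF := \sum_i rho w i t x * \sum_k W i k * friction gamma s b M rb i k t x.
pose SG := \sum_i rho w i t x * \sum_k W i k * G i k.
have {}fi : (2 * eps ^+ 2)^-1 * friction_diss b w t x + (eps ^+ 2)^-1 * damping_diss M w t x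
  - eps * ((eps ^+ 2)^-1 * friction_work b M w U t x) - eps^-1 * SF =
  (2 * eps ^+ 2)^-1 * FW + (eps ^+ 2)^-1 * DW + eps^-1 * SG := fi.
have FW0 : 0 <= (2 * eps ^+ 2)^-1 * FW.
  apply: mulr_ge0; first by rewrite invr_ge0 mulr_ge0// sqr_ge0.
  apply: sumr_ge0 => i _; apply: sumr_ge0 => j _; rewrite -!mulrA; apply: (friction_ge0 fc).
    by apply: mulr_ge0; [exact: ltW|apply: mulr_ge0; [exact: ltW|apply: sumr_ge0 => k _; exact: sqr_ge0]].
  by move=> ->; rewrite /sqn big1 ?mulr0// => k _; rewrite subrr expr0n.
have DW0 : \sum_i (eps ^+ 2)^-1 * (Mh * rho w i t x * sqn (W i)) <= (eps ^+ 2)^-1 * DW.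
  rewrite /DW mulr_sumr; apply: ler_sum => i _.
  apply: ler_wpM2l; first by rewrite invr_ge0 sqr_ge0.
  by apply: ler_wpM2r => //; apply: ler_wpM2r => //; exact: ltW.
pose LB i := rho w i t x * (3 * B * sqn (W i) + c2 * sqn (Z i)
       + c3 * (rho w i t x - rb i t x) ^+ 2 + c4 * eps ^+ 4 + sqn (G i) / Mh) + (gamma - 1) * B * H i.
pose Dn i := eps^-1 * rho w i t x * (\sum_k W i k * (X i k + G i k)) + Q i + (gamma - 1) * H i * divg (U i) t x.
have hsum : - (\sum_i LB i) <= \sum_i (eps ^+ 2)^-1 * (Mh * rho w i t x * sqn (W i)) + \sum_i Dn i.
  rewrite -sumrN -big_split; apply: ler_sum => i _; apply: le_trans (sp i) _.
  by rewrite /Dn /= !addrA.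
suff hLB : \sum_i LB i <= growth_rate * rel_energy t x + residual_rate * eps ^+ 4.
  rewrite -/Dn -/SF -/SG; move: hLB hsum DW0 FW0 fi hvd.
  move: (\sum_i LB i) (\sum_i Dn i) (\sum_i (eps ^+ 2)^-1 * _) (5 * _ * _ * _ * _) (eps^-1 * SF) (eps^-1 * SG).
  move: ((2 * eps ^+ 2)^-1 * FW) ((eps ^+ 2)^-1 * DW) (eps * _) ((2 * eps ^+ 2)^-1 * _) ((eps ^+ 2)^-1 * _).
  move: (growth_rate * _) (residual_rate * _) vd => *; lra.
have c2p : 0 <= c2.
  apply: addr_ge0; last by apply: divr_ge0; [apply: mulr_ge0; exact: sqr_ge0|exact: ltW].
  apply: addr_ge0 => //; apply: addr_ge0; exact: mulr_ge0.
have c3p : 0 <= c3.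
  have q : 0 <= 3 * L ^+ 2 * B ^+ 2 by apply: mulr_ge0; [apply: mulr_ge0 => //|]; exact: sqr_ge0.
  by apply: addr_ge0 => //; apply: divr_ge0 => //; exact: ltW.
have c4p : 0 <= c4 by apply: divr_ge0; [apply: mulr_ge0 => //; exact: sqr_ge0|exact: ltW].
have D20 : 0 <= D2 by apply: sumr_ge0 => i _; exact: sqr_ge0.
pose k1 := 6 * B + 2 * c2 + (gamma - 1) * B.
pose En i := 2^-1 * (rho w i t x * sqn (W i)) + 2^-1 * (rho w i t x * sqn (Z i)) + H i.
have hLBi i : LB i <= k1 * En i + N * c3 * (rho w i t x - rb i t x) ^+ 2 + N * c4 * eps ^+ 4
    + N / Mh * Cg * D2.
  have x0 : 0 <= 2^-1 * (rho w i t x * sqn (W i)) by rewrite mulr_ge0// mulr_ge0// ltW.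
  have y0 : 0 <= 2^-1 * (rho w i t x * sqn (Z i)) by rewrite mulr_ge0// mulr_ge0// ltW.
  have e1 : 6 * B * (2^-1 * (rho w i t x * sqn (W i))) <= 6 * B * En i.
    by apply: ler_wpM2l; [rewrite mulr_ge0|rewrite /En -addrA lerDl addr_ge0].
  have e2 : 2 * c2 * (2^-1 * (rho w i t x * sqn (Z i))) <= 2 * c2 * En i.
    by apply: ler_wpM2l; [rewrite mulr_ge0|rewrite /En addrAC lerDr addr_ge0].
  have e3 : (gamma - 1) * B * H i <= (gamma - 1) * B * En i.
    by apply: ler_wpM2l; [rewrite mulr_ge0|rewrite /En lerDr addr_ge0].
  have e4 : rho w i t x * (c3 * (rho w i t x - rb i t x) ^+ 2) <= N * (c3 * (rho w i t x - rb i t x) ^+ 2).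
    by apply: ler_wpM2r => //; rewrite mulr_ge0// sqr_ge0.
  have e5 : rho w i t x * (c4 * eps ^+ 4) <= N * (c4 * eps ^+ 4).
    by apply: ler_wpM2r => //; rewrite mulr_ge0// exprn_ge0// ltW.
  have e6 : rho w i t x * (sqn (G i) / Mh) <= N * (Cg * D2 / Mh).
    apply: ler_pM => //; first exact: ltW.
      by apply: divr_ge0; [apply: sumr_ge0 => k _; exact: sqr_ge0|exact: ltW].
    by rewrite ler_pM2r ?invr_gt0.
  exact: collect_bounds e1 e2 e3 e4 e5 e6.
apply: le_trans (ler_sum _ (fun i _ => hLBi i)) _.
rewrite sum_affine -/D2; have -> : \sum_i En i = rel_energy t x by rewrite Es.
rewrite /growth_rate /residual_rate -/k1.
have nN : 0 <= N * c3 + n%:R * (N / Mh * Cg).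
  have Cg0 : 0 <= Cg.
    by apply: mulr_ge0; [apply: mulr_ge0; [exact: mulr_ge0|exact: sqr_ge0]|exact: sqr_ge0].
  by apply: addr_ge0; [exact: mulr_ge0|do 2!(apply: mulr_ge0 => //); apply: divr_ge0 => //; exact: ltW].
have e7 : (N * c3 + n%:R * (N / Mh * Cg)) * D2 <= (N * c3 + n%:R * (N / Mh * Cg)) * (rel_energy t x / c).
  by apply: ler_wpM2l => //; rewrite ler_pdivlMr// mulrC.
have -> : (k1 + (N * c3 + n%:R * (N / Mh * Cg)) / c) * rel_energy t x =
   k1 * rel_energy t x + (N * c3 + n%:R * (N / Mh * Cg)) * (rel_energy t x / c) by ring.
have -> : k1 * rel_energy t x + N * c3 * D2 + n%:R * (N * c4 * eps ^+ 4) + n%:R * (N / Mh * Cg * D2) =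
  k1 * rel_energy t x + (N * c3 + n%:R * (N / Mh * Cg)) * D2 + n%:R * (N * c4) * eps ^+ 4 by ring.
by rewrite lerD2r lerD2l.
Qed.

End density.
Local Transparent dx dt divg.

(** * The relative energy inequality *)

Lemma Lp_norm1E (R : realType) (f : coords R -> R) :
  Lp_norm 1 f = (\int[leb3 R]_(x in @cell R) `|(f x)%:E|)%E.
Proof.
rewrite /Lp_norm Lnorm1 [RHS]integral_mkcond; apply: eq_integral => x _.
rewrite /patch /= indicE; case: (x \in _); first by rewrite mulr1.
by rewrite mulr0 normr0.
Qed.

Section ae_combinators.
Context d (X : measurableType d) (R : realType) (m : {measure set X -> \bar R}).
Implicit Types (D : set X).

Lemma ae_fin_all (J : finType) D (P : J -> X -> Prop) :
  (forall j, {ae m, forall x, D x -> P j x}) -> {ae m, forall x, D x -> forall j, P j x}.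
Proof.
move=> mP.
have H (k : nat) : m.-negligible
  (if insub k is Some q then ~` [set x | D x -> P (enum_val (q : 'I_#|J|)) x] else set0).
  by case: (insub k) => [q|]; [exact: mP|exact: negligible_set0].
apply: negligibleS (negligible_bigcup H) => x /= /not_implyP[Dx /existsNP[j nP]].
exists (val (enum_rank j)) => //; rewrite valK; apply/not_implyP; split=> //.
by rewrite enum_rankK.
Qed.

Lemma ae_and3 D (P1 P2 P3 : X -> Prop) : {ae m, forall x, D x -> P1 x} ->
  {ae m, forall x, D x -> P2 x} -> {ae m, forall x, D x -> P3 x} ->
  {ae m, forall x, D x -> [/\ P1 x, P2 x & P3 x]}.
Proof.
move=> h1 h2 h3; apply: negligibleS (negligibleU (negligibleU h1 h2) h3) => x /= H.
have [p1|] := pselect (D x -> P1 x); last by left; left.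
have [p2|] := pselect (D x -> P2 x); last by left; right.
right=> p3; apply: H => Dx; split; [exact: p1|exact: p2|exact: p3].
Qed.

End ae_combinators.

Section slab_bounds.
Context (R : realType).
Variable T : R.
Hypothesis T0 : 0 < T.
Implicit Types (f g : scalar_field R) (t : R) (x : coords R).
Local Notation OT := (`]0, T[%classic `*` @cell R : set (measurableTypeR R * mcoords R)).
Let mI : measurable (`]0, T[%classic : set (measurableTypeR R)).
Proof. exact: measurable_itv. Qed.

Lemma integrable_on_dominated f g : measurable_on `]0, T[ f -> integrable_on `]0, T[ g ->
  {ae leb4 R, forall z : R * coords R, OT z -> `|f z.1 z.2| <= g z.1 z.2} ->
  integrable_on `]0, T[ f.
Proof.
move=> mf gi fg; apply/integrable_onP/integrableP; split; first exact: measurable_onE.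
have /integrable_onP/integrableP[mg] := gi; apply: le_lt_trans.
apply: ae_ge0_le_integral => //; first exact: measurable_OT.
- by apply: measurableT_comp => //; exact: measurable_onE.
- exact: measurableT_comp.
- apply: ae_sub fg _ => -[t x] h Dz; rewrite /= lee_fin.
  exact: le_trans (h Dz) (ler_norm _).
Qed.

Lemma integrable_on_bounded_ae f C : measurable_on `]0, T[ f ->
  {ae leb4 R, forall z : R * coords R, OT z -> `|f z.1 z.2| <= C} ->
  integrable_on `]0, T[ f.
Proof.
move=> mf fC; apply: (@integrable_on_dominated _ (fun _ _ => C)) => //.
by apply: (continuous_on_integrable T0); exact: (@continuous_on_cst R _ C).
Qed.

Lemma Linf_L1_slab f E : 0 <= E -> Linf_Lp_le T 1 f E ->
  integrable_on `]0, T[ f /\ (slab_int T (fun t x => `|f t x|)%R <= (E * T)%:E)%E.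
Proof.
move=> E0 [mf fE].
have mabs : measurable_fun OT (fun z => (`|f z.1 z.2|)%:E).
  by apply: (measurable_onE (f := fun t x => `|f t x|)); apply: measurable_on_comp.
have le : (slab_int T (fun t x => `|f t x|)%R <= (E * T)%:E)%E.
  apply: (@le_trans _ _ (\int[lebesgue_measure]_(t in `]0%R, T[) E%:E)%E).
    apply: (@tonelli_rect_le _ _ _ _ R lebesgue_measure (leb3 R) _ _ mI (@measurable_cell R) _ _ mabs) => //.
    apply: ae_sub fE _ => t ht; rewrite /= in_itv/= => tT.
    by have := ht tT; rewrite Lp_norm1E.
  by rewrite integral_cst//= lebesgue_measure_itv/= lte_fin T0 oppr0 adde0 -EFinM.
split=> //; apply/integrable_onP/integrableP; split; first exact: measurable_onE.
by apply: le_lt_trans le _; exact: ltry.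
Qed.

End slab_bounds.

Section relative_energy.
Local Opaque dx dt divg.
Context (R : realType) (n : nat) (gamma s : R) (b : 'I_n -> 'I_n -> R) (M : 'I_n -> R).
Hypotheses (hgamma : 1 < gamma) (hs : -1 <= s) (hM : forall i, 0 <= M i).
Hypothesis fc : friction_condition b M.
Variables (T : R) (rb : 'I_n -> scalar_field R).
Hypothesis T0 : 0 < T.
Hypothesis hrb : smooth_equilibrium gamma s b M rb T.
Local Notation I := `[0, T]%classic.
Local Notation OT := (`]0, T[%classic `*` @cell R : set (measurableTypeR R * mcoords R)).
Local Notation U := (ubar1 gamma s b M rb).
Local Notation V := (vbar s rb).
Local Notation Q := (massQ gamma s b M rb).

Let sU i k : smooth_on I (U i k) := ubar1_smooth fc hrb i k.
Let sV i k : smooth_on I (V i k) := vbar_smooth hrb i k.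
Let pU i k : periodic_on I (U i k) := @ubar1_periodic _ _ _ _ _ _ _ _ hrb i k.
Let pV i k : periodic_on I (V i k) := @vbar_periodic _ _ _ _ _ _ _ _ hrb i k.

Variables (eps nu : R) (muL lamL : R -> R) (w : state R n).
Hypotheses (eps0 : 0 < eps) (nu0 : 0 <= nu) (lame : lame_condition muL lamL).
Hypothesis ws : weak_solution gamma s b M eps nu muL lamL w.
Hypothesis ds : dissipative gamma b M eps nu muL lamL w.
Variable K : R.
Hypothesis hK : mass_energy_le gamma T K w.
Variable E : R.
Hypothesis E0 : 0 <= E.
Hypothesis hE : forall i, Linf_Lp_le T 1 (fun t x => lamL (rho w i t x)) E /\
  Linf_Lp_le T 1 (fun t x => muL (rho w i t x)) E.
Variables (kst N : R).
Hypothesis k0 : 0 < kst.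
Hypothesis bnd : forall i, {ae @leb4 R, forall z : R * coords R,
            0 < z.1 < T -> cell z.2 -> kst <= rho w i z.1 z.2 <= N}.

(** The combination that the tested equations produce. It agrees with [rel_energy] wherever the
    density is positive, and integrability and continuity in time can be checked on it term by
    term. *)
Definition rel_energy_affine : scalar_field R := fun t x =>
  eta_state gamma w t x - \sum_i rho w i t x * Q eps i t x
  - eps * (\sum_i \sum_k mom w i k t x * U i k t x)
  - \sum_i \sum_k dmom w i k t x * V i k t x
  + \sum_i press gamma (rb i t x).

Let ie : integrable_on `]0, T[ (eta_state gamma w) := eta_integrable T0 hgamma ws ds hK k0 bnd.

Lemma rho_integrable i : integrable_on `]0, T[ (rho w i).
Proof.
apply: (integrable_on_bounded_ae T0 (C := N)); first by have [] := state_measurable T ws i.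
apply: ae_sub (bounds_all_species bnd) _ => -[t x] h Dz /=; have /andP[h1 h2] := h Dz i.
by rewrite ger0_norm// (le_trans (ltW k0)).
Qed.

(** Since |u| <= 1/2 + u^2/2, a momentum is at most half the density plus the kinetic energy. *)
Let mom_dominated i k t x : (forall j, kst <= rho w j t x <= N) ->
  `|mom w i k t x| <= N + eta_state gamma w t x /\
  `|dmom w i k t x| <= N + eta_state gamma w t x.
Proof.
move=> hkN; have r0 j : 0 <= rho w j t x by have /andP[/(le_trans (ltW k0))] := hkN j.
have rN : rho w i t x <= N by have /andP[] := hkN i.
have sq (u : 'I_3 -> R) : 0 <= \sum_k u k * u k by apply: sumr_ge0 => l _; rewrite -expr2 sqr_ge0.
have key (u : 'I_3 -> R) : 2^-1 * (rho w i t x * \sum_k u k * u k) <= eta_state gamma w t x ->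
    `|rho w i t x * u k| <= N + eta_state gamma w t x.
  move=> h; rewrite normrM (ger0_norm (r0 i)).
  have h1 : u k * u k <= \sum_k u k * u k.
    by rewrite (bigD1 k)//= lerDl sumr_ge0// => l _; rewrite -expr2 sqr_ge0.
  have h2 : `|u k| <= 2^-1 + 2^-1 * (u k * u k).
    have := sqr_ge0 (`|u k| - 1); rewrite sqrrB expr1n mulr1 real_normK ?num_real// expr2.
    by move: (u k * u k) => q; lra.
  have h3 := ler_wpM2l (r0 i) h2; have h4 := ler_wpM2l (r0 i) h1.
  move: h h3 h4 rN (r0 i); move: (rho w i t x) (u k * u k) (\sum_k _) (eta_state _ _ _ _) (`|u k|).
  by move=> *; lra.
have hen j : 0 <= henergy gamma (rho w j t x).
  by apply: divr_ge0; [exact: powR_ge0|rewrite subr_ge0 ltW].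
have te j : 0 <= 2^-1 * (rho w j t x * \sum_k vel w j k t x * vel w j k t x)
    + 2^-1 * (rho w j t x * \sum_k drift w j k t x * drift w j k t x)
    + henergy gamma (rho w j t x).
  by rewrite !addr_ge0// mulr_ge0// mulr_ge0.
have te' : 2^-1 * (rho w i t x * \sum_k vel w i k t x * vel w i k t x)
    + 2^-1 * (rho w i t x * \sum_k drift w i k t x * drift w i k t x)
    + henergy gamma (rho w i t x) <= eta_state gamma w t x.
  by rewrite eta_stateE [leRHS](bigD1 i)//= lerDl sumr_ge0.
split; [apply: (key (fun k => vel w i k t x))|apply: (key (fun k => drift w i k t x))].
- by apply: le_trans te'; rewrite -addrA lerDl addr_ge0// mulr_ge0// mulr_ge0.
- by apply: le_trans te'; rewrite addrAC lerDr addr_ge0// mulr_ge0// mulr_ge0.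
Qed.

Lemma mom_integrable i k : integrable_on `]0, T[ (mom w i k) /\ integrable_on `]0, T[ (dmom w i k).
Proof.
have [h1 h2] := state_measurable T ws i; have [h3 h4 _] := h2 k.
have gi : integrable_on `]0, T[ (fun t x => N + eta_state gamma w t x).
  have ci : integrable_on `]0, T[ (fun _ _ => N).
    by apply: (continuous_on_integrable T0); exact: (@continuous_on_cst R _ N).
  by have [] := integrable_onD ci ie.
split; apply: (integrable_on_dominated _ gi); try exact: measurable_onM.
- apply: ae_sub (bounds_all_species bnd) _ => -[t x] h Dz /=.
  by have [] := mom_dominated i k (h Dz).
- apply: ae_sub (bounds_all_species bnd) _ => -[t x] h Dz /=.
  by have [] := mom_dominated i k (h Dz).
Qed.

Lemma rel_energy_affine_integrable : integrable_on `]0, T[ rel_energy_affine.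
Proof.
have cm f g : smooth_on I f -> integrable_on `]0, T[ g -> integrable_on `]0, T[ (fun t x => g t x * f t x).
  move=> sf gi; have := integrable_on_continuous_mul (smooth_on_cont sf) gi.
  by apply: eq_integrable_on => t x _ _; rewrite mulrC.
have i1 : integrable_on `]0, T[ (fun t x => \sum_i rho w i t x * Q eps i t x).
  by apply: integrable_on_sum => i; apply: cm; [exact: (massQ_smooth fc hrb eps i)|exact: rho_integrable].
have i2 : integrable_on `]0, T[ (fun t x => \sum_i \sum_k mom w i k t x * U i k t x).
  apply: integrable_on_sum => i; apply: integrable_on_sum => k.
  by apply: cm => //; have [] := mom_integrable i k.
have i3 : integrable_on `]0, T[ (fun t x => \sum_i \sum_k dmom w i k t x * V i k t x).
  apply: integrable_on_sum => i; apply: integrable_on_sum => k.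
  by apply: cm => //; have [] := mom_integrable i k.
have i4 : integrable_on `]0, T[ (fun t x => \sum_i press gamma (rb i t x)).
  apply: integrable_on_sum => i; apply: (continuous_on_integrable T0).
  exact/smooth_on_cont/(press_smooth hrb).
have [j1 _] := integrable_onZ (-1) i1; have [j2 _] := integrable_onZ (- eps) i2.
have [j3 _] := integrable_onZ (-1) i3.
have [a1 _] := integrable_onD ie j1; have [a2 _] := integrable_onD a1 j2.
have [a3 _] := integrable_onD a2 j3; have [a4 _] := integrable_onD a3 i4.
by apply: eq_integrable_on a4 => t x _ _; rewrite /rel_energy_affine; ring.
Qed.

Variables (a0 b0 : R).
Hypotheses (ha0 : 0 < a0) (hb0 : b0 < T).
Variables (th dth : R -> R).
Hypotheses (dthE : forall t : R, is_derive t 1 th (dth t)) (cdth : continuous dth).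
Hypotheses (th0 : forall t, ~~ (a0 <= t <= b0) -> th t = 0)
           (dth0 : forall t, ~~ (a0 <= t <= b0) -> dth t = 0).
Hypotheses (th_ge0 : forall t, 0 <= th t) (th_le1 : forall t, th t <= 1).

Let cont_time (h : R -> R) : continuous h -> continuous_on `[0, T] (fun t _ => h t).
Proof.
move=> ch; apply: continuous_continuous_on.
have -> : uncurry (fun t (_ : coords R) => h t) = h \o fst by apply/funext => -[].
by move=> z; apply: (@continuous_comp _ _ _ fst h z); [exact: cvg_fst|exact: ch].
Qed.

(** The pressure of the equilibrium is the part of the relative energy that no weak equation tests.
    By the continuity equation it satisfies dt P + div (P U) = (1 - gamma) P div U, which is
    integrated directly. *)
Lemma pressure_piece : null_slab T (fun t x =>
  dth t * (\sum_i press gamma (rb i t x))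
  + th t * (\sum_i (1 - gamma) * press gamma (rb i t x) * divg (U i) t x)).
Proof.
suff H i : null_slab T (fun t x => dth t * press gamma (rb i t x)
    + th t * ((1 - gamma) * press gamma (rb i t x) * divg (U i) t x)).
  apply: eq_null_slab (null_slab_sum (index_enum 'I_n) H) => t x _ _.
  by rewrite !mulr_sumr -big_split.
pose P : scalar_field R := fun t x => press gamma (rb i t x).
have sP : smooth_on I P := press_smooth hrb i.
have pP : periodic_on I P.
  by apply: (periodic_on_comp (fun r => r `^ gamma)); exact: (rb_periodic hrb).
have sPU l : smooth_on I (fun t x => P t x * U i l t x) by exact: smooth_onM.
have pPU l : periodic_on I (fun t x => P t x * U i l t x) by exact: periodic_onM.
have nx l : null_slab T (fun t x => th t * dx l (fun t x => P t x * U i l t x) t x).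
  split; last exact: (integral_cutf_dx T0 ha0 hb0 dthE th0 l (sPU l) (pPU l)).
  apply: (continuous_on_integrable T0); apply: continuous_onM; first exact/cont_time/(th_continuous dthE).
  exact/smooth_on_cont/smooth_on_dx.
have nt : null_slab T (fun t x => dth t * P t x + th t * dt P t x).
  split; last exact: (integral_cutf_dt T0 ha0 hb0 dthE cdth th0 dth0 sP).
  have [g cg hg] := smooth_on_td sP.
  apply: (@eq_integrable_on _ _ (fun t x => dth t * P t x + th t * g t x)).
    by move=> t x tT _; have [_ ->] := hg t x (interior_cc tT).
  apply: (continuous_on_integrable T0); apply: continuous_onD; apply: continuous_onM => //.
  - exact: cont_time.
  - exact: smooth_on_cont.
  - exact/cont_time/(th_continuous dthE).
have nS := null_slabD nt (null_slab_sum (index_enum 'I_3) nx).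
apply: eq_null_slab nS => t x tT _.
have It := inI tT; have iI := interiorI tT; have r0 := rb_gt0 hrb i x It.
rewrite -mulr_sumr -addrA -mulrDr; congr (_ + _ * _).
rewrite (dt_pow gamma x (@rb_gt0 _ _ _ _ _ _ _ _ hrb i) (rb_smooth hrb i) iI) (dt_rb fc hrb i x tT).
have -> : \sum_l dx l (fun t x => P t x * U i l t x) t x =
   \sum_l (gamma * rb i t x `^ (gamma - 1) * dx l (rb i) t x * U i l t x + P t x * dx l (U i l) t x).
  apply: eq_bigr => l _; rewrite (dx_mul l x sP (sU i l) It).
  by rewrite (dx_pow gamma l x (@rb_gt0 _ _ _ _ _ _ _ _ hrb i) (rb_smooth hrb i) It).
rewrite big_split/= -mulr_sumr -divgE.
have -> : \sum_l gamma * rb i t x `^ (gamma - 1) * dx l (rb i) t x * U i l t x =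
   gamma * rb i t x `^ (gamma - 1) * \sum_l U i l t x * dx l (rb i) t x.
  by rewrite mulr_sumr; apply: eq_bigr => l _; ring.
rewrite /P /press -(powR_step gamma r0); ring.
Qed.

Variables (B L c Mh bb : R).
Hypotheses (hB : equilibrium_bound gamma s b M T rb B) (L0 : 0 <= L) (c0 : 0 < c).
Hypothesis hL : forall i t x rh, 0 < t < T -> cell x -> kst <= rh <= N ->
  `|mu_deriv s rh - mu_deriv s (rb i t x)| <= L * `|rh - rb i t x|.
Hypothesis hc : forall i t x rh, 0 < t < T -> cell x -> kst <= rh <= N ->
  c * (rh - rb i t x) ^+ 2 <= relative (henergy gamma) rh (rb i t x).
Hypotheses (Mh0 : 0 < Mh) (MhM : forall i, Mh <= M i) (hbb : forall i j, `|b i j| <= bb).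
Hypotheses (B0 : 0 <= B) (N0 : 0 <= N).

Local Notation Chat := (growth_rate n gamma s N B L c Mh bb).
Local Notation Cres := (residual_rate n N B Mh).

Let mmuL i : measurable_on `]0, T[ (fun t x => muL (rho w i t x)).
Proof. by have [_ []] := hE i. Qed.
Let mlamL i : measurable_on `]0, T[ (fun t x => lamL (rho w i t x)).
Proof. by have [[]] := hE i. Qed.

Let total t x : R := - dth t * rel_energy_affine t x + th t * density gamma s b M rb eps nu muL lamL w t x.

Lemma total_le0 : integrable_on `]0, T[ total /\ (slab_int T total <= 0)%E.
Proof.
have [_ i6 l6] := dissipation_piece T0 hgamma hM fc eps0 nu0 lame ws ds hK mmuL mlamL k0 bnd
  ha0 hb0 dthE cdth th0 dth0 th_ge0.
have p1 := mass_piece ws ha0 hb0 dthE cdth th0 dth0 (fun i => massQ_smooth fc hrb eps i)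
  (fun i => massQ_periodic hrb eps i).
have p3 := drift_piece ws ha0 hb0 dthE cdth th0 dth0 sV pV.
(* The momentum equation is tested with [eps * U]; the factor [eps] is put into the cutoff, so that
   the fields remain free of it. *)
have dthE' (t : R) : is_derive t 1 (fun t => eps * th t) (eps * dth t).
  by apply: is_deriveZ; exact: dthE.
have cdth' : continuous (fun t => eps * dth t).
  by move=> t; apply: cvgM; [exact: cvg_cst|exact: cdth].
have th0' t : ~~ (a0 <= t <= b0) -> eps * th t = 0 by move=> /th0 ->; rewrite mulr0.
have dth0' t : ~~ (a0 <= t <= b0) -> eps * dth t = 0 by move=> /dth0 ->; rewrite mulr0.
have p2 := momentum_piece ws ha0 hb0 dthE' cdth' th0' dth0' sU pU.
have p4 := null_slab_sum (index_enum 'I_n) (fun i => gradmu_piece T0 ws i ha0 hb0 dthE cdth th0 dth0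
  (fun k => crossY_smooth fc hrb i k) (fun k => crossY_periodic hrb i k)).
have p5 := null_slabZ (-1) pressure_piece.
have [i0 e0] := null_slabD (null_slabD (null_slabD (null_slabD p1 p2) p3) p4) p5.
have [i7 e7] := integrable_onD i6 i0.
have ES h := @eq_slab R T _ total h i7.
have [t x _ _|ti te] := ES _; last by split=> //; rewrite -te e7 e0 adde0; exact: l6.
  rewrite /total /rel_energy_affine /density.
  rewrite -mulr_sumr.
  move: (\sum_i \sum_k mom w i k t x * _) (\sum_i \sum_k dmom w i k t x * _).
  move: (momentum_flux _ _ _ _ _ _ _) (viscous_flux _ _ _ _ _ _ _ _) (friction_work _ _ _ _ _ _).
  move: (drift_flux _ _ _ _ _) (korteweg_flux _ _ _ _ _) (viscous_diss _ _ _ _ _).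
  move: (friction_diss _ _ _ _) (damping_diss _ _ _ _) (eta_state _ _ _ _).
  move: (\sum_i rho w i t x * Q eps i t x).
  move=> x1 x2 x3 x4 x5 x6 x7 x8 x9 x10 x11 x12.
  by ring.
Qed.

(** The growth term is moved to the left, where it joins the derivative of the cutoff in a single
    weight that an exponential factor can later remove. The 10 is twice the viscous constant 5, as
    [E] bounds both Lame coefficients; [T] comes from integrating in time a cutoff that is at most
    1. *)
Lemma relative_energy_slab :
  (slab_int T (fun t x => ((- dth t - Chat * th t) * rel_energy_affine t x)%R) <=
   ((10 * n%:R * B ^+ 2 * E * nu * eps + Cres * eps ^+ 4) * T)%:E)%E.
Proof.
have [ti tl] := total_le0.
have E5 i : integrable_on `]0, T[ (fun t x => `|muL (rho w i t x)| + `|lamL (rho w i t x)|) /\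
    (slab_int T (fun t x => (`|muL (rho w i t x)| + `|lamL (rho w i t x)|)%R) <= (2 * E * T)%:E)%E.
  have [hl hm] := hE i.
  have [mi ml] := Linf_L1_slab T0 E0 hm; have [li ll] := Linf_L1_slab T0 E0 hl.
  have mabs f : integrable_on `]0, T[ f -> integrable_on `]0, T[ (fun t x => `|f t x|).
    move=> /integrable_onP fi; apply/integrable_onP.
    by have := integrable_abse fi.
  have [h1 h2] := integrable_onD (mabs _ mi) (mabs _ li).
  split=> //; rewrite h2 (_ : 2 * E * T = E * T + E * T); last by ring.
  by rewrite EFinD leeD.
have mth : measurable_on `]0, T[ (fun t _ => th t) by apply: measurable_on_time; exact: th_continuous dthE.
have bth f : integrable_on `]0, T[ f -> integrable_on `]0, T[ (fun t x => th t * f t x).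
  move=> fi; apply: (integrable_on_bounded (C := 1)) fi => // t x _ _.
  by rewrite ger0_norm.
pose Lm : scalar_field R := fun t x => \sum_i (`|muL (rho w i t x)| + `|lamL (rho w i t x)|).
have Li : integrable_on `]0, T[ Lm by apply: integrable_on_sum => i; have [] := E5 i.
have Ls : (slab_int T (fun t x => (th t * Lm t x)%R) <= (n%:R * (2 * E * T))%:E)%E.
  apply: (@le_trans _ _ (slab_int T Lm)).
    apply: le_slab_int; [exact: bth|exact: Li|].
    apply: nearW => -[t x] _ /=; apply: ler_piMl => //.
    by apply: sumr_ge0 => i _; apply: addr_ge0.
  have -> : slab_int T Lm = (\sum_(i < n) slab_int T (fun t x => (`|muL (rho w i t x)| + `|lamL (rho w i t x)|)%R))%E.
    rewrite /slab_int /Lm; under eq_integral do rewrite -sumEFin.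
    rewrite integral_sum//; first exact: measurable_OT.
    by move=> i *; have [/integrable_onP] := E5 i.
  apply: (@le_trans _ _ (\sum_(i < n) (2 * E * T)%:E)%E).
    by apply: lee_sum => i _; have [] := E5 i.
  by rewrite sumEFin sumr_const card_ord -[_ *+ n]mulr_natl.
have ci : integrable_on `]0, T[ (fun _ _ => 1 : R).
  by apply: (continuous_on_integrable T0); exact: (@continuous_on_cst R _ 1).
have Cs : (slab_int T (fun t x => (th t * 1)%R) <= T%:E)%E.
  apply: (@le_trans _ _ (slab_int T (fun _ _ => 1))).
    by apply: le_slab_int; [exact: bth|exact: ci|apply: nearW => -[t x] _ /=; rewrite mulr1].
  have -> : slab_int T (fun _ _ => 1) = leb4 R OT by rewrite /slab_int integral_cst ?mul1e//; exact: measurable_OT.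
  by rewrite leb4_OT.
have ri := rel_energy_affine_integrable.
have [L0' hL0'] := cutoff_bounded ha0 hb0 cdth dth0.
have fi : integrable_on `]0, T[ (fun t x => (- dth t - Chat * th t) * rel_energy_affine t x).
  apply: (integrable_on_bounded (C := L0' + `|Chat|)) ri.
    apply: measurable_on_time => t; apply: cvgB; first by apply: cvgN; exact: cdth.
    by apply: cvgM; [exact: cvg_cst|exact: (th_continuous dthE)].
  move=> t x _ _; apply: le_trans (ler_normB _ _) _; rewrite normrN lerD// normrM (ger0_norm (th_ge0 t)).
  exact: ler_piMr.
have [i1 e1] := integrable_onZ (- (5 * B ^+ 2 * nu * eps)) (bth _ Li).
have [i2 e2] := integrable_onZ (- (Cres * eps ^+ 4)) (bth _ ci).
have [i3 e3] := integrable_onD fi i1.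
have [i4 e4] := integrable_onD i3 i2.
have c1 : 0 <= 5 * B ^+ 2 * nu * eps.
  by apply: mulr_ge0; [apply: mulr_ge0 => //; apply: mulr_ge0 => //; exact: sqr_ge0|exact: ltW].
have c2 : 0 <= Cres * eps ^+ 4.
  apply: mulr_ge0; last by apply: exprn_ge0; exact: ltW.
  do 2!(apply: mulr_ge0 => //); apply: divr_ge0; last exact: ltW.
  by apply: mulr_ge0 => //; exact: sqr_ge0.
(* The pointwise estimate holds off one null set, on which the density bounds, the relation between
   the two gradients, or grad mu(rho) = rho v may fail. *)
have H : (slab_int T (fun t x => ((- dth t - Chat * th t) * rel_energy_affine t x +
   - (5 * B ^+ 2 * nu * eps) * (th t * Lm t x) + - (Cres * eps ^+ 4) * (th t * 1))%R) <= 0)%E.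
  apply: le_trans tl; apply: le_slab_int => //.
  have gl i k := gradlam_ae T0 ws k0 bnd i k.
  have GL : {ae leb4 R, forall z : R * coords R, OT z -> forall i k,
      gradlam w i k z.1 z.2 = (s + 1) * gradmu w i k z.1 z.2}.
    have := ae_fin_all (fun p : 'I_n * 'I_3 => gl p.1 p.2).
    by move=> /ae_sub; apply => z h Dz i k; exact: (h Dz (i, k)).
  have GM : {ae leb4 R, forall z : R * coords R, OT z -> forall i k,
      gradmu w i k z.1 z.2 = dmom w i k z.1 z.2}.
    have gm i k : {ae leb4 R, forall z : R * coords R, OT z -> gradmu w i k z.1 z.2 = dmom w i k z.1 z.2}.
      apply: ae_sub (ws_drift_def ws i k) _ => -[t x] /= h [/=]; rewrite in_itv/= => /andP[t0 _] cx.
      by rewrite h.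
    have := ae_fin_all (fun p : 'I_n * 'I_3 => gm p.1 p.2).
    by move=> /ae_sub; apply => z h Dz i k; exact: (h Dz (i, k)).
  have AE := ae_and3 (bounds_all_species bnd) GL GM.
  apply: ae_sub AE _ => -[t x] h Dz; have [hkN hgl hgm] := h Dz.
  have tT : 0 < t < T by move: Dz => [/=]; rewrite in_itv.
  have cx : cell x by case: Dz.
  have r0 i : 0 < rho w i t x by have /andP[/(lt_le_trans k0)] := hkN i.
  have D := density_ge hgamma hs fc hrb eps0 nu0 lame hB k0 L0 c0 hL hc Mh0 MhM hbb B0 N0 tT cx hkN hgm hgl.
  rewrite /total (rel_energy_eta hgamma hrb eps (inI tT) r0) -/(rel_energy_affine t x) in D *.
  have Lle : \sum_i (muL (rho w i t x) + `|lamL (rho w i t x)|) <= Lm t x.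
    by apply: ler_sum => i _; rewrite lerD2r ler_norm.
  have := ler_wpM2l (th_ge0 t) D; have := ler_wpM2l (th_ge0 t) (ler_wpM2l c1 Lle).
  move: (density _ _ _ _ _ _ _ _ _ _ _ _) (rel_energy_affine t x) (\sum_i _) (Lm t x) Chat (Cres * _) (5 * _ * _ * _).
  by move=> *; lra.
move: H; rewrite e4 e3 e1 e2.
have f1 := slab_fin_num fi; have f2 := slab_fin_num (bth _ Li); have f3 := slab_fin_num (bth _ ci).
move: Ls Cs; rewrite -(fineK f1) -(fineK f2) -(fineK f3) -!EFinM -!EFinD !lee_fin => Ls Cs H.
have h1 := ler_wpM2l c1 Ls; have h2 := ler_wpM2l c2 Cs.
have -> : (10 * n%:R * B ^+ 2 * E * nu * eps + Cres * eps ^+ 4) * T =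
  5 * B ^+ 2 * nu * eps * (n%:R * (2 * E * T)) + Cres * eps ^+ 4 * T by ring.
move: H h1 h2.
move: (5 * B ^+ 2 * nu * eps) (Cres * eps ^+ 4) (fine _) (fine _) (fine _) (n%:R * _).
by move=> x1 x2 x3 x4 x5 x6 *; lra.
Qed.

End relative_energy.
Local Transparent dx dt divg.

(** * Values at every time *)

Section pairing.
Context (R : realType).
Variable T : R.
Hypothesis T0 : 0 < T.
Local Notation I := `[0, T]%classic.
Implicit Types (f a : scalar_field R) (t : R) (x : coords R).
Local Notation mcell := (@measurable_cell R).

Lemma continuous_on_fiber J f x : J `<=` I -> continuous_on I f ->
  {within J, continuous (f^~ x)}.
Proof.
move=> JI cf; apply/subspace_continuousP => t Jt A nA.
have := (subspace_continuousP _ _).1 cf (t, x) (conj (JI _ Jt) Logic.I) A nA.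
move=> [[P Q] /= [nP nQ] PQ]; apply: filterS nP => s Ps Js.
by apply: (PQ (s, x)); split => //=; [exact: nbhs_singleton|exact: JI].
Qed.

Lemma time_lipschitz a : smooth_on I a -> exists2 C, 0 <= C &
  forall r t x, I r -> I t -> cell x -> `|a r x - a t x| <= C * `|r - t|.
Proof.
move=> sa; have [g cg hg] := smooth_on_td sa.
have [C C0 hC] := continuous_on_bounded cg.
exists C; first exact: ltW.
move=> r t x; wlog tr : r t / t < r => [H Ir It cx|Ir It cx].
  have [tr|rt|->] := ltgtP t r; [exact: H| |by rewrite !subrr normr0 mulr0].
  by rewrite distrC [`|r - t|]distrC; exact: H.
have sub : `[t, r]%classic `<=` I.
  move: Ir It; rewrite /= !in_itv/= => /andP[r0 rT] /andP[t0 tT] y /=; rewrite !in_itv/=.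
  by move=> /andP[ty yr]; rewrite (le_trans t0 ty) (le_trans yr rT).
have int c : t < c < r -> 0 < c < T.
  move: Ir It; rewrite /= !in_itv/= => /andP[r0 rT] /andP[t0 tT] /andP[tc cr].
  by rewrite (le_lt_trans t0 tc) (lt_le_trans cr rT).
have [||c + ->] := @MVT R (a^~ x) (g^~ x) t r tr.
- by move=> c; rewrite in_itv/= => /int cT; have [] := hg c x (interior_cc cT).
- by apply: continuous_on_fiber sub _; exact: smooth_on_cont.
rewrite in_itv/= => /int /andP[c0 cT]; rewrite normrM ler_wpM2r//.
by apply: hC => //; rewrite !ltW.
Qed.

Lemma cell_integrable_mul (f a : coords R -> R) C :
  (leb3 R).-integrable (@cell R) (EFin \o f) -> measurable_fun (@cell R : set (mcoords R)) a ->
  (forall x, cell x -> `|a x| <= C) ->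
  (leb3 R).-integrable (@cell R) (EFin \o (fun x => f x * a x)).
Proof.
move=> fi ma aC; have ba : [bounded a z | z in @cell R] by exact: bounded_on_le aC.
have := integrableMl mcell fi ma ba.
by apply: eq_integrable => [|x _]; [exact: mcell|rewrite /= EFinM].
Qed.

Lemma pairing_integrable f a t : C0_Lp 1 f -> smooth_on I a -> I t ->
  (leb3 R).-integrable (@cell R) (EFin \o (fun x => f t x * a t x)).
Proof.
move=> cf sa It; have t0 : 0 <= t by move: It; rewrite /= in_itv => /andP[].
have [C _ hC] := continuous_on_bounded (smooth_on_cont sa).
apply: (cell_integrable_mul (C := C)); first exact: C0_Lp1_integrable.
- exact: continuous_on_measurable_section It (smooth_on_cont sa).
- by move=> x; apply: hC; move: It; rewrite /= in_itv.
Qed.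

(** The increment of the product splits as (f(r) - f(t)) a(r) + f(t) (a(r) - a(t)): the first part
    is small because [a] is bounded and [f] continuous into L^1, the second because [a] is Lipschitz
    in time uniformly over the cell. *)
Lemma pairing_cvg f a t : C0_Lp 1 f -> smooth_on I a -> I t ->
  int_x (fun x => f r x * a r x) @[r --> within I (nbhs t)] -->
  int_x (fun x => f t x * a t x).
Proof.
move=> cf sa It; have t0 : 0 <= t by move: It; rewrite /= in_itv => /andP[].
have [C C0 hC] := continuous_on_bounded (smooth_on_cont sa).
have [C' C'0 hC'] := time_lipschitz sa.
have ft := C0_Lp1_integrable cf t0.
pose S := int_x (fun x => `|f t x|).
pose D r := fine (Lp_norm 1 (fun x => f r x - f t x)).
have bound r : I r -> `|int_x (fun x => f t x * a t x) - int_x (fun x => f r x * a r x)| <=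
    C * D r + C' * `|r - t| * S.
  move=> Ir; have r0 : 0 <= r by move: Ir; rewrite /= in_itv => /andP[].
  have fr := C0_Lp1_integrable cf r0.
  have i1 := pairing_integrable cf sa It; have i2 := pairing_integrable cf sa Ir.
  rewrite distrC /int_x -(RintegralB mcell i2 i1).
  have id : (leb3 R).-integrable (@cell R) (EFin \o (fun x => f r x - f t x)).
    have := integrableB mcell fr ft.
    by apply: eq_integrable => [|x _]; [exact: mcell|].
  have iN (g : coords R -> R) : (leb3 R).-integrable (@cell R) (EFin \o g) ->
      (leb3 R).-integrable (@cell R) (EFin \o (fun x => `|g x|)).
    by move=> /integrable_abse.
  have iZ k (g : coords R -> R) : (leb3 R).-integrable (@cell R) (EFin \o g) ->
      (leb3 R).-integrable (@cell R) (EFin \o (fun x => k * g x)).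
    move=> gi; have := integrableZl mcell k gi.
    by apply: eq_integrable => [|x _]; [exact: mcell|].
  have ii : (leb3 R).-integrable (@cell R) (EFin \o (fun x => f r x * a r x - f t x * a t x)).
    have := integrableB mcell i2 i1.
    by apply: eq_integrable => [|x _]; [exact: mcell|].
  have iR : (leb3 R).-integrable (@cell R) (EFin \o (fun x => C * `|f r x - f t x| + C' * `|r - t| * `|f t x|)).
    have := integrableD mcell (iZ C _ (iN _ id)) (iZ (C' * `|r - t|) _ (iN _ ft)).
    by apply: eq_integrable => [|x _]; [exact: mcell|].
  apply: le_trans (le_normr_Rintegral mcell ii) _.
  apply: le_trans (le_Rintegral mcell (iN _ ii) iR _) _ => [x cx|].
    have -> : f r x * a r x - f t x * a t x = (f r x - f t x) * a r x + f t x * (a r x - a t x) by ring.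
    apply: le_trans (ler_normD _ _) _; rewrite !normrM; apply: lerD.
      by rewrite mulrC ler_wpM2r//; apply: hC => //; move: Ir; rewrite /= in_itv.
    by rewrite mulrC ler_wpM2r// hC'.
  rewrite (RintegralD mcell (iZ C _ (iN _ id)) (iZ (C' * `|r - t|) _ (iN _ ft))).
  rewrite (RintegralZl _ mcell (iN _ id)) (RintegralZl _ mcell (iN _ ft)).
  by rewrite /D Lp_norm1E.
have [_ _ cvf] := cf t t0.
have /fine_cvgP[_ cvD] := cvf.
have sub : within I (nbhs t) `=>` within `[0, +oo[%classic (nbhs t).
  move=> A hA; apply: (@filterS _ (nbhs t) _ _ _ _ hA) => s h Is; apply: h.
  by move: Is; rewrite /= !in_itv/= => /andP[->].
have {}cvD : D r @[r --> within I (nbhs t)] --> 0 by move=> A /cvD; exact: sub.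
have cvt : `|r - t| @[r --> within I (nbhs t)] --> 0.
  have : `|r - t| @[r --> nbhs t] --> `|t - t|.
    by apply: cvg_norm; apply: cvgB; [exact: cvg_id|exact: cvg_cst].
  by rewrite subrr normr0; exact: cvg_within_filter.
have cvB : C * D r + C' * `|r - t| * S @[r --> within I (nbhs t)] --> C * 0 + C' * 0 * S.
  apply: cvgD; first by apply: cvgM => //; exact: cvg_cst.
  by apply: cvgM; [apply: cvgM => //; exact: cvg_cst|exact: cvg_cst].
rewrite !mulr0 mul0r addr0 in cvB.
apply/cvgrPdist_le => e e0; near=> r.
have Ir : I r by near: r; exact: withinT.
apply: le_trans (bound r Ir) _; apply: le_trans (ler_norm _) _.
near: r; apply: cvgr0_norm_le => //; exact: cvB.
Unshelve. all: by end_near. Qed.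

End pairing.

Lemma measurable_inv (R : realType) : measurable_fun setT (fun x : R => x^-1).
Proof.
have -> : (fun x : R => x^-1) = (fun x => x * (x ^+ 2) `^ (-1)).
  apply/funext => x; rewrite powR_inv1 ?sqr_ge0//.
  by have [->|x0] := eqVneq x 0; [rewrite invr0 mul0r|field].
apply: measurable_funM => //.
exact: (measurableT_comp (measurable_powR _)).
Qed.

(** A null set contains no interval of positive length, so good times exist arbitrarily close to any
    time of [0, T], end points included. *)
Lemma ae_dense (R : realType) (T : R) (P : R -> Prop) : 0 < T ->
  {ae lebesgue_measure, forall t : R, 0 < t < T -> P t} ->
  forall t d, `[0, T]%classic t -> 0 < d -> exists r, [/\ 0 < r < T, `|r - t| < d & P r].
Proof.
move=> T0 [A [mA A0 sA]] t d; rewrite /= in_itv/= => /andP[t0 tT] d0.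
apply: contrapT => nP.
pose lo := Num.max 0 (t - d); pose hi := Num.min T (t + d).
have lh : lo < hi.
  rewrite /lo /hi gt_max !lt_min T0 /=; apply/andP; split; [lra|apply/andP; split; lra].
have sub : `]lo, hi[%classic `<=` A.
  move=> r; rewrite /= in_itv/= /lo /hi gt_max lt_min => /andP[/andP[r0 rl] /andP[rT rh]].
  apply: sA => /= H; apply: nP; exists r; split; [by rewrite r0 rT| |by apply: H; rewrite r0 rT].
  by rewrite ltr_norml; apply/andP; split; lra.
have mJ : measurable (`]lo, hi[%classic : set (measurableTypeR R)) by exact: measurable_itv.
have : (lebesgue_measure `]lo, hi[%classic <= lebesgue_measure A)%E.
  by apply: le_measure => //; rewrite inE.
rewrite A0 lebesgue_measure_itv/= lte_fin lh -EFinB lee_fin; lra.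
Qed.

Section every_time.
Context (R : realType) (n : nat).
Variables (T : R) (f : scalar_field R).
Hypothesis T0 : 0 < T.
Local Notation I := `[0, T]%classic.
Local Notation mcell := (@measurable_cell R).

(** At a good time r the function [phi] of f(r) vanishes, and [phi] is 1-Lipschitz, so the L^1 norm
    of [phi] of f(t) is at most the distance from f(r) to f(t); good times r approach t. *)
Lemma ae_vanish_every_time (phi : R -> R) t : C0_Lp 1 f -> measurable_fun setT phi ->
  (forall y z, `|phi y - phi z| <= `|y - z|) ->
  {ae lebesgue_measure, forall t : R, 0 < t < T ->
    {ae leb3 R, forall x : coords R, cell x -> phi (f t x) = 0}} ->
  I t -> {ae leb3 R, forall x : coords R, cell x -> phi (f t x) = 0}.
Proof.
move=> cf mphi lip ae0 It; have t0 : 0 <= t by move: It; rewrite /= in_itv => /andP[].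
have [mf _ cvf] := cf t t0.
have mpf r : 0 <= r -> measurable_fun (@cell R : set (mcoords R)) (fun x => (phi (f r x))%:E).
  move=> r0; have [mfr _ _] := cf r r0; apply: measurableT_comp => //.
  exact: (measurableT_comp mphi).
have le r : 0 < r < T -> {ae leb3 R, forall x : coords R, cell x -> phi (f r x) = 0} ->
    (\int[leb3 R]_(x in @cell R) `|(phi (f t x))%:E| <= Lp_norm 1 (fun x => f r x - f t x)%R)%E.
  move=> /andP[r0 rT] ar; rewrite Lp_norm1E; have [mfr _ _] := cf r (ltW r0).
  apply: ae_ge0_le_integral => //; first exact: mcell.
  - by apply: measurableT_comp => //; exact: mpf.
  - apply: measurableT_comp => //; apply: measurableT_comp => //; exact: measurable_funB.
  - apply: ae_sub ar _ => x hx cx; rewrite /= lee_fin.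
    by have := lip (f t x) (f r x); rewrite hx// subr0 distrC.
have int0 : (\int[leb3 R]_(x in @cell R) `|(phi (f t x))%:E| = 0)%E.
  apply/eqP; rewrite eq_le integral_ge0 ?andbT//; apply/lee_addgt0Pr => e e0; rewrite add0e.
  have /fine_cvgP[fin cvD] := cvf.
  have small : \forall r \near within `[0, +oo[%classic (nbhs t),
      `|fine (Lp_norm 1 (fun x => f r x - f t x))| <= e.
    by apply: cvgr0_norm_le => //; exact: cvD.
  have [d /= d0 hd] : nbhs t (fun r => 0 <= r -> Lp_norm 1 (fun x => f r x - f t x) \is a fin_num /\
      `|fine (Lp_norm 1 (fun x => f r x - f t x))| <= e).
    have : \forall r \near within `[0, +oo[%classic (nbhs t),
        Lp_norm 1 (fun x => f r x - f t x) \is a fin_num /\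
        `|fine (Lp_norm 1 (fun x => f r x - f t x))| <= e by exact: filterI.
    rewrite near_withinE; apply: filterS => r h r0; apply: h.
    by rewrite /= in_itv/= r0.
  have [r [rT rd hr]] := ae_dense T0 ae0 It d0.
  have r0 : 0 <= r by case/andP: rT => /ltW.
  have br : ball t d r by rewrite /ball/= distrC.
  have [h1 h2] := hd r br r0.
  apply: le_trans (le r rT hr) _; rewrite -(fineK h1) lee_fin.
  exact: le_trans (ler_norm _) h2.
have := (ae_eq_integral_abs (leb3 R) mcell (mpf t t0)).1 int0.
move=> /ae_sub; apply => x h cx; have := h cx.
by move=> [].
Qed.

End every_time.

(** * The relative energy at a fixed time *)

Section relative_energy_at.
Local Opaque dx dt divg.
Context (R : realType) (n : nat) (gamma s : R) (b : 'I_n -> 'I_n -> R) (M : 'I_n -> R).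
Hypotheses (hgamma : 1 < gamma).
Hypothesis fc : friction_condition b M.
Variables (T : R) (rb : 'I_n -> scalar_field R).
Hypothesis T0 : 0 < T.
Hypothesis hrb : smooth_equilibrium gamma s b M rb T.
Local Notation I := `[0, T]%classic.
Local Notation mcell := (@measurable_cell R).
Local Notation U := (ubar1 gamma s b M rb).
Local Notation V := (vbar s rb).
Local Notation Q := (massQ gamma s b M rb).
Variables (eps nu : R) (muL lamL : R -> R) (w : state R n).
Hypothesis ws : weak_solution gamma s b M eps nu muL lamL w.
Hypothesis ds : dissipative gamma b M eps nu muL lamL w.
Variables (kst N : R).
Hypothesis k0 : 0 < kst.
Hypothesis bnd : forall i, {ae @leb4 R, forall z : R * coords R,
            0 < z.1 < T -> cell z.2 -> kst <= rho w i z.1 z.2 <= N}.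
Hypothesis rel_ge0 : forall i t x rh, I t -> cell x -> kst <= rh <= N ->
  0 <= relative (henergy gamma) rh (rb i t x).

(* The clipped density vanishes in L^1 for almost every time, and it is continuous
   in time with values in L^1. *)
Lemma bounds_every_time t : I t ->
  {ae leb3 R, forall x : coords R, cell x -> forall i, kst <= rho w i t x <= N}.
Proof.
move=> It; apply: ae_fin_all => i.
have [cr _] := ws_rho ws i.
have AT := ae_time (bounds_all_species bnd).
have lip (h : R -> R) : (forall y z, `|h y - h z| <= `|y - z|) ->
    forall y z, `|Num.max 0 (h y) - Num.max 0 (h z)| <= `|y - z|.
  move=> hh y z; apply: le_trans (hh y z).
  have := ler_norm (h y - h z); have := ler_norm (h z - h y); rewrite distrC.
  by rewrite /Num.max; case: ltP => h1; case: ltP => h2; rewrite ler_norml ?subr0 ?sub0r => *;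
    apply/andP; split; lra.
have mmax (h : R -> R) : measurable_fun setT h -> measurable_fun setT (fun y => Num.max 0 (h y)).
  by move=> mh; exact: measurable_maxr.
pose f1 (y : R) := Num.max 0 (kst - y); pose f2 (y : R) := Num.max 0 (y - N).
have clip1 : {ae leb3 R, forall x : coords R, cell x -> f1 (rho w i t x) = 0}.
  apply: (ae_vanish_every_time T0 cr (phi := f1)) => //.
  - by apply: mmax; exact: measurable_funB.
  - by apply: lip => y z; have -> : (kst - y) - (kst - z) = z - y by [ring]; rewrite distrC.
  - apply: ae_sub AT _ => r h rT; apply: ae_sub (h rT) _ => x hx cx.
    by have /andP[h1 _] := hx cx i; rewrite /f1 max_l// subr_le0.
have clip2 : {ae leb3 R, forall x : coords R, cell x -> f2 (rho w i t x) = 0}.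
  apply: (ae_vanish_every_time T0 cr (phi := f2)) => //.
  - by apply: mmax; exact: measurable_funB.
  - by apply: lip => y z; rewrite opprB addrA subrK.
  - apply: ae_sub AT _ => r h rT; apply: ae_sub (h rT) _ => x hx cx.
    by have /andP[_ h1] := hx cx i; rewrite /f2 max_l// subr_le0.
apply: ae_sub (ae_and3 clip1 clip2 clip2) _ => x h cx; have [h1 h2 _] := h cx.
have le0 (y : R) : Num.max 0 y = 0 -> y <= 0 by move=> <-; rewrite le_max lexx orbT.
by move: (le0 _ h1) (le0 _ h2); rewrite !subr_le0 => -> ->.
Qed.

(** Every integral pairs a quantity continuous in time with values in L^1 with a smooth field; the
    factors 1 bring the energy and the pressure into that shape. Continuity in time is then
    immediate at every time of [0, T]. *)
Definition rel_energy_int t : R :=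
  int_x (fun x => eta_state gamma w t x * 1)
  - \sum_i int_x (fun x => rho w i t x * Q eps i t x)
  - eps * (\sum_i \sum_k int_x (fun x => mom w i k t x * U i k t x))
  - \sum_i \sum_k int_x (fun x => dmom w i k t x * V i k t x)
  + \sum_i int_x (fun x => 1 * press gamma (rb i t x)).

Let cst1 : C0_Lp 1 (fun _ _ => 1 : R).
Proof.
move=> t t0; split.
- exact: measurable_cst.
- rewrite Lp_norm1E.
  have /integrableP[_] : (leb3 R).-integrable (@cell R) (EFin \o (fun _ => 1 : R)).
    by apply: continuous_integrable_cell; exact: cst_continuous.
  by [].
- have -> : (fun r : R => Lp_norm 1 (fun x : coords R => (1 : R) - 1)) = (fun=> 0%E).
    apply/funext => r; rewrite Lp_norm1E integral0_eq// => x _.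
    by rewrite subrr abse0.
  exact: cvg_cst.
Qed.

Let sQ i : smooth_on I (Q eps i) := massQ_smooth fc hrb eps i.
Let sU i k : smooth_on I (U i k) := ubar1_smooth fc hrb i k.
Let sV i k : smooth_on I (V i k) := vbar_smooth hrb i k.
Let sP i : smooth_on I (fun t x => press gamma (rb i t x)) := press_smooth hrb i.
Let s1 : smooth_on I (fun _ _ => 1 : R) := smooth_on_cst I 1.
Let ceta : C0_Lp 1 (eta_state gamma w) := ds.1.
Let crho i : C0_Lp 1 (rho w i) := (ws_rho ws i).1.
Let cmom i k : C0_Lp 1 (mom w i k) := (ws_mom ws i k).1.
Let cdmom i k : C0_Lp 1 (dmom w i k) := (ws_mom ws i k).2.

Local Notation psi := rel_energy_int.

Lemma rel_energy_int_cvg t : I t -> psi r @[r --> within I (nbhs t)] --> psi t.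
Proof.
move=> It.
have csum (J : finType) (F : J -> R -> R) : (forall j, F j r @[r --> within I (nbhs t)] --> F j t) ->
    \sum_j F j r @[r --> within I (nbhs t)] --> \sum_j F j t.
  move=> cF; elim: (index_enum J) => [|j l IH].
    by rewrite big_nil; under eq_fun do rewrite big_nil; exact: cvg_cst.
  rewrite big_cons; under eq_fun do rewrite big_cons.
  by apply: cvgD.
apply: cvgD; [apply: cvgB; [apply: cvgB; [apply: cvgB|]|]|].
- exact: pairing_cvg.
- by apply: (csum) => i; exact: pairing_cvg.
- apply: cvgM; first exact: cvg_cst.
  by apply: (csum) => i; apply: (csum) => k; exact: pairing_cvg.
- by apply: (csum) => i; apply: (csum) => k; exact: pairing_cvg.
- by apply: (csum) => i; exact: (pairing_cvg cst1 (sP i) It).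
Qed.

Local Notation relF := (rel_energy_affine gamma s b M rb eps w).

Lemma rel_energy_affine_section t : I t ->
  (leb3 R).-integrable (@cell R) (fun x => (relF t x)%:E) /\
  (\int[leb3 R]_(x in @cell R) (relF t x)%:E = (psi t)%:E)%E.
Proof.
move=> It.
pose ok (g : coords R -> R) (v : R) := (leb3 R).-integrable (@cell R) (EFin \o g) /\ int_x g = v.
have okD g1 g2 v1 v2 : ok g1 v1 -> ok g2 v2 -> ok (fun x => g1 x + g2 x) (v1 + v2).
  move=> [i1 <-] [i2 <-]; split; last exact: (RintegralD mcell i1 i2).
  by have := integrableD mcell i1 i2; apply: eq_integrable => [|x _]; [exact: mcell|].
have okZ g v c : ok g v -> ok (fun x => c * g x) (c * v).
  move=> [i1 <-]; split; last exact: (RintegralZl c mcell i1).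
  by have := integrableZl mcell c i1; apply: eq_integrable => [|x _]; [exact: mcell|].
have oksum (J : finType) (G : J -> coords R -> R) (v : J -> R) : (forall j, ok (G j) (v j)) ->
    ok (fun x => \sum_j G j x) (\sum_j v j).
  move=> hG; elim: (index_enum J) => [|j l IH].
    rewrite big_nil; under [X in ok X _]eq_fun do rewrite big_nil.
    split; first exact: integrable0.
    by rewrite /int_x /Rintegral integral0_eq.
  by rewrite big_cons; under [X in ok X _]eq_fun do rewrite big_cons; exact: okD.
have okp f a : C0_Lp 1 f -> smooth_on I a -> ok (fun x => f t x * a t x) (int_x (fun x => f t x * a t x)).
  by move=> cf sa; split=> //; exact: pairing_integrable.
have o1 := okp _ _ ceta s1.
have o2 := oksum _ _ _ (fun i => okp _ _ (crho i) (sQ i)).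
have o3 := oksum _ _ _ (fun i => oksum _ _ _ (fun k => okp _ _ (cmom i k) (sU i k))).
have o4 := oksum _ _ _ (fun i => oksum _ _ _ (fun k => okp _ _ (cdmom i k) (sV i k))).
have o5 := oksum _ _ _ (fun i => okp _ _ cst1 (sP i)).
have [i0 e0] := okD _ _ _ _ (okD _ _ _ _ (okD _ _ _ _ (okD _ _ _ _ o1 (okZ _ _ (-1) o2)) (okZ _ _ (- eps) o3)) (okZ _ _ (-1) o4)) o5.
have pE x : \sum_i 1 * press gamma (rb i t x) = \sum_i press gamma (rb i t x).
  by apply: eq_bigr => i _; rewrite mul1r.
pose g x := eta_state gamma w t x * 1 + -1 * (\sum_i rho w i t x * Q eps i t x)
  + - eps * (\sum_i \sum_k mom w i k t x * U i k t x)
  + -1 * (\sum_i \sum_k dmom w i k t x * V i k t x) + \sum_i 1 * press gamma (rb i t x).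
have gE x : g x = relF t x.
  rewrite /g /rel_energy_affine pE.
  by move: (eta_state _ _ _ _) (\sum_i _) (\sum_i _) (\sum_i _) (\sum_i _) => A1 A2 A3 A4 A5; ring.
have i0' : (leb3 R).-integrable (@cell R) (fun x => (relF t x)%:E).
  by apply: eq_integrable i0 => [|x _]; [exact: mcell|congr EFin; exact: gE].
split=> //.
transitivity (\int[leb3 R]_(x in @cell R) (g x)%:E)%E.
  by apply: eq_integral => x _; rewrite gE.
rewrite -(fineK (integrable_fin_num mcell i0)); congr EFin.
apply: etrans e0 _; rewrite /rel_energy_int.
by move: (int_x _) (\sum_i _) (\sum_i _) (\sum_i _) (\sum_i _) => A1 A2 A3 A4 A5; ring.
Qed.

(** The density bounds hold at this very time, so almost everywhere in the cell the integrand of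
    [Psi], which contains quotients, equals the affine expression and is nonnegative. *)
Lemma PsiE t : I t -> Psi gamma s b M rb eps w t = (psi t)%:E /\ 0 <= psi t.
Proof.
move=> It; have t0 : 0 <= t by move: It; rewrite /= in_itv => /andP[].
have [ri <-] := rel_energy_affine_section It.
have ae1 : {ae leb3 R, forall x : coords R, cell x ->
    rel_energy gamma s b M rb eps w t x = relF t x /\ 0 <= relF t x}.
  apply: ae_sub (bounds_every_time It) _ => x hx cx.
  have r0 i : 0 < rho w i t x by have /andP[h _] := hx cx i; exact: lt_le_trans h.
  have e1 : rel_energy gamma s b M rb eps w t x = relF t x by exact: (rel_energy_eta hgamma hrb eps It r0).
  split=> //; rewrite -e1 (rel_energy_vel hrb eps It r0).
  apply: sumr_ge0 => i _.
  have q0 : forall q : 'I_3 -> R, 0 <= sqn q by move=> q; apply: sumr_ge0 => k _; exact: sqr_ge0.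
  have ri0 := ltW (r0 i).
  have p0 q : 0 <= 2^-1 * (rho w i t x * sqn q) :> R.
    by apply: mulr_ge0; [rewrite invr_ge0 ler0n|exact: mulr_ge0].
  by apply: addr_ge0; [exact: addr_ge0|exact: rel_ge0 It cx (hx cx i)].
have mF := measurable_int _ ri.
have mE : measurable_fun (@cell R : set (mcoords R)) (fun x => rel_energy gamma s b M rb eps w t x).
  have ms f : smooth_on I f -> measurable_fun (@cell R : set (mcoords R)) (f t).
    by move=> sf; exact: continuous_on_measurable_section It (smooth_on_cont sf).
  have m1 f : C0_Lp 1 f -> measurable_fun (@cell R : set (mcoords R)) (f t).
    by move=> cf; have [] := cf t t0.
  have mrb i := ms _ (rb_smooth hrb i).
  have mrho i := m1 _ (crho i).
  have msum (J : finType) (f : J -> coords R -> R) :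
      (forall j, measurable_fun (@cell R : set (mcoords R)) (f j)) ->
      measurable_fun (@cell R : set (mcoords R)) (fun x => \sum_j f j x).
    by move=> mf; exact: (@measurable_sum _ _ _ _ _ _ f).
  have mT (h : R -> R) f : measurable_fun setT h ->
      measurable_fun (@cell R : set (mcoords R)) f ->
      measurable_fun (@cell R : set (mcoords R)) (fun x => h (f x)).
    by move=> mh mf; exact: measurableT_comp mh mf.
  have msq (f g : 'I_3 -> coords R -> R) i :
      (forall k, measurable_fun (@cell R : set (mcoords R)) (f k)) ->
      (forall k, measurable_fun (@cell R : set (mcoords R)) (g k)) ->
      measurable_fun (@cell R : set (mcoords R))
        (fun x => 2^-1 * rho w i t x * sqn (fun k => f k x / rho w i t x - g k x)).
    move=> mf mg; apply: measurable_funM; first by apply: measurable_funM.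
    apply: (msum _ (fun k x => (f k x / rho w i t x - g k x) ^+ 2)) => k.
    apply: measurable_funX; apply: measurable_funB => //.
    by apply: measurable_funM => //; exact: mT (@measurable_inv R) (mrho i).
  apply: (msum _ (fun i x => _)) => i.
  apply: measurable_funD; first apply: measurable_funD.
  - apply: msq => k; first exact: m1.
    have -> : (fun x => mbar gamma s b M rb eps i k t x / rb i t x) = (fun x => eps * U i k t x).
      apply/funext => x; rewrite /mbar ubarE; field.
      by rewrite gt_eqF// (rb_gt0 hrb).
    by apply: measurable_funM => //; exact: ms.
  - apply: msq => k; first exact: m1.
    have -> : (fun x => Jbar s rb i k t x / rb i t x) = V i k t.
      apply/funext => x; rewrite /Jbar; field.
      by rewrite gt_eqF// (rb_gt0 hrb).
    exact: ms.
  - have -> : (fun x => relative (henergy gamma) (rho w i t x) (rb i t x)) =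
      (fun x => henergy gamma (rho w i t x) - henergy gamma (rb i t x)
        - (gamma / (gamma - 1) * rb i t x `^ (gamma - 1)) * (rho w i t x - rb i t x)).
      by apply/funext => x; rewrite /relative derive1_henergy// (rb_gt0 hrb).
    have mh := @measurable_henergy R gamma.
    apply: measurable_funB; first by apply: measurable_funB; exact: mT.
    apply: measurable_funM; last exact: measurable_funB.
    by apply: measurable_funM => //; apply: mT (measurable_powR _) _.
split.
  apply: ae_eq_integral => //; first exact: mcell.
  - exact/measurable_EFinP.
  - by apply: ae_sub ae1 _ => x h cx; have [e _] := h cx; exact: (congr1 EFin e).
have [_ e] := rel_energy_affine_section It.
rewrite -lee_fin -e.
have -> : (\int[leb3 R]_(x in @cell R) (relF t x)%:E =
    \int[leb3 R]_(x in @cell R) `|(relF t x)%:E|)%E.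
  apply: ae_eq_integral => //; first exact: mcell.
  - exact: measurableT_comp.
  - by apply: ae_sub ae1 _ => x h cx; have [_ h0] := h cx; rewrite /= ger0_norm.
exact: integral_ge0.
Qed.

End relative_energy_at.
Local Transparent dx dt divg.

(** * Gronwall *)

Section mollified_increment.
Context (R : realType).
Variables (T : R) (F : R -> R) (BT : R).
Hypothesis T0 : 0 < T.
Hypothesis cF : {within `[0, T]%classic, continuous F}.
Local Notation leb := (@lebesgue_measure R).
Local Notation I := `[0, T]%classic.
Local Notation J := (`]0, T[%classic : set (measurableTypeR R)).
(** The derivative of a step rising on [c, c + d]: a mollifier of unit mass, concentrated at [c] as
    [d] tends to 0. *)
Let st (c d t : R) : R := d^-1 * dstep ((t - c) / d).

Let mJ : measurable J. Proof. exact: measurable_itv. Qed.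

Lemma within_integrable (f : R -> R) : {within I, continuous f} -> leb.-integrable J (EFin \o f).
Proof.
move=> cf; have : leb.-integrable (`[0, T]%classic : set (measurableTypeR R)) (EFin \o f).
  by apply: continuous_compact_integrable => //; exact: segment_compact.
by apply: integrableS => //; exact: subset_itv_oo_cc.
Qed.

Let st_cont c d : continuous (st c d).
Proof.
move=> t; apply: cvgM; first exact: cvg_cst.
apply: (@continuous_comp _ _ _ (fun s : R => (s - c) / d) (@dstep R)); last exact: continuous_dstep.
by apply: cvgM; [apply: cvgB; [exact: cvg_id|exact: cvg_cst]|exact: cvg_cst].
Qed.

Let st_integral c d : 0 <= c -> 0 < d -> c + d <= T -> \int[leb]_(t in J) st c d t = 1.
Proof.
move=> c0 d0 cd; rewrite /Rintegral.
have h (t : R) : is_derive t 1 (fun s => step ((s - c) / d)) (st c d t).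
  have E s : (s - c) / d = d^-1 * s + - c / d by rewrite mulrDl mulrC.
  rewrite /st; under eq_fun do rewrite E; rewrite E.
  exact/is_derive_affine/is_derive_step.
rewrite (ftc_itvoo T0 (@st_cont c d) h) /=.
have [_ ->] := @step_scale R d d0 T c; last by [].
by have [-> //] := @step_scale R d d0 0 c; rewrite subr0.
Qed.

Let st_ge0 c d t : 0 < d -> 0 <= st c d t.
Proof. by move=> d0; rewrite mulr_ge0 ?invr_ge0 ?dstep_ge0// ltW. Qed.

Let st_out c d t : 0 < d -> ~~ (c <= t <= c + d) -> st c d t = 0.
Proof.
move=> d0 H; rewrite /st dstep_out ?mulr0//; apply: contra H.
by rewrite ler_pdivlMr// ler_pdivrMr// mul0r mul1r subr_ge0 lerBlDl.
Qed.

(** Minus the derivative of the bump is the mollifier at [be] minus the one at [al]. Each of them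
    averages [F] up to an error [e]. *)
Lemma bump_increment al be d e : 0 <= al -> 0 < d -> al <= be -> be + d <= T ->
  (forall t, al <= t <= al + d -> `|F t - F al| <= e) ->
  (forall t, be <= t <= be + d -> `|F t - F be| <= e) ->
  F be - F al - 2 * e <= \int[leb]_(t in J) (- dbump al be d t * F t).
Proof.
move=> al0 d0 ab bd Fal Fbe.
have cst c : {within I, continuous (st c d)}.
  by apply: continuous_subspaceT; exact: st_cont.
have cb : {within I, continuous (dbump al be d)}.
  by apply: continuous_subspaceT; exact: continuous_dbump.
have cK : {within I, continuous (fun t => - dbump al be d t * F t)}.
  move=> t; apply: cvgM; last exact: cF.
  by apply: cvgN; apply: cvgB; exact: cst.
pose A := F be - e; pose B := F al + e.
have ci c k : {within I, continuous (fun t => k * st c d t)}.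
  by move=> t; apply: cvgM; [exact: cvg_cst|exact: cst].
have ck : {within I, continuous (fun t => A * st be d t - B * st al d t)}.
  by move=> t; apply: cvgB; exact: ci.
have ii c := within_integrable (cst c).
have -> : F be - F al - 2 * e = \int[leb]_(t in J) (A * st be d t - B * st al d t).
  rewrite (RintegralB mJ (within_integrable (ci be A)) (within_integrable (ci al B))).
  rewrite (RintegralZl A mJ (ii be)) (RintegralZl B mJ (ii al)) !st_integral//.
  - by rewrite /A /B; lra.
  - by apply: le_trans bd; rewrite lerD2r.
  - exact: le_trans ab.
apply: (le_Rintegral mJ (within_integrable ck) (within_integrable cK)) => t _.
rewrite /dbump -/(st al d t) -/(st be d t).
have hb : 0 <= st be d t * (F t - A).
  have [tb|tb] := boolP (be <= t <= be + d); last by rewrite (st_out d0 tb) mul0r.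
  rewrite mulr_ge0 ?st_ge0// /A; move: (Fbe t tb); rewrite ler_norml => /andP[h _]; lra.
have ha : 0 <= st al d t * (B - F t).
  have [tb|tb] := boolP (al <= t <= al + d); last by rewrite (st_out d0 tb) mul0r.
  rewrite mulr_ge0 ?st_ge0// /B; move: (Fal t tb); rewrite ler_norml => /andP[_ h]; lra.
nra.
Qed.

Hypothesis bump_le : forall al be d, 0 < al -> 0 < d -> al + d <= be -> be + d < T ->
  \int[leb]_(t in J) (- dbump al be d t * F t) <= BT.

Lemma within_near t e : I t -> 0 < e ->
  exists2 d, 0 < d & forall r, I r -> `|r - t| < d -> `|F r - F t| <= e.
Proof.
move=> It e0; have /subspace_continuousP/(_ t It) := cF.
move=> /cvgrPdist_le/(_ e e0); rewrite near_withinE => -[d /= d0 hd]; exists d => // r Ir rt.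
by rewrite distrC; apply: hd => //; rewrite /ball/= distrC.
Qed.

Lemma interior_increment al be : 0 < al -> al < be -> be < T -> F be - F al <= BT.
Proof.
move=> al0 ab bT; apply/ler_addgt0Pr => e e0.
have e2 : 0 < e / 2 by rewrite divr_gt0.
have Ial : I al by rewrite /= in_itv/= (ltW al0) (ltW (lt_trans ab bT)).
have Ibe : I be by rewrite /= in_itv/= (ltW (lt_trans al0 ab)) (ltW bT).
have [d1 d10 h1] := within_near Ial e2.
have [d2 d20 h2] := within_near Ibe e2.
pose d := Num.min (Num.min (d1 / 2) (d2 / 2)) (Num.min (be - al) ((T - be) / 2)).
have d0 : 0 < d.
  by rewrite !lt_min !divr_gt0//= ?subr_gt0// ab.
have [dd1 dd2 dd3 dd4] : [/\ d <= d1 / 2, d <= d2 / 2, d <= be - al & d <= (T - be) / 2].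
  by split; rewrite /d !ge_min lexx ?orbT.
have inc : F be - F al - 2 * (e / 2) <= \int[leb]_(t in J) (- dbump al be d t * F t).
  apply: bump_increment => //; [exact: ltW|exact: ltW|lra|move=> t tt|move=> t tt].
  - apply: h1; first by rewrite /= in_itv/=; case/andP: tt => ? ?; apply/andP; split; lra.
    by case/andP: tt => ? ?; rewrite ger0_norm; lra.
  - apply: h2; first by rewrite /= in_itv/=; case/andP: tt => ? ?; apply/andP; split; lra.
    by case/andP: tt => ? ?; rewrite ger0_norm; lra.
have [h3 h4] : al + d <= be /\ be + d < T by split; lra.
have := bump_le al0 d0 h3 h4; lra.
Qed.

(** The bumps live strictly inside ]0, T[, so both 0 and [t], which may be [T], are approached from
    the interior by continuity. *)
Lemma closed_increment t : 0 < t <= T -> F t - F 0 <= BT.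
Proof.
move=> /andP[t0 tT]; apply/ler_addgt0Pr => e e0.
have e2 : 0 < e / 2 by rewrite divr_gt0.
have I0 : I 0 by rewrite /= in_itv/= lexx ltW.
have It : I t by rewrite /= in_itv/= tT ltW.
have [d1 d10 h1] := within_near I0 e2.
have [d2 d20 h2] := within_near It e2.
(* The quarters keep the two interior times ordered: al <= t/4 < 3 t/4 <= t - m. *)
pose al := Num.min (d1 / 2) (t / 4); pose m := Num.min (d2 / 2) (t / 4).
have [al0 m0] : 0 < al /\ 0 < m by rewrite !lt_min !divr_gt0.
have [a1 a2 m1 m2] : [/\ al <= d1 / 2, al <= t / 4, m <= d2 / 2 & m <= t / 4].
  by split; rewrite /al /m !ge_min lexx ?orbT.
have := @interior_increment al (t - m) al0; have := h1 al; have := h2 (t - m).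
rewrite /= !in_itv/= => H2 H1 H3.
have {}H1 : `|F al - F 0| <= e / 2.
  by apply: H1; [apply/andP; split; lra|rewrite subr0 gtr0_norm; lra].
have {}H2 : `|F (t - m) - F t| <= e / 2.
  apply: H2; first by apply/andP; split; lra.
  by rewrite ler0_norm; lra.
have {}H3 : F (t - m) - F al <= BT by apply: H3; lra.
move: H1 H2; rewrite !ler_norml => /andP[? ?] /andP[? ?]; lra.
Qed.

End mollified_increment.

Section gronwall.
Context (R : realType) (n : nat) (gamma s : R) (b : 'I_n -> 'I_n -> R) (M : 'I_n -> R).
Hypotheses (hgamma : 1 < gamma) (hs : -1 <= s) (hM : forall i, 0 <= M i).
Hypothesis fc : friction_condition b M.
Variables (T : R) (rb : 'I_n -> scalar_field R).
Hypothesis T0 : 0 < T.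
Hypothesis hrb : smooth_equilibrium gamma s b M rb T.
Local Notation I := `[0, T]%classic.
Local Notation J := (`]0, T[%classic : set (measurableTypeR R)).
Variables (kst N B L c Mh bb K E : R).
Hypotheses (hB : equilibrium_bound gamma s b M T rb B) (L0 : 0 <= L) (c0 : 0 < c).
Hypothesis hL : forall i t x rh, 0 < t < T -> cell x -> kst <= rh <= N ->
  `|mu_deriv s rh - mu_deriv s (rb i t x)| <= L * `|rh - rb i t x|.
Hypothesis hc : forall i t x rh, I t -> cell x -> kst <= rh <= N ->
  c * (rh - rb i t x) ^+ 2 <= relative (henergy gamma) rh (rb i t x).
Hypotheses (Mh0 : 0 < Mh) (MhM : forall i, Mh <= M i) (hbb : forall i j, `|b i j| <= bb).
Hypotheses (B0 : 0 <= B) (N0 : 0 <= N) (E0 : 0 <= E) (k0 : 0 < kst).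

Local Notation Chat := (growth_rate n gamma s N B L c Mh bb).
Local Notation Cres := (residual_rate n N B Mh).

(** The sign is needed for the weight [expR (- Chat * t)] to be at most 1, as is required of the
    cutoff. *)
Lemma growth_rate_ge0 : 0 <= Chat.
Proof.
have s0 : 0 <= (s + 1) / 2.
  by apply: divr_ge0; [rewrite -lerBlDr sub0r|exact: ler0n].
have Mh' := ltW Mh0; have g0 : 0 <= gamma - 1 by rewrite subr_ge0 ltW.
rewrite /growth_rate; move: ((s + 1) / 2) s0 (gamma - 1) g0 => kap kap0 g g0; apply: addr_ge0; last first.
  apply: divr_ge0; last exact: ltW.
  apply: addr_ge0; last by rewrite !(sqr_ge0, divr_ge0, mulr_ge0).
  by rewrite !(sqr_ge0, divr_ge0, mulr_ge0, addr_ge0).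
by rewrite !(sqr_ge0, divr_ge0, mulr_ge0, addr_ge0).
Qed.

Lemma residual_rate_ge0 : 0 <= Cres.
Proof.
have Mh' := ltW Mh0; rewrite /residual_rate.
by rewrite !(sqr_ge0, divr_ge0, mulr_ge0).
Qed.

Variables (eps nu : R) (muL lamL : R -> R) (w : state R n).
Hypotheses (eps0 : 0 < eps) (nu0 : 0 <= nu) (lame : lame_condition muL lamL).
Hypothesis ws : weak_solution gamma s b M eps nu muL lamL w.
Hypothesis ds : dissipative gamma b M eps nu muL lamL w.
Hypothesis hK : mass_energy_le gamma T K w.
Hypothesis hE : forall i, Linf_Lp_le T 1 (fun t x => lamL (rho w i t x)) E /\
  Linf_Lp_le T 1 (fun t x => muL (rho w i t x)) E.
Hypothesis bnd : forall i, {ae @leb4 R, forall z : R * coords R,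
            0 < z.1 < T -> cell z.2 -> kst <= rho w i z.1 z.2 <= N}.

Let rel_ge0 i t x rh : I t -> cell x -> kst <= rh <= N ->
  0 <= relative (henergy gamma) rh (rb i t x).
Proof.
move=> It cx h; have := hc i It cx h; apply: le_trans.
by rewrite mulr_ge0 ?sqr_ge0// ltW.
Qed.

Local Notation psi := (rel_energy_int gamma s b M rb eps w).

Lemma relative_energy_time (k : R -> R) : continuous k ->
  slab_int T (fun t x => (k t * rel_energy_affine gamma s b M rb eps w t x)%R) =
  (\int[lebesgue_measure]_(t in J) (k t * psi t)%:E)%E.
Proof.
move=> ck; have mJ : measurable J by exact: measurable_itv.
have ri := rel_energy_affine_integrable hgamma fc T0 hrb ws ds hK k0 bnd.
have [C C0 hC] : exists2 C, 0 <= C & forall t, 0 <= t <= T -> `|k t| <= C.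
  have : continuous_on I (fun t (_ : coords R) => k t).
    apply: continuous_continuous_on.
    have -> : uncurry (fun t (_ : coords R) => k t) = k \o fst by apply/funext => -[].
    by move=> z; apply: (@continuous_comp _ _ _ fst k z); [exact: cvg_fst|exact: ck].
  by move=> /continuous_on_bounded[C C0 h]; exists C; [exact: ltW|move=> t tT; apply: (h t (0,0,0)) => //; rewrite /cell/= !in_itv/= lexx ltr01].
have fi : integrable_on `]0, T[ (fun t x => k t * rel_energy_affine gamma s b M rb eps w t x).
  apply: (integrable_on_bounded (C := C)) ri; first exact: measurable_on_time.
  by move=> t x tT _; apply: hC; case/andP: tT => /ltW -> /ltW ->.
move/integrable_onP : fi => fi.
apply: etrans (fubini_rect1 mJ (@measurable_cell R) fi) _.
apply: eq_integral => t; rewrite inE/= in_itv/= => /andP[t0 tT].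
have It : I t by rewrite /= in_itv/= !ltW.
have [ri' e] := rel_energy_affine_section fc hrb ws ds It; rewrite EFinM -e.
under eq_integral do rewrite EFinM.
by rewrite integralZl//; exact: measurable_cell.
Qed.

Let BT := (10 * n%:R * B ^+ 2 * E * nu * eps + Cres * eps ^+ 4) * T.
(** With this integrating factor Gronwall's inequality says that [F] increases by at most [BT],
    which is what the bump functions can test. *)
Let F t := expR (- Chat * t) * psi t.

Let cF : {within I, continuous F}.
Proof.
apply/subspace_continuousP => t It; apply: cvgM; last exact: (rel_energy_int_cvg fc hrb ws ds It).
apply: cvg_within_filter; apply: (@continuous_comp _ _ _ (fun t => - Chat * t) expR); last exact: continuous_expR.
by apply: cvgM; [exact: cvg_cst|exact: cvg_id].
Qed.

Lemma bump_energy al be d : 0 < al -> 0 < d -> al + d <= be -> be + d < T ->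
  \int[lebesgue_measure]_(t in J) (- dbump al be d t * F t) <= BT.
Proof.
move=> al0 d0 ab bT.
(* With the cutoff [th = expR (- Chat * t) * bump], the weight [- dth - Chat * th] of the
   relative energy inequality is [- expR (- Chat * t) * dbump]. *)
pose ex t := expR (- Chat * t).
pose th t := ex t * bump al be d t.
pose dth t := ex t * dbump al be d t - Chat * th t.
have dex (t : R) : is_derive t 1 ex (- Chat * ex t).
  have := @is_deriveZ _ _ _ (@id R) (- Chat) t 1 1 (is_derive_id _ _).
  move=> h; rewrite /ex mulrC.
  apply: (@is_derive1_comp _ expR (fun t => - Chat * t)).
  by apply: is_derive_eq h _; rewrite [_ *: _]mulr1.
have dthE (t : R) : is_derive t 1 th (dth t).
  have h := is_deriveM (dex t) (is_derive_bump al be d t).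
  by apply: is_derive_eq h _; rewrite /dth /th /GRing.scale/=; ring.
have cex : continuous ex.
  by move=> t; apply: differentiable_continuous; apply/derivable1_diffP; have [] := dex t.
have th_continuous := th_continuous dthE.
have cdth : continuous dth.
  move=> t; apply: cvgB; last by apply: cvgM; [exact: cvg_cst|exact: th_continuous].
  by apply: cvgM; [exact: cex|exact: continuous_dbump].
have b0 t : 0 <= bump al be d t := bump_ge0 d0 ab t.
have th0 t : ~~ (al <= t <= be + d) -> th t = 0.
  by move=> h; rewrite /th bump_out ?mulr0.
have dth0 t : ~~ (al <= t <= be + d) -> dth t = 0.
  by move=> h; rewrite /dth th0// mulr0 subr0 dbump_out ?mulr0.
have th_ge0 t : 0 <= th t by rewrite mulr_ge0// expR_ge0.
have th_le1 t : th t <= 1.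
  have [ht|ht] := boolP (al <= t <= be + d); last by rewrite th0.
  apply: mulr_ile1 => //; [exact: expR_ge0| |exact: bump_le1].
  rewrite /ex -[leRHS]expR0 ler_expR mulNr oppr_le0 mulr_ge0 ?growth_rate_ge0//.
  by case/andP: ht => ht _; exact: ltW (lt_le_trans al0 ht).
have hc' i t x rh : 0 < t < T -> cell x -> kst <= rh <= N ->
  c * (rh - rb i t x) ^+ 2 <= relative (henergy gamma) rh (rb i t x).
  by move=> /andP[t0 tT]; apply: hc; rewrite /= in_itv/= !ltW.
have := relative_energy_slab hgamma hs hM fc T0 hrb eps0 nu0 lame ws ds hK E0 hE k0 bnd al0 bT
  dthE cdth th0 dth0 th_ge0 th_le1 hB L0 c0 hL hc' Mh0 MhM hbb B0 N0.
rewrite (@relative_energy_time (fun t => - dth t - Chat * th t)); last first.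
  by move=> t; apply: cvgB; [apply: cvgN; exact: cdth|apply: cvgM; [exact: cvg_cst|exact: th_continuous]].
have -> : (\int[lebesgue_measure]_(t in J) ((- dth t - Chat * th t) * psi t)%:E)%E =
    (\int[lebesgue_measure]_(t in J) (- dbump al be d t * F t)%:E)%E.
  by apply: eq_integral => t _; congr EFin; rewrite /dth /F -/(ex t); ring.
have cb : {within I, continuous (dbump al be d)}.
  by apply: continuous_subspaceT; exact: continuous_dbump.
have cK : {within I, continuous (fun t => - dbump al be d t * F t)}.
  move=> t; apply: cvgM; last exact: cF.
  by apply: cvgN; exact: cb.
have mJ : measurable J by exact: measurable_itv.
have fin := integrable_fin_num mJ (within_integrable cK).
by rewrite /Rintegral -lee_fin (fineK fin).
Qed.

Lemma rel_energy_int_gronwall t : I t -> psi t <= (psi 0 + BT) * expR (Chat * t).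
Proof.
have I0 : I 0 by rewrite /= in_itv/= lexx ltW.
move=> It; have [t0 tT] : 0 <= t /\ t <= T by move: It; rewrite /= in_itv/= => /andP.
have BT0 : 0 <= BT.
  apply: mulr_ge0; last exact: ltW.
  have e0 := ltW eps0; apply: addr_ge0; last by rewrite mulr_ge0 ?residual_rate_ge0 ?exprn_ge0.
  by rewrite !mulr_ge0 ?sqr_ge0.
have [->|tn] := eqVneq t 0; first by rewrite mulr0 expR0 mulr1 lerDl.
have := @closed_increment R T F BT T0 cF bump_energy t.
rewrite lt_neqAle eq_sym tn t0 tT => /(_ isT).
rewrite /F mulr0 expR0 mul1r lerBlDl mulNr expRN => h.
by rewrite -ler_pdivrMr ?expR_gt0// mulrC.
Qed.

Lemma Psi_gronwall t : I t -> (0 <= Psi gamma s b M rb eps w t)%E /\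
  (Psi gamma s b M rb eps w t <=
   (Psi gamma s b M rb eps w 0 + BT%:E) * (expR (Chat * t))%:E)%E.
Proof.
have I0 : I 0 by rewrite /= in_itv/= lexx ltW.
move=> It; have P t' It' := @PsiE _ _ _ _ _ _ hgamma fc _ _ T0 hrb eps _ _ _ _ ws ds _ _ k0 bnd rel_ge0 t' It'.
have [-> p0] := P t It; have [-> _] := P 0 I0.
by rewrite !lee_fin; split=> //; exact: rel_energy_int_gronwall.
Qed.

End gronwall.

(** * Bounds on the data and conclusion *)

Section constants.
Context (R : realType) (n : nat) (gamma s : R) (b : 'I_n -> 'I_n -> R) (M : 'I_n -> R).
Hypotheses (hgamma : 1 < gamma).
Hypothesis fc : friction_condition b M.
Variables (T : R) (rb : 'I_n -> scalar_field R).
Hypothesis T0 : 0 < T.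
Hypothesis hrb : smooth_equilibrium gamma s b M rb T.
Local Notation I := `[0, T]%classic.

(** The positive lower bound is the reciprocal of an upper bound for 1/[rb], which is smooth as
    well. *)
Lemma density_enclosed : exists m N, 0 < m /\
  forall i t x, I t -> cell x -> m <= rb i t x <= N.
Proof.
have bs (f : 'I_n -> scalar_field R) : (forall i, smooth_on I (f i)) ->
    exists2 C, 0 < C & forall i t x, I t -> cell x -> `|f i t x| <= C.
  move=> sf.
  have /choice[C hC] : forall i, exists C, forall t x, I t -> cell x -> `|f i t x| <= C.
    move=> i; have [C _ hC] := continuous_on_bounded (smooth_on_cont (sf i)).
    by exists C => t x It; apply: hC; move: It; rewrite /= in_itv.
  exists (\big[Num.max/1]_i C i).
    by apply: lt_le_trans ltr01 _; exact: bigmax_ge_id.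
  by move=> i t x It cx; exact: le_trans (hC i t x It cx) (le_bigmax _ _ _).
have r0 i t x (It : I t) : 0 < rb i t x := rb_gt0 hrb i x It.
have [N N0 hN] := bs rb (rb_smooth hrb).
have [C C0 hC] := bs (fun i t x => (rb i t x)^-1) (fun i =>
  smooth_onV (fun t x It => lt0r_neq0 (r0 i t x It)) (rb_smooth hrb i)).
exists C^-1, N; split; first by rewrite invr_gt0.
move=> i t x It cx; apply/andP; split; last exact: le_trans (ler_norm _) (hN i t x It cx).
have := hC i t x It cx; rewrite ger0_norm ?invr_ge0 ?(ltW (r0 _ _ _ It))//.
by move=> h; rewrite -[leRHS]invrK lef_pV2 ?posrE ?invr_gt0 ?r0.
Qed.

Lemma damping_min : exists2 Mh, 0 < Mh & forall i, Mh <= M i.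
Proof.
(* The default 1 keeps the minimum positive for any number of species. *)
exists (\big[Num.min/1]_i M i); last by move=> i; exact: bigmin_le_cond.
elim/big_ind: _ => [|x y x0 y0|i _]; [exact: ltr01|by rewrite lt_min x0|exact: (friction_M_gt0 fc)].
Qed.

Lemma friction_max : exists bb, forall i j, `|b i j| <= bb.
Proof.
exists (\big[Num.max/0]_(p : 'I_n * 'I_n) `|b p.1 p.2|) => i j.
exact: (le_bigmax _ (fun p : 'I_n * 'I_n => `|b p.1 p.2|) (i, j)).
Qed.

End constants.
Theorem theorem3p4 (R : realType) (n : nat) (hn : (0 < n)%N)
    (gamma s : R) (hgamma : 1 < gamma) (hs : -1 <= s) (hgs : s + 2 <= gamma)
    (b : 'I_n -> 'I_n -> R) (M : 'I_n -> R)
    (hM : forall i, 0 <= M i) (hA2b : friction_condition b M)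
    (T K kst N E : R) (hT : 0 < T) (hK : 0 < K) (hkst : 0 < kst) (hE : 0 < E)
    (rb : 'I_n -> scalar_field R)
    (hrb : smooth_equilibrium gamma s b M rb T) :
  exists C Chat : R, [/\ 0 < C, 0 < Chat &
  forall (nu : R) (muL lamL : R -> R) (w : R -> state R n),
    0 <= nu ->
    lame_condition muL lamL ->
    (forall eps, 0 < eps ->
      [/\ weak_solution gamma s b M eps nu muL lamL (w eps),
          dissipative gamma b M eps nu muL lamL (w eps),
          mass_energy_le gamma T K (w eps),
          forall i,
            Linf_Lp_le T 1 (fun t x => lamL (rho (w eps) i t x)) E /\
            Linf_Lp_le T 1 (fun t x => muL (rho (w eps) i t x)) E &
          forall i, {ae @leb4 R, forall z : R * coords R,
            0 < z.1 < T -> cell z.2 -> kst <= rho (w eps) i z.1 z.2 <= N}]) ->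
    (forall eps t, 0 < eps -> 0 <= t <= T ->
      (Psi gamma s b M rb eps (w eps) t <=
       (Psi gamma s b M rb eps (w eps) 0
        + (C * nu * eps)%:E + (C * eps ^+ 4)%:E) * (expR (Chat * t))%:E)%E) /\
    (Psi gamma s b M rb eps (w eps) 0 @[eps --> 0^'+] --> 0%E ->
     ereal_sup [set Psi gamma s b M rb eps (w eps) t | t in `[0, T]]
       @[eps --> 0^'+] --> 0%E)].
Proof.
have [B B0 hB] := equilibrium_bounded hA2b hrb.
have [m [Nr [m0 hm]]] := density_enclosed hrb.
have [Mh Mh0 MhM] := damping_min hA2b.
have [bb hbb] := friction_max b.
(* One interval encloses the densities of the solution and of the equilibrium, so that the Lipschitz
   and convexity estimates apply between them; the 0 in [hi] makes the upper bound nonnegative. *)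
pose lo := Num.min kst m; pose hi := Num.max N (Num.max Nr 0).
have lo0 : 0 < lo by rewrite lt_min hkst.
have hi0 : 0 <= hi by rewrite !le_max lexx !orbT.
have enc r : kst <= r <= hi -> lo <= r <= hi.
  by move=> /andP[h1 h2]; rewrite h2 /lo ge_min h1.
have encb i t x : `[0, T]%classic t -> cell x -> lo <= rb i t x <= hi.
  by move=> It cx; have /andP[h1 h2] := hm i t x It cx; rewrite /lo /hi ge_min h1 orbT !le_max h2 orbT.
(* The exponent is that of mu', whose Lipschitz constant enters the capillary error. *)
have [L L0 hL] := @powR_lip R ((s + 3) / 2 - 1) lo hi lo0.
have [c c0 hc] := @relative_henergy_quad R gamma hgamma lo hi lo0.
pose L' := `|(s + 3) / 2| * L.
have L'0 : 0 <= L' by rewrite mulr_ge0// ltW.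
have hL' i t x rh : 0 < t < T -> cell x -> kst <= rh <= hi ->
    `|mu_deriv s rh - mu_deriv s (rb i t x)| <= L' * `|rh - rb i t x|.
  move=> /andP[t0 tT] cx h; rewrite /mu_deriv -mulrBr normrM /L' -mulrA ler_wpM2l//.
  by apply: hL; [exact: enc|apply: encb => //; rewrite /= in_itv/= !ltW].
have hc' i t x rh : `[0, T]%classic t -> cell x -> kst <= rh <= hi ->
    c * (rh - rb i t x) ^+ 2 <= relative (henergy gamma) rh (rb i t x).
  by move=> It cx h; apply: hc; [exact: enc|exact: encb].
pose G := growth_rate n gamma s hi B L' c Mh bb.
pose D := residual_rate n hi B Mh.
have D0 : 0 <= D by exact: residual_rate_ge0.
have G0 : 0 <= G by exact: growth_rate_ge0.
(* One constant for both residual terms, integrated over [0, T]; the added 1 makes it positive, as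
   with [G + 1] below. *)
pose C := (10 * n%:R * B ^+ 2 * E + D) * T + 1.
have CE : 0 <= 10 * n%:R * B ^+ 2 * E.
  by rewrite !(sqr_ge0, mulr_ge0)// ltW.
have C0 : 0 < C by rewrite ltr_pwDr// mulr_ge0 ?addr_ge0// ltW.
have CT : C = 10 * n%:R * B ^+ 2 * E * T + D * T + 1 by rewrite /C; ring.
have DT : 0 <= D * T by rewrite mulr_ge0// ltW.
have C1 : 10 * n%:R * B ^+ 2 * E * T <= C by rewrite CT -addrA lerDl addr_ge0.
have C2 : D * T <= C.
  by rewrite CT addrAC lerDr addr_ge0// mulr_ge0// ltW.
exists C; exists (G + 1).
split=> //; first by rewrite ltr_wpDl.
move=> nu muL lamL w nu0 lame hw.
pose Q eps : \bar R := (Psi gamma s b M rb eps (w eps) 0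
        + (C * nu * eps)%:E + (C * eps ^+ 4)%:E)%E.
have main eps t : 0 < eps -> 0 <= t <= T -> (0 <= Psi gamma s b M rb eps (w eps) t)%E /\
    (Psi gamma s b M rb eps (w eps) t <= Q eps * (expR ((G + 1) * t))%:E)%E.
  move=> eps0 tT; have [ws ds hKw hEw bnd] := hw eps eps0.
  have bnd' i : {ae leb4 R, forall z : R * coords R, 0 < z.1 < T -> cell z.2 ->
      kst <= rho (w eps) i z.1 z.2 <= hi}.
    apply: ae_sub (bnd i) _ => z h zT cz; have /andP[-> h2] := h zT cz.
    by rewrite /hi le_max h2.
  have It : `[0, T]%classic t by rewrite /= in_itv.
  have I0 : `[0, T]%classic 0 by rewrite /= in_itv/= lexx ltW.
  have PG r (Ir : `[0, T]%classic r) := Psi_gronwall hgamma hs hM hA2b hT hrb hB L'0 c0 hL' hc' Mh0 MhM hbb B0 hi0 (ltW hE) hkst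
    eps0 nu0 lame ws ds hKw hEw bnd' Ir.
  have [P0 Pt] := PG t It; have [P00 _] := PG 0 I0.
  have e0 := ltW eps0; have ne : 0 <= nu * eps by exact: mulr_ge0.
  have e4 : 0 <= eps ^+ 4 by exact: exprn_ge0.
  split=> //; apply: le_trans Pt _; apply: lee_pmul.
  - apply: adde_ge0 => //; rewrite lee_fin; apply: mulr_ge0; last exact: ltW.
    by apply: addr_ge0; [rewrite -mulrA; exact: mulr_ge0|exact: mulr_ge0].
  - by rewrite lee_fin expR_ge0.
  - rewrite /Q -[leRHS]addeA; apply: leeD2l; rewrite -EFinD lee_fin.
    have -> : (10 * n%:R * B ^+ 2 * E * nu * eps + D * eps ^+ 4) * T =
      (10 * n%:R * B ^+ 2 * E * T) * (nu * eps) + D * T * eps ^+ 4 by ring.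
    by rewrite -[C * nu * eps]mulrA lerD// ler_wpM2r.
  - rewrite lee_fin ler_expR ler_wpM2r//; last by rewrite lerDl.
    by case/andP: tT.
split=> [eps t eps0 tT|cv]; first by have [_] := main eps t eps0 tT.
(* For fixed [nu] both residual terms are continuous in [eps] and vanish at 0. *)
have Q0 : Q eps @[eps --> 0^'+] --> 0%E.
  have cR (f : R -> R) : continuous f -> f 0 = 0 -> (f eps)%:E @[eps --> 0^'+] --> 0%E.
    move=> cf f0; apply: cvg_EFin; first by apply: nearW.
    have h : f x @[x --> nbhs (0 : R)] --> f 0 by exact: cf.
    by rewrite f0 in h; exact: cvg_within_filter h.
  rewrite -[X in _ --> X](adde0 0%E) -[X in _ --> X](adde0 (0 + 0)%E).
  apply: cvgeD => //; first apply: cvgeD => //.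
  - by apply: (cR (fun eps => C * nu * eps)); [move=> x; apply: cvgM; [exact: cvg_cst|exact: cvg_id]|rewrite mulr0].
  - apply: (cR (fun eps => C * eps ^+ 4)); last by rewrite expr0n mulr0.
    by move=> x; apply: cvgM; [exact: cvg_cst|exact: exprn_continuous].
(* The bound at time [T] dominates those at all earlier times, since the exponential is
   nondecreasing in time. *)
apply: (squeeze_cvge _ (cvg_cst 0%E) (h := fun eps => (Q eps * (expR ((G + 1) * T))%:E)%E)).
  near=> eps; have eps0 : 0 < eps by near: eps; exact: nbhs_right_gt.
  have TT : (0 : R) <= 0 <= T by rewrite lexx ltW.
  have [P0 _] := main eps 0 eps0 TT.
  apply/andP; split.
    by apply: le_trans P0 _; apply: ereal_sup_ubound; exists 0.
  apply: ge_ereal_sup => _ [t + <-]; rewrite /= in_itv/= => tT.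
  have [_ h] := main eps t eps0 tT; apply: le_trans h _.
  apply: lee_wpmul2l; last by rewrite lee_fin ler_expR ler_wpM2l//; [exact: addr_ge0|case/andP: tT].
  by apply: adde_ge0; [apply: adde_ge0 => //|]; rewrite lee_fin !mulr_ge0 ?exprn_ge0// ltW.
rewrite -[X in _ --> X](mul0e (expR ((G + 1) * T))%:E).
exact: cvgeZr.
Unshelve. all: by end_near.
Qed.
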